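(* Let $b>0$ and $\chi=b^2/4$. Then, as $|a|\to\infty$ in $|\arg a|<\tfrac12\pi$, $$\sum_{n=1}^\infty\frac{K_0(nb/a)}{n(n^2+a^2)}-\mathrm{Res}(1)\sim a^{-2}\sum_{k=1}^\infty (-1)^k\zeta(1-2k)\,F^{(1)}_k(0;\chi)\,a^{-2k}\left\{\log\frac{2a}{b}-\gamma_0+\frac{\zeta'(1-2k)}{\zeta(1-2k)}+\hat F^{(1)}_*\right\},$$ where $$F_k^{(1)}(0;\chi)=\sum_{r=0}^k\frac{(-\chi)^r}{(r!)^2},\qquad \hat F^{(1)}_*=\hat F^{(1)}_*(k)=\frac{1}{F^{(1)}_k(0;\chi)}\sum_{r=1}^k\frac{(-\chi)^r}{(r!)^2}\,\bigl(\psi(1+r)-\psi(1)\bigr),$$ and $$\mathrm{Res}(1)=a^{-2}\Big\{B_2+(1-J_0(b))\big\{(A_1+A_0F^{(1)}_* )B_1+(A_2+A_1 F^{(1)}_*+A_0 F^{(2)}_* )B_0\big\}-\frac{\pi^2}{24}B_0J_0(b)-\frac{\pi}{2} B_1Y_0(b)\Big\},$$ with $$A_0=1,\quad A_1=1-\gamma_0-\tfrac12\log\chi,\quad A_2=\tfrac34-\gamma_0+\tfrac12\gamma_0^2+\tfrac{\pi^2}{24}+\tfrac12\log\chi\left(\gamma_0-1+\tfrac14\log\chi\right),$$ $$B_0=1,\quad B_1=\log a+\gamma_0,\quad B_2=\tfrac12(\log a)^2+\gamma_0\log a-\gamma_1,$$ $$F(\chi)=\sum_{r=0}^\infty\frac{(-\chi)^r}{((r+1)!)^2}=\frac{1-J_0(b)}{\chi},\qquad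 F^{(1)}_*=\frac{1}{F(\chi)}\sum_{r=1}^\infty \frac{(-\chi)^r}{((r+1)!)^2}\,\bigl(\psi(2+r)-\psi(2)\bigr),$$ $$F^{(2)}_*=\frac{1}{4F(\chi)}\sum_{r=1}^\infty\frac{(-\chi)^r}{((r+1)!)^2}\,\Big\{2\bigl(\psi(2+r)-\psi(2)\bigr)^2-\bigl(\psi'(2+r)-\psi'(2)\bigr)\Big\}.$$
   Context: $K_0$ is the modified Bessel function of the second kind of order $0$, $J_0,Y_0$ the Bessel functions of the first and second kind of order $0$, $\zeta$ the Riemann zeta function, $\psi=\Gamma'/\Gamma$. The constants $\gamma_0=0.5772156\ldots$ (Euler–Mascheroni) and $\gamma_1=-0.0728158\ldots$ (first Stieltjes constant) are given by $\zeta(1+\epsilon)=\frac1\epsilon\{1+\gamma_0\epsilon-\gamma_1\epsilon^2+O(\epsilon^3)\}$ as $\epsilon\to0$. Powers and logarithms take principal values. The product $F_k^{(1)}(0;\chi)\hat F_*^{(1)}$ is understood after cancellation of $F_k^{(1)}(0;\chi)$. Meaning of the expansion: for every integer $K\ge1$ and every $\delta\in(0,\frac12\pi)$, the left-hand side minus the terms $1\le k<K$ of the right-hand side is $O(|a|^{-2-2K}\log|a|)$ as $|a|\to\infty$ uniformly in $|\arg a|\le\frac12\pi-\delta$. *)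

(* Defs.v *)
From Stdlib Require Import Reals Factorial.
From Coquelicot Require Import Coquelicot.
Open Scope R_scope.

(* Principal values.  For z <> 0, [Carg z] is the argument in (-PI, PI]. *)
Definition Carg (z : C) : R :=
  if Rle_dec 0 (Im z) then acos (Re z / Cmod z) else - acos (Re z / Cmod z).

Definition Clog (z : C) : C := (ln (Cmod z), Carg z).

Definition CSeries (u : nat -> C) : C :=
  (Series (fun n => Re (u n)), Series (fun n => Im (u n))).

(* Euler's integral; only used for x > 0. *)
Definition Gamma (x : R) : R :=
  RInt_gen (fun t => Rpower t (x - 1) * exp (- t))
    (at_right 0) (Rbar_locally p_infty).

Definition digamma (x : R) : R := Derive Gamma x / Gamma x.

Definition trigamma (x : R) : R := Derive digamma x.

(* (-chi)^r / (r!)^2 *)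
Definition bterm (chi : R) (r : nat) : R := (- chi) ^ r / INR (fact r) ^ 2.

Definition BesselJ0 (x : R) : R := Series (bterm (x ^ 2 / 4)).

(* Y_0(x) = (2/pi) log(x/2) J_0(x)
            - (2/pi) sum_r psi(r+1) (-x^2/4)^r / (r!)^2,   x > 0 *)
Definition BesselY0 (x : R) : R :=
  2 / PI * ln (x / 2) * BesselJ0 x
  - 2 / PI * Series (fun r => digamma (INR r + 1) * bterm (x ^ 2 / 4) r).

Definition BesselI0 (z : C) : C :=
  CSeries (fun r => ((z ^ 2 / 4) ^ r / INR (fact r) ^ 2)%C).

(* K_0(z) = - log(z/2) I_0(z) + sum_r psi(r+1) (z^2/4)^r / (r!)^2,
   on the plane cut along the negative real axis. *)
Definition BesselK0 (z : C) : C :=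
  (- Clog (z / 2) * BesselI0 z
   + CSeries (fun r =>
       digamma (INR r + 1) * ((z ^ 2 / 4) ^ r / INR (fact r) ^ 2)))%C.

(* The Riemann zeta function at real arguments s <> 1: it is the Dirichlet
   series for s > 1, and zeta(s) - 1/(s-1) extends to an entire function, that
   is, it is the sum of an everywhere convergent power series in s - 1.  This
   determines zeta on R \ {1}; the value at 1 is left free. *)
Definition is_riemann_zeta (zeta : R -> R) : Prop :=
  (forall s, 1 < s ->
     is_series (fun n => Rpower (INR (S n)) (- s)) (zeta s)) /\
  (exists c : nat -> R, CV_radius c = p_infty /\
     forall s, s <> 1 -> zeta s = / (s - 1) + PSeries c (s - 1)).

(* zeta(1+e) = (1/e) (1 + gamma0 e - gamma1 e^2 + O(e^3)) as e -> 0 *)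
Definition laurent_at_1 (zeta : R -> R) (gamma0 gamma1 : R) : Prop :=
  exists M eta : R, 0 < eta /\
    forall e, e <> 0 -> Rabs e < eta ->
      Rabs (e * zeta (1 + e) - (1 + gamma0 * e - gamma1 * e ^ 2))
        <= M * Rabs e ^ 3.

Definition F1k (k : nat) (chi : R) : R := sum_n (bterm chi) k.

(* The product F1k k chi * hatF, after cancellation of F1k k chi (which may
   vanish). *)
Definition F1k_hatF (k : nat) (chi : R) : R :=
  sum_n_m (fun r => bterm chi r * (digamma (1 + INR r) - digamma 1)) 1 k.

(* (-chi)^r / ((r+1)!)^2 *)
Definition fterm (chi : R) (r : nat) : R := (- chi) ^ r / INR (fact (r + 1)) ^ 2.

Definition Fchi (chi : R) : R := Series (fterm chi).

(* In the next two definitions the sums over r >= 1 are reindexed by r = S n. *)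
Definition F1star (chi : R) : R :=
  / Fchi chi *
  Series (fun n => let r := S n in
    fterm chi r * (digamma (2 + INR r) - digamma 2)).

Definition F2star (chi : R) : R :=
  / (4 * Fchi chi) *
  Series (fun n => let r := S n in
    fterm chi r * (2 * (digamma (2 + INR r) - digamma 2) ^ 2
                   - (trigamma (2 + INR r) - trigamma 2))).

Definition A0 : R := 1.
Definition A1 (gamma0 chi : R) : R := 1 - gamma0 - / 2 * ln chi.
Definition A2 (gamma0 chi : R) : R :=
  3 / 4 - gamma0 + / 2 * gamma0 ^ 2 + PI ^ 2 / 24
  + / 2 * ln chi * (gamma0 - 1 + / 4 * ln chi).

Definition B0 : C := 1.
Definition B1 (gamma0 : R) (a : C) : C := (Clog a + gamma0)%C.
Definition B2 (gamma0 gamma1 : R) (a : C) : C :=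
  (/ 2 * Clog a ^ 2 + gamma0 * Clog a - gamma1)%C.

Definition Res1 (gamma0 gamma1 b : R) (a : C) : C :=
  let chi := b ^ 2 / 4 in
  let a1 := A1 gamma0 chi in
  let a2 := A2 gamma0 chi in
  let b1 := B1 gamma0 a in
  let b2 := B2 gamma0 gamma1 a in
  let f1 := F1star chi in
  let f2 := F2star chi in
  (/ a ^ 2 *
   (b2
    + (1 - BesselJ0 b) *
        ((a1 + A0 * f1) * b1 + (a2 + a1 * f1 + A0 * f2) * B0)
    - PI ^ 2 / 24 * B0 * BesselJ0 b
    - PI / 2 * b1 * BesselY0 b))%C.

Definition mathieu_term (b : R) (a : C) (n : nat) : C :=
  (BesselK0 (INR n * b / a) / (INR n * (INR n ^ 2 + a ^ 2)))%C.

(* The k-th term of the expansion, without the prefactor a^(-2). *)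
Definition expansion_term (zeta : R -> R) (gamma0 b : R) (a : C) (k : nat) : C :=
  let chi := b ^ 2 / 4 in
  let s := 1 - 2 * INR k in
  ((-1) ^ k * zeta s * / a ^ (2 * k) *
   (F1k k chi * (Clog (2 * a / b) - gamma0 + Derive zeta s / zeta s)
    + F1k_hatF k chi))%C.

(* Main.v *)
(* With [h = 1 / a] the series is [h^2] times [sum_n g(n h) / n], where
   [g z = K_0(b z) / (1 + z^2)].  Euler-Maclaurin summation assigns to a function
   [f] with prescribed derivatives a regularised value [Reg f] of [sum_n f'(n)]
   that depends only on the antiderivative [f], is linear, is controlled by a high
   derivative of [f], and equals the convergent sum when [f] and its derivatives
   vanish at infinity.  It is applied to [f x = G (h x)], where [G' z = g z / z]
   and [G] vanishes at infinity.  Near [0], [G] is a polynomial in [z] and [log z]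
   (from the ascending series of [K_0]) up to a remainder of size
   [z^(2 n + 2) log z]; the regularised values of [(log x)^j x^a] are derivatives of
   [a * zeta (1 - a)], which yields the terms [zeta (1 - 2 k)], [zeta' (1 - 2 k)]
   and the Stieltjes constants, and the remainder contributes the error term,
   uniformly on sectors because all estimates are symbol estimates there.  The
   constant term of [G] at [0] is a finite part, found by Green's identity for
   [K_0] and a dilogarithm: as a function of [b] it satisfies an inhomogeneous
   Bessel equation whose solution is given by the series of [J_0] and its
   derivatives with respect to the order.  [BesselK0], defined by its ascending
   series, is identified with the integral of [exp (- z cosh t)] by uniqueness for
   the Bessel equation, the constant at [0] coming from the Mellin transform of
   [K_0] and the Bohr-Mollerup theorem. *)

Require Import Defs.
From Stdlib Require Import Reals Lra Lia Psatz Factorial Wf_nat.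
From Coquelicot Require Import Coquelicot.
Open Scope R_scope.

(** The regularised value sees the constant of integration: the constant function [1] receives the
    value of [a * zeta (1 - a)] at [a = 0], which is [-1]. So the singular part of the summand does
    not determine [Res1], and the finite part of the antiderivative at the origin is the one
    quantity that needs an exact evaluation. Divergent powers are treated by continuation in the
    exponent: for [a < 0] the value is a Dirichlet series, and the derivatives in [a] are bounded
    well enough for the Taylor series at [a = 0] to reach every even exponent in use. Logarithms
    come for free, being derivatives in [a]. Summation runs along real [x] while [h = 1 / a] is only
    a complex parameter, so no contour is moved; sectors keep [z] away from the imaginary axis,
    where [1 + z ^ 2] has its zeros and [K_0] loses its fast decay. Two quotients in the statement
    need care: [zeta (1 - 2 k)] is nonzero by the alternating signs of the Bernoulli numbers, and
    [Fchi] is nonzero because [J_0 b <> 1] for [b > 0]. *)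

Ltac eqR := match goal with |- @eq _ ?a ?b => change (@eq R a b) end.

Ltac pos := first [assumption | lra | lazymatch goal with
  | |- 0 < _ * _ => apply Rmult_lt_0_compat; pos
  | |- 0 <= _ * _ => apply Rmult_le_pos; pos
  | |- 0 < _ / _ => apply Rdiv_lt_0_compat; pos
  | |- 0 <= _ / _ => apply Rdiv_le_0_compat; pos
  | |- 0 < / _ => apply Rinv_0_lt_compat; pos
  | |- 0 < _ ^ _ => apply pow_lt; pos
  | |- 0 <= _ ^ 2 => apply pow2_ge_0
  | |- 0 <= _ ^ _ => apply pow_le; pos
  | |- 0 < exp _ => apply exp_pos
  | |- 0 < PI => apply PI_RGT_0
  | |- 0 < INR (fact _) => apply INR_fact_lt_0
  | |- 0 < INR _ => apply lt_0_INR; lia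
  | |- 0 <= INR _ => apply pos_INR
  | |- 0 <= Rabs _ => apply Rabs_pos
  | |- 0 <= Cmod _ => apply Cmod_ge_0
  | |- 0 < _ + _ => first [apply Rplus_lt_le_0_compat; pos | apply Rplus_le_lt_0_compat; pos]
  | |- 0 <= _ + _ => apply Rplus_le_le_0_compat; pos
  | |- ?a * _ <= ?a * _ => apply Rmult_le_compat_l; pos
  | |- ?a * _ < ?a * _ => apply Rmult_lt_compat_l; pos
  | |- _ * ?a <= _ * ?a => apply Rmult_le_compat_r; pos
  | |- _ / ?a <= _ / ?a => apply Rmult_le_compat_r; pos
  | |- ?a / _ <= ?a / _ => apply Rmult_le_compat_l; pos
  | |- _ * _ <= _ * _ => apply Rmult_le_compat; pos
  | |- / _ <= / _ => apply Rinv_le_contravar; pos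
  | |- _ + _ <= _ + _ => apply Rplus_le_compat; pos
  | |- _ ^ _ <= _ ^ _ => apply pow_incr; pos
  | |- Rabs (_ * _) <= _ * _ => rewrite Rabs_mult; pos
  | |- Cmod (_ * _)%C <= _ * _ => rewrite Cmod_mult; pos
  | |- _ <> 0 => apply Rgt_not_eq; pos
  | |- _ >= _ => apply Rle_ge; pos
  | |- _ > _ => apply Rlt_gt; pos
  | |- _ /\ _ => split; pos
  | |- _ <= _ => apply Rlt_le; pos
  end].

Tactic Notation "via" uconstr(t) := eapply Rle_trans; [apply t|].

(** * Finite sums *)

Fixpoint psum (f : nat -> R) (n : nat) : R :=
  match n with O => 0 | S p => psum f p + f p end.

Lemma psum_sum_n f n : sum_n f n = psum f (S n).
Proof.
  induction n as [|n IH].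
  - rewrite sum_O. simpl; lra.
  - rewrite sum_Sn, IH. reflexivity.
Qed.

Lemma psum_ext f g n : (forall i, (i < n)%nat -> f i = g i) -> psum f n = psum g n.
Proof. intros H. induction n as [|n IH]; simpl; [reflexivity|]. rewrite IH, H; auto. Qed.

Lemma psum_plus f g n : psum (fun i => f i + g i) n = psum f n + psum g n.
Proof. induction n; simpl; [ring|rewrite IHn; ring]. Qed.

Lemma psum_minus f g n : psum (fun i => f i - g i) n = psum f n - psum g n.
Proof. induction n; simpl; [ring|rewrite IHn; ring]. Qed.

Lemma psum_scal c f n : psum (fun i => c * f i) n = c * psum f n.
Proof. induction n; simpl; [ring|rewrite IHn; ring]. Qed.

Lemma psum_le f g n : (forall i, (i < n)%nat -> f i <= g i) -> psum f n <= psum g n.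
Proof. intros H. induction n as [|n IH]; simpl; [lra|]. apply Rplus_le_compat; auto. Qed.

Lemma psum_Rabs f n : Rabs (psum f n) <= psum (fun i => Rabs (f i)) n.
Proof. induction n; simpl. rewrite Rabs_R0; lra. eapply Rle_trans; [apply Rabs_triang|lra]. Qed.

Lemma psum_pos f n : (forall i, 0 <= f i) -> 0 <= psum f n.
Proof. intros H; induction n; simpl; [lra|]. specialize (H n). lra. Qed.

Lemma psum_const c n : psum (fun _ => c) n = INR n * c.
Proof. induction n. simpl; ring. rewrite S_INR. simpl; lra. Qed.

Lemma psum_S_l f n : psum f (S n) = f O + psum (fun i => f (S i)) n.
Proof.
  induction n. simpl; ring. change (psum f (S n) + f (S n) = f O + (psum (fun i => f (S i)) n + f (S n))). lra.
Qed.

Lemma psum_add f n m : psum f (n + m) = psum f n + psum (fun i => f (n + i)%nat) m.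
Proof. induction m as [|m IH]; [rewrite Nat.add_0_r; simpl; ring|]. rewrite Nat.add_succ_r. simpl; lra. Qed.

Lemma psum_even_odd f n : psum f (2 * n) = psum (fun i => f (2 * i)%nat) n + psum (fun i => f (S (2 * i))) n.
Proof. induction n as [|n IH]; [simpl; ring|]. replace (2 * S n)%nat with (S (S (2 * n))) by lia. cbn [psum]. lra. Qed.

Lemma psum_telescope f n : psum (fun i => f (S i) - f i) n = f n - f O.
Proof. induction n; simpl; [ring|rewrite IHn; ring]. Qed.

(** Regrouping by the total order [l = j + i]; it collects the Taylor coefficients of several
    truncated expansions in [em_err_bound]. *)
Lemma psum_triangle (u : nat -> nat -> R) m :
  psum (fun j => psum (fun i => u j (j + i)%nat) (m - j)) m
  = psum (fun l => psum (fun j => u j l) (S l)) m.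
Proof.
  induction m as [|m IH]; [reflexivity|]. change (psum (fun j => psum (fun i => u j (j + i)%nat) (S m - j)) m
    + psum (fun i => u m (m + i)%nat) (S m - m)
    = psum (fun l => psum (fun j => u j l) (S l)) m
    + psum (fun j => u j m) (S m)).
  rewrite <- IH. replace (S m - m)%nat with 1%nat by lia. rewrite (psum_ext (fun j => psum (fun i => u j (j + i)%nat) (S m - j))
    (fun j => psum (fun i => u j (j + i)%nat) (m - j) + u j m)).
  - rewrite psum_plus. simpl. rewrite Nat.add_0_r. ring.
  - intros j Hj. replace (S m - j)%nat with (S (m - j)) by lia. simpl. replace (j + (m - j))%nat with m by lia. reflexivity.
Qed.

Lemma is_series_psum (u : nat -> R) (l : R) :
  is_series u l <-> is_lim_seq (psum u) l.
Proof.
  split; intros H.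
  - apply is_lim_seq_incr_1. apply is_lim_seq_ext with (sum_n u). intros n; apply psum_sum_n. auto.
  - apply is_lim_seq_incr_1 in H. apply is_lim_seq_ext with (v := sum_n u) in H. exact H. intros n; symmetry; apply psum_sum_n.
Qed.

(** * Derivatives of real functions and Taylor's formula *)

Lemma is_derive_Rconst (c x : R) : is_derive (fun _ => c) x 0.
Proof. apply (is_derive_const (K := R_AbsRing) (V := R_NormedModule)). Qed.

Lemma is_derive_Rid (x : R) : is_derive (fun x => x) x 1.
Proof. apply (is_derive_id (K := R_AbsRing)). Qed.

Lemma is_derive_Rplus (f g : R -> R) (x a c : R) :
  is_derive f x a -> is_derive g x c -> is_derive (fun t => f t + g t) x (a + c).
Proof. intros Hf Hg. exact (is_derive_plus f g x a c Hf Hg). Qed.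

Lemma is_derive_Rminus (f g : R -> R) (x a c : R) :
  is_derive f x a -> is_derive g x c -> is_derive (fun t => f t - g t) x (a - c).
Proof. intros Hf Hg. exact (is_derive_minus f g x a c Hf Hg). Qed.

Lemma is_derive_Rmult (f g : R -> R) (x a c : R) :
  is_derive f x a -> is_derive g x c ->
  is_derive (fun t => f t * g t) x (a * g x + f x * c).
Proof.
  intros Hf Hg. apply is_derive_Reals. apply is_derive_Reals in Hf, Hg. exact (derivable_pt_lim_mult f g x a c Hf Hg).
Qed.

Lemma is_derive_Rscal (f : R -> R) (x a k : R) :
  is_derive f x a -> is_derive (fun t => k * f t) x (k * a).
Proof. intros Hf. exact (is_derive_scal f x k a Hf). Qed.

Lemma is_derive_Rcomp (f g : R -> R) (x a c : R) :
  is_derive f (g x) a -> is_derive g x c -> is_derive (fun t => f (g t)) x (a * c).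
Proof.
  intros Hf Hg. apply is_derive_Reals. apply is_derive_Reals in Hf, Hg. exact (derivable_pt_lim_comp g f x c a Hg Hf).
Qed.

Lemma is_derive_eq (f : R -> R) (x a c : R) : is_derive f x a -> a = c -> is_derive f x c.
Proof. congruence. Qed.

Lemma nondecreasing_of_deriv (f f' : R -> R) (a b : R) :
  a <= b ->
  (forall x, a <= x <= b -> is_derive f x (f' x)) ->
  (forall x, a <= x <= b -> 0 <= f' x) -> f a <= f b.
Proof.
  intros Hab Hd Hp. destruct (MVT_gen f a b f') as [c [Hc E]].
  - intros x Hx. rewrite Rmin_left, Rmax_right in Hx by lra. apply Hd; lra.
  - intros x Hx. rewrite Rmin_left, Rmax_right in Hx by lra. apply derivable_continuous_pt. exists (f' x). apply is_derive_Reals, Hd; lra.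
  - rewrite Rmin_left, Rmax_right in Hc by lra. assert (0 <= f' c * (b - a)) by (apply Rmult_le_pos; [apply Hp; lra|lra]). lra.
Qed.

(** Both [g - f] and [g + f] are nondecreasing. This comparison replaces the integration of
    inequalities, so that Taylor estimates need no integrals. *)
Lemma deriv_comparison (f f' g g' : R -> R) (a b : R) :
  a <= b ->
  (forall x, a <= x <= b -> is_derive f x (f' x)) ->
  (forall x, a <= x <= b -> is_derive g x (g' x)) ->
  (forall x, a <= x <= b -> Rabs (f' x) <= g' x) ->
  Rabs (f b - f a) <= g b - g a.
Proof.
  intros Hab Hf Hg Hl. assert (H1 : g a - f a <= g b - f b).
  { apply (nondecreasing_of_deriv (fun x => g x - f x) (fun x => g' x - f' x)); auto.
    - intros x Hx. apply is_derive_Rminus; auto.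
    - intros x Hx. specialize (Hl x Hx). apply Rabs_le_between in Hl. lra. }
  assert (H2 : g a + f a <= g b + f b).
  { apply (nondecreasing_of_deriv (fun x => g x + f x) (fun x => g' x + f' x)); auto.
    - intros x Hx. apply is_derive_Rplus; auto.
    - intros x Hx. specialize (Hl x Hx). apply Rabs_le_between in Hl. lra. }
  apply Rabs_le_between. lra.
Qed.

Lemma deriv_bound (f f' : R -> R) (a b M : R) :
  (forall x, Rmin a b <= x <= Rmax a b -> is_derive f x (f' x)) ->
  (forall x, Rmin a b <= x <= Rmax a b -> Rabs (f' x) <= M) ->
  Rabs (f b - f a) <= M * Rabs (b - a).
Proof.
  intros Hd Hb. destruct (Rle_dec a b) as [Hab|Hab].
  - rewrite Rmin_left, Rmax_right in * by lra. rewrite (Rabs_right (b - a)) by lra. replace (M * (b - a)) with (M * b - M * a) by ring.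
    apply (deriv_comparison f f' (fun x => M * x) (fun _ => M)); auto. intros x _. auto_derive; auto; eqR; ring.
  - rewrite Rmin_right, Rmax_left in * by lra. rewrite (Rabs_left (b - a)), Rabs_minus_sym by lra.
    replace (M * - (b - a)) with (M * a - M * b) by ring. apply (deriv_comparison f f' (fun x => M * x) (fun _ => M)); auto; try lra.
    intros x _. auto_derive; auto; eqR; ring.
Qed.

(** A function is carried together with an explicit family of derivatives: [J 0] is the function and
    only the first [m] derivative relations are demanded. *)
Definition is_jet (m : nat) (P : R -> Prop) (J : nat -> R -> R) : Prop :=
  forall j x, (j < m)%nat -> P x -> is_derive (J j) x (J (S j) x).

Lemma is_derive_taylor_monomial (c : R) (n : nat) (t : R) :
  is_derive (fun t => c * t ^ S n / INR (fact (S n))) t (c * t ^ n / INR (fact n)).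
Proof.
  apply (is_derive_ext (fun t => c / INR (fact (S n)) * t ^ S n)).
  - intros; pos.
  - apply is_derive_eq with (c / INR (fact (S n)) * (INR (S n) * t ^ n)).
    + apply is_derive_Rscal. apply is_derive_Reals. apply (derivable_pt_lim_pow t (S n)).
    + rewrite fact_simpl, mult_INR. field. pos.
Qed.

Lemma is_derive_taylor_poly (c : nat -> R) (n : nat) (t : R) :
  is_derive (fun t => psum (fun i => c i * t ^ i / INR (fact i)) (S n)) t
    (psum (fun i => c (S i) * t ^ i / INR (fact i)) n).
Proof.
  induction n as [|n IH].
  - auto_derive; auto; eqR; field.
  - apply is_derive_Rplus; [exact IH|]. apply is_derive_taylor_monomial.
Qed.

(** Induction on the order: as a function of the increment, the remainder of [J] has as derivative
    the lower-order remainder of the shifted jet, and [deriv_comparison] with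
    [M * s ^ S n / INR (fact (S n))] raises the order by one. *)
Lemma jet_taylor n : forall (J : nat -> R -> R) (a t M : R),
  0 <= t ->
  is_jet n (fun x => a <= x <= a + t) J ->
  (forall x, a <= x <= a + t -> Rabs (J n x) <= M) ->
  Rabs (J O (a + t) - psum (fun i => J i a * t ^ i / INR (fact i)) n)
    <= M * t ^ n / INR (fact n).
Proof.
  induction n as [|n IH]; intros J a t M Ht HJ HM.
  - simpl. rewrite Rminus_0_r. replace (M * 1 / 1) with M by field. apply HM; lra.
  - set (f := fun s => J O (a + s) - psum (fun i => J i a * s ^ i / INR (fact i)) (S n)).
    set (f' := fun s => J 1%nat (a + s) - psum (fun i => J (S i) a * s ^ i / INR (fact i)) n).
    set (g := fun s => M * s ^ (S n) / INR (fact (S n))). set (g' := fun s => M * s ^ n / INR (fact n)).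
    assert (Hc : Rabs (f t - f 0) <= g t - g 0).
    { apply (deriv_comparison f f' g g'); auto.
      - intros s Hs. apply is_derive_Rminus.
        + apply is_derive_eq with (J 1%nat (a + s) * 1); [|eqR; ring]. apply (is_derive_Rcomp (J O) (fun s => a + s)).
          * apply (HJ O); [lia|lra].
          * auto_derive; auto.
        + apply is_derive_taylor_poly.
      - intros s _. apply is_derive_taylor_monomial.
      - intros s Hs. unfold f', g'. apply (IH (fun j => J (S j))); [lra| |].
        + intros j x Hj Hx. apply HJ; [lia|lra].
        + intros x Hx. apply HM; lra. }
    replace (f 0) with 0 in Hc. replace (g 0) with 0 in Hc.
    + rewrite !Rminus_0_r in Hc. auto.
    + unfold g. simpl; lra.
    + unfold f. rewrite Rplus_0_r. rewrite psum_S_l. rewrite (psum_ext _ (fun _ => 0)). rewrite psum_const. simpl. field. intros i _.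
      simpl; lra.
Qed.

(** * Euler-Maclaurin summation *)

(* [beta j] is the coefficient of [t ^ j] in [t / (exp t - 1)]. *)
Fixpoint beta_upto (n : nat) : nat -> R :=
  match n with
  | O => fun _ => 1
  | S p => fun j => if Nat.leb j p then beta_upto p j
                    else - psum (fun i => beta_upto p i / INR (fact (S (S p) - i))) (S p)
  end.

Definition beta (j : nat) : R := beta_upto j j.

Lemma beta_upto_stable n j : (j <= n)%nat -> beta_upto n j = beta j.
Proof.
  induction n as [|n IH]; intros Hj.
  - replace j with O by lia. reflexivity.
  - destruct (Nat.eq_dec j (S n)) as [->|Hn]; [reflexivity|]. simpl. destruct (Nat.leb_spec j n); [|lia]. auto.
Qed.

Lemma beta_S p :
  beta (S p) = - psum (fun i => beta i / INR (fact (S (S p) - i))) (S p).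
Proof.
  unfold beta at 1. change (beta_upto (S p) (S p)) with
    (if Nat.leb (S p) p then beta_upto p (S p)
    else - psum (fun i => beta_upto p i / INR (fact (S (S p) - i))) (S p)).
  destruct (Nat.leb_spec (S p) p) as [H|_]; [lia|]. f_equal. apply psum_ext. intros i Hi. rewrite beta_upto_stable by lia. reflexivity.
Qed.

(** Coefficient of [t ^ l] in [b t * exp t = b t + t] for [b t = t / (exp t - 1)]. *)
Lemma beta_conv l :
  psum (fun j => beta j / INR (fact (l - j))) (S l)
  = beta l + (if Nat.eqb l 1 then 1 else 0).
Proof.
  change (psum (fun j => beta j / INR (fact (l - j))) l + beta l / INR (fact (l - l))
    = beta l + (if Nat.eqb l 1 then 1 else 0)).
  rewrite Nat.sub_diag. destruct l as [|[|p]].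
  - simpl; lra.
  - simpl. change (beta 0) with 1. lra.
  - change (psum (fun j => beta j / INR (fact (S (S p) - j))) (S p)
      + beta (S p) / INR (fact (S (S p) - S p))
      + beta (S (S p)) / 1 = beta (S (S p)) + 0).
    replace (S (S p) - S p)%nat with 1%nat by lia. rewrite (beta_S p). simpl; lra.
Qed.

(** Local Euler-Maclaurin error on [[x, x + 1]]. With [D] the derivative, [D = b(D) (exp D - 1)] for
    [b t = t / (exp t - 1)], and [exp D] is the shift by one; truncating [b] at order [m] leaves
    this error. *)
Definition em_err (m : nat) (J : nat -> R -> R) (x : R) : R :=
  J 1%nat x - psum (fun j => beta j * (J j (x + 1) - J j x)) (S m).

Definition em_const (m : nat) : R := psum (fun j => Rabs (beta j)) (S m).

Lemma em_const_pos m : 0 <= em_const m.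
Proof. apply psum_pos; intros; apply Rabs_pos. Qed.

Lemma em_err_bound m J x M :
  (1 <= m)%nat ->
  is_jet (S m) (fun y => x <= y <= x + 1) J ->
  (forall y, x <= y <= x + 1 -> Rabs (J (S m) y) <= M) ->
  Rabs (em_err m J x) <= em_const m * M.
Proof.
  intros Hm HJ HM. assert (HM0 : 0 <= M) by (eapply Rle_trans; [apply Rabs_pos|apply (HM x); lra]).
  (* [T j] expands [J j (x + 1)] up to total order [m], so every remainder is governed by the same
     derivative [J (S m)]. *)
  set (T := fun j => psum (fun i => J (j + i)%nat x / INR (fact i)) (S m - j)).
  assert (HT : forall j, (j < S m)%nat -> Rabs (J j (x + 1) - T j) <= M).
  { intros j Hj. assert (H := jet_taylor (S m - j) (fun i => J (j + i)%nat) x 1 M). cbv beta in H. rewrite Nat.add_0_r in H.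
    assert (Hf : 1 <= INR (fact (S m - j))).
    { apply (le_INR 1). apply lt_O_fact. }
    eapply Rle_trans; [|via H].
    - apply Req_le. do 2 f_equal. apply psum_ext. intros i _. rewrite pow1. lra.
    - lra.
    - intros i y Hi Hy. replace (j + S i)%nat with (S (j + i)) by lia. apply HJ; [lia|auto].
    - replace (j + (S m - j))%nat with (S m) by lia. auto.
    - rewrite pow1. rewrite Rmult_1_r. rewrite <- (Rmult_1_r M) at 2. apply Rmult_le_compat_l; auto. rewrite <- Rinv_1. pos. }
  (* By [beta_conv] the derivative [J l x] gets the coefficient [beta l], plus [1] when [l = 1];
     hence [em_err] is a combination of Taylor remainders only. *)
  assert (E : psum (fun j => beta j * T j) (S m)
    = psum (fun j => beta j * J j x) (S m) + J 1%nat x).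
  { rewrite (psum_ext _ (fun j => psum (fun i =>
      beta j * J (j + i)%nat x / INR (fact ((j + i) - j))) (S m - j))).
    2:{ intros j _. unfold T. rewrite <- psum_scal. apply psum_ext. intros i _. replace (j + i - j)%nat with i by lia. lra. }
    rewrite (psum_triangle (fun j l => beta j * J l x / INR (fact (l - j)))). rewrite (psum_ext _ (fun l => beta l * J l x
      + (if Nat.eqb l 1 then 1 else 0) * J l x)).
    2:{ intros l _. rewrite <- Rmult_plus_distr_r, <- beta_conv. rewrite (Rmult_comm _ (J l x)), <- psum_scal. apply psum_ext.
      intros; pos. }
    rewrite psum_plus. f_equal. destruct m as [|m]; [lia|]. rewrite !psum_S_l. simpl (Nat.eqb 0 1). simpl (Nat.eqb 1 1).
    rewrite (psum_ext _ (fun _ => 0)). rewrite psum_const. ring. intros i _. simpl; lra. }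
  replace (em_err m J x) with (psum (fun j => beta j * (T j - J j (x + 1))) (S m)).
  - via psum_Rabs. unfold em_const. rewrite Rmult_comm, <- psum_scal. apply psum_le. intros j Hj.
    rewrite Rabs_mult, Rmult_comm, Rabs_minus_sym. apply Rmult_le_compat_r; [apply Rabs_pos|]. auto.
  - unfold em_err. rewrite (psum_ext (fun j => beta j * (J j (x + 1) - J j x))
      (fun j => beta j * J j (x + 1) - beta j * J j x)) by (intros; ring).
    rewrite (psum_ext (fun j => beta j * (T j - J j (x + 1)))
      (fun j => beta j * T j - beta j * J j (x + 1))) by (intros; ring).
    rewrite !psum_minus, E. ring.
Qed.

(** Summing [em_err] over [n] telescopes the differences of each [J j]. The boundary terms at [1]
    are kept and those at infinity are dropped, which is what regularises a divergent sum. *)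
Definition Reg (m : nat) (J : nat -> R -> R) : R :=
  - psum (fun j => beta j * J j 1) (S m) + Series (fun n => em_err m J (INR (S n))).

Lemma is_lim_seq_inv_S : is_lim_seq (fun n => / INR (S n)) 0.
Proof.
  apply (is_lim_seq_incr_1 (fun n => / INR n)). apply (is_lim_seq_inv _ p_infty); [apply is_lim_seq_INR|discriminate].
Qed.

Lemma lim_scal0 c u : is_lim_seq u 0 -> is_lim_seq (fun n => c * u n) 0.
Proof. intros H. rewrite <- (Rmult_0_r c). apply (is_lim_seq_scal_l u c 0 H). Qed.

Lemma lim_squeeze0 u v : (forall n, Rabs (u n) <= v n) -> is_lim_seq v 0 -> is_lim_seq u 0.
Proof.
  intros H Hv. apply is_lim_seq_abs_0, (is_lim_seq_le_le (fun _ => 0) _ v); auto using is_lim_seq_const. split; [apply Rabs_pos|auto].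
Qed.

Lemma lim_squeeze u v (l : R) : (forall n, Rabs (u n - l) <= v n) -> is_lim_seq v 0 -> is_lim_seq u l.
Proof.
  intros H Hv. apply (is_lim_seq_ext (fun n => (u n - l) + l)); [intros; ring|].
  replace (Finite l) with (Finite (0 + l)) by (f_equal; ring). apply (is_lim_seq_plus' _ (fun _ => l)); [|apply is_lim_seq_const].
  apply (lim_squeeze0 _ v); auto.
Qed.

Lemma inv_S_bounds n : 0 < / INR (S n) <= 1.
Proof. assert (H := le_INR 1 (S n) ltac:(lia)). simpl (INR 1) in H. rewrite <- Rinv_1. pos. Qed.

Lemma le_lim_lo (f : R -> R) (a l x : R) : 0 < x -> (forall y, 0 < y <= x -> a <= f y) ->
  is_lim_seq (fun n => f (/ INR (S n))) l -> a <= l.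
Proof.
  intros Hx H L. change (Rbar_le a l).
  apply (is_lim_seq_le_loc (fun _ => a) (fun n => f (/ INR (S n)))); [|apply is_lim_seq_const|exact L].
  destruct (nfloor_ex (/ x)) as [N [_ HN]]; [pos|]. exists N. intros n Hn. apply H. assert (Hn2 : INR N <= INR n) by (apply le_INR; auto).
  rewrite S_INR. rewrite <- (Rinv_inv x). pos.
Qed.

Lemma is_series_telescope (f : nat -> R) (l : R) :
  is_lim_seq f l -> is_series (fun n => f n - f (S n)) (f O - l).
Proof.
  intros H. apply is_series_psum. apply is_lim_seq_ext with (fun n => f O - f n).
  - intros n. rewrite (psum_ext _ (fun i => -1 * (f (S i) - f i))) by (intros; ring). rewrite psum_scal, psum_telescope. ring.
  - apply (is_lim_seq_minus' (fun _ => f O) f); [apply is_lim_seq_const|exact H].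
Qed.

Lemma inv_sq_le_telescope n :
  / INR (S n) ^ 2 <= 2 * (/ INR (S n) - / INR (S (S n))).
Proof.
  rewrite (S_INR (S n)). assert (H : 1 <= INR (S n)) by (apply (le_INR 1); lia). set (x := INR (S n)) in *.
  replace (2 * (/ x - / (x + 1))) with (/ x ^ 2 * (2 * x / (x + 1))) by (field; lra). rewrite <- (Rmult_1_r (/ x ^ 2)) at 1.
  apply Rmult_le_compat_l.
  - pos.
  - apply Rmult_le_reg_r with (x + 1); [lra|]. field_simplify; lra.
Qed.

Lemma ex_series_inv_sq : ex_series (fun n => / INR (S n) ^ 2).
Proof.
  apply (@ex_series_le R_AbsRing R_CompleteNormedModule _
    (fun n => 2 * (/ INR (S n) - / INR (S (S n))))).
  - intros n. rewrite Rabs_right. apply inv_sq_le_telescope. pos.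
  - apply (@ex_series_scal R_AbsRing R_NormedModule 2 (fun n => / INR (S n) - / INR (S (S n)))). eexists.
    apply (is_series_telescope (fun n => / INR (S n)) 0), is_lim_seq_inv_S.
Qed.

Lemma Series_inv_sq_le : Series (fun n => / INR (S n) ^ 2) <= 2.
Proof.
  assert (H := is_series_telescope (fun n => / INR (S n)) 0 is_lim_seq_inv_S).
  replace 2 with (Series (fun n => 2 * (/ INR (S n) - / INR (S (S n))))).
  - apply Series_le.
    + intros n; split; [|apply inv_sq_le_telescope]. pos.
    + apply (@ex_series_scal R_AbsRing R_NormedModule 2 (fun n => / INR (S n) - / INR (S (S n)))). eexists; exact H.
  - rewrite Series_scal_l, (is_series_unique _ _ H). simpl; lra.
Qed.

Lemma ex_series_Rabs_le (u v : nat -> R) :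
  (forall n, Rabs (u n) <= v n) -> ex_series v -> ex_series u.
Proof. apply (@ex_series_le R_AbsRing R_CompleteNormedModule _ v); auto. Qed.

Lemma Series_Rabs_le (u v : nat -> R) :
  (forall n, Rabs (u n) <= v n) -> ex_series v -> Rabs (Series u) <= Series v.
Proof.
  intros H Hv. via Series_Rabs.
  - apply ex_series_Rabs_le with v; auto. intros n; rewrite Rabs_Rabsolu; auto.
  - apply Series_le; auto. intros n; split; [apply Rabs_pos|auto].
Qed.

(* Under this condition the series in [Reg] converges absolutely. *)
Definition em_admissible (m : nat) (J : nat -> R -> R) (B : R) : Prop :=
  is_jet (S m) (fun x => 1 <= x) J /\ forall x, 1 <= x -> Rabs (J (S m) x) <= B / x ^ 2.

Lemma em_err_admissible m J B n :
  (1 <= m)%nat -> em_admissible m J B ->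
  Rabs (em_err m J (INR (S n))) <= em_const m * B * / INR (S n) ^ 2.
Proof.
  intros Hm [HJ HB]. assert (H1 : 1 <= INR (S n)) by (apply (le_INR 1); lia). assert (HB0 : 0 <= B).
  { specialize (HB 1 (Rle_refl 1)). assert (H := Rabs_pos (J (S m) 1)). lra. }
  rewrite Rmult_assoc. apply em_err_bound; auto.
  - intros j y Hj Hy. apply HJ; auto; lra.
  - intros y Hy. eapply Rle_trans; [apply HB; lra|]. apply Rmult_le_compat_l; auto. pos.
Qed.

Lemma ex_series_em_err m J B :
  (1 <= m)%nat -> em_admissible m J B -> ex_series (fun n => em_err m J (INR (S n))).
Proof.
  intros Hm H. eapply ex_series_Rabs_le.
  - intros n. apply (em_err_admissible m J B n Hm H).
  - apply (@ex_series_scal R_AbsRing R_NormedModule (em_const m * B) (fun n => / INR (S n) ^ 2)). apply ex_series_inv_sq.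
Qed.

Lemma Reg_bound m J B :
  (1 <= m)%nat -> em_admissible m J B ->
  (forall j, (j <= m)%nat -> Rabs (J j 1) <= B) ->
  Rabs (Reg m J) <= 3 * em_const m * B.
Proof.
  intros Hm H HB. unfold Reg. via Rabs_triang. assert (HB0 : 0 <= B) by (eapply Rle_trans; [apply Rabs_pos|apply (HB O); lia]).
  (* One share comes from the boundary terms at [1], two from the error series, since the sum of the
     inverse squares is at most [2]. *)
  assert (H0 := em_const_pos m). replace (3 * em_const m * B) with (em_const m * B + em_const m * B * 2) by ring. apply Rplus_le_compat.
  - rewrite Rabs_Ropp. via psum_Rabs. unfold em_const. rewrite Rmult_comm, <- psum_scal. apply psum_le. intros j Hj.
    rewrite Rabs_mult, Rmult_comm. apply Rmult_le_compat_r; [apply Rabs_pos|]. apply HB; lia.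
  - via Series_Rabs_le.
    + intros n. apply (em_err_admissible m J B n Hm H).
    + apply (@ex_series_scal R_AbsRing R_NormedModule (em_const m * B) (fun n => / INR (S n) ^ 2)). apply ex_series_inv_sq.
    + rewrite Series_scal_l. apply Rmult_le_compat_l; [nra|]. apply Series_inv_sq_le.
Qed.

Lemma em_err_plus m J1 J2 x :
  em_err m (fun j y => J1 j y + J2 j y) x = em_err m J1 x + em_err m J2 x.
Proof.
  unfold em_err. rewrite (psum_ext _ (fun j => beta j * (J1 j (x + 1) - J1 j x)
    + beta j * (J2 j (x + 1) - J2 j x))) by (intros; ring).
  rewrite psum_plus. ring.
Qed.

Lemma em_err_scal m c J x :
  em_err m (fun j y => c * J j y) x = c * em_err m J x.
Proof.
  unfold em_err. rewrite (psum_ext _ (fun j => c * (beta j * (J j (x + 1) - J j x))))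
    by (intros; ring).
  rewrite psum_scal. ring.
Qed.

Lemma Reg_plus m J1 J2 B1 B2 :
  (1 <= m)%nat -> em_admissible m J1 B1 -> em_admissible m J2 B2 ->
  Reg m (fun j y => J1 j y + J2 j y) = Reg m J1 + Reg m J2.
Proof.
  intros Hm H1 H2. unfold Reg. rewrite (psum_ext _ (fun j => beta j * J1 j 1 + beta j * J2 j 1)) by (intros; ring). rewrite psum_plus.
  rewrite (Series_ext _ (fun n => em_err m J1 (INR (S n)) + em_err m J2 (INR (S n))))
    by (intros; apply em_err_plus).
  rewrite Series_plus by (eapply ex_series_em_err; eauto). ring.
Qed.

Lemma Reg_scal m c J : Reg m (fun j y => c * J j y) = c * Reg m J.
Proof.
  unfold Reg. rewrite (psum_ext _ (fun j => c * (beta j * J j 1))) by (intros; ring). rewrite psum_scal.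
  rewrite (Series_ext _ (fun n => c * em_err m J (INR (S n))))
    by (intros; apply em_err_scal).
  rewrite Series_scal_l. ring.
Qed.

Lemma em_admissible_plus m J1 J2 B1 B2 :
  em_admissible m J1 B1 -> em_admissible m J2 B2 ->
  em_admissible m (fun j y => J1 j y + J2 j y) (B1 + B2).
Proof.
  intros [H1 H1'] [H2 H2']. split.
  - intros j x Hj Hx. apply is_derive_Rplus; auto.
  - intros x Hx. via Rabs_triang. unfold Rdiv. rewrite Rmult_plus_distr_r. apply Rplus_le_compat; auto.
Qed.

Lemma em_admissible_scal m c J B :
  em_admissible m J B -> em_admissible m (fun j y => c * J j y) (Rabs c * B).
Proof.
  intros [H H']. split.
  - intros j x Hj Hx. apply is_derive_Rscal; auto.
  - intros x Hx. rewrite Rabs_mult. unfold Rdiv. rewrite Rmult_assoc. apply Rmult_le_compat_l; [apply Rabs_pos|auto].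
Qed.

Lemma Reg_ext m J1 J2 : (1 <= m)%nat ->
  (forall j x, (j <= m)%nat -> 1 <= x -> J1 j x = J2 j x) -> Reg m J1 = Reg m J2.
Proof.
  intros Hm H. unfold Reg. f_equal.
  - f_equal. apply psum_ext. intros i Hi. rewrite H; [reflexivity|lia|lra].
  - apply Series_ext. intros n. assert (H1 : 1 <= INR (S n)) by (apply (le_INR 1); lia). unfold em_err. rewrite H by auto. f_equal.
    apply psum_ext. intros i Hi. rewrite !H by (lia || lra). reflexivity.
Qed.

Lemma em_partial_sum m J N :
  psum (fun n => J 1%nat (INR (S n))) N
  = psum (fun j => beta j * J j (INR (S N))) (S m)
    - psum (fun j => beta j * J j 1) (S m)
    + psum (fun n => em_err m J (INR (S n))) N.
Proof.
  induction N as [|N IH].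
  - simpl; lra.
  - change (psum (fun n => J 1%nat (INR (S n))) N + J 1%nat (INR (S N)) =
      psum (fun j => beta j * J j (INR (S (S N)))) (S m)
      - psum (fun j => beta j * J j 1) (S m)
      + (psum (fun n => em_err m J (INR (S n))) N + em_err m J (INR (S N)))).
    rewrite IH. unfold em_err at 3. rewrite (S_INR (S N)). rewrite (psum_ext (fun j => beta j * (J j (INR (S N) + 1) - J j (INR (S N))))
      (fun j => beta j * J j (INR (S N) + 1) - beta j * J j (INR (S N)))) by (intros; ring).
    rewrite psum_minus. ring.
Qed.

Lemma is_lim_seq_psum0 (u : nat -> nat -> R) p :
  (forall j, (j < p)%nat -> is_lim_seq (u j) 0) ->
  is_lim_seq (fun n => psum (fun j => u j n) p) 0.
Proof.
  induction p as [|p IH]; intros H; simpl.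
  - apply is_lim_seq_const.
  - replace 0 with (0 + 0) by ring. apply (is_lim_seq_plus' _ (u p)); auto.
Qed.

(** Only the derivatives of order at least one have to vanish at infinity, because [J 0] is
    subtracted. With [J 0 = ln] this is Euler's limit for the harmonic numbers. *)
Lemma is_lim_seq_em_partial m J B :
  (1 <= m)%nat -> em_admissible m J B ->
  (forall j, (1 <= j <= m)%nat -> is_lim_seq (fun n => J j (INR (S n))) 0) ->
  is_lim_seq (fun N => psum (fun n => J 1%nat (INR (S n))) N - J O (INR (S N))) (Reg m J).
Proof.
  intros Hm H H0. apply is_lim_seq_ext with
    (fun N => psum (fun j => beta (S j) * J (S j) (INR (S N))) m
    + (- psum (fun j => beta j * J j 1) (S m)
    + psum (fun n => em_err m J (INR (S n))) N)).
  - intros N. rewrite (em_partial_sum m J N), (psum_S_l (fun j => beta j * J j (INR (S N))) m). change (beta 0) with 1. ring.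
  - replace (Finite (Reg m J)) with (Finite (0 + Reg m J)) by (f_equal; ring).
    apply (is_lim_seq_plus' (fun N => psum (fun j => beta (S j) * J (S j) (INR (S N))) m)).
    + apply is_lim_seq_psum0. intros j Hj. replace 0 with (beta (S j) * 0) by ring.
      apply (is_lim_seq_scal_l (fun n => J (S j) (INR (S n))) (beta (S j)) 0). apply H0; lia.
    + apply (is_lim_seq_plus' (fun _ => _)); [apply is_lim_seq_const|]. apply is_series_psum. apply Series_correct.
      eapply ex_series_em_err; eauto.
Qed.

Lemma is_series_Reg m J B :
  (1 <= m)%nat -> em_admissible m J B ->
  (forall j, (j <= m)%nat -> is_lim_seq (fun n => J j (INR (S n))) 0) ->
  is_series (fun n => J 1%nat (INR (S n))) (Reg m J).
Proof.
  intros Hm H H0. apply is_series_psum. apply is_lim_seq_ext with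
    (fun N => (psum (fun n => J 1%nat (INR (S n))) N - J O (INR (S N))) + J O (INR (S N))).
  - intros; pos.
  - replace (Finite (Reg m J)) with (Finite (Reg m J + 0)) by (f_equal; ring). apply (is_lim_seq_plus' _ (fun N => J O (INR (S N)))).
    + eapply is_lim_seq_em_partial; eauto. intros; apply H0; lia.
    + apply H0; lia.
Qed.

(** * Elementary estimates *)

(** A quadratic bound on the first-order Taylor error is stable under every linear process.
    Differentiation of [Reg], of integrals and of series with respect to a parameter all go through
    this criterion. *)
Lemma is_derive_of_quadratic (f : R -> R) (x l eta B : R) :
  0 < eta ->
  (forall y, Rabs (y - x) < eta -> Rabs (f y - f x - (y - x) * l) <= B * (y - x) ^ 2) ->
  is_derive f x l.
Proof.
  intros Heta H. apply is_derive_Reals. intros eps Heps. assert (Hd : 0 < Rmin eta (eps / (Rabs B + 1))).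
  { apply Rmin_pos; auto. pos. }
  exists (mkposreal _ Hd). intros h Hh0 Hh. assert (Hh1 : Rabs h < eta) by (eapply Rlt_le_trans; [exact Hh|apply Rmin_l]).
  assert (Hh2 : Rabs h < eps / (Rabs B + 1)) by (eapply Rlt_le_trans; [exact Hh|apply Rmin_r]). specialize (H (x + h)).
  replace (x + h - x) with h in H by ring. specialize (H Hh1).
  replace ((f (x + h) - f x) / h - l) with ((f (x + h) - f x - h * l) / h) by (field; auto). unfold Rdiv. rewrite Rabs_mult, Rabs_inv.
  assert (Ha : 0 < Rabs h) by (apply Rabs_pos_lt; auto). apply Rmult_lt_reg_r with (Rabs h); auto.
  rewrite Rmult_assoc, Rinv_l, Rmult_1_r by lra. eapply Rle_lt_trans; [exact H|].
  replace (h ^ 2) with (Rabs h * Rabs h) by (rewrite <- (pow2_abs h); ring). assert (H0 := Rabs_pos B). assert (H1 := Rle_abs B).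
  apply Rle_lt_trans with ((Rabs B + 1) * Rabs h * Rabs h).
  - nra.
  - apply Rmult_lt_compat_r; auto. apply Rmult_lt_reg_r with (/ (Rabs B + 1)); [apply Rinv_0_lt_compat; lra|].
    replace ((Rabs B + 1) * Rabs h * / (Rabs B + 1)) with (Rabs h) by (field; lra). lra.
Qed.

Lemma taylor2_bound (f f1 f2 : R -> R) (a b M : R) :
  (forall x, Rmin a b <= x <= Rmax a b -> is_derive f x (f1 x)) ->
  (forall x, Rmin a b <= x <= Rmax a b -> is_derive f1 x (f2 x)) ->
  (forall x, Rmin a b <= x <= Rmax a b -> Rabs (f2 x) <= M) ->
  Rabs (f b - f a - (b - a) * f1 a) <= M * (b - a) ^ 2.
Proof.
  intros H1 H2 HM. replace (f b - f a - (b - a) * f1 a)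
    with ((f b - f1 a * b) - (f a - f1 a * a)) by ring.
  rewrite <- (pow2_abs (b - a)). replace (M * Rabs (b - a) ^ 2) with (M * Rabs (b - a) * Rabs (b - a)) by ring.
  apply (deriv_bound (fun x => f x - f1 a * x) (fun x => f1 x - f1 a)).
  - intros x Hx. apply is_derive_Rminus; auto. auto_derive; auto; eqR; ring.
  - intros x Hx. assert (HM0 : 0 <= M) by (eapply Rle_trans; [apply Rabs_pos|apply (HM x); auto]).
    apply Rle_trans with (M * Rabs (x - a)).
    + apply (deriv_bound f1 f2); intros y Hy; [apply H2|apply HM];
        revert Hx Hy; unfold Rmin, Rmax; repeat destruct Rle_dec; lra.
    + apply Rmult_le_compat_l; auto. revert Hx; unfold Rmin, Rmax; repeat destruct Rle_dec; intros;
        unfold Rabs; repeat destruct Rcase_abs; lra.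
Qed.

Lemma pow_le_fact_exp n : forall u, 0 <= u -> u ^ n / INR (fact n) <= exp u.
Proof.
  induction n as [|n IH]; intros u Hu.
  - simpl. assert (H := exp_ineq1_le u). lra.
  - assert (H : exp 0 - 1 * 0 ^ S n / INR (fact (S n)) <= exp u - 1 * u ^ S n / INR (fact (S n))).
    { apply (nondecreasing_of_deriv (fun u => exp u - 1 * u ^ S n / INR (fact (S n)))
        (fun u => exp u - 1 * u ^ n / INR (fact n))); auto.
      - intros x _. apply is_derive_Rminus; [|apply is_derive_taylor_monomial]. apply is_derive_Reals, derivable_pt_lim_exp.
      - intros x Hx. specialize (IH x). lra. }
    rewrite exp_0, pow_i, !Rmult_1_l in H by lia. lra.
Qed.

Lemma pow_le_exp n u : 0 <= u -> u ^ n <= INR (fact n) * exp u.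
Proof.
  intros Hu. assert (H := pow_le_fact_exp n u Hu). apply Rmult_le_reg_r with (/ INR (fact n)); [apply Rinv_0_lt_compat, INR_fact_lt_0|].
  replace (INR (fact n) * exp u * / INR (fact n)) with (exp u) by (field; apply INR_fact_neq_0). lra.
Qed.

Lemma is_lim_seq_poly_geom (c q : R) (p : nat) :
  0 <= c -> 0 < q < 1 -> is_lim_seq (fun n => (INR n + c) ^ p * q ^ n) 0.
Proof.
  (* Write [q = exp (- e) ^ 2]: one factor [exp (- e) ^ n] absorbs the power of [n], the other stays
     geometric. *)
  intros Hc Hq. assert (Hl : ln q < ln 1) by (apply ln_increasing; lra). rewrite ln_1 in Hl. set (e := - ln q / 2).
  assert (He : 0 < e) by (unfold e; lra). assert (Hq2 : q = exp (- e) * exp (- e)).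
  { rewrite <- exp_plus. replace (- e + - e) with (ln q) by (unfold e; lra). rewrite exp_ln; lra. }
  assert (H1 : exp e * exp (- e) = 1) by (rewrite <- exp_plus, Rplus_opp_r; apply exp_0).
  apply (lim_squeeze0 _ (fun n => INR (fact p) * exp (e * c) / e ^ p * exp (- e) ^ n)).
  - intros n. assert (Hn := pos_INR n). rewrite Rabs_right by pos. assert (H := pow_le_exp p (e * (INR n + c)) ltac:(pos)).
    rewrite Rpow_mult_distr, Rmult_plus_distr_l, exp_plus in H. replace (exp (e * INR n)) with (exp e ^ n) in H
      by (rewrite <- Rpower_pow by apply exp_pos; unfold Rpower; rewrite ln_exp; f_equal; ring).
    apply (Rmult_le_reg_l (e ^ p)); [pos|].
    replace (e ^ p * (INR (fact p) * exp (e * c) / e ^ p * exp (- e) ^ n)) with (INR (fact p) * (exp e ^ n * exp (e * c)) * q ^ n).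
    + rewrite <- Rmult_assoc. pos.
    + assert (HE : exp e ^ n * exp (- e) ^ n = 1) by (rewrite <- Rpow_mult_distr, H1; apply pow1).
      rewrite Hq2, Rpow_mult_distr. set (E := exp (- e) ^ n) in *.
      replace (INR (fact p) * (exp e ^ n * exp (e * c)) * (E * E)) with (INR (fact p) * exp (e * c) * E * (exp e ^ n * E)) by ring.
      rewrite HE. field. pos.
  - apply lim_scal0, is_lim_seq_geom. rewrite Rabs_right by pos. assert (H := exp_pos (- e)). nra.
Qed.

Definition entire (a : nat -> R) : Prop :=
  forall r, 0 <= r -> ex_series (fun n => Rabs (a n) * r ^ n).

Lemma entire_CV_radius a : entire a <-> CV_radius a = p_infty.
Proof.
  split.
  - intros H. destruct (CV_radius a) as [r| |] eqn:E; auto; exfalso.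
    + assert (H0 := CV_radius_ge_0 a). rewrite E in H0. simpl in H0. apply (CV_disk_outside a (r + 1)).
      * rewrite E. simpl. rewrite Rabs_right; lra.
      * apply ex_series_lim_0. apply ex_series_Rabs_le with (fun n => Rabs (a n) * (r + 1) ^ n).
        -- intros n. rewrite Rabs_mult, (Rabs_right ((r + 1) ^ n)). lra. apply Rle_ge, pow_le; lra.
        -- apply H; lra.
    + assert (H0 := CV_radius_ge_0 a). rewrite E in H0. exact H0.
  - intros H r Hr. apply ex_series_ext with (fun n => Rabs (a n * r ^ n)).
    + intros n. rewrite Rabs_mult, (Rabs_right (r ^ n)); auto. apply Rle_ge, pow_le; auto.
    + apply CV_disk_inside. rewrite H. exact I.
Qed.

Lemma entire_ex_series a x : entire a -> ex_series (fun n => a n * x ^ n).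
Proof.
  intros H. apply ex_series_Rabs_le with (fun n => Rabs (a n) * Rabs x ^ n).
  - intros n. rewrite Rabs_mult, RPow_abs. lra.
  - apply H, Rabs_pos.
Qed.

Lemma entire_PS_derive a : entire a -> entire (PS_derive a).
Proof. rewrite !entire_CV_radius, CV_radius_derive. auto. Qed.

Lemma is_derive_PSeries_entire a (x : R) :
  entire a -> is_derive (PSeries a) x (PSeries (PS_derive a) x).
Proof. intros H. apply is_derive_PSeries. apply entire_CV_radius in H. rewrite H. exact I. Qed.

Lemma is_lim_seq_Rpower_neg (c : R) : c < 0 -> is_lim_seq (fun n => Rpower (INR (S n)) c) 0.
Proof.
  intros Hc. apply (is_lim_comp_seq exp (fun n => c * ln (INR (S n))) m_infty 0).
  - apply is_lim_exp_m.
  - exists O; intros; discriminate.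
  - replace m_infty with (Rbar_mult c p_infty).
    + apply is_lim_seq_scal_l. apply (is_lim_comp_seq ln (fun n => INR (S n)) p_infty p_infty).
      * apply is_lim_ln_p.
      * exists O; intros; discriminate.
      * apply (is_lim_seq_incr_1 INR p_infty), is_lim_seq_INR.
    + simpl. destruct (Rle_dec 0 c); [exfalso; lra|reflexivity].
Qed.

(** * The zeta function through Euler-Maclaurin summation *)

(* The [j]-th derivative of [(ln x) ^ k * x ^ a] with respect to [x]. *)
Fixpoint plj (j k : nat) (a x : R) : R :=
  match j with
  | O => ln x ^ k * Rpower x a
  | S i => INR k * plj i (pred k) (a - 1) x + a * plj i k (a - 1) x
  end.

Lemma Rpower_minus_1 x a : 0 < x -> Rpower x (a - 1) = Rpower x a / x.
Proof. intros Hx. unfold Rminus. rewrite Rpower_plus, Rpower_Ropp, Rpower_1 by auto. reflexivity. Qed.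

Lemma is_derive_plj_x j : forall k (a x : R), 0 < x ->
  is_derive (plj j k a) x (plj (S j) k a x).
Proof.
  induction j as [|j IH]; intros k a x Hx.
  - apply (is_derive_ext (fun x => ln x ^ k * exp (a * ln x))).
    + auto.
    + auto_derive; auto. simpl. rewrite Rpower_minus_1 by auto. unfold Rpower. lra.
  - apply is_derive_Rplus; apply is_derive_Rscal; apply IH; auto.
Qed.

(** Differentiation in the exponent multiplies by [ln x], so the index [k] counts derivatives in
    [a]; this is what makes [RegF m (S k)] the derivative of [RegF m k]. *)
Lemma is_derive_plj_a j : forall k (a x : R), 0 < x ->
  is_derive (fun a => plj j k a x) a (plj j (S k) a x).
Proof.
  induction j as [|j IH]; intros k a x Hx.
  - change (is_derive (fun a => ln x ^ k * exp (a * ln x)) a (ln x * ln x ^ k * exp (a * ln x))). auto_derive; auto; eqR; ring.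
  - assert (Hs : forall k, is_derive (fun a => plj j k (a - 1) x) a (plj j (S k) (a - 1) x)).
    { intros k'. apply is_derive_eq with (plj j (S k') (a - 1) x * 1); [|eqR; ring].
      apply (is_derive_Rcomp (fun a => plj j k' a x) (fun a => a - 1)); [apply IH; auto|]. auto_derive; auto; eqR; ring. }
    change (is_derive (fun a => INR k * plj j (pred k) (a - 1) x + a * plj j k (a - 1) x) a
      (INR (S k) * plj j k (a - 1) x + a * plj j (S k) (a - 1) x)).
    apply is_derive_eq with (INR k * plj j (S (pred k)) (a - 1) x
      + (1 * plj j k (a - 1) x + a * plj j (S k) (a - 1) x)).
    + apply is_derive_Rplus; [apply is_derive_Rscal; apply Hs|].
      apply (is_derive_Rmult (fun a => a) (fun a => plj j k (a - 1) x)); [|apply Hs]. auto_derive; auto; eqR; ring.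
    + rewrite S_INR. destruct k as [|k]; simpl pred; [simpl INR|]; ring.
Qed.

Lemma plj_bound j : forall k a x, 1 <= x ->
  Rabs (plj j k a x)
    <= (INR k + Rabs a + INR j) ^ j * (1 + ln x) ^ k * Rpower x (a - INR j).
Proof.
  assert (Hln : forall x, 1 <= x -> 0 <= ln x).
  { intros x Hx. destruct (Req_dec x 1) as [->|]; [rewrite ln_1; lra|]. rewrite <- ln_1. apply Rlt_le, ln_increasing; lra. }
  induction j as [|j IH]; intros k a x Hx; specialize (Hln x Hx).
  - simpl (plj _ _ _ _). rewrite Rminus_0_r, pow_O, Rmult_1_l.
    rewrite Rabs_mult, (Rabs_right (Rpower x a)) by (apply Rle_ge, Rlt_le, exp_pos). apply Rmult_le_compat_r; [apply Rlt_le, exp_pos|].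
    rewrite Rabs_right by (apply Rle_ge, pow_le; auto). pos.
  - assert (Hk := pos_INR k). assert (Hj := pos_INR j). assert (Ha := Rabs_pos a).
    set (E := (INR k + Rabs a + INR (S j)) ^ j * (1 + ln x) ^ k * Rpower x (a - INR (S j))). assert (HE : 0 <= E).
    { apply Rmult_le_pos; [apply Rmult_le_pos; apply pow_le|apply Rlt_le, exp_pos];
        rewrite ?S_INR; lra. }
    assert (Hb : forall k', (k' <= k)%nat -> Rabs (plj j k' (a - 1) x) <= E).
    { intros k' Hk'. eapply Rle_trans; [apply IH; auto|]. assert (Hk2 : INR k' <= INR k) by (apply le_INR; auto).
      assert (Hk3 := pos_INR k'). replace (a - 1 - INR j) with (a - INR (S j)) by (rewrite S_INR; ring).
      apply Rmult_le_compat_r; [apply Rlt_le, exp_pos|]. assert (Ha1 : Rabs (a - 1) <= Rabs a + 1).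
      { unfold Rabs; repeat destruct Rcase_abs; lra. }
      assert (Ha2 := Rabs_pos (a - 1)). apply Rmult_le_compat.
      - pos.
      - pos.
      - apply pow_incr. rewrite S_INR. lra.
      - apply Rle_pow; [lra|auto]. }
    via Rabs_triang. rewrite !Rabs_mult, (Rabs_right (INR k)) by lra. apply Rle_trans with (INR k * E + Rabs a * E).
    + apply Rplus_le_compat; apply Rmult_le_compat_l; auto. apply Hb; lia.
    + replace ((INR k + Rabs a + INR (S j)) ^ S j * (1 + ln x) ^ k * Rpower x (a - INR (S j)))
        with ((INR k + Rabs a + INR (S j)) * E) by (unfold E; simpl; ring).
      rewrite <- Rmult_plus_distr_r. apply Rmult_le_compat_r; auto. rewrite S_INR; lra.
Qed.

Definition RegF (m k : nat) (a : R) : R := Reg m (fun j x => plj j k a x).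

(** Uniform for [Rabs a <= A]. The factorial is tempered by [(A + 1) ^ k], which wins against the
    [a ^ k] of a Taylor series in [a], [a < A]; the remaining dependence on [k] is polynomial. *)
Definition plj_const (A : R) (m k : nat) : R :=
  (INR k + (A + INR m + 1)) ^ S m * (INR (fact k) / (A + 1) ^ k * exp (A + 1)).

Lemma log_pow_le rho x k : 0 < rho -> 1 <= x ->
  (1 + ln x) ^ k <= INR (fact k) / rho ^ k * exp rho * Rpower x rho.
Proof.
  intros Hr Hx. assert (Hl : 0 <= ln x).
  { rewrite <- ln_1. destruct (Req_dec x 1) as [->|]; [lra|]. apply Rlt_le, ln_increasing; lra. }
  assert (H := pow_le_exp k (rho * (1 + ln x))). rewrite Rpow_mult_distr, Rmult_plus_distr_l, exp_plus, Rmult_1_r in H.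
  assert (Hp : 0 < rho ^ k) by (apply pow_lt; auto). apply Rmult_le_reg_l with (rho ^ k); auto.
  replace (rho ^ k * (INR (fact k) / rho ^ k * exp rho * Rpower x rho))
    with (INR (fact k) * (exp rho * Rpower x rho)) by (field; lra).
  apply H. pos.
Qed.

Lemma plj_admissible (A : R) (m k : nat) (a : R) :
  0 <= A -> 2 * A + 2 <= INR m -> Rabs a <= A ->
  em_admissible m (fun j => plj j k a) (plj_const A m k)
  /\ forall j, (j <= m)%nat -> Rabs (plj j k a 1) <= plj_const A m k.
Proof.
  intros HA Hm Ha. assert (Ha0 := Rabs_pos a). assert (Hk := pos_INR k). assert (Haa := Rle_abs a). split; [split|].
  - intros j x Hj Hx. apply is_derive_plj_x; lra.
  - intros x Hx. eapply Rle_trans; [apply plj_bound; auto|]. eapply Rle_trans.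
    { apply Rmult_le_compat_r; [apply Rlt_le, exp_pos|]. apply Rmult_le_compat_l; [|apply (log_pow_le (A + 1)); lra]. apply pow_le.
      assert (H := pos_INR (S m)). lra. }
    unfold plj_const, Rdiv. rewrite !Rmult_assoc. apply Rmult_le_compat.
    + apply pow_le. assert (H := pos_INR (S m)). lra.
    + repeat (apply Rmult_le_pos); try (apply Rlt_le, exp_pos). apply pos_INR. apply Rlt_le, Rinv_0_lt_compat, pow_lt; lra.
    + apply pow_incr. rewrite S_INR. assert (H := pos_INR m). lra.
    + apply Rmult_le_compat_l; [apply pos_INR|]. apply Rmult_le_compat_l; [apply Rlt_le, Rinv_0_lt_compat, pow_lt; lra|].
      (* The powers of the logarithm were traded for [Rpower x (A + 1)], so the exponent is
         [a - (m + 1) + (A + 1)]. It is at most [-2] exactly because [2 A + 2 <= m]. *)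
      apply Rmult_le_compat_l; [apply Rlt_le, exp_pos|]. rewrite <- Rpower_plus. replace (/ x ^ 2) with (Rpower x (-2)).
      * apply Rle_Rpower; auto. rewrite S_INR. lra.
      * rewrite <- (Rpower_pow 2) by lra. rewrite <- Rpower_Ropp. replace (- INR 2) with (-2) by (simpl; lra). reflexivity.
  - intros j Hj. eapply Rle_trans; [apply plj_bound; lra|]. assert (Hjm : INR j <= INR m) by (apply le_INR; auto).
    assert (Hj0 := pos_INR j). assert (E : forall c, Rpower 1 c = 1) by (intros; unfold Rpower; rewrite ln_1, Rmult_0_r; apply exp_0).
    assert (H1 := log_pow_le (A + 1) 1 k). rewrite E in *. rewrite ln_1, Rplus_0_r, pow1 in *. rewrite !Rmult_1_r in *. unfold plj_const.
    apply Rle_trans with ((INR k + (A + INR m + 1)) ^ S m * 1).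
    + rewrite Rmult_1_r. apply Rle_trans with ((INR k + (A + INR m + 1)) ^ j).
      * apply pow_incr; lra.
      * apply Rle_pow; [lra|lia].
    + apply Rmult_le_compat_l; [apply pow_le; lra|]. apply H1; lra.
Qed.

Lemma RegF_bound A m k a :
  0 <= A -> 2 * A + 2 <= INR m -> Rabs a <= A ->
  Rabs (RegF m k a) <= 3 * em_const m * plj_const A m k.
Proof.
  intros HA Hm Ha. destruct (plj_admissible A m k a) as [H1 H2]; auto. apply Reg_bound; auto. apply INR_le. simpl; lra.
Qed.

Lemma is_derive_RegF A m k (a : R) :
  0 <= A -> 2 * A + 2 <= INR m -> Rabs a < A -> is_derive (RegF m k) a (RegF m (S k) a).
Proof.
  intros HA Hm Ha. assert (Hm1 : (1 <= m)%nat) by (apply INR_le; simpl; lra).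
  apply (is_derive_of_quadratic _ _ _ (A - Rabs a) (3 * em_const m * plj_const A m (S (S k)))).
  { lra. }
  intros a' Ha'. assert (Ha2 : Rabs a' <= A).
  { replace a' with ((a' - a) + a) by ring. via Rabs_triang. lra. }
  assert (Hbt : forall c, Rmin a a' <= c <= Rmax a a' -> Rabs c <= A).
  { intros c Hc. apply Rabs_le_between. apply Rlt_le, Rabs_le_between in Ha. apply Rabs_le_between in Ha2. revert Hc. unfold Rmin, Rmax.
    destruct Rle_dec; lra. }
  (* Since [Reg] is linear, the Taylor remainder of [RegF] in [a] is [Reg] of the Taylor remainder
     of [plj], whose bound is quadratic in [a' - a] with the decay in [x] preserved. *)
  set (J := fun j x => (plj j k a' x + (-1) * plj j k a x) + (- (a' - a)) * plj j (S k) a x).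
  assert (EJ : Reg m J = RegF m k a' - RegF m k a - (a' - a) * RegF m (S k) a).
  { destruct (plj_admissible A m k a' HA Hm Ha2) as [H1 _]. destruct (plj_admissible A m k a HA Hm) as [H2 _]; [lra|].
    destruct (plj_admissible A m (S k) a HA Hm) as [H3 _]; [lra|]. unfold J. erewrite Reg_plus; auto.
    2:{ eapply em_admissible_plus; [exact H1|]. apply em_admissible_scal. eauto. }
    2:{ apply em_admissible_scal. eauto. }
    erewrite Reg_plus; auto; [|exact H1|apply em_admissible_scal; exact H2]. rewrite !Reg_scal. unfold RegF. ring. }
  rewrite <- EJ. assert (HJ : forall j x, 1 <= x -> forall D,
    (forall c, Rabs c <= A -> Rabs (plj j (S (S k)) c x) <= D) ->
    Rabs (J j x) <= D * (a' - a) ^ 2).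
  { intros j x Hx D HD. unfold J. replace (plj j k a' x + -1 * plj j k a x + - (a' - a) * plj j (S k) a x)
      with (plj j k a' x - plj j k a x - (a' - a) * plj j (S k) a x) by ring.
    apply (taylor2_bound (fun c => plj j k c x) (fun c => plj j (S k) c x)
      (fun c => plj j (S (S k)) c x)); intros c Hc.
    - apply is_derive_plj_a; lra.
    - apply is_derive_plj_a; lra.
    - auto. }
  rewrite Rmult_assoc. apply Reg_bound; auto.
  - split.
    + intros j x Hj Hx. apply (is_derive_Rplus (fun x => plj j k a' x + -1 * plj j k a x)).
      * apply is_derive_Rplus; [|apply is_derive_Rscal]; apply is_derive_plj_x; lra.
      * apply is_derive_Rscal; apply is_derive_plj_x; lra.
    + intros x Hx. replace (plj_const A m (S (S k)) * (a' - a) ^ 2 / x ^ 2)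
        with (plj_const A m (S (S k)) / x ^ 2 * (a' - a) ^ 2) by (field; lra).
      apply HJ; auto. intros c Hc. destruct (plj_admissible A m (S (S k)) c HA Hm Hc) as [[_ H] _]. auto.
  - intros j Hj. apply HJ; [lra|]. intros c Hc. destruct (plj_admissible A m (S (S k)) c HA Hm Hc) as [_ H]. auto.
Qed.

(** For a negative exponent the whole jet vanishes at infinity, so nothing is discarded and the
    regularised value is the convergent sum. This is the base of the continuation in [a]. *)
Lemma RegF_neg A m a :
  0 <= A -> 2 * A + 2 <= INR m -> - A <= a < 0 ->
  is_series (fun n => a * Rpower (INR (S n)) (a - 1)) (RegF m 0 a).
Proof.
  intros HA Hm Ha. assert (Hm1 : (1 <= m)%nat) by (apply INR_le; simpl; lra). assert (Haa : Rabs a <= A) by (rewrite Rabs_left; lra).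
  apply is_series_ext with (fun n => plj 1 0 a (INR (S n))).
  - intros n. simpl; lra.
  - apply (is_series_Reg m (fun j => plj j 0 a) (plj_const A m 0)); auto.
    + apply plj_admissible; auto.
    + intros j Hj. apply is_lim_seq_abs_0. apply is_lim_seq_le_le with (u := fun _ => 0)
        (w := fun n => (Rabs a + INR j) ^ j * Rpower (INR (S n)) (a - INR j)).
      * split; [apply Rabs_pos|]. eapply Rle_trans; [apply plj_bound; apply (le_INR 1); lia|]. rewrite Rplus_0_l, Rmult_1_r. lra.
      * apply is_lim_seq_const.
      * replace 0 with ((Rabs a + INR j) ^ j * 0) by ring. apply (is_lim_seq_scal_l _ _ 0), is_lim_seq_Rpower_neg.
        assert (H := pos_INR j). lra.
Qed.

Lemma is_derive_continuity_pt (f : R -> R) (x l : R) : is_derive f x l -> continuity_pt f x.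
Proof.
  intros H. apply derivable_continuous_pt. exists l. apply is_derive_Reals, H.
Qed.

Lemma left_limit_zero (h : R -> R) (A : R) :
  0 < A -> continuity_pt h 0 -> (forall x, - A < x < 0 -> h x = 0) -> h 0 = 0.
Proof.
  intros HA Hc H0. destruct (Req_dec (h 0) 0) as [E|E]; [lra|exfalso].
  destruct (Hc (Rabs (h 0))) as [al [Hal H]]; [apply Rabs_pos_lt; auto|]. set (x := - (Rmin al A / 2)).
  assert (Hm : 0 < Rmin al A) by (apply Rmin_pos; auto). assert (Hm1 := Rmin_l al A). assert (Hm2 := Rmin_r al A). specialize (H x).
  simpl in H. unfold Rdist in H. rewrite H0 in H by (unfold x; lra). rewrite Rminus_0_l, Rabs_Ropp in H.
  apply (Rlt_irrefl (Rabs (h 0))), H. split.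
  - split; [exact I|]. unfold x; lra.
  - unfold x. rewrite Rminus_0_r, Rabs_Ropp, Rabs_right; lra.
Qed.

Lemma is_derive_local_eq (f g f' g' : R -> R) (a u v : R) :
  u < a < v -> (forall x, u < x < v -> f x = g x) ->
  is_derive f a (f' a) -> is_derive g a (g' a) -> f' a = g' a.
Proof.
  intros Ha He Hf Hg. assert (Hf2 : is_derive f a (g' a)).
  { apply (is_derive_ext_loc g); auto. assert (Hd : 0 < Rmin (a - u) (v - a)) by (apply Rmin_pos; lra). exists (mkposreal _ Hd).
    intros y Hy. symmetry. apply He. change (Rabs (y - a) < Rmin (a - u) (v - a)) in Hy. assert (H1 := Rmin_l (a - u) (v - a)).
    assert (H2 := Rmin_r (a - u) (v - a)). apply Rabs_lt_between in Hy. lra. }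
  rewrite <- (is_derive_unique f a (f' a) Hf). apply is_derive_unique. auto.
Qed.

Fixpoint PS_diter (k : nat) (d : nat -> R) : nat -> R :=
  match k with O => d | S p => PS_derive (PS_diter p d) end.

Lemma entire_PS_diter k d : entire d -> entire (PS_diter k d).
Proof. intros H. induction k; simpl; auto. apply entire_PS_derive; auto. Qed.

Lemma PS_diter_eq k d n : PS_diter k d n = INR (fact (n + k)) / INR (fact n) * d (n + k)%nat.
Proof.
  revert n. induction k as [|k IH]; intros n.
  - simpl. rewrite Nat.add_0_r. field. pos.
  - simpl. unfold PS_derive. rewrite IH. replace (n + S k)%nat with (S n + k)%nat by lia. rewrite (fact_simpl n), mult_INR. field. pos.
Qed.

(* Coefficients in powers of [a] of [a * zeta (1 - a)], where [c] are those of
    [zeta s - 1 / (s - 1)] in powers of [s - 1]. *)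
Definition zeta_coef (c : nat -> R) (n : nat) : R :=
  match n with O => -1 | S i => (-1) ^ i * c i end.

Lemma entire_zeta_coef c : entire c -> entire (zeta_coef c).
Proof.
  intros H r Hr. apply ex_series_incr_1. apply ex_series_ext with (fun n => r * (Rabs (c n) * r ^ n)).
  - intros n. unfold zeta_coef. rewrite Rabs_mult, pow_1_abs. simpl; lra.
  - apply (@ex_series_scal R_AbsRing R_NormedModule r (fun n => Rabs (c n) * r ^ n)). auto.
Qed.

Lemma PSeries_zeta_coef c a :
  entire c -> PSeries (zeta_coef c) a = -1 + a * PSeries c (- a).
Proof.
  intros H. rewrite PSeries_decr_1.
  - do 2 f_equal. apply Series_ext. intros n. unfold PS_decr_1, zeta_coef. replace (- a) with (-1 * a) by ring. rewrite Rpow_mult_distr.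
    ring.
  - apply CV_radius_inside. apply entire_zeta_coef, entire_CV_radius in H. rewrite H. exact I.
Qed.

(** Analytic continuation done by hand on the real line. For [a < 0] both sides are the Dirichlet
    series; their derivatives of all orders agree there, hence at [0]; and on [[0, A)] the Taylor
    series of [RegF] at [0] converges to it, so it equals the entire series. *)
Lemma RegF_PSeries (zeta : R -> R) (c : nat -> R) (A : R) (m : nat) :
  (forall s, 1 < s -> is_series (fun n => Rpower (INR (S n)) (- s)) (zeta s)) ->
  entire c -> (forall s, s <> 1 -> zeta s = / (s - 1) + PSeries c (s - 1)) ->
  1 <= A -> 2 * A + 2 <= INR m ->
  forall a, - A < a < A -> RegF m 0 a = PSeries (zeta_coef c) a.
Proof.
  intros Hz Hc Hzc HA Hm. set (d := zeta_coef c). assert (Hd : entire d) by (apply entire_zeta_coef; auto).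
  assert (H0 : forall a, - A < a < 0 -> RegF m 0 a = PSeries d a).
  { intros a Ha. assert (H := RegF_neg A m a ltac:(lra) Hm ltac:(lra)). apply is_series_unique in H. rewrite <- H. rewrite Series_scal_l.
    rewrite (Series_ext _ (fun n => Rpower (INR (S n)) (- (1 - a)))).
    2:{ intros n. f_equal. ring. }
    rewrite (is_series_unique _ _ (Hz (1 - a) ltac:(lra))). rewrite Hzc by lra. unfold d. rewrite PSeries_zeta_coef by auto.
    replace (1 - a - 1) with (- a) by ring. field. lra. }
  assert (Hk : forall k a, - A < a < 0 -> RegF m k a = PSeries (PS_diter k d) a).
  { induction k as [|k IH]; intros a Ha; [apply H0; auto|]. apply (is_derive_local_eq (RegF m k) (PSeries (PS_diter k d)) (RegF m (S k))
      (PSeries (PS_diter (S k) d)) a (- A) 0); auto.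
    - apply (is_derive_RegF A); auto; try lra. rewrite Rabs_left; lra.
    - apply is_derive_PSeries_entire, entire_PS_diter; auto. }
  (* Each derivative is continuous at [0], so equality to the left of [0] passes to [0] itself. *)
  assert (Hk0 : forall k, RegF m k 0 = INR (fact k) * d k).
  { intros k. apply Rminus_diag_uniq. rewrite <- (Rmult_1_l (_ * _)). replace (1 * (INR (fact k) * d k)) with (PSeries (PS_diter k d) 0).
    2:{ rewrite PSeries_0, PS_diter_eq. simpl; lra. }
    apply (left_limit_zero (fun a => RegF m k a - PSeries (PS_diter k d) a) A); try lra.
    - apply (is_derive_continuity_pt _ _ (RegF m (S k) 0 - PSeries (PS_diter (S k) d) 0)). apply is_derive_Rminus.
      + apply (is_derive_RegF A); auto; try lra. rewrite Rabs_R0; lra.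
      + apply is_derive_PSeries_entire, entire_PS_diter; auto.
    - intros x Hx. rewrite Hk by auto. ring. }
  intros a Ha. destruct (Rlt_dec a 0) as [Hn|Hn]; [apply H0; lra|]. set (P := fun n => psum (fun i => d i * a ^ i) n).
  assert (HT : forall n, Rabs (RegF m 0 a - P n)
    <= 3 * em_const m * plj_const A m n * a ^ n / INR (fact n)).
  { intros n. replace a with (0 + a) at 1 by ring. replace (P n) with (psum (fun i => RegF m i 0 * a ^ i / INR (fact i)) n).
    - apply (jet_taylor n (fun k => RegF m k)); [lra| |].
      + intros k x Hkn Hx. apply (is_derive_RegF A); auto; try lra. rewrite Rabs_right; lra.
      + intros x Hx. apply RegF_bound; auto; try lra. rewrite Rabs_right; lra.
    - apply psum_ext. intros i _. rewrite Hk0. field. pos. }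
  assert (Hl1 : is_lim_seq P (PSeries d a)).
  { apply is_series_psum. apply Series_correct. apply entire_ex_series; auto. }
  (* In the Taylor remainder the factorials cancel, leaving a power of [n] of fixed degree times
     [(a / (A + 1)) ^ n]. *)
  assert (Hl2 : is_lim_seq (fun n => RegF m 0 a - P n) 0).
  { apply is_lim_seq_abs_0. apply is_lim_seq_le_le with (u := fun _ => 0)
      (w := fun n => (3 * em_const m * exp (A + 1)) *
      ((INR n + (A + INR m + 1)) ^ S m * (A / (A + 1)) ^ n)).
    - split; [apply Rabs_pos|]. via HT. assert (Hf : 0 < INR (fact n)) by apply INR_fact_lt_0.
      assert (Ha1 : 0 < (A + 1) ^ n) by (apply pow_lt; lra). unfold plj_const.
      replace (3 * em_const m * ((INR n + (A + INR m + 1)) ^ S m *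
        (INR (fact n) / (A + 1) ^ n * exp (A + 1))) * a ^ n / INR (fact n))
        with ((3 * em_const m * exp (A + 1)) * ((INR n + (A + INR m + 1)) ^ S m
        * (a ^ n * / (A + 1) ^ n))) by (field; lra).
      apply Rmult_le_compat_l.
      { repeat apply Rmult_le_pos; try lra. apply em_const_pos. pos. }
      apply Rmult_le_compat_l.
      { pos. }
      unfold Rdiv. rewrite Rpow_mult_distr, pow_inv. apply Rmult_le_compat_r; [apply Rlt_le, Rinv_0_lt_compat; auto|].
      apply pow_incr; lra.
    - apply is_lim_seq_const.
    - replace 0 with ((3 * em_const m * exp (A + 1)) * 0) by ring. apply (is_lim_seq_scal_l _ _ 0). apply is_lim_seq_poly_geom.
      + lra.
      + split; [apply Rdiv_lt_0_compat; lra|]. apply Rmult_lt_reg_r with (A + 1); [lra|]. field_simplify; lra. }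
  assert (Hl3 : is_lim_seq (fun n => RegF m 0 a - P n) (RegF m 0 a - PSeries d a)).
  { apply is_lim_seq_minus'; [apply is_lim_seq_const|exact Hl1]. }
  apply is_lim_seq_unique in Hl2. apply is_lim_seq_unique in Hl3. rewrite Hl2 in Hl3. injection Hl3 as E. lra.
Qed.

Lemma RegF_PSeries_iter (c : nat -> R) (A : R) (m : nat) :
  entire c -> 1 <= A -> 2 * A + 2 <= INR m ->
  (forall a, - A < a < A -> RegF m 0 a = PSeries (zeta_coef c) a) ->
  forall k a, - A < a < A -> RegF m k a = PSeries (PS_diter k (zeta_coef c)) a.
Proof.
  intros Hc HA Hm H. induction k as [|k IH]; intros a Ha; [apply H; auto|].
  apply (is_derive_local_eq (RegF m k) (PSeries (PS_diter k (zeta_coef c))) (RegF m (S k))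
           (PSeries (PS_diter (S k) (zeta_coef c))) a (- A) A); auto.
  - apply (is_derive_RegF A); auto; try lra. apply Rabs_lt_between; lra.
  - apply is_derive_PSeries_entire, entire_PS_diter, entire_zeta_coef; auto.
Qed.

Lemma laurent_coef (zeta : R -> R) (c : nat -> R) (g0 g1 : R) :
  entire c -> (forall s, s <> 1 -> zeta s = / (s - 1) + PSeries c (s - 1)) ->
  laurent_at_1 zeta g0 g1 -> c O = g0 /\ c 1%nat = - g1.
Proof.
  intros Hc Hz [M [eta [Heta HL]]].
  set (h := fun e => PSeries c e - (g0 - g1 * e)).
  assert (Hh : forall e, e <> 0 -> Rabs e < eta -> Rabs (h e) <= M * e ^ 2).
  { intros e He Hee. specialize (HL e He Hee).
    rewrite Hz in HL by lra. replace (1 + e - 1) with e in HL by ring.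
    replace (e * (/ e + PSeries c e) - (1 + g0 * e - g1 * e ^ 2)) with (e * h e) in HL
      by (unfold h; field; auto).
    rewrite Rabs_mult in HL. apply Rmult_le_reg_l with (Rabs e); [apply Rabs_pos_lt; auto|].
    rewrite <- pow2_abs. replace (Rabs e * (M * Rabs e ^ 2)) with (M * Rabs e ^ 3) by ring.
    exact HL. }
  assert (Hd : forall x : R, is_derive h x (PSeries (PS_derive c) x - (0 - g1 * 1))).
  { intros x. apply is_derive_Rminus; [apply is_derive_PSeries_entire; auto|].
    apply is_derive_Rminus; [apply is_derive_Rconst|].
    apply is_derive_Rscal. apply is_derive_Rid. }
  (* The Laurent estimate is silent at [e = 0], so the value there is obtained by continuity along
     [/ INR (S n)]. *)
  assert (E : h 0 = 0).
  { apply Rabs_eq_0, Rle_antisym; [|apply Rabs_pos]. enough (0 <= M * (0 * 0) - Rabs (h 0)) by lra.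
    apply (le_lim_lo (fun y => M * (y * y) - Rabs (h y)) _ _ (eta / 2)); [lra| |].
    - intros y Hy. assert (H := Hh y ltac:(lra)). rewrite Rabs_right in H by lra. simpl in H. lra.
    - assert (L := is_lim_seq_inv_S). apply is_lim_seq_minus'; [apply (is_lim_seq_scal_l _ M (0 * 0)), is_lim_seq_mult'; exact L|].
      apply (is_lim_seq_abs _ (h 0)), (is_lim_seq_continuous h _ 0); [|exact L]. exact (is_derive_continuity_pt _ _ _ (Hd 0)). }
  assert (Hd0 : is_derive h 0 0).
  { apply (is_derive_of_quadratic _ _ _ eta M); auto.
    intros y Hy. rewrite Rminus_0_r in *. rewrite E, Rmult_0_r, !Rminus_0_r.
    destruct (Req_dec y 0) as [->|Hy0]; [rewrite E, Rabs_R0; lra|]. apply Hh; auto. }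
  split.
  - unfold h in E. rewrite PSeries_0 in E. lra.
  - specialize (Hd 0). apply is_derive_unique in Hd. apply is_derive_unique in Hd0.
    rewrite Hd0, PSeries_0 in Hd. unfold PS_derive in Hd. simpl in Hd. lra.
Qed.

(** * Regularised powers in terms of zeta, its derivative and the Stieltjes constants *)

Section ZetaValues.

Variables (zeta : R -> R) (c : nat -> R) (g0 g1 A : R) (m : nat).
Hypothesis Hz1 : forall s, 1 < s -> is_series (fun n => Rpower (INR (S n)) (- s)) (zeta s).
Hypothesis Hc : entire c.
Hypothesis Hz : forall s, s <> 1 -> zeta s = / (s - 1) + PSeries c (s - 1).
Hypothesis HL : laurent_at_1 zeta g0 g1.
Hypothesis HA : 1 <= A.
Hypothesis Hm : 2 * A + 2 <= INR m.

Let d := zeta_coef c.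

Lemma RegF_diter k a : - A < a < A -> RegF m k a = PSeries (PS_diter k d) a.
Proof.
  apply RegF_PSeries_iter; auto. intros; eapply RegF_PSeries; eauto.
Qed.

Lemma RegF_at_0 k : RegF m k 0 = INR (fact k) * d k.
Proof.
  rewrite RegF_diter by lra. rewrite PSeries_0, PS_diter_eq.
  simpl (0 + k)%nat. simpl (INR (fact 0)). field.
Qed.

Lemma RegF_0_0 : RegF m 0 0 = -1.
Proof. rewrite RegF_at_0. simpl. ring. Qed.

Lemma RegF_1_0 : RegF m 1 0 = g0.
Proof.
  rewrite RegF_at_0. destruct (laurent_coef zeta c g0 g1 Hc Hz HL) as [H _].
  simpl. rewrite H. ring.
Qed.

Lemma RegF_2_0 : RegF m 2 0 = 2 * g1.
Proof.
  rewrite RegF_at_0. destruct (laurent_coef zeta c g0 g1 Hc Hz HL) as [_ H].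
  simpl. rewrite H. ring.
Qed.

Lemma zeta_PSeries a : a <> 0 -> zeta (1 - a) = PSeries d a / a.
Proof.
  intros Ha. rewrite Hz by lra. unfold d. rewrite PSeries_zeta_coef by auto.
  replace (1 - a - 1) with (- a) by ring. field. auto.
Qed.

Lemma RegF_0_zeta a : - A < a < A -> a <> 0 -> RegF m 0 a = a * zeta (1 - a).
Proof.
  intros H H0. rewrite RegF_diter, zeta_PSeries by auto. simpl. field. auto.
Qed.

Lemma RegF_1_zeta a : - A < a < A -> a <> 0 ->
  RegF m 1 a = zeta (1 - a) - a * Derive zeta (1 - a).
Proof.
  intros H H0. rewrite RegF_diter by auto.
  assert (Hd : is_derive zeta (1 - a)
    (- ((PSeries (PS_derive d) a * a - PSeries d a) / a ^ 2))).
  { apply (is_derive_ext_loc (fun s => PSeries d (1 - s) / (1 - s))).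
    - exists (mkposreal _ (Rabs_pos_lt _ H0)). intros s Hs.
      change (Rabs (s - (1 - a)) < Rabs a) in Hs.
      assert (s <> 1).
      { intros ->. replace (1 - (1 - a)) with a in Hs by ring. lra. }
      replace s with (1 - (1 - s)) at 3 by ring. rewrite zeta_PSeries; [reflexivity|lra].
    - apply is_derive_eq with ((PSeries (PS_derive d) a * a - PSeries d a) / a ^ 2 * (-1)).
      2:{ eqR. ring. }
      apply (is_derive_Rcomp (fun u => PSeries d u / u) (fun s => 1 - s)).
      + replace (1 - (1 - a)) with a by ring.
        apply is_derive_eq with (PSeries (PS_derive d) a * / a + PSeries d a * (- / a ^ 2)).
        2:{ eqR. field. auto. }
        apply (is_derive_Rmult (PSeries d) (fun u => / u)).
        * apply is_derive_PSeries_entire, entire_zeta_coef; auto.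
        * auto_derive; auto. eqR. field. auto.
      + auto_derive; auto; eqR; ring. }
  rewrite (is_derive_unique _ _ _ Hd), zeta_PSeries by auto. simpl PS_diter. field. auto.
Qed.

End ZetaValues.

(** * Non-vanishing of zeta at negative odd integers *)

Lemma psum_sum_f_R0 f n : sum_f_R0 f n = psum f (S n).
Proof. induction n as [|n IH]; [simpl; ring|]. rewrite tech5, IH. reflexivity. Qed.

(** The radius is at least [/ 2] because [n + 1 <= 2 ^ n]. A small disc is enough, as identities
    near [0] determine all coefficients. *)
Lemma CV_radius_linear_growth a C x :
  (forall n, Rabs (a n) <= C * (INR n + 1)) -> Rabs x < / 2 ->
  Rbar_lt (Rabs x) (CV_radius a).
Proof.
  intros H Hx. apply Rbar_lt_le_trans with (/ 2); [exact Hx|]. apply (proj1 (CV_radius_bounded a)). exists C. intros n.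
  assert (H2 : INR n + 1 <= 2 ^ n).
  { clear. induction n as [|n IH]; [simpl; lra|]. rewrite S_INR. assert (H := pos_INR n). simpl; lra. }
  assert (H3 : 0 < 2 ^ n) by (apply pow_lt; lra). assert (HC : 0 <= C).
  { specialize (H O). simpl in H. assert (H4 := Rabs_pos (a O)). lra. }
  rewrite Rabs_mult, (Rabs_right ((/ 2) ^ n)) by (apply Rle_ge, pow_le; lra). rewrite pow_inv. apply Rmult_le_reg_r with (2 ^ n); auto.
  rewrite Rmult_assoc, Rinv_l, Rmult_1_r by lra. via H. nra.
Qed.

Lemma psum_inv_fact_le p : psum (fun i => / INR (fact (S (S i)))) p <= 1.
Proof.
  assert (H : psum (fun i => / INR (fact (S (S i)))) p <= 1 - / INR (S p)).
  { induction p as [|p IH].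
    - simpl. lra.
    - change (psum (fun i => / INR (fact (S (S i)))) p + / INR (fact (S (S p))) <= 1 - / INR (S (S p))).
      assert (H1 : / INR (fact (S (S p))) <= / (INR (S p) * INR (S (S p)))).
      { apply Rinv_le_contravar.
        - pos.
        - rewrite <- mult_INR. apply le_INR. rewrite !fact_simpl. assert (H0 := lt_O_fact p). nia. }
      assert (H2 : / INR (S p) - / INR (S (S p)) = / (INR (S p) * INR (S (S p)))).
      { rewrite (S_INR (S p)). assert (H0 : 0 < INR (S p)) by (apply lt_0_INR; lia). field. lra. }
      lra. }
  assert (H0 : 0 < / INR (S p)) by (apply Rinv_0_lt_compat, lt_0_INR; lia). lra.
Qed.

Lemma psum_rev f n : psum f n = psum (fun i => f (n - S i)%nat) n.
Proof.
  induction n as [|n IH]; [reflexivity|]. rewrite (psum_S_l (fun i => f (S n - S i)%nat)). simpl (S n - 1)%nat. rewrite Nat.sub_0_r.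
  simpl; lra.
Qed.

(** Strong induction on the recursion for [beta], whose weights [/ 2!, / 3!, ...] sum to at most
    [1]. It makes [beta] the coefficients of a convergent series near [0]. *)
Lemma beta_le_1 n : Rabs (beta n) <= 1.
Proof.
  induction n as [n IH] using Wf_nat.lt_wf_ind. destruct n as [|p].
  - change (beta 0) with 1. rewrite Rabs_R1; lra.
  - rewrite beta_S, Rabs_Ropp. via psum_Rabs. eapply Rle_trans; [|apply (psum_inv_fact_le (S p))].
    rewrite (psum_rev (fun i => / INR (fact (S (S i))))). apply psum_le. intros i Hi.
    replace (S (S (S p - S i))) with (S (S p) - i)%nat by lia. unfold Rdiv. rewrite Rabs_mult.
    rewrite (Rabs_right (/ _)) by (apply Rle_ge, Rlt_le, Rinv_0_lt_compat, INR_fact_lt_0). rewrite <- (Rmult_1_l (/ _)) at 2.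
    apply Rmult_le_compat_r.
    + pos.
    + auto.
Qed.

Lemma PS_zero (a : nat -> R) (C : R) :
  (forall n, Rabs (a n) <= C * (INR n + 1)) ->
  (forall x, Rabs x < / 2 -> PSeries a x = 0) -> forall n, a n = 0.
Proof.
  intros HC H n. apply (PSeries_ext_recip a (fun _ => 0)).
  - rewrite <- Rabs_R0 at 1. apply (CV_radius_linear_growth a C); auto. rewrite Rabs_R0; lra.
  - rewrite CV_radius_const_0. exact I.
  - assert (Hd : 0 < / 2) by lra. exists (mkposreal _ Hd). intros y Hy. rewrite PSeries_const_0. apply H.
    change (Rabs (y - 0) < / 2) in Hy. rewrite Rminus_0_r in Hy. lra.
Qed.

Section Bernoulli.

(** Coefficients of [(exp x - 1) / x], the reciprocal of the series with coefficients [beta]. *)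
Let u : nat -> R := fun n => / INR (fact (S n)).

Local Lemma u_le n : Rabs (u n) <= 1 * (INR n + 1).
Proof.
  unfold u. rewrite Rabs_right by (apply Rle_ge, Rlt_le, Rinv_0_lt_compat, INR_fact_lt_0). assert (H : / INR (fact (S n)) <= 1).
  { rewrite <- Rinv_1. apply Rinv_le_contravar; [lra|]. apply (le_INR 1), lt_O_fact. }
  assert (H2 := pos_INR n). lra.
Qed.

Local Lemma beta_lin n : Rabs (beta n) <= 1 * (INR n + 1).
Proof. assert (H := beta_le_1 n). assert (H2 := pos_INR n). lra. Qed.

Local Lemma beta_mul_u x : Rabs x < / 2 -> PSeries beta x * PSeries u x = 1.
Proof.
  intros Hx. rewrite <- PSeries_mult. 2: apply (CV_radius_linear_growth _ 1); auto; apply beta_lin.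
  2: apply (CV_radius_linear_growth _ 1); auto; apply u_le. apply is_series_unique. apply is_series_psum. apply is_lim_seq_incr_1.
  apply is_lim_seq_ext with (fun _ => 1); [|apply is_lim_seq_const]. intros n. rewrite psum_S_l. rewrite (psum_ext _ (fun _ => 0)).
  - rewrite psum_const. unfold PS_mult, u. simpl. change (beta 0) with 1. lra.
  - intros i _. unfold PS_mult, u. rewrite psum_sum_f_R0. assert (H := beta_conv (S (S i))).
    change (psum (fun j => beta j / INR (fact (S (S i) - j))) (S (S i))
      + beta (S (S i)) / INR (fact (S (S i) - S (S i)))
      = beta (S (S i)) + 0) in H.
    rewrite Nat.sub_diag in H. simpl (INR (fact 0)) in H. rewrite (psum_ext _ (fun j => beta j / INR (fact (S (S i) - j)))).
    + nra.
    + intros j Hj. replace (S (S i - j)) with (S (S i) - j)%nat by lia. reflexivity.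
Qed.

Local Lemma mul_u x : x * PSeries u x = exp x - 1.
Proof.
  rewrite exp_Reals, (PSeries_decr_1 (fun n => / INR (fact n))).
  - unfold PS_decr_1, u. simpl; lra.
  - eexists. apply is_exp_Reals.
Qed.

(* The Riccati equation [x b' = b - x b - b ^ 2] of [b x = x / (exp x - 1)]. *)
Local Lemma beta_riccati_fun x : Rabs x < / 2 ->
  x * PSeries (PS_derive beta) x
  = PSeries beta x - x * PSeries beta x - PSeries beta x * PSeries beta x.
Proof.
  intros Hx. assert (Hb : is_derive (PSeries beta) x (PSeries (PS_derive beta) x)).
  { apply is_derive_PSeries, (CV_radius_linear_growth _ 1); auto; apply beta_lin. }
  assert (Hu : is_derive (PSeries u) x (PSeries (PS_derive u) x)).
  { apply is_derive_PSeries, (CV_radius_linear_growth _ 1); auto; apply u_le. }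
  assert (H1 := beta_mul_u x Hx). assert (Hx' : - / 2 < x < / 2) by (apply Rabs_lt_between; auto).
  assert (D1 : PSeries (PS_derive beta) x * PSeries u x
    + PSeries beta x * PSeries (PS_derive u) x = 0).
  { apply (is_derive_local_eq (fun x => PSeries beta x * PSeries u x) (fun _ => 1)
      (fun x => PSeries (PS_derive beta) x * PSeries u x
      + PSeries beta x * PSeries (PS_derive u) x) (fun _ => 0) x (- / 2) (/ 2)); auto.
    - intros y Hy. apply beta_mul_u, Rabs_lt_between; auto.
    - apply is_derive_Rmult; auto.
    - apply is_derive_Rconst. }
  assert (D2 : 1 * PSeries u x + x * PSeries (PS_derive u) x = exp x).
  { apply (is_derive_local_eq (fun x => x * PSeries u x) (fun x => exp x - 1)
      (fun x => 1 * PSeries u x + x * PSeries (PS_derive u) x) exp x (- / 2) (/ 2)); auto.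
    - intros; apply mul_u.
    - apply (is_derive_Rmult (fun x => x)); auto. apply is_derive_Rid.
    - auto_derive; auto; eqR; ring. }
  assert (E := mul_u x). set (b := PSeries beta x) in *. set (b' := PSeries (PS_derive beta) x) in *. set (v := PSeries u x) in *.
  set (v' := PSeries (PS_derive u) x) in *. assert (Ev : x * v' = 1 + x * v - v) by lra.
  apply Rmult_eq_reg_r with v; [|intro Hv; rewrite Hv in H1; lra]. replace (x * b' * v) with (x * (b' * v)) by ring.
  replace (b' * v) with (- (b * v')) by lra. replace (x * - (b * v')) with (- b * (x * v')) by ring. rewrite Ev.
  replace ((b - x * b - b * b) * v) with (b * v - x * (b * v) - b * (b * v)) by ring.
  replace (- b * (1 + x * v - v)) with (- b - x * (b * v) + b * v) by ring. rewrite H1. ring.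
Qed.

(** Comparison of coefficients in the Riccati equation. It yields a quadratic recursion, from which
    signs can be read, unlike from the linear recursion that defines [beta]. *)
Lemma beta_riccati n :
  INR (S n) * beta (S n)
  = beta (S n) - beta n - psum (fun i => beta i * beta (S n - i)) (S (S n)).
Proof.
  set (w := fun n => PS_incr_1 (PS_derive beta) n - beta n
    + (PS_incr_1 beta n + PS_mult beta beta n)).
  assert (Hlin : forall n, Rabs (PS_incr_1 (PS_derive beta) n) <= 1 * (INR n + 1)
    /\ Rabs (PS_incr_1 beta n) <= 1 * (INR n + 1)
    /\ Rabs (PS_mult beta beta n) <= 1 * (INR n + 1)).
  { intros p. assert (Hp := pos_INR p). repeat split.
    - destruct p as [|p].
      + change (Rabs 0 <= 1 * (INR 0 + 1)). rewrite Rabs_R0. simpl; lra.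
      + change (Rabs (INR (S p) * beta (S p)) <= 1 * (INR (S p) + 1)). rewrite Rabs_mult, (Rabs_right (INR (S p))) by lra.
        assert (H := beta_le_1 (S p)). nra.
    - destruct p as [|p].
      + change (Rabs 0 <= 1 * (INR 0 + 1)). rewrite Rabs_R0. simpl; lra.
      + change (Rabs (beta p) <= 1 * (INR (S p) + 1)). assert (H := beta_le_1 p). lra.
    - unfold PS_mult. rewrite psum_sum_f_R0. via psum_Rabs. via (psum_le _ (fun _ => 1)).
      + intros i _. rewrite Rabs_mult. assert (H := beta_le_1 i). assert (H2 := beta_le_1 (p - i)).
        assert (H4 := Rabs_pos (beta (p - i))). nra.
      + rewrite psum_const, S_INR. lra. }
  assert (Hw : w (S n) = 0).
  { apply (PS_zero w 4).
    - intros p. destruct (Hlin p) as [H1 [H2 H3]]. assert (H4 := beta_lin p). via Rabs_triang.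
      eapply Rle_trans; [apply Rplus_le_compat; [apply Rabs_triang|apply Rabs_triang]|]. rewrite Rabs_Ropp. lra.
    - intros x Hx. assert (Hex : forall a, (forall n, Rabs (a n) <= 1 * (INR n + 1)) -> ex_pseries a x).
      { intros a Ha. apply CV_radius_inside, (CV_radius_linear_growth _ 1); auto. }
      change (PSeries (PS_plus (PS_minus (PS_incr_1 (PS_derive beta)) beta)
        (PS_plus (PS_incr_1 beta) (PS_mult beta beta))) x = 0).
      rewrite !PSeries_plus, PSeries_minus, !PSeries_incr_1, PSeries_mult.
      + rewrite beta_riccati_fun by auto. ring.
      + apply (CV_radius_linear_growth _ 1); auto; apply beta_lin.
      + apply (CV_radius_linear_growth _ 1); auto; apply beta_lin.
      + apply Hex; intros; apply Hlin.
      + apply Hex, beta_lin.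
      + apply Hex; intros; apply Hlin.
      + apply Hex; intros; apply Hlin.
      + apply ex_pseries_minus; [apply Hex; intros; apply Hlin|apply Hex, beta_lin].
      + apply ex_pseries_plus; apply Hex; intros; apply Hlin. }
  unfold w in Hw. change (PS_incr_1 (PS_derive beta) (S n)) with (INR (S n) * beta (S n)) in Hw.
  change (PS_incr_1 beta (S n)) with (beta n) in Hw. unfold PS_mult in Hw. rewrite psum_sum_f_R0 in Hw. lra.
Qed.

Lemma beta_1 : beta 1 = - / 2.
Proof. rewrite beta_S. simpl. change (beta 0) with 1. lra. Qed.

(** In the convolution the two products with [beta 0 = 1] move to the left and turn the factor into
    [n + 4], while those with [beta 1 = - / 2] cancel [beta (n + 2)]. *)
Lemma beta_quadratic n : (INR n + 4) * beta (n + 3) = - psum (fun i => beta (S (S i)) * beta (S n - i)) n.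
Proof.
  assert (H := beta_riccati (n + 2)). replace (S (n + 2)) with (n + 3)%nat in H by lia.
  replace (n + 3)%nat with (S (S (S n))) in * by lia. replace (n + 2)%nat with (S (S n)) in * by lia.
  rewrite psum_S_l, psum_S_l in H. cbn [psum] in H. rewrite (psum_ext _ (fun i => beta (S (S i)) * beta (S n - i))) in H.
  - rewrite !Nat.sub_diag, Nat.sub_0_r in H. replace (S (S (S n)) - 1)%nat with (S (S n)) in H by lia.
    replace (S (S (S n)) - S (S n))%nat with 1%nat in H by lia. rewrite beta_1 in H. change (beta 0) with 1 in H.
    rewrite !S_INR in H. lra.
  - reflexivity.
Qed.

(** The two indices in each product of [beta_quadratic] add up to an odd number, so one of them is a
    smaller odd index that is at least [3]. *)
Lemma beta_odd k : beta (2 * k + 3) = 0.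
Proof.
  induction k as [k IH] using Wf_nat.lt_wf_ind. assert (H := beta_quadratic (2 * k)).
  rewrite (psum_ext _ (fun _ => 0)), psum_const in H.
  - assert (Hk := pos_INR (2 * k)). nra.
  - intros i Hi. destruct (Nat.Even_or_Odd i) as [[p ->]|[p ->]].
    + replace (S (2 * k) - 2 * p)%nat with (2 * (k - 1 - p) + 3)%nat by lia. rewrite (IH (k - 1 - p)%nat) by lia. ring.
    + replace (S (S (2 * p + 1))) with (2 * p + 3)%nat by lia. rewrite (IH p) by lia. ring.
Qed.

(** Products of odd indices drop out by [beta_odd]. The remaining products
    [beta (2 j + 2) * beta (2 (k - j) + 2)] all have the sign of [(-1) ^ k] by induction, and the
    minus sign in [beta_quadratic] flips it for the next index. *)
Lemma beta_even_sign k : 0 < (-1) ^ k * beta (2 * k + 2).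
Proof.
  induction k as [k IH] using Wf_nat.lt_wf_ind. destruct k as [|k].
  - simpl. assert (H := beta_riccati 1). simpl in H. change (beta 0) with 1 in H. rewrite beta_1 in H. lra.
  - assert (H := beta_quadratic (2 * k + 1)). replace (2 * k + 1 + 3)%nat with (2 * S k + 2)%nat in H by lia.
    replace (psum _ _) with (psum (fun j => beta (2 * j + 2) * beta (2 * (k - j) + 2)) (S k)) in H.
    + assert (HP : psum (fun _ => 0) k <= psum (fun j => (-1) ^ k * (beta (2 * j + 2) * beta (2 * (k - j) + 2))) k /\
        0 < (-1) ^ k * (beta (2 * k + 2) * beta (2 * (k - k) + 2))).
      { assert (G : forall j, (j <= k)%nat -> 0 < (-1) ^ k * (beta (2 * j + 2) * beta (2 * (k - j) + 2))).
        { intros j Hj. replace ((-1) ^ k) with ((-1) ^ j * (-1) ^ (k - j)) by (rewrite <- pow_add; f_equal; lia).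
          assert (H1 := IH j ltac:(lia)). assert (H2 := IH (k - j)%nat ltac:(lia)). nra. }
        split; [|auto]. apply psum_le. intros j Hj. apply Rlt_le, G. lia. }
      rewrite psum_const, Rmult_0_r, psum_scal in HP. cbn [psum] in H. assert (Hk := pos_INR (2 * k + 1)). simpl ((-1) ^ S k).
      apply (Rmult_lt_reg_l (INR (2 * k + 1) + 4)); [lra|]. nra.
    + rewrite Nat.add_1_r. cbn [psum]. rewrite psum_even_odd, (psum_ext (fun i => beta (S (S (S (2 * i)))) * _) (fun _ => 0)), psum_const.
      * rewrite Rmult_0_r, Rplus_0_r. f_equal; [apply psum_ext; intros j Hj|]; do 2 f_equal; lia.
      * intros j _. replace (S (S (S (2 * j)))) with (2 * j + 3)%nat by lia. rewrite beta_odd. ring.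
Qed.

End Bernoulli.

(** The jet of [x ^ p] in polynomial form. It replaces [plj j 0 (INR p)] because it must also be
    evaluated at [x = 0], outside the reach of [Rpower]. *)
Definition mono_jet (p j : nat) (x : R) : R :=
  if Nat.leb j p then INR (fact p) / INR (fact (p - j)) * x ^ (p - j) else 0.

Lemma is_derive_mono_jet p j (x : R) : is_derive (mono_jet p j) x (mono_jet p (S j) x).
Proof.
  unfold mono_jet. destruct (Nat.leb_spec j p) as [H|H]; destruct (Nat.leb_spec (S j) p) as [H'|H'];
    try lia.
  - replace (p - j)%nat with (S (p - S j)) by lia.
    apply is_derive_eq with (INR (fact p) / INR (fact (S (p - S j))) * (INR (S (p - S j)) * x ^ (p - S j))).
    + apply is_derive_Rscal. apply is_derive_Reals. apply (derivable_pt_lim_pow x (S (p - S j))).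
    + rewrite fact_simpl, mult_INR. field. pos.
  - replace (p - j)%nat with O by lia. simpl. apply is_derive_Rconst.
  - apply is_derive_Rconst.
Qed.

Lemma mono_jet_plj p j : forall x, 0 < x -> plj j 0 (INR p) x = mono_jet p j x.
Proof.
  induction j as [|j IH]; intros x Hx.
  - unfold mono_jet. simpl. rewrite Nat.sub_0_r, Rpower_pow by auto. field. pos.
  - apply (is_derive_local_eq (plj j 0 (INR p)) (mono_jet p j) (plj (S j) 0 (INR p))
      (mono_jet p (S j)) x 0 (x + 1)); try lra.
    + intros y Hy. apply IH; lra.
    + apply is_derive_plj_x; auto.
    + apply is_derive_mono_jet.
Qed.

Lemma RegF_monomial p m : (2 <= p)%nat -> (p <= m)%nat ->
  RegF m 0 (INR p) = - (INR (fact p) * beta p).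
Proof.
  intros Hp Hm. unfold RegF. rewrite (Reg_ext m _ (mono_jet p)) by (lia || (intros; apply mono_jet_plj; lra)).
  assert (H0 : forall x, em_err m (mono_jet p) x = 0).
  { intros x. assert (H := em_err_bound m (mono_jet p) x 0 ltac:(lia)). rewrite Rmult_0_r in H.
    assert (H1 : Rabs (em_err m (mono_jet p) x) <= 0).
    { apply H.
      - intros j y _ _. apply is_derive_mono_jet.
      - intros y _. unfold mono_jet. destruct (Nat.leb_spec (S m) p); [lia|]. rewrite Rabs_R0; lra. }
    destruct (Req_dec (em_err m (mono_jet p) x) 0) as [E|E]; auto. apply Rabs_pos_lt in E. lra. }
  unfold Reg. rewrite (Series_ext _ (fun n => 0 * 0)) by (intros; rewrite H0; ring). rewrite Series_scal_l, Rmult_0_l, Rplus_0_r.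
  (* Euler-Maclaurin is exact on [x ^ p]. Used on [[0, 1]] it moves the boundary terms from [1] to
     [0], where only the derivative of order [p] survives. *)
  assert (E := H0 0). unfold em_err in E. rewrite Rplus_0_l in E.
  rewrite (psum_ext _ (fun j => beta j * mono_jet p j 1 - beta j * mono_jet p j 0)) in E
    by (intros; ring).
  rewrite psum_minus in E. replace (mono_jet p 1 0) with 0 in E.
  2:{ unfold mono_jet. destruct (Nat.leb_spec 1 p); [|lia]. rewrite pow_i by lia. ring. }
  replace (psum (fun j => beta j * mono_jet p j 0) (S m)) with (INR (fact p) * beta p) in E; [lra|].
  assert (Hd : forall q, psum (fun j => beta j * mono_jet p j 0) q
    = if Nat.leb q p then 0 else INR (fact p) * beta p).
  { induction q as [|q IH]; [reflexivity|]. simpl psum. rewrite IH. unfold mono_jet.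
    destruct (Nat.leb_spec q p) as [H1|H1]; destruct (Nat.leb_spec (S q) p) as [H2|H2]; try lia.
    - rewrite pow_i by lia. ring.
    - replace q with p by lia. rewrite Nat.sub_diag. simpl; lra.
    - ring. }
  rewrite Hd. destruct (Nat.leb_spec (S m) p); [lia|reflexivity].
Qed.

(** The regularised value of the power [2 k] is both [2 k * zeta (1 - 2 k)] and
    [- (2 k)! * beta (2 k)]. Nonvanishing matters because the expansion is stated with the quotient
    [Derive zeta s / zeta s]. *)
Lemma zeta_neg_odd_neq_0 zeta k : is_riemann_zeta zeta -> (1 <= k)%nat -> zeta (1 - 2 * INR k) <> 0.
Proof.
  intros [Hz1 [c [Hc Hz]]] Hk E. apply entire_CV_radius in Hc. assert (Hk1 : 1 <= INR k) by (apply (le_INR 1); auto).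
  set (m := (4 * k + 6)%nat). assert (Hm : INR m = 4 * INR k + 6).
  { unfold m. rewrite plus_INR, mult_INR. simpl; lra. }
  assert (H := RegF_0_zeta zeta c (2 * INR k + 1) m Hz1 Hc Hz ltac:(lra) ltac:(lra)
    (2 * INR k) ltac:(lra) ltac:(lra)).
  rewrite E, Rmult_0_r in H. replace (2 * INR k) with (INR (2 * k)) in H by (rewrite mult_INR; reflexivity).
  rewrite RegF_monomial in H by (unfold m; lia). assert (Hb := beta_even_sign (k - 1)).
  replace (2 * (k - 1) + 2)%nat with (2 * k)%nat in Hb by lia. assert (Hf := INR_fact_neq_0 (2 * k)).
  assert (H0 : beta (2 * k) = 0) by nra. nra.
Qed.

(** * Improper integrals along exhausting sequences of intervals *)

(** Nested intervals make the integrals of a nonnegative function increasing in [n], so existence of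
    an improper integral reduces to boundedness. The same interface serves the half-lines starting
    at [0] (open or closed) and at [1]. *)
Record improper (lo hi : nat -> R) (P : R -> Prop) : Prop := {
  imp_le : forall n, lo n <= hi n;
  imp_in : forall n x, lo n <= x <= hi n -> P x;
  imp_lo : forall n, lo (S n) <= lo n;
  imp_hi : forall n, hi n <= hi (S n) }.

Definition cont_on (P : R -> Prop) (f : R -> R) : Prop := forall x, P x -> continuous f x.

Definition is_iint (lo hi : nat -> R) (f : R -> R) (l : R) : Prop :=
  is_lim_seq (fun n => RInt f (lo n) (hi n)) l.

Lemma RInt_Rplus (f g : R -> R) a b :
  ex_RInt f a b -> ex_RInt g a b ->
  RInt (fun x => f x + g x) a b = RInt f a b + RInt g a b.
Proof. intros Hf Hg. exact (RInt_plus f g a b Hf Hg). Qed.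

Lemma RInt_Rscal (f : R -> R) a b k :
  ex_RInt f a b -> RInt (fun x => k * f x) a b = k * RInt f a b.
Proof. intros Hf. exact (RInt_scal f a b k Hf). Qed.

Lemma RInt_primitive (F f : R -> R) a b :
  a <= b ->
  (forall x, a <= x <= b -> is_derive F x (f x)) ->
  (forall x, a <= x <= b -> continuous f x) ->
  RInt f a b = F b - F a.
Proof.
  intros Hab HF Hf. apply is_RInt_unique. apply (is_RInt_derive F f); intros x; rewrite Rmin_left, Rmax_right by lra; auto.
Qed.

Lemma cont_on_plus P f g : cont_on P f -> cont_on P g -> cont_on P (fun x => f x + g x).
Proof. intros Hf Hg x Hx. exact (continuous_plus f g x (Hf x Hx) (Hg x Hx)). Qed.

Lemma cont_on_scal P f k : cont_on P f -> cont_on P (fun x => k * f x).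
Proof. intros Hf x Hx. exact (continuous_scal_r k f x (Hf x Hx)). Qed.

Lemma cont_on_mult P f g : cont_on P f -> cont_on P g -> cont_on P (fun x => f x * g x).
Proof. intros Hf Hg x Hx. exact (continuous_mult f g x (Hf x Hx) (Hg x Hx)). Qed.

Lemma cont_on_ext (P : R -> Prop) f g :
  (forall x, f x = g x) -> cont_on P f -> cont_on P g.
Proof. intros H Hf x Hx. apply (continuous_ext f); auto. Qed.

Lemma is_derive_cont_on (P : R -> Prop) (f f' : R -> R) :
  (forall x, P x -> is_derive f x (f' x)) -> cont_on P f.
Proof. intros H x Hx. apply (ex_derive_continuous f). eexists. auto. Qed.

Section Improper.

Variables (lo hi : nat -> R) (P : R -> Prop).
Hypothesis HI : improper lo hi P.

Lemma iint_ex_RInt f n : cont_on P f -> ex_RInt f (lo n) (hi n).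
Proof.
  intros Hf. apply (ex_RInt_continuous (V := R_CompleteNormedModule)). intros x Hx. assert (H := imp_le _ _ _ HI n).
  rewrite Rmin_left, Rmax_right in Hx by lra. apply Hf, (imp_in _ _ _ HI n); auto.
Qed.

Lemma iint_unique f l1 l2 : is_iint lo hi f l1 -> is_iint lo hi f l2 -> l1 = l2.
Proof. intros H1 H2. apply is_lim_seq_unique in H1. apply is_lim_seq_unique in H2. congruence. Qed.

Lemma iint_plus f g lf lg :
  cont_on P f -> cont_on P g -> is_iint lo hi f lf -> is_iint lo hi g lg ->
  is_iint lo hi (fun x => f x + g x) (lf + lg).
Proof.
  intros Cf Cg Hf Hg. apply is_lim_seq_ext with (fun n => RInt f (lo n) (hi n) + RInt g (lo n) (hi n)).
  - symmetry. apply RInt_Rplus; apply iint_ex_RInt; auto.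
  - apply is_lim_seq_plus'; auto.
Qed.

Lemma iint_scal f k lf :
  cont_on P f -> is_iint lo hi f lf -> is_iint lo hi (fun x => k * f x) (k * lf).
Proof.
  intros Cf Hf. apply is_lim_seq_ext with (fun n => k * RInt f (lo n) (hi n)).
  - symmetry. apply RInt_Rscal; apply iint_ex_RInt; auto.
  - apply (is_lim_seq_scal_l _ k lf); auto.
Qed.

Lemma iint_ext f g l :
  (forall x, P x -> f x = g x) -> is_iint lo hi f l -> is_iint lo hi g l.
Proof.
  intros H Hf. apply is_lim_seq_ext with (fun n => RInt f (lo n) (hi n)); auto. intros n. apply RInt_ext. intros x Hx.
  assert (Hl := imp_le _ _ _ HI n). rewrite Rmin_left, Rmax_right in Hx by lra. apply H, (imp_in _ _ _ HI n); lra.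
Qed.

Lemma RInt_le_on f g n :
  cont_on P f -> cont_on P g -> (forall x, P x -> f x <= g x) ->
  RInt f (lo n) (hi n) <= RInt g (lo n) (hi n).
Proof.
  intros Cf Cg H. apply RInt_le; try apply iint_ex_RInt; auto.
  - apply (imp_le _ _ _ HI).
  - intros x Hx. apply H, (imp_in _ _ _ HI n); lra.
Qed.

Lemma iint_le f g lf lg :
  cont_on P f -> cont_on P g -> (forall x, P x -> f x <= g x) ->
  is_iint lo hi f lf -> is_iint lo hi g lg -> lf <= lg.
Proof.
  intros Cf Cg H Hf Hg. apply (is_lim_seq_le (fun n => RInt f (lo n) (hi n)) (fun n => RInt g (lo n) (hi n)) lf lg); auto. intros n.
  apply RInt_le_on; auto.
Qed.

Lemma RInt_incr_on f n :
  cont_on P f -> (forall x, P x -> 0 <= f x) ->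
  RInt f (lo n) (hi n) <= RInt f (lo (S n)) (hi (S n)).
Proof.
  intros Cf H. assert (H1 := imp_lo _ _ _ HI n). assert (H2 := imp_le _ _ _ HI n). assert (H3 := imp_hi _ _ _ HI n).
  assert (Hex : forall a b, lo (S n) <= a -> a <= b -> b <= hi (S n) ->
    ex_RInt f a b /\ 0 <= RInt f a b).
  { intros a b Ha Hab Hb. assert (E : ex_RInt f a b).
    { apply (ex_RInt_continuous (V := R_CompleteNormedModule)). intros x Hx. rewrite Rmin_left, Rmax_right in Hx by lra.
      apply Cf, (imp_in _ _ _ HI (S n)); lra. }
    split; auto. apply RInt_ge_0; auto. intros x Hx. apply H, (imp_in _ _ _ HI (S n)); lra. }
  destruct (Hex (lo (S n)) (lo n)) as [E1 G1]; try lra. destruct (Hex (lo n) (hi n)) as [E2 G2]; try lra.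
  destruct (Hex (hi n) (hi (S n))) as [E3 G3]; try lra. destruct (Hex (lo (S n)) (hi n)) as [E4 G4]; try lra.
  assert (C1 : RInt f (lo (S n)) (lo n) + RInt f (lo n) (hi n) = RInt f (lo (S n)) (hi n))
    by exact (RInt_Chasles f _ _ _ E1 E2).
  assert (C2 : RInt f (lo (S n)) (hi n) + RInt f (hi n) (hi (S n)) = RInt f (lo (S n)) (hi (S n)))
    by exact (RInt_Chasles f _ _ _ E4 E3).
  lra.
Qed.

Lemma RInt_le_iint f n l :
  cont_on P f -> (forall x, P x -> 0 <= f x) -> is_iint lo hi f l ->
  RInt f (lo n) (hi n) <= l.
Proof.
  intros Cf H Hl. apply (is_lim_seq_incr_compare (fun n => RInt f (lo n) (hi n))); auto. intros p. apply RInt_incr_on; auto.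
Qed.

Lemma iint_ex_pos f D M :
  cont_on P f -> cont_on P D -> (forall x, P x -> 0 <= f x <= D x) ->
  (forall n, RInt D (lo n) (hi n) <= M) -> exists l, is_iint lo hi f l /\ 0 <= l <= M.
Proof.
  intros Cf CD H HM. assert (Hb : forall n, RInt f (lo n) (hi n) <= M).
  { intros n. eapply Rle_trans; [|apply (HM n)]. apply RInt_le_on; auto. apply H. }
  destruct (ex_finite_lim_seq_incr (fun n => RInt f (lo n) (hi n)) M) as [l Hl]; auto.
  - intros n. apply RInt_incr_on; auto. apply H.
  - exists l. split; auto. split.
    + apply (is_lim_seq_le (fun _ => 0) (fun n => RInt f (lo n) (hi n)) 0 l); auto.
      * intros n. apply RInt_ge_0; [apply (imp_le _ _ _ HI)|apply iint_ex_RInt; auto|]. intros x Hx. apply H, (imp_in _ _ _ HI n); lra.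
      * apply is_lim_seq_const.
    + apply (is_lim_seq_le (fun n => RInt f (lo n) (hi n)) (fun _ => M) l M); auto. apply is_lim_seq_const.
Qed.

Lemma iint_dominated f D LD :
  cont_on P f -> cont_on P D -> (forall x, P x -> Rabs (f x) <= D x) ->
  is_iint lo hi D LD -> exists l, is_iint lo hi f l /\ Rabs l <= LD.
Proof.
  intros Cf CD H HD. assert (HD0 : forall x, P x -> 0 <= D x).
  { intros x Hx. eapply Rle_trans; [apply Rabs_pos|apply H; auto]. }
  (* Since [0 <= f + D <= 2 D], the nonnegative case applies to [f + D]; then [D] is subtracted
     again. *)
  destruct (iint_ex_pos (fun x => f x + D x) (fun x => 2 * D x) (2 * LD)) as [l [Hl Hl2]].
  - apply cont_on_plus; auto.
  - apply cont_on_scal; auto.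
  - intros x Hx. specialize (H x Hx). apply Rabs_le_between in H. lra.
  - intros n. rewrite RInt_Rscal by (apply iint_ex_RInt; auto). apply Rmult_le_compat_l; [lra|]. apply RInt_le_iint; auto.
  - exists (l + -1 * LD). split.
    + apply (iint_ext (fun x => (f x + D x) + -1 * D x)); [intros; ring|]. apply iint_plus; auto.
      * apply cont_on_plus; auto.
      * apply cont_on_scal; auto.
      * apply iint_scal; auto.
    + apply Rabs_le_between. lra.
Qed.

Lemma iint_Rabs_le f D l LD :
  cont_on P f -> cont_on P D -> (forall x, P x -> Rabs (f x) <= D x) ->
  is_iint lo hi f l -> is_iint lo hi D LD -> Rabs l <= LD.
Proof.
  intros Cf CD H Hf HD. destruct (iint_dominated f D LD) as [l' [Hl' Hb]]; auto. rewrite (iint_unique f l l'); auto.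
Qed.

Lemma iint_primitive (F f : R -> R) (l0 l1 : R) :
  (forall x, P x -> is_derive F x (f x)) -> cont_on P f ->
  is_lim_seq (fun n => F (lo n)) l0 -> is_lim_seq (fun n => F (hi n)) l1 ->
  is_iint lo hi f (l1 - l0).
Proof.
  intros HF Cf H0 H1. apply is_lim_seq_ext with (fun n => F (hi n) - F (lo n)).
  - symmetry. apply (RInt_primitive F f); [apply (imp_le _ _ _ HI)| |].
    + intros x Hx. apply HF, (imp_in _ _ _ HI n); auto.
    + intros x Hx. apply Cf, (imp_in _ _ _ HI n); auto.
  - apply is_lim_seq_minus'; auto.
Qed.

(** The quantity [I p - I p0 - (p - p0) * J] is the integral of a Taylor remainder, dominated by
    [(p - p0) ^ 2 * D]; a majorant for the second parameter derivative is all that is required. *)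
Lemma is_derive_iint (f f1 f2 : R -> R -> R) (D I : R -> R) (p0 eta J LD : R) :
  0 < eta ->
  (forall p, Rabs (p - p0) < eta -> cont_on P (f p)) -> cont_on P (f1 p0) -> cont_on P D ->
  (forall p x, Rabs (p - p0) < eta -> P x -> is_derive (fun p => f p x) p (f1 p x)) ->
  (forall p x, Rabs (p - p0) < eta -> P x -> is_derive (fun p => f1 p x) p (f2 p x)) ->
  (forall p x, Rabs (p - p0) < eta -> P x -> Rabs (f2 p x) <= D x) ->
  is_iint lo hi D LD ->
  (forall p, Rabs (p - p0) < eta -> is_iint lo hi (f p) (I p)) ->
  is_iint lo hi (f1 p0) J ->
  is_derive I p0 J.
Proof.
  intros Heta Cf Cf1 CD H1 H2 H3 HD HIp HJ. apply (is_derive_of_quadratic _ _ _ eta LD); auto. intros p Hp.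
  assert (Hp0 : Rabs (p0 - p0) < eta) by (rewrite Rminus_diag, Rabs_R0; auto).
  set (g := fun x => (f p x + -1 * f p0 x) + - (p - p0) * f1 p0 x). assert (Cg1 : cont_on P (fun x => f p x + -1 * f p0 x)).
  { apply cont_on_plus; [|apply cont_on_scal]; apply Cf; auto. }
  assert (Hg : is_iint lo hi g (I p - I p0 - (p - p0) * J)).
  { replace (I p - I p0 - (p - p0) * J) with ((I p + -1 * I p0) + - (p - p0) * J) by ring. apply iint_plus; auto.
    - apply cont_on_scal; auto.
    - apply iint_plus; auto; [apply cont_on_scal; auto|apply iint_scal; auto].
    - apply iint_scal; auto. }
  rewrite (Rmult_comm LD). apply (iint_Rabs_le g (fun x => (p - p0) ^ 2 * D x)); auto.
  - apply cont_on_plus; auto. apply cont_on_scal; auto.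
  - apply cont_on_scal; auto.
  - intros x Hx. unfold g. replace (f p x + -1 * f p0 x + - (p - p0) * f1 p0 x)
      with (f p x - f p0 x - (p - p0) * f1 p0 x) by ring.
    rewrite (Rmult_comm ((p - p0) ^ 2)). assert (Hbt : forall q, Rmin p0 p <= q <= Rmax p0 p -> Rabs (q - p0) < eta).
    { intros q Hq. apply Rabs_lt_between in Hp. apply Rabs_lt_between. revert Hq. unfold Rmin, Rmax. destruct Rle_dec; lra. }
    apply (taylor2_bound (fun q => f q x) (fun q => f1 q x) (fun q => f2 q x));
      intros q Hq; auto.
  - apply iint_scal; auto.
Qed.

End Improper.

Lemma improper_0_oo : improper (fun n => / INR (S n)) (fun n => INR (S n)) (fun x => 0 < x).
Proof.
  assert (H1 : forall n, 1 <= INR (S n)) by (intros; apply (le_INR 1); lia). split.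
  - intros n. specialize (H1 n). apply Rle_trans with 1; auto. rewrite <- Rinv_1. pos.
  - intros n x Hx. specialize (H1 n). assert (0 < / INR (S n)) by (apply Rinv_0_lt_compat; lra). lra.
  - intros n. apply Rinv_le_contravar; [specialize (H1 n); lra|apply le_INR; lia].
  - intros n. simpl; lra.
Qed.

Notation iint_0_oo := (is_iint (fun n => / INR (S n)) (fun n => INR (S n))).

Lemma is_lim_seq_hi : is_lim_seq (fun n => INR (S n)) p_infty.
Proof. apply (is_lim_seq_incr_1 INR p_infty), is_lim_seq_INR. Qed.

(** Bridge to the two-sided filter limit in the definition of [Gamma]. By nonnegativity every
    integral over a larger interval is squeezed between the [N]-th one and the limit [l]. *)
Lemma is_RInt_gen_iint f l :
  cont_on (fun x => 0 < x) f -> (forall x, 0 < x -> 0 <= f x) -> iint_0_oo f l ->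
  is_RInt_gen f (at_right 0) (Rbar_locally p_infty) l.
Proof.
  intros Cf Hf Hl. intros Q [eps HQ]. assert (Hle : forall n, RInt f (/ INR (S n)) (INR (S n)) <= l).
  { intros n. apply (RInt_le_iint _ _ _ improper_0_oo f n l); auto. }
  destruct (proj2 (is_lim_seq_spec _ l) Hl eps) as [N HN]. specialize (HN N (Nat.le_refl N)). apply Rabs_lt_between in HN.
  assert (H1 : 1 <= INR (S N)) by (apply (le_INR 1); lia). assert (Hi : 0 < / INR (S N)) by (apply Rinv_0_lt_compat; lra).
  assert (Hi1 : / INR (S N) <= 1) by (rewrite <- Rinv_1; apply Rinv_le_contravar; lra).
  apply (Filter_prod _ _ _ (fun a => 0 < a < / INR (S N)) (fun b => INR (S N) < b)).
  - exists (mkposreal _ Hi). intros y Hy Hy0. change (Rabs (y - 0) < / INR (S N)) in Hy. rewrite Rminus_0_r, Rabs_right in Hy; lra.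
  - exists (INR (S N)). auto.
  - intros a b Ha Hb. simpl. assert (Hex : forall u v, 0 < u -> u <= v -> ex_RInt f u v /\ 0 <= RInt f u v).
    { intros u v Hu Huv. assert (E : ex_RInt f u v).
      { apply (ex_RInt_continuous (V := R_CompleteNormedModule)). intros x Hx. rewrite Rmin_left, Rmax_right in Hx by lra. apply Cf; lra. }
      split; auto. apply RInt_ge_0; auto. intros x Hx. apply Hf; lra. }
    destruct (Hex a b) as [Eab _]; try lra. exists (RInt f a b). split; [apply (RInt_correct f a b Eab)|]. apply HQ.
    change (Rabs (RInt f a b - l) < eps). destruct (Hex a (/ INR (S N))) as [E1 G1]; try lra.
    destruct (Hex (/ INR (S N)) (INR (S N))) as [E2 G2]; try lra. destruct (Hex (INR (S N)) b) as [E3 G3]; try lra.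
    destruct (Hex a (INR (S N))) as [E4 G4]; try lra.
    assert (C1 : RInt f a (/ INR (S N)) + RInt f (/ INR (S N)) (INR (S N)) = RInt f a (INR (S N)))
      by exact (RInt_Chasles f _ _ _ E1 E2).
    assert (C2 : RInt f a (INR (S N)) + RInt f (INR (S N)) b = RInt f a b)
      by exact (RInt_Chasles f _ _ _ E4 E3).
    assert (Hup : RInt f a b <= l).
    { destruct (INR_unbounded (Rmax b (/ a))) as [M HM]. assert (HM1 := Rmax_l b (/ a)). assert (HM2 := Rmax_r b (/ a)).
      assert (HMS : INR M <= INR (S M)) by (apply le_INR; lia). assert (Ha0 : 0 < / a) by (apply Rinv_0_lt_compat; lra).
      assert (HaM : / INR (S M) <= a).
      { rewrite <- (Rinv_inv a). pos. }
      assert (HaM0 : 0 < / INR (S M)) by (apply Rinv_0_lt_compat; lra). eapply Rle_trans; [|apply (Hle M)].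
      destruct (Hex (/ INR (S M)) a) as [E5 G5]; try lra. destruct (Hex b (INR (S M))) as [E6 G6]; try lra.
      destruct (Hex (/ INR (S M)) b) as [E7 G7]; try lra. assert (C3 : RInt f (/ INR (S M)) a + RInt f a b = RInt f (/ INR (S M)) b)
        by exact (RInt_Chasles f _ _ _ E5 Eab).
      assert (C4 : RInt f (/ INR (S M)) b + RInt f b (INR (S M)) = RInt f (/ INR (S M)) (INR (S M)))
        by exact (RInt_Chasles f _ _ _ E7 E6).
      lra. }
    apply Rabs_lt_between. lra.
Qed.

Lemma RInt_gen_iint f l :
  cont_on (fun x => 0 < x) f -> (forall x, 0 < x -> 0 <= f x) -> iint_0_oo f l ->
  RInt_gen f (at_right 0) (Rbar_locally p_infty) = l.
Proof. intros. apply is_RInt_gen_unique. apply is_RInt_gen_iint; auto. Qed.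

(** The tangent to [exp] at the weighted mean [w] lies below the graph; the two tangent values
    average to [exp w]. *)
Lemma weighted_am_gm a b lam : 0 <= lam <= 1 ->
  exp (lam * a + (1 - lam) * b) <= lam * exp a + (1 - lam) * exp b.
Proof.
  intros Hl. set (w := lam * a + (1 - lam) * b). assert (Ha : exp w * (1 + (a - w)) <= exp a).
  { replace (exp a) with (exp w * exp (a - w)) by (rewrite <- exp_plus; f_equal; ring). apply Rmult_le_compat_l; [pos|apply exp_ineq1_le]. }
  assert (Hb : exp w * (1 + (b - w)) <= exp b).
  { replace (exp b) with (exp w * exp (b - w)) by (rewrite <- exp_plus; f_equal; ring). apply Rmult_le_compat_l; [pos|apply exp_ineq1_le]. }
  apply Rle_trans with (lam * (exp w * (1 + (a - w))) + (1 - lam) * (exp w * (1 + (b - w)))).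
  - apply Req_le. unfold w. ring.
  - nra.
Qed.

(* Hoelder's inequality. *)
Lemma mellin_log_convex (w : R -> R) (s1 s2 lam l1 l2 l : R) :
  (forall s, cont_on (fun x => 0 < x) (fun x => w x * Rpower x s)) ->
  (forall x, 0 < x -> 0 <= w x) -> 0 <= lam <= 1 -> 0 < l1 -> 0 < l2 -> 0 < l ->
  iint_0_oo (fun x => w x * Rpower x s1) l1 ->
  iint_0_oo (fun x => w x * Rpower x s2) l2 ->
  iint_0_oo (fun x => w x * Rpower x (lam * s1 + (1 - lam) * s2)) l ->
  ln l <= lam * ln l1 + (1 - lam) * ln l2.
Proof.
  intros Cw Hw Hlam Hl1 Hl2 Hl H1 H2 H. set (E := lam * ln l1 + (1 - lam) * ln l2).
  assert (Hle : l <= exp E * (lam / l1) * l1 + exp E * ((1 - lam) / l2) * l2).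
  { apply (iint_le _ _ _ improper_0_oo
      (fun x => w x * Rpower x (lam * s1 + (1 - lam) * s2))
      (fun x => exp E * (lam / l1) * (w x * Rpower x s1)
      + exp E * ((1 - lam) / l2) * (w x * Rpower x s2))); auto.
    - apply cont_on_plus; apply cont_on_scal; auto.
    (* The inequality is applied to the two powers normalised by their integrals [l1] and [l2], so
       that the majorant integrates to [exp E]. *)
    - intros x Hx. assert (Hy := weighted_am_gm (s1 * ln x - ln l1) (s2 * ln x - ln l2) lam Hlam).
      replace (exp E * (lam / l1) * (w x * Rpower x s1)
        + exp E * ((1 - lam) / l2) * (w x * Rpower x s2))
        with (w x * (exp E * (lam * (Rpower x s1 / l1) + (1 - lam) * (Rpower x s2 / l2))))
        by (field; lra).
      apply Rmult_le_compat_l; auto. replace (Rpower x s1 / l1) with (exp (s1 * ln x - ln l1)).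
      2:{ unfold Rminus. rewrite exp_plus, exp_Ropp, exp_ln; auto. }
      replace (Rpower x s2 / l2) with (exp (s2 * ln x - ln l2)).
      2:{ unfold Rminus. rewrite exp_plus, exp_Ropp, exp_ln; auto. }
      eapply Rle_trans; [|apply Rmult_le_compat_l; [pos|exact Hy]]. rewrite <- exp_plus. apply Req_le. unfold Rpower. f_equal. unfold E.
      ring.
    - apply (iint_plus _ _ _ improper_0_oo); try apply cont_on_scal; auto;
        apply (iint_scal _ _ _ improper_0_oo); auto. }
  replace (exp E * (lam / l1) * l1 + exp E * ((1 - lam) / l2) * l2) with (exp E) in Hle
    by (field; lra).
  rewrite <- (ln_exp E). destruct (Rle_lt_or_eq_dec _ _ Hle) as [H0|H0].
  - apply Rlt_le, ln_increasing; auto.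
  - rewrite H0. lra.
Qed.

(** * Differentiation of series, limits with logarithms *)

Lemma is_derive_Series (u u1 u2 : nat -> R -> R) (D : nat -> R) (x eta : R) :
  0 < eta ->
  (forall y, Rabs (y - x) < eta -> ex_series (fun n => u n y)) ->
  ex_series (fun n => u1 n x) -> ex_series D ->
  (forall n y, Rabs (y - x) < eta -> is_derive (u n) y (u1 n y)) ->
  (forall n y, Rabs (y - x) < eta -> is_derive (u1 n) y (u2 n y)) ->
  (forall n y, Rabs (y - x) < eta -> Rabs (u2 n y) <= D n) ->
  is_derive (fun y => Series (fun n => u n y)) x (Series (fun n => u1 n x)).
Proof.
  intros Heta Hu Hu1 HD H1 H2 H3. apply (is_derive_of_quadratic _ _ _ eta (Series D)); auto. intros y Hy.
  assert (Hx : Rabs (x - x) < eta) by (rewrite Rminus_diag, Rabs_R0; auto). rewrite <- Series_minus, <- Series_scal_l; auto.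
  assert (Hs1 : ex_series (fun n => u n y - u n x)).
  { apply (ex_series_minus (V := R_NormedModule) (fun n => u n y) (fun n => u n x)); auto. }
  assert (Hs2 : ex_series (fun n => (y - x) * u1 n x)).
  { apply (ex_series_scal (V := R_NormedModule) (y - x) (fun n => u1 n x)); auto. }
  rewrite <- Series_minus, Rmult_comm, <- Series_scal_l; auto. apply Series_Rabs_le.
  - intros n. rewrite (Rmult_comm ((y - x) ^ 2)). assert (Hbt : forall q, Rmin x y <= q <= Rmax x y -> Rabs (q - x) < eta).
    { intros q Hq. apply Rabs_lt_between in Hy. apply Rabs_lt_between. revert Hq. unfold Rmin, Rmax. destruct Rle_dec; lra. }
    apply (taylor2_bound (u n) (u1 n) (u2 n)); intros q Hq; auto.
  - apply (ex_series_scal (V := R_NormedModule) ((y - x) ^ 2) D); auto.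
Qed.

Lemma one_le_INR_S n : 1 <= INR (S n).
Proof. apply (le_INR 1); lia. Qed.

Lemma sub_ln_1p_bounds v : 0 <= v -> 0 <= v - ln (1 + v) <= v ^ 2 / 2.
Proof.
  assert (Hd : forall x, 0 <= x <= v -> is_derive (fun x => x - ln (1 + x)) x (x / (1 + x))).
  { intros x Hx. auto_derive; [lra|]. field; lra. }
  assert (E0 : 0 - ln (1 + 0) = 0) by (rewrite Rplus_0_r, ln_1; ring). split.
  - rewrite <- E0 at 1. apply (nondecreasing_of_deriv (fun x => x - ln (1 + x)) (fun x => x / (1 + x))); auto. intros; pos.
  - replace (v - ln (1 + v)) with ((v - ln (1 + v)) - (0 - ln (1 + 0))) by lra. via Rle_abs.
    replace (v ^ 2 / 2) with (v ^ 2 / 2 - 0 ^ 2 / 2) by (simpl; field).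
    apply (deriv_comparison (fun x => x - ln (1 + x)) (fun x => x / (1 + x))
      (fun x => x ^ 2 / 2) (fun x => x)); auto.
    + intros x _. auto_derive; auto. lra.
    + intros x Hx. assert (0 < / (1 + x) <= 1).
      { split; [apply Rinv_0_lt_compat; lra|]. rewrite <- Rinv_1. pos. }
      rewrite Rabs_right; nra.
Qed.

Lemma abs_ln_le x : 0 < x <= 1 -> Rabs (ln x) = - ln x.
Proof. intros Hx. assert (H := ln_le x 1 ltac:(lra) ltac:(lra)). rewrite ln_1 in H. apply Rabs_left1; auto. Qed.

Lemma ln_ge_0 x : 1 <= x -> 0 <= ln x.
Proof. rewrite <- ln_1. apply ln_le; lra. Qed.

Lemma ln_le_minus_1 x : 1 <= x -> ln x <= x - 1.
Proof.
  intros Hx. assert (H := sub_ln_1p_bounds (x - 1) ltac:(lra)). replace (1 + (x - 1)) with x in H by ring. lra.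
Qed.

Lemma x_log_pow_le x n : 0 < x <= 1 -> x * (1 + Rabs (ln x)) ^ n <= INR (fact n) * exp 1.
Proof.
  intros Hx. assert (Ha := Rabs_pos (ln x)). assert (H := pow_le_exp n (1 + Rabs (ln x)) ltac:(lra)).
  rewrite exp_plus, (abs_ln_le x Hx), exp_Ropp, exp_ln in H by lra. rewrite (abs_ln_le x Hx). apply Rmult_le_reg_r with (/ x); [pos|].
  replace (x * (1 + - ln x) ^ n * / x) with ((1 + - ln x) ^ n) by (field; lra). lra.
Qed.

(** With [L = 1 + Rabs (ln x)], boundedness of [x * L ^ S n] gives [x * L ^ n = O(1 / L)], which
    tends to [0]. All boundary terms at the lower end are treated this way. *)
Lemma lim_lo_log (F : R -> R) (C l : R) (n : nat) :
  (forall x, 0 < x <= 1 -> Rabs (F x - l) <= C * (x * (1 + Rabs (ln x)) ^ n)) ->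
  is_lim_seq (fun n => F (/ INR (S n))) l.
Proof.
  intros H. apply (lim_squeeze _ (fun k => Rabs C * (INR (fact (S n)) * exp 1) * / (1 + ln (INR (S k))))).
  - intros k. assert (Hk := one_le_INR_S k). assert (Hx := inv_S_bounds k). assert (E : Rabs (ln (/ INR (S k))) = ln (INR (S k))).
    { rewrite ln_Rinv, Rabs_Ropp by lra. apply Rabs_right, Rle_ge, ln_ge_0; auto. }
    assert (Hlog := ln_ge_0 _ Hk). assert (B := x_log_pow_le _ (S n) Hx). specialize (H _ Hx). rewrite E in *.
    set (x := / INR (S k)) in *. set (L := 1 + ln (INR (S k))) in *. assert (HL : 0 < L) by (unfold L; lra). via H. rewrite Rmult_assoc.
    apply Rle_trans with (Rabs C * (x * L ^ n)).
    + apply Rmult_le_compat_r; [pos|apply Rle_abs].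
    + apply Rmult_le_compat_l; [pos|]. apply (Rmult_le_reg_r L); auto. rewrite (Rmult_assoc _ (/ L)), Rinv_l, Rmult_1_r by lra.
      simpl pow in B. lra.
  - apply lim_scal0, (is_lim_seq_inv _ p_infty); [|discriminate].
    apply (is_lim_seq_plus _ _ 1 p_infty); [apply is_lim_seq_const| |reflexivity].
    apply (is_lim_comp_seq ln _ p_infty p_infty); [apply is_lim_ln_p| |apply is_lim_seq_hi]. exists 0%nat. congruence.
Qed.

Lemma lim_hi_0 (F : R -> R) (C : R) :
  (forall x, 1 <= x -> Rabs (F x) <= C / x) -> is_lim_seq (fun n => F (INR (S n))) 0.
Proof.
  intros H. apply (lim_squeeze0 _ (fun n => C * / INR (S n))); [intros n; apply H, one_le_INR_S|]. apply lim_scal0, is_lim_seq_inv_S.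
Qed.

Lemma cont_on_id P : cont_on P (fun x => x).
Proof. intros x _. apply continuous_id. Qed.

Lemma cont_on_ln : cont_on (fun x => 0 < x) ln.
Proof. apply (is_derive_cont_on _ ln Rinv). intros x Hx. apply is_derive_Reals, derivable_pt_lim_ln; auto. Qed.

Lemma cont_on_Rpower s : cont_on (fun x => 0 < x) (fun x => Rpower x s).
Proof.
  apply (is_derive_cont_on _ _ (fun x => s * Rpower x (s - 1))). intros x Hx. apply is_derive_Reals, derivable_pt_lim_power; auto.
Qed.

Lemma cont_on_pow P f n : cont_on P f -> cont_on P (fun x => f x ^ n).
Proof.
  intros H. induction n as [|n IH]; [intros x _; apply continuous_const|]. apply (cont_on_mult _ f (fun x => f x ^ n)); auto.
Qed.

Lemma Rpower_pos x y : 0 < Rpower x y.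
Proof. apply exp_pos. Qed.

Lemma iint_dominated_0_oo f A : cont_on (fun x => 0 < x) f ->
  (forall x, 0 < x <= 1 -> Rabs (f x) <= A / sqrt x) -> (forall x, 1 <= x -> Rabs (f x) <= A / x ^ 2) ->
  exists l, iint_0_oo f l.
Proof.
  intros Cf H1 H2. assert (HA : 0 <= A) by (specialize (H2 1 ltac:(lra)); assert (H := Rabs_pos (f 1)); lra).
  (* A single majorant with an explicit primitive, [- 8 A / (1 + sqrt x)]. The constant pays for the
     factor [2] and for [(1 + sqrt x) ^ 2 <= 4 * max(1, x)], so [D] covers both ends. *)
  set (D := fun x => 8 * A * (/ (2 * sqrt x) * / (1 + sqrt x) ^ 2)).
  assert (HD : forall x : R, 0 < x -> is_derive (fun x => - (8 * A) * / (1 + sqrt x)) x (D x)).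
  { intros x Hx. assert (Hs := sqrt_lt_R0 x Hx). unfold D. auto_derive; [repeat split; lra|]. field; lra. }
  assert (CD : cont_on (fun x => 0 < x) D).
  { intros x Hx. assert (Hs := sqrt_lt_R0 x Hx). apply (ex_derive_continuous (V := R_NormedModule)). unfold D. auto_derive. pos. }
  assert (Ls : is_lim_seq (fun n => sqrt (/ INR (S n))) 0).
  { rewrite <- sqrt_0. apply (is_lim_seq_continuous sqrt _ 0); [apply continuity_pt_sqrt; lra|apply is_lim_seq_inv_S]. }
  assert (L0 : is_lim_seq (fun n => - (8 * A) * / (1 + sqrt (/ INR (S n)))) (- (8 * A) * / (1 + 0))).
  { apply (is_lim_seq_continuous (fun u => - (8 * A) * / (1 + u)) _ 0); auto. apply (is_derive_continuity_pt _ _ (8 * A / (1 + 0) ^ 2)).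
    auto_derive; [lra|]. lra. }
  assert (L1 : is_lim_seq (fun n => - (8 * A) * / (1 + sqrt (INR (S n)))) 0).
  { apply (lim_scal0 (- (8 * A))), (lim_squeeze0 _ (fun n => sqrt (/ INR (S n)))); auto. intros n. assert (Hn := one_le_INR_S n).
    assert (Hs := sqrt_lt_R0 (INR (S n)) ltac:(lra)). rewrite sqrt_inv, Rabs_right by (apply Rle_ge; pos). pos. }
  assert (HDi := iint_primitive _ _ _ improper_0_oo _ _ _ _ HD CD L0 L1). assert (Hdom : forall x, 0 < x -> Rabs (f x) <= D x).
  2:{ destruct (iint_dominated _ _ _ improper_0_oo f _ _ Cf CD Hdom HDi) as [l [Hl _]]. eauto. }
  intros x Hx. assert (Hs := sqrt_lt_R0 x Hx). assert (Hss := sqrt_sqrt x ltac:(lra)). set (y := sqrt x) in *.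
  assert (Hq : forall t, 0 < t -> (1 + y) ^ 2 * 2 * y <= 8 * t -> A / t <= D x).
  { intros t Ht Hle. unfold D. fold y. rewrite <- Rinv_mult. replace (A / t) with (8 * A * / (8 * t)) by (field; lra). pos. }
  destruct (Rle_dec x 1) as [Hx1|Hx1].
  - eapply Rle_trans; [apply H1; lra|]. apply Hq; auto. fold y. nra.
  - eapply Rle_trans; [apply H2; lra|]. apply Hq; [nra|]. replace (x ^ 2) with ((y * y) * (y * y)) by (rewrite Hss; ring).
    apply Rle_trans with (4 * (y * y) * (2 * (y * y))); [|lra]. rewrite Rmult_assoc. apply Rmult_le_compat; nra.
Qed.

Definition iintv (f : R -> R) : R := real (Lim_seq (fun n => RInt f (/ INR (S n)) (INR (S n)))).

Lemma iintv_eq f l : iint_0_oo f l -> iintv f = l.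
Proof. intros H. unfold iintv. rewrite (is_lim_seq_unique _ _ H). reflexivity. Qed.

(** * Mellin transforms *)

(** Common features of the two weights [exp (- t)] and [K_0]: at most a logarithmic singularity at
    [0] and decay faster than any power at infinity. *)
Record mellin_kernel (w : R -> R) : Prop := {
  mk_cont : cont_on (fun x => 0 < x) w;
  mk_pos : forall x, 0 < x -> 0 < w x;
  mk_lo : exists A, forall x, 0 < x <= 1 -> w x <= A * (1 + Rabs (ln x));
  mk_hi : forall p, exists A, forall x, 1 <= x -> w x * x ^ p <= A }.

Section Mellin.

Variable w : R -> R.
Hypothesis Hw : mellin_kernel w.

(** Majorant of the Mellin integrands for all [3 / 4 <= s <= INR p] at once: the exponent [s - 1]
    lies between [- / 4] and [INR p]. The lower limit [3 / 4] leaves room on both sides of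
    [s = 1]. *)
Definition mweight (p n : nat) (x : R) : R := w x * ((Rpower x (- / 4) + x ^ p) * (1 + Rabs (ln x)) ^ n).
Definition mint (k : nat) (s x : R) : R := w x * (Rpower x (s - 1) * ln x ^ k).
Definition Mel (k : nat) (s : R) : R := iintv (mint k s).

Lemma mweight_pos p n x : 0 < x -> 0 <= mweight p n x.
Proof. intros Hx. assert (H1 := mk_pos w Hw x Hx). assert (H2 := Rpower_pos x (- / 4)). unfold mweight. pos. Qed.

Lemma cont_on_mweight p n : cont_on (fun x => 0 < x) (mweight p n).
Proof.
  apply (cont_on_mult _ w); [apply mk_cont, Hw|]. apply (cont_on_mult _ (fun x => Rpower x (- / 4) + x ^ p)).
  - apply cont_on_plus; [apply cont_on_Rpower|apply (cont_on_pow _ (fun x => x)), cont_on_id].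
  - apply (cont_on_pow _ (fun x => 1 + Rabs (ln x))), (cont_on_plus _ (fun _ => 1)); [intros x _; apply continuous_const|]. intros x Hx.
    apply (continuous_comp ln Rabs); [apply cont_on_ln; auto|apply continuous_Rabs].
Qed.

Lemma mellin_integrable (f : R -> R) p n : cont_on (fun x => 0 < x) f ->
  (forall x, 0 < x -> Rabs (f x) <= mweight p n x) -> exists l, iint_0_oo f l.
Proof.
  intros Cf Hf. destruct (mk_lo w Hw) as [A1 H1]. destruct (mk_hi w Hw (p + n + 2)) as [A2 H2].
  assert (HA1 : 0 < A1) by (specialize (H1 1 ltac:(lra)); rewrite ln_1, Rabs_R0 in H1; assert (H := mk_pos w Hw 1 ltac:(lra)); lra).
  assert (HA2 : 0 < A2) by (specialize (H2 1 ltac:(lra)); rewrite pow1 in H2; assert (H := mk_pos w Hw 1 ltac:(lra)); lra).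
  set (B := INR (fact (S n)) * exp 1). assert (HB : 0 < B) by (unfold B; pos). assert (HC1 : 0 < A1 * 2 * (4 ^ S n * B)) by pos.
  assert (HC2 : 0 < A2 * (2 * 2 ^ n)) by pos. apply (iint_dominated_0_oo f (A1 * 2 * (4 ^ S n * B) + A2 * (2 * 2 ^ n))); auto.
  (* In terms of [y = Rpower x (/ 4)] the claim near [0] is that [y] times a power of
     [1 + Rabs (ln y)] is bounded; this spends [Rpower x (- / 4)] once more and gives the admissible
     [/ sqrt x]. *)
  - intros x Hx. eapply Rle_trans; [apply Hf; lra|]. unfold mweight. set (y := Rpower x (/ 4)). assert (Hy0 : 0 < y) by apply Rpower_pos.
    assert (Hyy : y * y = sqrt x) by (unfold y; rewrite <- Rpower_plus, <- Rpower_sqrt by lra; f_equal; field).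
    assert (Ely : ln y = / 4 * ln x) by (unfold y, Rpower; apply ln_exp). assert (Hlx := abs_ln_le x Hx). assert (Hl0 := Rabs_pos (ln x)).
    assert (Hy1 : y <= 1) by (apply Rnot_lt_le; intros Hy; apply ln_increasing in Hy; rewrite ?ln_1 in Hy; lra).
    assert (Hly := x_log_pow_le y (S n) (conj Hy0 Hy1)). rewrite Rpower_Ropp. fold y. set (l := 1 + Rabs (ln x)).
    assert (Hl : 0 < l <= 4 * (1 + Rabs (ln y))).
    { unfold l. rewrite Ely, Rabs_mult, (Rabs_right (/ 4)) by lra. lra. }
    assert (Hxp : x ^ p <= / y).
    { apply Rle_trans with 1; [rewrite <- (pow1 p); apply pow_incr; lra|]. rewrite <- Rinv_1. pos. }
    assert (Hln : 0 < l ^ n) by (unfold l; pos). apply Rle_trans with (A1 * l * ((/ y + / y) * l ^ n)).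
    + apply Rmult_le_compat; [apply Rlt_le, (mk_pos w Hw); lra|pos|auto|apply Rmult_le_compat_r; lra].
    + rewrite <- Hyy. apply (Rmult_le_reg_r (y * y)); [pos|].
      replace (A1 * l * ((/ y + / y) * l ^ n) * (y * y)) with (A1 * 2 * (l ^ S n * y)) by (simpl; field; lra).
      replace ((A1 * 2 * (4 ^ S n * B) + A2 * (2 * 2 ^ n)) / (y * y) * (y * y)) with (A1 * 2 * (4 ^ S n * B) + A2 * (2 * 2 ^ n)) by (field; lra).
      assert (Hp : l ^ S n <= 4 ^ S n * (1 + Rabs (ln y)) ^ S n) by (rewrite <- Rpow_mult_distr; apply pow_incr; lra).
      assert (l ^ S n * y <= 4 ^ S n * B).
      { apply Rle_trans with (4 ^ S n * (y * (1 + Rabs (ln y)) ^ S n)); [|apply Rmult_le_compat_l; auto; pos]. nra. }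
      nra.
  - intros x Hx. eapply Rle_trans; [apply Hf; lra|]. assert (Hw0 := mk_pos w Hw x ltac:(lra)).
    assert (Hl : 0 <= ln x <= x - 1) by (split; [apply ln_ge_0|apply ln_le_minus_1]; auto). unfold mweight.
    rewrite (Rabs_right (ln x)) by lra.
    assert (Hln : 0 <= (1 + ln x) ^ n <= 2 ^ n * x ^ n) by (rewrite <- Rpow_mult_distr; split; [apply pow_le|apply pow_incr]; lra).
    assert (Hxp : 1 <= x ^ p) by (apply pow_R1_Rle; auto). assert (Hx2 : 0 < x ^ 2) by pos. assert (Hr : 0 < Rpower x (- / 4) <= 1).
    { split; [apply Rpower_pos|]. rewrite <- (Rpower_O x) by lra. apply Rle_Rpower; lra. }
    apply Rle_trans with (w x * (2 * x ^ p * (2 ^ n * x ^ n))).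
    + pos.
    + specialize (H2 x Hx). rewrite !pow_add in H2. apply (Rmult_le_reg_r (x ^ 2)); auto.
      replace ((A1 * 2 * (4 ^ S n * B) + A2 * (2 * 2 ^ n)) / x ^ 2 * x ^ 2) with (A1 * 2 * (4 ^ S n * B) + A2 * (2 * 2 ^ n)) by (field; lra).
      nra.
Qed.

Lemma cont_on_mint k s : cont_on (fun x => 0 < x) (mint k s).
Proof.
  apply (cont_on_mult _ w); [apply mk_cont, Hw|]. apply (cont_on_mult _ (fun x => Rpower x (s - 1))).
  - apply cont_on_Rpower.
  - apply (cont_on_pow _ ln), cont_on_ln.
Qed.

Lemma mint_bound k s p x : 3 / 4 <= s <= INR p -> 0 < x -> Rabs (mint k s x) <= mweight p k x.
Proof.
  intros Hs Hx. assert (Hw0 := mk_pos w Hw x Hx). assert (HR := Rpower_pos x (s - 1)). assert (H0 := Rabs_pos (ln x)).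
  unfold mint, mweight. rewrite !Rabs_mult, <- RPow_abs, (Rabs_right (w x)), (Rabs_right (Rpower _ _)) by lra.
  apply Rmult_le_compat_l; [lra|]. apply Rmult_le_compat; [lra|pos| |apply pow_incr; lra]. assert (Hxp : 0 < x ^ p) by pos.
  assert (H4 := Rpower_pos x (- / 4)). destruct (Rle_dec 1 x) as [H1|H1].
  - apply Rle_trans with (Rpower x (INR p)); [apply Rle_Rpower; lra|]. rewrite Rpower_pow by auto. lra.
  - apply Rle_trans with (Rpower x (- / 4)); [|lra]. destruct (Req_dec (s - 1) (- / 4)) as [->|]; [lra|]. apply Rlt_le, exp_increasing.
    assert (ln x < 0) by (rewrite <- ln_1; apply ln_increasing; lra). nra.
Qed.

Lemma Mel_iint k s : 3 / 4 <= s -> iint_0_oo (mint k s) (Mel k s).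
Proof.
  intros Hs. destruct (INR_unbounded s) as [p Hp].
  destruct (mellin_integrable (mint k s) p k) as [l Hl]; [apply cont_on_mint|intros; apply mint_bound; lra|]. unfold Mel.
  rewrite (iintv_eq _ _ Hl). auto.
Qed.

Lemma is_derive_Mel k (s : R) : 3 / 4 < s -> is_derive (Mel k) s (Mel (S k) s).
Proof.
  intros Hs. destruct (INR_unbounded (s + (s - 3 / 4))) as [p Hp].
  destruct (mellin_integrable (mweight p (S (S k))) p (S (S k))) as [L HL]; [apply cont_on_mweight| |].
  { intros x Hx. rewrite Rabs_right; [lra|]. apply Rle_ge, mweight_pos; auto. }
  assert (Hin : forall q, Rabs (q - s) < s - 3 / 4 -> 3 / 4 <= q <= INR p) by (intros q Hq; apply Rabs_def2 in Hq; lra).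
  assert (D : forall j (q x : R), 0 < x -> is_derive (fun q => mint j q x) q (mint (S j) q x)).
  { intros j q x Hx. unfold mint, Rpower. auto_derive; auto. fold (q - 1). simpl; lra. }
  apply (is_derive_iint _ _ _ improper_0_oo (mint k) (mint (S k)) (mint (S (S k))) (mweight p (S (S k))) (Mel k) s (s - 3 / 4) _ L); auto.
  - lra.
  - intros; apply cont_on_mint.
  - apply cont_on_mint.
  - apply cont_on_mweight.
  - intros q x Hq Hx. apply mint_bound; auto.
  - intros q Hq. apply Mel_iint, Hin; auto.
  - apply Mel_iint; lra.
Qed.

Lemma Mel_pos s : 3 / 4 <= s -> 0 < Mel 0 s.
Proof.
  intros Hs. assert (Hp : forall x, 0 < x -> 0 < mint 0 s x).
  { intros x Hx. unfold mint. rewrite pow_O, Rmult_1_r. apply Rmult_lt_0_compat; [apply (mk_pos w Hw); auto|apply Rpower_pos]. }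
  assert (H : RInt (mint 0 s) (/ INR 2) (INR 2) <= Mel 0 s).
  { apply (RInt_le_iint _ _ _ improper_0_oo _ 1); [apply cont_on_mint| |apply Mel_iint; auto]. intros x Hx. apply Rlt_le; auto. }
  assert (E2 : INR 2 = 2) by (simpl; ring). rewrite E2 in H. eapply Rlt_le_trans; [|exact H]. apply RInt_gt_0; [lra| |].
  - intros x Hx. apply Hp. lra.
  - intros x Hx. apply cont_on_mint. lra.
Qed.

Lemma Mel_log_convex s1 s2 lam : 3 / 4 <= s1 -> 3 / 4 <= s2 -> 0 <= lam <= 1 ->
  ln (Mel 0 (lam * s1 + (1 - lam) * s2)) <= lam * ln (Mel 0 s1) + (1 - lam) * ln (Mel 0 s2).
Proof.
  intros H1 H2 Hl. set (s := lam * s1 + (1 - lam) * s2). assert (Hs : 3 / 4 <= s) by (unfold s; nra).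
  assert (HE : forall t, 3 / 4 <= t -> iint_0_oo (fun x => w x * Rpower x (t - 1)) (Mel 0 t)).
  { intros t Ht. apply (iint_ext _ _ _ improper_0_oo (mint 0 t)); [intros; unfold mint; ring|apply Mel_iint; auto]. }
  apply (mellin_log_convex w (s1 - 1) (s2 - 1)); auto; try (apply Mel_pos; auto).
  - intros s'. apply (cont_on_mult _ w); [apply mk_cont, Hw|apply cont_on_Rpower].
  - intros; apply Rlt_le, (mk_pos w Hw); auto.
  - replace (lam * (s1 - 1) + (1 - lam) * (s2 - 1)) with (s - 1) by (unfold s; ring). auto.
Qed.

End Mellin.

(** * The Gamma function *)

Definition euler_limit (g0 : R) : Prop :=
  is_lim_seq (fun N => psum (fun n => / INR (S n)) N - ln (INR (S N))) g0.

Section LogGamma.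

Variable g0 : R.

(* [ln (Gamma (1 + x))], by Weierstrass's product. *)
Definition LG (x : R) : R :=
  - g0 * x + Series (fun j => x / INR (S j) - ln (1 + x / INR (S j))).

(** Termwise derivative of [LG], that is [psi (1 + x)]; [LG2] is likewise [psi' (1 + x)]. *)
Definition LG1 (x : R) : R := - g0 + Series (fun j => / INR (S j) - / (INR (S j) + x)).

Definition LG2 (x : R) : R := Series (fun j => / (INR (S j) + x) ^ 2).

Lemma ex_series_LG x : 0 <= x -> ex_series (fun j => x / INR (S j) - ln (1 + x / INR (S j))).
Proof.
  intros Hx. apply ex_series_Rabs_le with (fun j => x ^ 2 * / INR (S j) ^ 2).
  - intros j. assert (H := one_le_INR_S j).
    assert (Hv : 0 <= x / INR (S j)) by (apply Rmult_le_pos; auto; apply Rlt_le, Rinv_0_lt_compat; lra).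
    destruct (sub_ln_1p_bounds _ Hv) as [H1 H2]. rewrite Rabs_right by lra. via H2.
    replace ((x / INR (S j)) ^ 2 / 2) with (x ^ 2 * / INR (S j) ^ 2 * / 2) by (field; lra). assert (0 <= x ^ 2 * / INR (S j) ^ 2); [|lra].
    pos.
  - apply (ex_series_scal (V := R_NormedModule) (x ^ 2)), ex_series_inv_sq.
Qed.

Lemma ex_series_LG1 x : 0 <= x -> ex_series (fun j => / INR (S j) - / (INR (S j) + x)).
Proof.
  intros Hx. apply ex_series_Rabs_le with (fun j => x * / INR (S j) ^ 2).
  - intros j. assert (H := one_le_INR_S j).
    replace (/ INR (S j) - / (INR (S j) + x)) with (x * / (INR (S j) * (INR (S j) + x))) by (field; lra).
    assert (0 < / (INR (S j) * (INR (S j) + x))) by (apply Rinv_0_lt_compat; nra). rewrite Rabs_right by nra.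
    apply Rmult_le_compat_l; auto. apply Rinv_le_contravar; nra.
  - apply (ex_series_scal (V := R_NormedModule) x), ex_series_inv_sq.
Qed.

Lemma inv_shift_sq_le x j : 0 <= x -> 0 < / (INR (S j) + x) ^ 2 <= / INR (S j) ^ 2.
Proof. split; pos. Qed.

Lemma ex_series_LG2 x : 0 <= x -> ex_series (fun j => / (INR (S j) + x) ^ 2).
Proof.
  intros Hx. apply ex_series_Rabs_le with (fun j => / INR (S j) ^ 2); [|apply ex_series_inv_sq]. intros j.
  assert (H := inv_shift_sq_le x j Hx). rewrite Rabs_right; lra.
Qed.

Lemma pos_of_near (x y : R) : 0 < x -> Rabs (y - x) < x -> 0 < y.
Proof. intros Hx H. apply Rabs_lt_between in H. lra. Qed.

Lemma is_derive_LG x : 0 < x -> is_derive LG x (LG1 x).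
Proof.
  intros Hx. apply is_derive_Rplus.
  - auto_derive; auto. lra.
  - apply (is_derive_Series (fun j x => x / INR (S j) - ln (1 + x / INR (S j)))
      (fun j x => / INR (S j) - / (INR (S j) + x))
      (fun j x => / (INR (S j) + x) ^ 2) (fun j => / INR (S j) ^ 2) x x); auto.
    + intros y Hy. apply ex_series_LG, Rlt_le, (pos_of_near x); auto.
    + apply ex_series_LG1; lra.
    + apply ex_series_inv_sq.
    + intros j y Hy. apply pos_of_near in Hy; auto. assert (H := one_le_INR_S j). remember (INR (S j)) as a eqn:Ea.
      assert (0 < y * / a) by (apply Rmult_lt_0_compat; auto; apply Rinv_0_lt_compat; lra). auto_derive; [unfold Rdiv; lra|]. field; lra.
    + intros j y Hy. apply pos_of_near in Hy; auto. assert (H := one_le_INR_S j). remember (INR (S j)) as a eqn:Ea. auto_derive; [lra|].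
      field; lra.
    + intros j y Hy. apply pos_of_near in Hy; auto. assert (H := inv_shift_sq_le y j (Rlt_le _ _ Hy)). rewrite Rabs_right; lra.
Qed.

Lemma is_derive_LG1 x : 0 < x -> is_derive LG1 x (LG2 x).
Proof.
  intros Hx. unfold LG1, LG2. apply is_derive_eq with (0 + Series (fun j => / (INR (S j) + x) ^ 2)); [|eqR; ring].
  apply is_derive_Rplus; [apply is_derive_Rconst|]. apply (is_derive_Series (fun j x => / INR (S j) - / (INR (S j) + x))
    (fun j x => / (INR (S j) + x) ^ 2)
    (fun j x => - 2 * / (INR (S j) + x) ^ 3) (fun j => 2 * / INR (S j) ^ 2) x x); auto.
  - intros y Hy. apply ex_series_LG1, Rlt_le, (pos_of_near x); auto.
  - apply ex_series_LG2; lra.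
  - apply (ex_series_scal (V := R_NormedModule) 2), ex_series_inv_sq.
  - intros j y Hy. apply pos_of_near in Hy; auto. assert (H := one_le_INR_S j). remember (INR (S j)) as a eqn:Ea. auto_derive; [lra|].
    field; lra.
  - intros j y Hy. apply pos_of_near in Hy; auto. assert (H := one_le_INR_S j). remember (INR (S j)) as a eqn:Ea.
    auto_derive; [apply Rgt_not_eq; nra|]. field; lra.
  - intros j y Hy. apply pos_of_near in Hy; auto. assert (H := one_le_INR_S j). assert (H2 := inv_shift_sq_le y j (Rlt_le _ _ Hy)).
    assert (0 < / (INR (S j) + y) <= 1).
    { rewrite <- Rinv_1. pos. }
    replace (- 2 * / (INR (S j) + y) ^ 3) with (- (2 * (/ (INR (S j) + y) ^ 2 * / (INR (S j) + y))))
      by (field; lra).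
    rewrite Rabs_Ropp, Rabs_right; nra.
Qed.

Lemma LG1_1 : LG1 1 = 1 - g0.
Proof.
  unfold LG1. rewrite (Series_ext _ (fun j => / INR (S j) - / INR (S (S j)))).
  - rewrite (is_series_unique _ _ (is_series_telescope (fun n => / INR (S n)) 0 is_lim_seq_inv_S)). simpl; lra.
  - auto.
Qed.

Lemma LG1_shift x : 0 <= x -> LG1 (x + 1) = LG1 x + / (x + 1).
Proof.
  intros Hx. unfold LG1. assert (E : Series (fun j => / INR (S j) - / (INR (S j) + (x + 1)))
    - Series (fun j => / INR (S j) - / (INR (S j) + x)) = / (x + 1)).
  { rewrite <- Series_minus by (apply ex_series_LG1; lra). rewrite (Series_ext _ (fun j => / (INR (S j) + x) - / (INR (S (S j)) + x))).
    - rewrite (is_series_unique _ (/ (INR 1 + x) - 0)).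
      + simpl INR. field; lra.
      + apply (is_series_telescope (fun j => / (INR (S j) + x)) 0).
        apply is_lim_seq_le_le with (u := fun _ => 0) (w := fun n => / INR (S n)).
        * split; pos.
        * apply is_lim_seq_const.
        * apply is_lim_seq_inv_S.
    - intros j. rewrite (S_INR (S j)). assert (H := one_le_INR_S j). field. lra. }
  lra.
Qed.

Lemma LG2_shift x : 0 <= x -> LG2 (x + 1) = LG2 x - / (x + 1) ^ 2.
Proof.
  intros Hx. unfold LG2. rewrite (Series_incr_1 (fun j => / (INR (S j) + x) ^ 2)) by (apply ex_series_LG2; auto).
  rewrite (Series_ext (fun j => / (INR (S j) + (x + 1)) ^ 2) (fun k => / (INR (S (S k)) + x) ^ 2)).
  - simpl (INR 1). field; lra.
  - intros j. rewrite (S_INR (S j)). f_equal. ring.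
Qed.

Hypothesis Hg0 : euler_limit g0.

Lemma ln_ratio_le u v : 0 < u -> u <= v -> 0 <= ln v - ln u <= (v - u) / u.
Proof.
  intros Hu Huv. assert (E : ln v = ln u + ln (1 + (v - u) / u)).
  { rewrite <- ln_mult; [f_equal; field; lra|auto|]. pos. }
  assert (Hv : 0 <= (v - u) / u) by pos. destruct (sub_ln_1p_bounds _ Hv) as [H1 _]. assert (0 <= ln (1 + (v - u) / u)); [|lra].
  destruct (Req_dec ((v - u) / u) 0) as [->|Hn]; [rewrite Rplus_0_r, ln_1; lra|]. rewrite <- ln_1. apply Rlt_le, ln_increasing; lra.
Qed.

(** The conditions are asked on [[1, oo)] only and [phi 1] is left free, because the theorem serves
    twice: for [ln (Gamma x)] and for a normalised logarithm of the Mellin transform of [K_0]. *)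
Theorem bohr_mollerup (phi : R -> R) :
  (forall x, 1 <= x -> phi (x + 1) = ln x + phi x) ->
  (forall x y lam, 1 <= x -> 1 <= y -> 0 <= lam <= 1 ->
     phi (lam * x + (1 - lam) * y) <= lam * phi x + (1 - lam) * phi y) ->
  forall x, 0 < x -> phi (1 + x) = phi 1 + LG x.
Proof.
  intros Hrec Hconv x Hx. assert (Hsum : forall y N, 0 <= y ->
    phi (INR (S N) + y) = phi (1 + y) + psum (fun j => ln (INR (S j) + y)) N).
  { intros y N Hy. induction N as [|N IH].
    - simpl; lra.
    - rewrite (S_INR (S N)). replace (INR (S N) + 1 + y) with (INR (S N) + y + 1) by ring.
      rewrite Hrec, IH by (assert (H := one_le_INR_S N); lra). simpl; lra. }
  (* [q] measures how far [phi] deviates from growing like [x * ln N] over a shift by [x]. Once it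
     tends to [0], the iterated recursion becomes Weierstrass's series. *)
  set (q := fun N => phi (INR (S N) + x) - phi (INR (S N)) - x * ln (INR (S N))). assert (Hq : is_lim_seq q 0).
  { apply is_lim_seq_incr_1. apply is_lim_seq_le_le with (u := fun N => - x * / INR (S N)) (w := fun N => x ^ 2 * / INR (S N)).
    - intros N. unfold q. rewrite (S_INR (S N)). set (n := INR (S N)). assert (Hn : 1 <= n) by apply one_le_INR_S.
      assert (Hr1 := Hrec n Hn). assert (Hr2 := Hrec (n + 1 + x) ltac:(lra)). assert (Hl : 0 < / (x + 1)) by pos.
      assert (Hl1 : / (x + 1) <= 1) by (rewrite <- Rinv_1; apply Rinv_le_contravar; lra).
      (* With weight [/ (x + 1)], the point [n + 1 + x] lies between [n + 1] and [n + 2 + x], and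
         [n + 1] lies between [n + 1 + x] and [n]. Both sides of the estimate thus hold for every
         [x > 0], without restriction to [x <= 1]. *)
      assert (C1 := Hconv (n + 1) (n + 1 + x + 1) (/ (x + 1)) ltac:(lra) ltac:(lra) ltac:(lra)).
      assert (C2 := Hconv (n + 1 + x) n (/ (x + 1)) ltac:(lra) ltac:(lra) ltac:(lra)).
      replace (/ (x + 1) * (n + 1) + (1 - / (x + 1)) * (n + 1 + x + 1)) with (n + 1 + x) in C1
        by (field; lra).
      replace (/ (x + 1) * (n + 1 + x) + (1 - / (x + 1)) * n) with (n + 1) in C2 by (field; lra). rewrite Hr2 in C1.
      assert (K1 : (x + 1) * phi (n + 1 + x) <=
        phi (n + 1) + x * (ln (n + 1 + x) + phi (n + 1 + x))).
      { apply Rmult_le_compat_l with (r := x + 1) in C1; [|lra]. via C1. apply Req_le. field. lra. }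
      assert (K2 : (x + 1) * phi (n + 1) <= phi (n + 1 + x) + x * phi n).
      { apply Rmult_le_compat_l with (r := x + 1) in C2; [|lra]. via C2. apply Req_le. field. lra. }
      destruct (ln_ratio_le n (n + 1)) as [_ L1]; try lra. destruct (ln_ratio_le (n + 1) (n + 1 + x)) as [_ L2]; try lra.
      assert (L3 : / (n + 1) <= / n) by (apply Rinv_le_contravar; lra). split; nra.
    - replace 0 with (- x * 0) by ring. apply (is_lim_seq_scal_l _ _ 0), is_lim_seq_inv_S.
    - replace 0 with (x ^ 2 * 0) by ring. apply (is_lim_seq_scal_l _ _ 0), is_lim_seq_inv_S. }
  set (t := fun j => x / INR (S j) - ln (1 + x / INR (S j))).
  assert (Hlim : is_lim_seq (fun N => q N + (- x * (psum (fun n => / INR (S n)) N - ln (INR (S N)))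
    + psum t N)) (0 + (- x * g0 + Series t))).
  { apply is_lim_seq_plus'; auto. apply is_lim_seq_plus'.
    - apply (is_lim_seq_scal_l _ _ g0); auto.
    - apply is_series_psum. apply Series_correct, ex_series_LG; lra. }
  apply is_lim_seq_ext with (v := fun _ => phi (1 + x) - phi 1) in Hlim.
  - apply is_lim_seq_unique in Hlim. rewrite Lim_seq_const in Hlim. injection Hlim as E. unfold LG. fold t. lra.
  - intros N. unfold q. rewrite (Hsum x N) by lra. assert (H0 := Hsum 0 N (Rle_refl 0)). rewrite !Rplus_0_r in H0.
    assert (Et : psum t N = x * psum (fun n => / INR (S n)) N
      - (psum (fun j => ln (INR (S j) + x)) N - psum (fun j => ln (INR (S j) + 0)) N)).
    { rewrite <- psum_scal, <- !psum_minus. apply psum_ext. intros j _. unfold t. assert (H := one_le_INR_S j). rewrite Rplus_0_r.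
      replace (INR (S j) + x) with (INR (S j) * (1 + x / INR (S j))) by (field; lra). rewrite ln_mult; [unfold Rdiv; ring|lra|]. pos. }
    lra.
Qed.

Lemma mellin_kernel_exp : mellin_kernel (fun t => exp (- t)).
Proof.
  split.
  - apply (is_derive_cont_on _ _ (fun t => - exp (- t))). intros t _. auto_derive; auto. lra.
  - intros; pos.
  - exists 1. intros x Hx. assert (H := Rabs_pos (ln x)). apply Rle_trans with 1; [|lra]. rewrite <- exp_0. apply Rlt_le, exp_increasing.
    lra.
  - intros p. exists (INR (fact p)). intros x Hx. assert (H := pow_le_exp p x ltac:(lra)). rewrite exp_Ropp, Rmult_comm.
    apply Rle_div_l; [apply exp_pos|auto].
Qed.

Lemma Gamma_Mel s : 3 / 4 <= s -> Gamma s = Mel (fun t => exp (- t)) 0 s.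
Proof.
  intros Hs. assert (E : forall t, Rpower t (s - 1) * exp (- t) = mint (fun t => exp (- t)) 0 s t) by (intros; unfold mint; ring).
  unfold Gamma. apply RInt_gen_iint.
  - apply (cont_on_ext _ (mint (fun t => exp (- t)) 0 s)); [auto|apply cont_on_mint, mellin_kernel_exp].
  - intros x Hx. apply Rlt_le, Rmult_lt_0_compat; apply exp_pos.
  - apply (iint_ext _ _ _ improper_0_oo (mint (fun t => exp (- t)) 0 s)); [intros; symmetry; apply E|]. apply Mel_iint; auto.
    apply mellin_kernel_exp.
Qed.

Lemma is_lim_seq_exp_neg_Rpower s : is_lim_seq (fun n => exp (- INR (S n)) * Rpower (INR (S n)) s) 0.
Proof.
  destruct (INR_unbounded s) as [p Hp]. apply (lim_hi_0 (fun t => exp (- t) * Rpower t s) (INR (fact (S p)))). intros x Hx.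
  assert (H := pow_le_exp (S p) x ltac:(lra)). assert (HR := Rpower_pos x s). assert (He := exp_pos x).
  rewrite Rabs_right, exp_Ropp by pos. assert (H2 : Rpower x s <= x ^ p) by (rewrite <- Rpower_pow by lra; apply Rle_Rpower; lra).
  apply (Rmult_le_reg_r (x * exp x)); [pos|]. replace (/ exp x * Rpower x s * (x * exp x)) with (x * Rpower x s) by (field; lra).
  replace (INR (fact (S p)) / x * (x * exp x)) with (INR (fact (S p)) * exp x) by (field; lra). eapply Rle_trans; [|exact H]. simpl pow.
  nra.
Qed.

Lemma Gamma_S s : 3 / 4 <= s -> Gamma (s + 1) = s * Gamma s.
Proof.
  intros Hs. rewrite !Gamma_Mel by lra. set (w := fun t => exp (- t)). assert (Hc := fun s => cont_on_mint w mellin_kernel_exp 0 s).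
  assert (H4 : iint_0_oo (fun t => s * mint w 0 s t + -1 * mint w 0 (s + 1) t) (0 - 0)).
  { apply (iint_primitive _ _ _ improper_0_oo (fun t => exp (- t) * Rpower t s)).
    - intros t Ht. unfold mint, w. replace (s + 1 - 1) with s by ring. rewrite Rpower_minus_1 by auto. unfold Rpower. auto_derive; auto.
      lra.
    - apply cont_on_plus; apply cont_on_scal, Hc.
    - apply (lim_squeeze0 _ (fun n => Rpower (INR (S n)) (- s))); [|apply is_lim_seq_Rpower_neg; lra]. intros n.
      assert (Hn := one_le_INR_S n). assert (Hi := inv_S_bounds n).
      replace (Rpower (INR (S n)) (- s)) with (1 * Rpower (/ INR (S n)) s) by (unfold Rpower; rewrite ln_Rinv, Rmult_1_l by lra; f_equal; ring).
      rewrite Rabs_right by (apply Rle_ge, Rlt_le, Rmult_lt_0_compat; apply exp_pos).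
      apply Rmult_le_compat_r; [apply Rlt_le, Rpower_pos|]. rewrite <- exp_0. apply Rlt_le, exp_increasing. lra.
    - apply is_lim_seq_exp_neg_Rpower. }
  assert (H3 := iint_plus _ _ _ improper_0_oo _ _ _ _ (cont_on_scal _ _ s (Hc s)) (cont_on_scal _ _ (-1) (Hc (s + 1)))
    (iint_scal _ _ _ improper_0_oo _ s _ (Hc s) (Mel_iint w mellin_kernel_exp 0 s Hs))
    (iint_scal _ _ _ improper_0_oo _ (-1) _ (Hc (s + 1)) (Mel_iint w mellin_kernel_exp 0 (s + 1) ltac:(lra)))).
  assert (E := iint_unique _ _ _ _ _ H3 H4). lra.
Qed.

Lemma Gamma_1 : Gamma 1 = 1.
Proof.
  rewrite Gamma_Mel by lra. assert (H2 : iint_0_oo (mint (fun t => exp (- t)) 0 1) (0 - -1)).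
  { assert (E : forall t, 0 < t -> mint (fun t => exp (- t)) 0 1 t = exp (- t)).
    { intros t Ht. unfold mint. rewrite Rminus_diag, Rpower_O, pow_O by auto. ring. }
    apply (iint_primitive _ _ _ improper_0_oo (fun t => - exp (- t))).
    - intros t Ht. rewrite E by auto. auto_derive; auto. lra.
    - apply cont_on_mint, mellin_kernel_exp.
    - replace (-1) with (- exp (- 0)) by (rewrite Ropp_0, exp_0; ring).
      apply (is_lim_seq_continuous (fun t => - exp (- t)) (fun n => / INR (S n)) 0); [|apply is_lim_seq_inv_S].
      apply (is_derive_continuity_pt _ _ (exp (- 0))). auto_derive; auto. lra.
    - apply is_lim_seq_ext with (fun n => -1 * (exp (- INR (S n)) * Rpower (INR (S n)) 0)).
      + intros n. assert (H := one_le_INR_S n). rewrite Rpower_O by lra. ring.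
      + apply lim_scal0, is_lim_seq_exp_neg_Rpower. }
  rewrite (iint_unique _ _ _ _ _ (Mel_iint _ mellin_kernel_exp 0 1 ltac:(lra)) H2). ring.
Qed.

(** Bohr-Mollerup gives [Gamma (1 + x) = exp (LG x)]. Dividing by [x] yields a formula on a full
    neighbourhood of [1], where [digamma 1] and [trigamma 1] require derivatives. *)
Lemma Gamma_LG x : 3 / 4 <= x -> Gamma x = exp (LG x) / x.
Proof.
  intros Hx.
  assert (P : forall y, 3 / 4 <= y -> 0 < Gamma y) by (intros y Hy; rewrite Gamma_Mel by auto; apply Mel_pos; auto; apply mellin_kernel_exp).
  replace (LG x) with (ln (Gamma (1 + x))).
  - rewrite exp_ln, Rplus_comm, Gamma_S by (auto; apply P; lra). field. lra.
  - rewrite (bohr_mollerup (fun x => ln (Gamma x))); [rewrite Gamma_1, ln_1; ring| | |lra].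
    + intros y Hy. rewrite Gamma_S, ln_mult; try lra. apply P; lra.
    + intros y z lam Hy Hz Hlam. rewrite !Gamma_Mel by nra. apply Mel_log_convex; auto; try lra. apply mellin_kernel_exp.
Qed.

Lemma locally_gt (a x : R) : a < x -> locally x (fun y => a < y).
Proof.
  intros Hx. exists (mkposreal (x - a) (proj2 (Rlt_0_minus _ _) Hx)). intros y Hy. change (Rabs (y - x) < x - a) in Hy.
  apply Rabs_def2 in Hy. lra.
Qed.

Lemma is_derive_Gamma x : 3 / 4 < x -> is_derive Gamma x (Gamma x * (LG1 x - / x)).
Proof.
  intros Hx. apply (is_derive_ext_loc (fun x => exp (LG x) * / x)).
  - apply (filter_imp (fun y => 3 / 4 < y)); [|apply locally_gt; auto]. intros y Hy. rewrite Gamma_LG by lra. reflexivity.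
  - apply is_derive_eq with (exp (LG x) * LG1 x * / x + exp (LG x) * (- / x ^ 2)).
    + apply (is_derive_Rmult (fun x => exp (LG x)) (fun x => / x)).
      * apply (is_derive_Rcomp exp LG); [apply is_derive_exp|apply is_derive_LG; lra].
      * auto_derive; [lra|]. field; lra.
    + rewrite Gamma_LG by lra. field; lra.
Qed.

Lemma digamma_LG1 x : 3 / 4 < x -> digamma x = LG1 x - / x.
Proof.
  intros Hx. unfold digamma. rewrite (is_derive_unique _ _ _ (is_derive_Gamma x Hx)), Gamma_LG by lra. assert (H := exp_pos (LG x)).
  field. lra.
Qed.

Lemma trigamma_LG2 x : 3 / 4 < x -> trigamma x = LG2 x + / x ^ 2.
Proof.
  intros Hx. apply is_derive_unique, (is_derive_ext_loc (fun x => LG1 x - / x)).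
  - apply (filter_imp (fun y => 3 / 4 < y)); [|apply locally_gt; auto]. intros y Hy. rewrite digamma_LG1 by auto. reflexivity.
  - apply is_derive_eq with (LG2 x - (- / x ^ 2)); [|eqR; ring]. apply is_derive_Rminus; [apply is_derive_LG1; lra|]. auto_derive; [lra|].
    field; lra.
Qed.

Definition Hn (r : nat) : R := psum (fun i => / INR (S i)) r.
Definition H2n (r : nat) : R := psum (fun i => / INR (S i) ^ 2) r.

Lemma digamma_nat r : digamma (INR r + 1) = Hn r - g0.
Proof.
  induction r as [|r IH].
  - rewrite Rplus_0_l, digamma_LG1, LG1_1 by lra. unfold Hn; simpl. lra.
  - assert (H := pos_INR r). rewrite digamma_LG1 in IH by lra. rewrite S_INR, digamma_LG1, LG1_shift by lra.
    change (Hn (S r)) with (Hn r + / INR (S r)). rewrite (S_INR r). lra.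
Qed.

Lemma trigamma_nat r : trigamma (INR r + 1) = trigamma 1 - H2n r.
Proof.
  induction r as [|r IH].
  - rewrite Rplus_0_l. unfold H2n; simpl. ring.
  - assert (H := pos_INR r). rewrite trigamma_LG2 in IH by lra. rewrite S_INR, trigamma_LG2, LG2_shift by lra.
    change (H2n (S r)) with (H2n r + / INR (S r) ^ 2). rewrite (S_INR r). lra.
Qed.

End LogGamma.

(** * The value of zeta at 2 *)

(** Splitting into even and odd [k] halves the angle: [/ sin (x / 2) ^ 2 + / cos (x / 2) ^ 2 = 4 /
    sin x ^ 2]. *)
Lemma sum_inv_sin_sq n : forall x, 0 < x < PI ->
  psum (fun k => / sin ((x + INR k * PI) / 2 ^ n) ^ 2) (2 ^ n) = 4 ^ n / sin x ^ 2.
Proof.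
  induction n as [|n IH]; intros x Hx.
  - simpl (2 ^ 0)%nat. cbn [psum]. replace ((x + INR 0 * PI) / 2 ^ 0) with x by (simpl; field). simpl; lra.
  - simpl (2 ^ S n)%nat. rewrite Nat.add_0_r. replace (2 ^ n + 2 ^ n)%nat with (2 * 2 ^ n)%nat by lia. rewrite psum_even_odd.
    assert (H2 : 2 ^ n <> 0) by (apply pow_nonzero; lra). rewrite (psum_ext _ (fun k => / sin ((x / 2 + INR k * PI) / 2 ^ n) ^ 2)),
      (psum_ext (fun k => / sin ((x + INR (S _) * PI) / _) ^ 2) (fun k => / sin (((x + PI) / 2 + INR k * PI) / 2 ^ n) ^ 2)), !IH.
    2, 3: lra. 2: intros k _; do 3 f_equal; rewrite S_INR, mult_INR; simpl; field; auto.
    2: intros k _; do 3 f_equal; rewrite mult_INR; simpl; field; auto. replace ((x + PI) / 2) with (PI / 2 - - (x / 2)) by field.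
    rewrite sin_shift, cos_neg. replace x with (2 * (x / 2)) at 3 by field. rewrite sin_2a.
    assert (Hs : 0 < sin (x / 2)) by (apply sin_gt_0; lra). assert (Hc : 0 < cos (x / 2)) by (apply cos_gt_0; lra).
    assert (E := sin2_cos2 (x / 2)). unfold Rsqr in E. set (s := sin (x / 2)) in *. set (c := cos (x / 2)) in *.
    replace (4 ^ n / s ^ 2 + 4 ^ n / c ^ 2) with (4 ^ n * (s * s + c * c) / (s ^ 2 * c ^ 2)) by (field; lra). rewrite E. simpl. field.
    lra.
Qed.

(** From [sin y <= y <= tan y], since the inverse square of the tangent is [/ sin y ^ 2 - 1]. *)
Lemma inv_sin_sq_bounds y : 0 < y < PI / 2 -> / sin y ^ 2 - 1 <= / y ^ 2 <= / sin y ^ 2.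
Proof.
  intros Hy. assert (H1 := sin_lt_x y ltac:(lra)). assert (Hs : 0 < sin y) by (apply sin_gt_0; lra).
  assert (Hc : 0 < cos y) by (apply cos_gt_0; lra). assert (E := sin2_cos2 y). unfold Rsqr in E. assert (H2 : 0 <= sin y - y * cos y).
  { replace 0 with (sin 0 - 0 * cos 0) by (rewrite sin_0; ring).
    apply (nondecreasing_of_deriv (fun x => sin x - x * cos x) (fun x => x * sin x)); [lra| |].
    - intros x _. auto_derive; auto. lra.
    - intros x Hx. apply Rmult_le_pos; [lra|]. apply sin_ge_0; lra. }
  split; [|apply Rinv_le_contravar; nra]. replace (/ sin y ^ 2 - 1) with (/ (sin y / cos y) ^ 2).
  - apply Rinv_le_contravar; [pos|]. apply pow_incr. split; [lra|]. apply (Rmult_le_reg_r (cos y)); auto.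
    replace (sin y / cos y * cos y) with (sin y) by (field; lra). lra.
  - replace (/ (sin y / cos y) ^ 2) with (cos y * cos y / sin y ^ 2) by (field; lra).
    replace (cos y * cos y) with (1 - sin y * sin y) by lra. field. lra.
Qed.

(* With y_k = (2k+1) PI / (4m), m = 2^n, the partition identity at x = PI/2 gives sum_(k < m) 1/sin(y_k)^2 = 2 m^2. *)
Lemma sum_inv_odd_sq n : Rabs (psum (fun k => / INR (2 * k + 1) ^ 2) (2 ^ n) - PI ^ 2 / 8) <= PI ^ 2 / 16 * (/ 2) ^ n.
Proof.
  assert (HP := PI_RGT_0). assert (H := sum_inv_sin_sq (S n) (PI / 2) ltac:(lra)). assert (Hm : 0 < 2 ^ n) by pos.
  set (y := fun k => (PI / 2 + INR k * PI) / 2 ^ S n) in *. simpl (2 ^ S n)%nat in H.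
  rewrite Nat.add_0_r, psum_add, (psum_rev (fun i => / sin ((PI / 2 + INR (2 ^ n + i) * PI) / 2 ^ S n) ^ 2)) in H.
  assert (EI : INR (2 ^ n) = 2 ^ n) by (rewrite pow_INR; reflexivity).
  rewrite (psum_ext (fun k => / sin ((PI / 2 + INR (2 ^ n + _) * PI) / _) ^ 2) (fun k => / sin (y k) ^ 2)) in H.
  (* Reflection [y -> PI - y] identifies the upper half of the sum, taken in reverse order, with the
     lower half. *)
  2:{ intros k Hk. do 2 f_equal. rewrite <- sin_PI_x. f_equal. unfold y. rewrite plus_INR, !minus_INR, S_INR, EI by lia. simpl. field.
    lra. }
  replace (psum (fun k => / sin ((PI / 2 + INR k * PI) / 2 ^ S n) ^ 2) (2 ^ n)) with (psum (fun k => / sin (y k) ^ 2) (2 ^ n)) in H by auto.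
  rewrite sin_PI2 in H.
  assert (B : forall k, (k < 2 ^ n)%nat -> / sin (y k) ^ 2 - 1 <= 16 * 4 ^ n / PI ^ 2 * / INR (2 * k + 1) ^ 2 <= / sin (y k) ^ 2).
  { intros k Hk. assert (Hk0 := pos_INR k). assert (Hk1 : INR (S k) <= 2 ^ n) by (rewrite <- EI; apply le_INR; lia). rewrite S_INR in Hk1.
    replace (16 * 4 ^ n / PI ^ 2 * / INR (2 * k + 1) ^ 2) with (/ y k ^ 2).
    - apply inv_sin_sq_bounds. unfold y. simpl. split; [pos|]. apply (Rmult_lt_reg_r (2 * 2 ^ n)); [lra|]. field_simplify; [|lra]. nra.
    - unfold y. rewrite plus_INR, mult_INR. simpl. replace (4 ^ n) with (2 ^ n * 2 ^ n) by (rewrite <- Rpow_mult_distr; f_equal; ring).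
      field; nra. }
  assert (U := psum_le _ _ _ (fun k Hk => proj2 (B k Hk))). assert (L := psum_le _ _ _ (fun k Hk => proj1 (B k Hk))).
  rewrite psum_minus, psum_const, EI in L. rewrite psum_scal in U, L. set (O := psum (fun k => / INR (2 * k + 1) ^ 2) (2 ^ n)) in *.
  set (Q := psum (fun k => / sin (y k) ^ 2) (2 ^ n)) in *. simpl in H.
  assert (HQ : Q = 2 * (2 ^ n * 2 ^ n)) by (rewrite <- Rpow_mult_distr; replace (2 * 2) with 4 by ring; lra).
  replace (16 * 4 ^ n / PI ^ 2 * O) with (2 ^ n * 2 ^ n * (16 / PI ^ 2 * O)) in U, L
    by (replace 4 with (2 * 2) by ring; rewrite Rpow_mult_distr; field; lra).
  rewrite pow_inv. replace O with (PI ^ 2 / 16 * (16 / PI ^ 2 * O)) by (field; lra). set (O' := 16 / PI ^ 2 * O) in *.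
  replace (PI ^ 2 / 16 * O' - PI ^ 2 / 8) with (PI ^ 2 / 16 * (O' - 2)) by field.
  rewrite Rabs_mult, (Rabs_right (_ / _)) by (apply Rle_ge; pos). apply Rmult_le_compat_l; [pos|]. apply Rabs_le.
  assert (Hi : 2 ^ n * / 2 ^ n = 1) by (field; lra). split; apply (Rmult_le_reg_l (2 ^ n * 2 ^ n)); nra.
Qed.

Theorem basel : is_series (fun n => / INR (S n) ^ 2) (PI ^ 2 / 6).
Proof.
  assert (HS := Series_correct _ ex_series_inv_sq). set (L := Series _) in HS.
  set (P := fun n => psum (fun n => / INR (S n) ^ 2) (2 ^ n)). set (O := fun n => psum (fun k => / INR (2 * k + 1) ^ 2) (2 ^ n)).
  assert (LP : is_lim_seq P L).
  { apply (is_lim_seq_subseq (psum (fun n => / INR (S n) ^ 2)) _ (fun n => 2 ^ n)%nat); [|apply is_series_psum, HS].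
    apply eventually_subseq. intros n. simpl. assert (H := Nat.pow_nonzero 2 n ltac:(lia)). lia. }
  assert (LO : is_lim_seq O (PI ^ 2 / 8)).
  { apply (lim_squeeze _ (fun n => PI ^ 2 / 16 * (/ 2) ^ n)); [apply sum_inv_odd_sq|]. apply lim_scal0, is_lim_seq_geom.
    rewrite Rabs_right; lra. }
  (* Odd terms plus even terms, the latter being a quarter of the full sum. In the limit
     [L = PI ^ 2 / 8 + L / 4]. *)
  assert (E : forall n, P (S n) = O n + / 4 * P n).
  { intros n. unfold P, O. rewrite <- psum_scal. simpl (2 ^ S n)%nat. rewrite Nat.add_0_r.
    replace (2 ^ n + 2 ^ n)%nat with (2 * 2 ^ n)%nat by lia. rewrite psum_even_odd. f_equal; apply psum_ext; intros i _.
    - do 3 f_equal. lia.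
    - assert (H := pos_INR i). rewrite !S_INR, mult_INR. simpl. field. lra. }
  assert (LE := is_lim_seq_unique _ _ (proj1 (is_lim_seq_incr_1 _ _) LP)).
  rewrite (Lim_seq_ext _ _ E), (is_lim_seq_unique _ _ (is_lim_seq_plus' _ _ _ _ LO (is_lim_seq_scal_l _ (/ 4) _ LP))) in LE. injection LE.
  intros. replace (PI ^ 2 / 6) with L by lra. auto.
Qed.

Arguments Cmod x%_C_scope.
Arguments Re z%_C_scope.
Arguments Im z%_C_scope.

(** * Complex differentiation *)

(** Equivalent to [is_derive] over the complex field by [Cdiff_is_derive]; the explicit form is the
    one that norm estimates produce. *)
Definition Cdiff (f : C -> C) (z d : C) : Prop :=
  forall eps, 0 < eps -> exists eta, 0 < eta /\
    forall k, Cmod k < eta -> Cmod (f (z + k) - f z - k * d)%C <= eps * Cmod k.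

Lemma Cdiff_quadratic f z d eta B :
  0 < eta ->
  (forall k, Cmod k < eta -> Cmod (f (z + k) - f z - k * d)%C <= B * Cmod k ^ 2) ->
  Cdiff f z d.
Proof.
  intros He H eps Heps. assert (HB := Rabs_pos B). assert (HBl := Rle_abs B). exists (Rmin eta (eps / (Rabs B + 1))). split.
  - apply Rmin_pos; auto. pos.
  - intros k Hk. assert (Hk0 := Cmod_ge_0 k). assert (H1 : Cmod k < eta) by (eapply Rlt_le_trans; [exact Hk|apply Rmin_l]).
    assert (H2 : Cmod k < eps / (Rabs B + 1)) by (eapply Rlt_le_trans; [exact Hk|apply Rmin_r]). eapply Rle_trans; [apply H; auto|].
    assert (H3 : (Rabs B + 1) * Cmod k <= eps).
    { apply Rmult_le_reg_r with (/ (Rabs B + 1)); [apply Rinv_0_lt_compat; lra|].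
      replace ((Rabs B + 1) * Cmod k * / (Rabs B + 1)) with (Cmod k) by (field; lra). lra. }
    nra.
Qed.

Lemma Cdiff_eq f z d d' : Cdiff f z d -> d = d' -> Cdiff f z d'.
Proof. intros H <-; exact H. Qed.

Lemma Cdiff_ext f g z d : (forall z, f z = g z) -> Cdiff f z d -> Cdiff g z d.
Proof.
  intros E H eps He. destruct (H eps He) as [eta [Heta Hk]]. exists eta; split; auto. intros k Hkk. rewrite <- !E. auto.
Qed.

Lemma Cdiff_ext_loc f g z d r :
  0 < r -> (forall k, Cmod k < r -> f (z + k)%C = g (z + k)%C) -> Cdiff f z d -> Cdiff g z d.
Proof.
  intros Hr E H eps He. destruct (H eps He) as [eta [Heta Hk]]. exists (Rmin eta r); split; [apply Rmin_pos; auto|]. intros k Hkk.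
  assert (E0 : f z = g z).
  { replace z with (z + 0)%C by ring. apply E. rewrite Cmod_0; auto. }
  rewrite <- E0, <- E.
  - apply Hk. eapply Rlt_le_trans; [exact Hkk|apply Rmin_l].
  - eapply Rlt_le_trans; [exact Hkk|apply Rmin_r].
Qed.

Lemma Cmod_Re_pos_near z k : Cmod k < Re z -> 0 < Re (z + k)%C.
Proof. rewrite re_plus. assert (H1 := re_le_Cmod k). apply Rabs_le_between in H1. lra. Qed.

Lemma Cdiff_ext_half f g z d :
  (forall z, 0 < Re z -> f z = g z) -> 0 < Re z -> Cdiff f z d -> Cdiff g z d.
Proof. intros E Hz. apply (Cdiff_ext_loc f g z d (Re z)); auto. intros k Hk. apply E, Cmod_Re_pos_near; auto. Qed.

Lemma Cdiff_const c z : Cdiff (fun _ => c) z 0.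
Proof.
  apply (Cdiff_quadratic _ _ _ 1 0); [lra|]. intros k _. replace (c - c - k * 0)%C with (0 : C) by ring. rewrite Cmod_0. lra.
Qed.

Lemma Cdiff_id z : Cdiff (fun z => z) z 1.
Proof.
  apply (Cdiff_quadratic _ _ _ 1 0); [lra|]. intros k _. replace (z + k - z - k * 1)%C with (0 : C) by ring. rewrite Cmod_0. lra.
Qed.

Lemma Cdiff_is_derive f z d : Cdiff f z d <-> is_derive (K := C_AbsRing) (V := AbsRing_NormedModule C_AbsRing) f z d.
Proof.
  split.
  - split; [apply is_linear_scal_l|]. intros x Hx.
    rewrite <- (is_filter_lim_locally_unique (K := C_AbsRing) (V := AbsRing_NormedModule C_AbsRing) z x Hx). intros eps.
    destruct (H eps (cond_pos eps)) as [eta [He Hk]]. exists (mkposreal _ He). intros y Hy. specialize (Hk ((y : C) - z)%C Hy).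
    replace (z + ((y : C) - z))%C with (y : C) in Hk by (apply injective_projections; simpl; ring). auto.
  - intros [_ H] eps He. destruct (H z (fun P HP => HP) (mkposreal _ He)) as [eta Hk]. exists eta. split; [apply cond_pos|]. intros k Hkk.
    assert (E : (z + k - z)%C = k) by ring. specialize (Hk (z + k)%C). unfold ball in Hk. simpl in Hk.
    unfold AbsRing_ball, abs, minus, plus, opp, norm, scal, mult in Hk. unfold mult in Hk; simpl in Hk.
    change (z + k + - z)%C with (z + k - z)%C in Hk. rewrite E in Hk. auto.
Qed.

Lemma Cdiff_plus f g z d e :
  Cdiff f z d -> Cdiff g z e -> Cdiff (fun z => f z + g z)%C z (d + e).
Proof. rewrite !Cdiff_is_derive. apply (is_derive_plus (K := C_AbsRing) (V := AbsRing_NormedModule C_AbsRing)). Qed.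

Lemma Cdiff_mult f g z d e :
  Cdiff f z d -> Cdiff g z e -> Cdiff (fun z => f z * g z)%C z (d * g z + f z * e).
Proof. rewrite !Cdiff_is_derive. intros Hf Hg. apply (is_derive_mult (K := C_AbsRing) f g z d e Hf Hg Cmult_comm). Qed.

Lemma Cdiff_comp f g z d e :
  Cdiff f (g z) d -> Cdiff g z e -> Cdiff (fun z => f (g z)) z (d * e).
Proof.
  rewrite !Cdiff_is_derive, (Cmult_comm d). apply (is_derive_comp (K := C_AbsRing) (V := AbsRing_NormedModule C_AbsRing)).
Qed.

Lemma Cdiff_lip f z d : Cdiff f z d ->
  exists eta, 0 < eta /\ forall k, Cmod k < eta ->
    Cmod (f (z + k) - f z)%C <= (1 + Cmod d) * Cmod k.
Proof.
  intros Hf. destruct (Hf 1) as [eta [H1 H2]]; [lra|]. exists eta; split; auto. intros k Hk. specialize (H2 k Hk).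
  replace (f (z + k) - f z)%C with ((f (z + k) - f z - k * d) + k * d)%C by ring. via Cmod_triangle. rewrite Cmod_mult. lra.
Qed.

Lemma Cdiff_scal c f z d : Cdiff f z d -> Cdiff (fun z => c * f z)%C z (c * d).
Proof.
  intros H. apply (Cdiff_eq _ _ (0 * f z + c * d)); [|ring]. apply (Cdiff_mult (fun _ => c) f); auto. apply Cdiff_const.
Qed.

Lemma Cdiff_minus f g z d e :
  Cdiff f z d -> Cdiff g z e -> Cdiff (fun z => f z - g z)%C z (d - e).
Proof.
  intros Hf Hg. apply (Cdiff_ext (fun z => f z + (-(1)) * g z)%C); [intros; ring|]. apply (Cdiff_eq _ _ (d + (-(1)) * e)); [|ring].
  apply Cdiff_plus; auto. apply Cdiff_scal; auto.
Qed.

Lemma Cmod_pos z : z <> RtoC 0 -> 0 < Cmod z.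
Proof. apply (proj1 (Cmod_gt_0 z)). Qed.

Lemma Cmod_pos_neq_0 z : 0 < Cmod z -> z <> RtoC 0.
Proof. apply (proj2 (Cmod_gt_0 z)). Qed.

Lemma Cdiff_inv (z : C) : z <> 0 -> Cdiff Cinv z (- / (z * z)).
Proof.
  intros Hz. assert (Hm : 0 < Cmod z) by (apply Cmod_pos; auto). apply (Cdiff_quadratic _ _ _ (Cmod z / 2) (2 / Cmod z ^ 3)); [lra|].
  intros k Hk. assert (Hzk : Cmod z / 2 <= Cmod (z + k)%C).
  { assert (H := Cmod_triangle (z + k) (- k)). rewrite Cmod_opp in H. replace (z + k + - k)%C with z in H by ring. lra. }
  assert (Hn : (z + k)%C <> 0).
  { apply Cmod_pos_neq_0. lra. }
  replace (/ (z + k) - / z - k * - / (z * z))%C with (k * k * / (z + k) * / z * / z)%C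
    by (field; auto).
  rewrite !Cmod_mult, !Cmod_inv by auto. assert (H1 : / Cmod (z + k)%C <= 2 * / Cmod z).
  { replace (2 * / Cmod z) with (/ (Cmod z / 2)) by (field; lra). pos. }
  replace (2 / Cmod z ^ 3 * Cmod k ^ 2)
    with (Cmod k * Cmod k * (2 * / Cmod z) * / Cmod z * / Cmod z) by (field; lra).
  pos.
Qed.

Lemma Re_pos_neq_0 z : 0 < Re z -> z <> 0.
Proof. intros H ->. unfold Re in H; simpl in H. lra. Qed.

Lemma Re_le_Cmod z : Re z <= Cmod z.
Proof. assert (H := re_le_Cmod z). apply Rabs_le_between in H. lra. Qed.

Lemma Im_le_Cmod z : Rabs (Im z) <= Cmod z.
Proof. eapply Rle_trans; [|apply Rmax_Cmod]. apply Rmax_r. Qed.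

Lemma Cmod_le_Re_Im z : Cmod z <= Rabs (Re z) + Rabs (Im z).
Proof.
  destruct z as [x y]. simpl. replace ((x, y) : C) with (RtoC x + Ci * RtoC y)%C.
  2:{ unfold RtoC, Ci, Cplus, Cmult; simpl. f_equal; ring. }
  via Cmod_triangle. rewrite Cmod_mult, Cmod_Ci, Rmult_1_l, !Cmod_R. lra.
Qed.

Definition is_Cderive (f : R -> C) (t : R) (d : C) : Prop :=
  is_derive (fun t => Re (f t)%C) t (Re d) /\ is_derive (fun t => Im (f t)%C) t (Im d).

Lemma is_Cderive_eq f t d d' : is_Cderive f t d -> d = d' -> is_Cderive f t d'.
Proof. congruence. Qed.

Lemma Cdiff_curve f (g : R -> C) t d e :
  Cdiff f (g t) d -> is_Cderive g t e -> is_Cderive (fun t => f (g t)) t (d * e).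
Proof.
  intros Hf [G1 G2]. apply is_derive_Reals in G1, G2.
  (* Real and imaginary parts are handled together: [pr] stands for either projection, and
     [(l1, l2)] is its gradient given by the Cauchy-Riemann equations. *)
  assert (Half : forall (pr : C -> R) l1 l2, (forall a c, pr (a - c)%C = pr a - pr c) -> (forall a, Rabs (pr a) <= Cmod a) ->
    (forall k, pr (k * d)%C = l1 * Re k + l2 * Im k) -> is_derive (fun t => pr (f (g t))) t (l1 * Re e + l2 * Im e)).
  { intros pr l1 l2 P1 P2 P3. apply (is_derive_ext (fun t => pr (f (Re (g t), Im (g t))%C))); [intros x; destruct (g x); auto|].
    apply is_derive_Reals, (derivable_pt_lim_comp_2d (fun u v => pr (f (u, v)))); auto. intros eps.
    destruct (Hf (eps / 2)) as [eta [He Hk]]; [destruct eps; simpl; lra|]. exists (mkposreal (eta / 2) ltac:(lra)). simpl.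
    intros u v Hu Hv. specialize (Hk ((u, v) - g t)%C). set (k := ((u, v) - g t)%C) in *.
    replace (g t + k)%C with ((u, v) : C) in Hk by (apply injective_projections; unfold k; simpl; ring).
    assert (R1 : Re k = u - Re (g t)) by (unfold k; destruct (g t); reflexivity).
    assert (R2 : Im k = v - Im (g t)) by (unfold k; destruct (g t); reflexivity). assert (B := Cmod_le_Re_Im k). rewrite R1, R2 in B.
    specialize (Hk ltac:(lra)). assert (M1 := Rmax_l (Rabs (u - Re (g t))) (Rabs (v - Im (g t)))).
    assert (M2 := Rmax_r (Rabs (u - Re (g t))) (Rabs (v - Im (g t)))).
    replace (_ - _) with (pr (f (u, v) - f (g t) - k * d)%C) by (rewrite !P1, P3, R1, R2; destruct (g t); reflexivity). via P2.
    assert (He2 := cond_pos eps). nra. }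
  split; [replace (Re _) with (Re d * Re e + - Im d * Im e)|replace (Im _) with (Im d * Re e + Re d * Im e)]; try (destruct d, e; simpl; ring).
  - apply (Half Re (Re d) (- Im d)); [auto|apply re_le_Cmod|intros [? ?]; destruct d; simpl; ring].
  - apply (Half Im (Im d) (Re d)); [auto|apply Im_le_Cmod|intros [? ?]; destruct d; simpl; ring].
Qed.

Lemma is_Cderive_line (z h : C) (t : R) : is_Cderive (fun t => z + t * h)%C t h.
Proof. destruct z as [x y], h as [u v]. split; simpl; auto_derive; auto; eqR; ring. Qed.

Lemma is_Cderive_ray (h : C) (t : R) : is_Cderive (fun t => t * h)%C t h.
Proof. destruct h as [u v]. split; simpl; auto_derive; auto; eqR; ring. Qed.

Lemma C_eq_Re_Im (a c : C) : Re a = Re c -> Im a = Im c -> a = c.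
Proof. destruct a, c; simpl. congruence. Qed.

Lemma Cdiff_unique f z d e : Cdiff f z d -> Cdiff f z e -> d = e.
Proof.
  intros H1 H2. assert (G := is_Cderive_line z 1 0). assert (E : z = (z + 0 * 1)%C) by ring. rewrite E in H1, H2.
  destruct (Cdiff_curve f (fun t => z + t * 1)%C 0 d 1 H1 G) as [A1 A2].
  destruct (Cdiff_curve f (fun t => z + t * 1)%C 0 e 1 H2 G) as [B1 B2]. rewrite !Cmult_1_r in *. apply C_eq_Re_Im.
  - apply is_derive_unique in A1, B1. lra.
  - apply is_derive_unique in A2, B2. lra.
Qed.

(** The mean value theorem is applied to the real and imaginary parts separately, which costs the
    factor [2]. *)
Lemma Cderive_bound (f f' : R -> C) (a b M : R) :
  (forall t, Rmin a b <= t <= Rmax a b -> is_Cderive f t (f' t)) ->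
  (forall t, Rmin a b <= t <= Rmax a b -> Cmod (f' t)%C <= M) ->
  Cmod (f b - f a)%C <= 2 * M * Rabs (b - a).
Proof.
  intros H HM. via Cmod_le_Re_Im. replace (Re (f b - f a)%C) with (Re (f b)%C - Re (f a)%C) by (destruct (f a), (f b); simpl; ring).
  replace (Im (f b - f a)%C) with (Im (f b)%C - Im (f a)%C) by (destruct (f a), (f b); simpl; ring).
  assert (B1 : Rabs (Re (f b)%C - Re (f a)%C) <= M * Rabs (b - a)).
  { apply (deriv_bound (fun t => Re (f t)%C) (fun t => Re (f' t)%C)).
    - apply H.
    - intros t Ht. eapply Rle_trans; [apply re_le_Cmod|auto]. }
  assert (B2 : Rabs (Im (f b)%C - Im (f a)%C) <= M * Rabs (b - a)).
  { apply (deriv_bound (fun t => Im (f t)%C) (fun t => Im (f' t)%C)).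
    - apply H.
    - intros t Ht. eapply Rle_trans; [apply Im_le_Cmod|auto]. }
  lra.
Qed.

Lemma is_Cderive_minus (f g : R -> C) (t : R) (d e : C) :
  is_Cderive f t d -> is_Cderive g t e -> is_Cderive (fun t => f t - g t)%C t (d - e)%C.
Proof.
  intros [A1 A2] [B1 B2]. split.
  - apply (is_derive_ext (fun t : R => Re (f t) - Re (g t))).
    + auto.
    + eapply is_derive_eq; [apply is_derive_Rminus; [exact A1|exact B1]|]. auto.
  - apply (is_derive_ext (fun t : R => Im (f t) - Im (g t))).
    + auto.
    + eapply is_derive_eq; [apply is_derive_Rminus; [exact A2|exact B2]|]. auto.
Qed.

(** Complex differentiability from derivatives along all segments issuing from [z], given a
    candidate derivative that is Lipschitz at [z]. [Clog] and [Cexp] are differentiated in this way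
    from their real components. *)
Lemma Cdiff_of_lines f d z r B :
  0 < r ->
  (forall k t, Cmod k < r -> 0 <= t <= 1 -> is_Cderive (fun t => f (z + t * k)%C) t (k * d (z + t * k)%C)) ->
  (forall k, Cmod k < r -> Cmod (d (z + k) - d z)%C <= B * Cmod k) ->
  Cdiff f z (d z).
Proof.
  intros Hr H HB. apply (Cdiff_quadratic _ _ _ r (2 * B)); auto. intros k Hk. replace (f (z + k) - f z - k * d z)%C
    with ((f (z + 1 * k) - 1 * (k * d z)) - (f (z + 0 * k) - 0 * (k * d z)))%C
    by (rewrite Cmult_1_l, !Cmult_0_l, Cplus_0_r; ring).
  replace (2 * B * Cmod k ^ 2) with (2 * (B * Cmod k ^ 2) * Rabs (1 - 0))
    by (rewrite Rminus_0_r, Rabs_R1; ring).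
  apply (Cderive_bound (fun t : R => f (z + t * k) - t * (k * d z))%C
    (fun t : R => k * d (z + t * k) - k * d z)%C);
    rewrite Rmin_left, Rmax_right by lra; intros t Ht.
  - apply is_Cderive_minus; [auto|apply is_Cderive_ray].
  - replace (k * d (z + t * k) - k * d z)%C with (k * (d (z + t * k) - d z))%C by ring. rewrite Cmod_mult. assert (Hk0 := Cmod_ge_0 k).
    assert (Htk : Cmod (t * k)%C <= Cmod k) by (rewrite Cmod_mult, Cmod_R, Rabs_right; nra). assert (HB1 := HB (t * k)%C ltac:(lra)).
    assert (HB0 : 0 <= B * Cmod k).
    { eapply Rle_trans; [apply Cmod_ge_0|apply (HB k Hk)]. }
    nra.
Qed.

Lemma Cdiff_taylor2 f f1 f2 z k M :
  (forall t, 0 <= t <= 1 -> Cdiff f (z + RtoC t * k)%C (f1 (z + RtoC t * k)%C)) ->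
  (forall t, 0 <= t <= 1 -> Cdiff f1 (z + RtoC t * k)%C (f2 (z + RtoC t * k)%C)) ->
  (forall t, 0 <= t <= 1 -> Cmod (f2 (z + RtoC t * k)%C)%C <= M) ->
  Cmod (f (z + k) - f z - k * f1 z)%C <= 4 * M * Cmod k ^ 2.
Proof.
  intros H1 H2 HM. assert (Hk0 := Cmod_ge_0 k). assert (HM0 : 0 <= M) by (eapply Rle_trans; [apply Cmod_ge_0|apply (HM 0); lra]).
  replace (f (z + k) - f z - k * f1 z)%C
    with ((f (z + 1 * k) - 1 * (k * f1 z)) - (f (z + 0 * k) - 0 * (k * f1 z)))%C
    by (rewrite Cmult_1_l, !Cmult_0_l, Cplus_0_r; ring).
  replace (4 * M * Cmod k ^ 2) with (2 * (2 * M * Cmod k * Cmod k) * Rabs (1 - 0))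
    by (rewrite Rminus_0_r, Rabs_R1; ring).
  apply (Cderive_bound (fun t : R => f (z + t * k) - t * (k * f1 z))%C
    (fun t : R => f1 (z + t * k) * k - k * f1 z)%C);
    rewrite Rmin_left, Rmax_right by lra; intros t Ht.
  - apply is_Cderive_minus; [|apply is_Cderive_ray]. apply (Cdiff_curve f (fun t => z + t * k)%C); [apply H1; auto|apply is_Cderive_line].
  - replace (f1 (z + t * k) * k - k * f1 z)%C with ((f1 (z + t * k) - f1 (z + 0 * k)) * k)%C
      by (rewrite Cmult_0_l, Cplus_0_r; ring).
    rewrite Cmod_mult. apply Rmult_le_compat_r; auto. eapply Rle_trans.
    + apply (Cderive_bound (fun t : R => f1 (z + t * k))%C (fun t : R => f2 (z + t * k) * k)%C 0 t
        (M * Cmod k)); rewrite Rmin_left, Rmax_right by lra; intros u Hu.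
      * apply Cdiff_curve; [apply H2; lra|apply is_Cderive_line].
      * rewrite Cmod_mult. apply Rmult_le_compat_r; auto. apply HM; lra.
    + rewrite Rminus_0_r, Rabs_right by lra. assert (0 <= M * Cmod k) by (apply Rmult_le_pos; auto). nra.
Qed.

(** * The principal logarithm on the right half-plane *)

Lemma Cmod_polar x y : 0 < x -> Cmod (x, y)%C = sqrt (x * x + y * y).
Proof. intros _. unfold Cmod. simpl. f_equal. ring. Qed.

(** On the right half-plane the arccosine with its sign distinction merges into one arctangent, a
    formula that can be differentiated across the real axis. *)
Lemma Carg_atan z : 0 < Re z -> Carg z = atan (Im z / Re z).
Proof.
  intros Hz. destruct z as [x y]. simpl in *. unfold Carg. simpl Re. simpl Im. set (a := atan (y / x)).
  assert (Ha : - PI / 2 < a < PI / 2) by apply atan_bound. assert (Hc : 0 < cos a) by (apply cos_gt_0; lra).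
  assert (Et : y / x = sin a / cos a) by (change (y / x = tan a); unfold a; rewrite tan_atan; auto). assert (Ey : y = x * sin a / cos a).
  { apply Rmult_eq_reg_r with (/ x); [|apply Rinv_neq_0_compat; lra]. replace (y * / x) with (y / x) by reflexivity. rewrite Et. field.
    lra. }
  assert (Em : Cmod (x, y)%C = x / cos a).
  { rewrite Cmod_polar by auto. rewrite Ey. replace (x * x + x * sin a / cos a * (x * sin a / cos a))
      with (x / cos a * (x / cos a) * (cos a * cos a + sin a * sin a)) by (field; lra).
    assert (H := sin2_cos2 a). unfold Rsqr in H. replace (cos a * cos a + sin a * sin a) with 1 by lra. rewrite Rmult_1_r.
    apply sqrt_square. pos. }
  assert (Ec : x / Cmod (x, y)%C = cos a) by (rewrite Em; field; lra). rewrite Ec. destruct (Rle_dec 0 y) as [Hy|Hy].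
  - assert (0 <= a).
    { destruct (Rle_dec 0 a); auto. assert (sin a < 0) by (apply sin_lt_0_var; lra).
      assert (0 < x / cos a) by (apply Rdiv_lt_0_compat; auto). nra. }
    apply acos_cos; lra.
  - assert (a <= 0).
    { destruct (Rle_dec a 0); auto. assert (0 < sin a) by (apply sin_gt_0; lra). assert (0 < x / cos a) by (apply Rdiv_lt_0_compat; auto).
      nra. }
    rewrite <- (cos_neg a), acos_cos by lra. ring.
Qed.

Lemma Clog_half_plane z : 0 < Re z ->
  Clog z = (ln (sqrt (Re z * Re z + Im z * Im z)), atan (Im z / Re z)).
Proof.
  intros Hz. unfold Clog. rewrite Carg_atan by auto. destruct z as [x y]. rewrite Cmod_polar by auto. reflexivity.
Qed.

Lemma Clog_line_derive (z k : C) (t : R) :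
  0 < Re (z + t * k)%C -> is_Cderive (fun t => Clog (z + t * k)%C) t (k * / (z + t * k))%C.
Proof.
  intros Hz. destruct z as [x y], k as [u v]. assert (Ex : forall s : R, Re ((x, y) + s * (u, v))%C = x + s * u) by (intros; simpl; ring).
  assert (Ey : forall s : R, Im ((x, y) + s * (u, v))%C = y + s * v) by (intros; simpl; ring). rewrite Ex in Hz.
  assert (Hloc : locally t (fun s => 0 < x + s * u)).
  { assert (Hc : continuous (fun s => x + s * u) t).
    { apply (ex_derive_continuous (fun s => x + s * u)). auto_derive; auto. }
    apply (Hc (fun y => 0 < y)). apply locally_gt; auto. }
  assert (Hinv : forall X Y, 0 < X -> (/ (X, Y))%C = (X / (X * X + Y * Y), - Y / (X * X + Y * Y))).
  { intros X Y HX. unfold Cinv. simpl. f_equal; f_equal; ring. }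
  assert (Er : ((x, y) + t * (u, v))%C = (x + t * u, y + t * v)).
  { apply C_eq_Re_Im; [rewrite Ex|rewrite Ey]; reflexivity. }
  rewrite Er, Hinv by auto. set (X := x + t * u) in *. set (Y := y + t * v). assert (HXY : 0 < X * X + Y * Y) by nra. split.
  - apply (is_derive_ext_loc (fun s => ln (sqrt ((x + s * u) * (x + s * u) + (y + s * v) * (y + s * v))))).
    + apply (filter_imp (fun s => 0 < x + s * u)); [|exact Hloc]. intros s Hs. rewrite Clog_half_plane by (rewrite Ex; auto).
      rewrite Ex, Ey. reflexivity.
    + auto_derive.
      * split; [pos|split; [|exact I]]. apply sqrt_lt_R0; exact HXY.
      * fold X Y. assert (Hs := sqrt_lt_R0 _ HXY). simpl.
        assert (E : sqrt (X * X + Y * Y) * sqrt (X * X + Y * Y) = X * X + Y * Y) by (apply sqrt_sqrt; lra).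
        set (q := sqrt (X * X + Y * Y)) in *. rewrite <- E. field. lra.
  - apply (is_derive_ext_loc (fun s => atan ((y + s * v) / (x + s * u)))).
    + apply (filter_imp (fun s => 0 < x + s * u)); [|exact Hloc]. intros s Hs. rewrite Clog_half_plane by (rewrite Ex; auto).
      rewrite Ex, Ey. reflexivity.
    + auto_derive; [fold X; lra|]. fold X Y. simpl. field; lra.
Qed.

Lemma Cdiff_Clog z : 0 < Re z -> Cdiff Clog z (/ z).
Proof.
  intros Hz. destruct (Cdiff_lip Cinv z _ (Cdiff_inv z (Re_pos_neq_0 z Hz))) as [eta [He HL]].
  apply (Cdiff_of_lines Clog Cinv z (Rmin eta (Re z)) (1 + Cmod (- / (z * z))%C)).
  - apply Rmin_pos; auto.
  - intros k t Hk Ht. apply Clog_line_derive. apply Cmod_Re_pos_near. rewrite Cmod_mult, Cmod_R, Rabs_right by lra.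
    assert (H := Rmin_r eta (Re z)). assert (H0 := Cmod_ge_0 k). nra.
  - intros k Hk. apply HL. assert (H := Rmin_l eta (Re z)). lra.
Qed.

Lemma Clog_mult_pos (c : R) z : 0 < c -> 0 < Re z -> Clog (c * z)%C = (ln c + Clog z)%C.
Proof.
  intros Hc Hz. assert (Hz2 : 0 < Re (c * z)%C) by (rewrite re_scal_l; nra). unfold Clog. rewrite !Carg_atan by auto.
  rewrite re_scal_l, im_scal_l, Cmod_mult, Cmod_R, Rabs_right by lra. rewrite ln_mult; auto; [|apply Cmod_pos, Re_pos_neq_0; auto].
  apply C_eq_Re_Im; simpl; [reflexivity|]. rewrite Rplus_0_l. f_equal. field. lra.
Qed.

Lemma Clog_inv z : 0 < Re z -> Clog (/ z)%C = (- Clog z)%C.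
Proof.
  intros Hz. assert (Hz0 := Re_pos_neq_0 z Hz). destruct z as [x y]. simpl in Hz. assert (Hxy : 0 < x * x + y * y) by nra.
  assert (E : (/ (x, y))%C = (x / (x * x + y * y), - y / (x * x + y * y))).
  { unfold Cinv. simpl. f_equal; f_equal; ring. }
  assert (Hz2 : 0 < Re (/ (x, y))%C) by (rewrite E; simpl; apply Rdiv_lt_0_compat; auto). unfold Clog. rewrite !Carg_atan by auto.
  rewrite Cmod_inv by auto. rewrite ln_Rinv by (apply Cmod_pos; auto). apply C_eq_Re_Im; [reflexivity|]. simpl. rewrite <- atan_opp.
  f_equal. field; lra.
Qed.

Lemma Clog_R (x : R) : 0 < x -> Clog x = ln x.
Proof.
  intros Hx. unfold Clog. rewrite Carg_atan by (simpl; auto). rewrite Cmod_R, Rabs_right by lra. unfold Rdiv. rewrite Rmult_0_l, atan_0.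
  reflexivity.
Qed.

Lemma Cmod_Clog z : 0 < Re z -> Cmod (Clog z)%C <= Rabs (ln (Cmod z)) + PI / 2.
Proof.
  intros Hz. via Cmod_le_Re_Im. simpl. rewrite Carg_atan by auto. assert (H := atan_bound (Im z / Re z)). apply Rplus_le_compat_l.
  apply Rabs_le_between. lra.
Qed.

(** * Symbol estimates *)

(* [phi] is O(w) on [D], each of its first [m] derivatives gaining a factor [1 / |z|]. *)
Fixpoint Symb (m : nat) (D : C -> Prop) (w : C -> R) (phi : C -> C) : Prop :=
  (exists c, forall z, D z -> Cmod (phi z) <= c * w z) /\
  match m with
  | O => True
  | S p => exists phi', (forall z, 0 < Re z -> Cdiff phi z (phi' z)) /\
             Symb p D (fun z => w z / Cmod z) phi'
  end.

Section Symbols.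

Variable D : C -> Prop.
Hypothesis HD : forall z, D z -> 0 < Re z.

Lemma D_Cmod z : D z -> 0 < Cmod z.
Proof. intros Hz. apply Cmod_pos, Re_pos_neq_0, HD, Hz. Qed.

Lemma Symb_bound m w phi : Symb m D w phi -> (forall z, D z -> 0 <= w z) ->
  exists c, 0 <= c /\ forall z, D z -> Cmod (phi z) <= c * w z.
Proof.
  intros H Hw. assert (H0 : exists c, forall z, D z -> Cmod (phi z) <= c * w z) by (destruct m; apply H). destruct H0 as [c Hc].
  exists (Rabs c). split; [apply Rabs_pos|]. intros z Hz. eapply Rle_trans; [apply Hc; auto|]. apply Rmult_le_compat_r; auto.
  apply Rle_abs.
Qed.

Lemma Symb_weight m : forall w1 w2 phi K,
  (forall z, D z -> 0 <= w1 z) -> (forall z, D z -> w1 z <= K * w2 z) ->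
  Symb m D w1 phi -> Symb m D w2 phi.
Proof.
  induction m as [|m IH]; intros w1 w2 phi K H0 HK H.
  - destruct (Symb_bound _ _ _ H H0) as [c [Hc Hb]]. split; auto. exists (c * K). intros z Hz. eapply Rle_trans; [apply Hb; auto|].
    rewrite Rmult_assoc. apply Rmult_le_compat_l; auto.
  - split.
    + destruct (Symb_bound _ _ _ H H0) as [c [Hc Hb]]. exists (c * K). intros z Hz. eapply Rle_trans; [apply Hb; auto|].
      rewrite Rmult_assoc. apply Rmult_le_compat_l; auto.
    + destruct H as [_ [phi' [H1 H2]]]. exists phi'. split; auto. apply (IH (fun z => w1 z / Cmod z) _ _ K); auto.
      * intros z Hz. apply Rmult_le_pos; auto. apply Rlt_le, Rinv_0_lt_compat, D_Cmod; auto.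
      * intros z Hz. unfold Rdiv. rewrite <- Rmult_assoc. apply Rmult_le_compat_r; auto. apply Rlt_le, Rinv_0_lt_compat, D_Cmod; auto.
Qed.

Lemma Symb_weight_eq m w1 w2 phi :
  (forall z, D z -> 0 <= w1 z) -> (forall z, D z -> w1 z = w2 z) ->
  Symb m D w1 phi -> Symb m D w2 phi.
Proof. intros H0 H. apply (Symb_weight m w1 w2 phi 1); auto. intros z Hz. rewrite H by auto. lra. Qed.

Lemma Symb_S m : forall w phi, Symb (S m) D w phi -> Symb m D w phi.
Proof. induction m as [|m IH]; intros w phi [H1 H2]; split; auto. destruct H2 as [phi' [H3 H4]]. eauto. Qed.

Lemma Symb_ext m w phi psi :
  (forall z, 0 < Re z -> phi z = psi z) -> Symb m D w phi -> Symb m D w psi.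
Proof.
  intros E H. assert (H0 : exists c, forall z, D z -> Cmod (psi z) <= c * w z).
  { assert (H0 : exists c, forall z, D z -> Cmod (phi z) <= c * w z) by (destruct m; apply H). destruct H0 as [c Hc]. exists c.
    intros z Hz. rewrite <- E; auto. }
  destruct m as [|m]; split; auto. destruct H as [_ [phi' [H1 H2]]]. exists phi'. split; auto. intros z Hz.
  apply (Cdiff_ext_half phi); auto.
Qed.

Lemma Symb_derive m w phi phi' :
  Symb (S m) D w phi -> (forall z, 0 < Re z -> Cdiff phi z (phi' z)) ->
  Symb m D (fun z => w z / Cmod z) phi'.
Proof. intros [_ [psi [H1 H2]]] H. apply (Symb_ext m _ psi); auto. intros z Hz. apply (Cdiff_unique phi z); auto. Qed.

Lemma Symb_zero m : forall w, (forall z, D z -> 0 <= w z) -> Symb m D w (fun _ => RtoC 0).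
Proof.
  induction m as [|m IH]; intros w Hw; split; auto.
  - exists 0. intros z _. rewrite Cmod_0. lra.
  - exists 0. intros z _. rewrite Cmod_0. lra.
  - exists (fun _ => RtoC 0). split; [intros; apply Cdiff_const|]. apply IH. intros z Hz. apply Rmult_le_pos; auto.
    apply Rlt_le, Rinv_0_lt_compat, D_Cmod; auto.
Qed.

Lemma Symb_plus m : forall w phi psi, Symb m D w phi -> Symb m D w psi ->
  Symb m D w (fun z => phi z + psi z)%C.
Proof.
  induction m as [|m IH]; intros w phi psi [[c1 H1] K1] [[c2 H2] K2]; split; auto.
  - exists (c1 + c2). intros z Hz. via Cmod_triangle. specialize (H1 z Hz). specialize (H2 z Hz). lra.
  - exists (c1 + c2). intros z Hz. via Cmod_triangle. specialize (H1 z Hz). specialize (H2 z Hz). lra.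
  - destruct K1 as [phi' [P1 P2]]. destruct K2 as [psi' [Q1 Q2]]. exists (fun z => phi' z + psi' z)%C. split; [|apply IH; auto].
    intros z Hz. apply Cdiff_plus; auto.
Qed.

Lemma Symb_mult m : forall w1 w2 phi psi,
  (forall z, D z -> 0 <= w1 z) -> (forall z, D z -> 0 <= w2 z) ->
  Symb m D w1 phi -> Symb m D w2 psi -> Symb m D (fun z => w1 z * w2 z) (fun z => phi z * psi z)%C.
Proof.
  assert (B : forall m w1 w2 phi psi, 
    (forall z, D z -> 0 <= w1 z) -> (forall z, D z -> 0 <= w2 z) ->
    Symb m D w1 phi -> Symb m D w2 psi -> exists c, forall z, D z ->
    Cmod (phi z * psi z)%C <= c * (w1 z * w2 z)).
  { intros p w1 w2 phi psi W1 W2 H1 H2. destruct (Symb_bound _ _ _ H1 W1) as [c1 [C1 B1]].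
    destruct (Symb_bound _ _ _ H2 W2) as [c2 [C2 B2]]. exists (c1 * c2). intros z Hz. rewrite Cmod_mult.
    replace (c1 * c2 * (w1 z * w2 z)) with ((c1 * w1 z) * (c2 * w2 z)) by ring. apply Rmult_le_compat; auto; apply Cmod_ge_0. }
  induction m as [|m IH]; intros w1 w2 phi psi W1 W2 H1 H2; split; auto.
  - eauto.
  - eauto.
  - assert (H1' := Symb_S _ _ _ H1). assert (H2' := Symb_S _ _ _ H2). destruct H1 as [_ [phi' [P1 P2]]].
    destruct H2 as [_ [psi' [Q1 Q2]]]. exists (fun z => phi' z * psi z + phi z * psi' z)%C. split.
    + intros z Hz. apply Cdiff_mult; auto.
    + assert (Wq : forall w : C -> R, (forall z, D z -> 0 <= w z) ->
        forall z, D z -> 0 <= w z / Cmod z).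
      { intros w W z Hz. apply Rmult_le_pos; auto. apply Rlt_le, Rinv_0_lt_compat, D_Cmod; auto. }
      apply Symb_plus.
      * apply (Symb_weight_eq m (fun z => w1 z / Cmod z * w2 z)).
        -- intros z Hz. apply Rmult_le_pos; auto.
        -- intros; pos.
        -- auto.
      * apply (Symb_weight_eq m (fun z => w1 z * (w2 z / Cmod z))).
        -- intros z Hz. apply Rmult_le_pos; auto.
        -- intros; pos.
        -- auto.
Qed.

Lemma Symb_const m c : Symb m D (fun _ => 1) (fun _ => c).
Proof.
  assert (H0 : exists k, forall z, D z -> Cmod c <= k * 1) by (exists (Cmod c); intros; lra). destruct m as [|m]; split; auto.
  exists (fun _ => RtoC 0). split; [intros; apply Cdiff_const|]. apply Symb_zero. intros z Hz. unfold Rdiv. rewrite Rmult_1_l.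
  apply Rlt_le, Rinv_0_lt_compat, D_Cmod; auto.
Qed.

Lemma Symb_scal m w c phi : (forall z, D z -> 0 <= w z) ->
  Symb m D w phi -> Symb m D w (fun z => c * phi z)%C.
Proof.
  intros Hw H. apply (Symb_weight_eq m (fun z => 1 * w z)).
  - intros z Hz. rewrite Rmult_1_l; auto.
  - intros; pos.
  - apply (Symb_mult m (fun _ => 1) w (fun _ => c) phi); auto; [intros; lra|]. apply Symb_const.
Qed.

Lemma Symb_id m : Symb m D Cmod (fun z => z).
Proof.
  assert (H0 : exists c, forall z, D z -> Cmod z <= c * Cmod z) by (exists 1; intros; lra). destruct m as [|m]; split; auto.
  exists (fun _ => RtoC 1). split; [intros; apply Cdiff_id|]. apply (Symb_weight_eq m (fun _ => 1)); [intros; lra| |apply Symb_const].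
  intros z Hz. assert (H := D_Cmod z Hz). field. lra.
Qed.

Lemma Symb_pow m n : Symb m D (fun z => Cmod z ^ n) (fun z => z ^ n)%C.
Proof.
  induction n as [|n IH].
  - apply (Symb_const m (RtoC 1)).
  - apply (Symb_mult m Cmod (fun z => Cmod z ^ n) (fun z => z) (fun z => z ^ n)%C); auto.
    + intros; pos.
    + intros; pos.
    + apply Symb_id.
Qed.

Lemma Symb_inv m : Symb m D (fun z => / Cmod z) Cinv.
Proof.
  assert (W : forall z, D z -> 0 <= / Cmod z).
  { intros z Hz. apply Rlt_le, Rinv_0_lt_compat, D_Cmod; auto. }
  assert (H0 : exists c, forall z, D z -> Cmod (/ z)%C <= c * / Cmod z).
  { exists 1. intros z Hz. rewrite Cmod_inv; [lra|]. apply Re_pos_neq_0; auto. }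
  induction m as [|m IH]; split; auto. exists (fun z => - (1) * (/ z * / z))%C. split.
  - intros z Hz. eapply Cdiff_eq; [apply Cdiff_inv, Re_pos_neq_0; auto|]. field. apply Re_pos_neq_0; auto.
  - apply Symb_scal.
    + intros z Hz. nra.
    + apply (Symb_mult m (fun z => / Cmod z) (fun z => / Cmod z) Cinv Cinv); auto.
Qed.

Definition logw (z : C) : R := 1 + Rabs (ln (Cmod z)).

Lemma logw_ge_1 z : 1 <= logw z.
Proof. unfold logw. assert (H := Rabs_pos (ln (Cmod z))). lra. Qed.

Lemma Cmod_Clog_logw z : 0 < Re z -> Cmod (Clog z) <= 2 * logw z.
Proof.
  intros Hz. eapply Rle_trans; [apply Cmod_Clog; auto|]. unfold logw. assert (H := Rabs_pos (ln (Cmod z))). assert (H2 := PI_4). lra.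
Qed.

Lemma Symb_log m : Symb m D logw Clog.
Proof.
  assert (H0 : exists c, forall z, D z -> Cmod (Clog z) <= c * logw z).
  { exists 2. intros z Hz. apply Cmod_Clog_logw; auto. }
  destruct m as [|m]; split; auto. exists Cinv. split; [intros; apply Cdiff_Clog; auto|].
  apply (Symb_weight m (fun z => / Cmod z) _ _ 1); [| |apply Symb_inv].
  - intros z Hz. apply Rlt_le, Rinv_0_lt_compat, D_Cmod; auto.
  - intros z Hz. assert (H := D_Cmod z Hz). assert (H1 := logw_ge_1 z). assert (0 < / Cmod z) by (apply Rinv_0_lt_compat; auto). nra.
Qed.

End Symbols.

Lemma Symb_sub m (D E : C -> Prop) : forall w phi,
  (forall z, E z -> D z) -> Symb m D w phi -> Symb m E w phi.
Proof.
  induction m as [|m IH]; intros w phi H [[c H1] H2]; split; auto.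
  - eauto.
  - eauto.
  - destruct H2 as [phi' [K1 K2]]. eauto.
Qed.

(** Derivatives in [Symb] live on the whole half-plane and only the bounds are restricted to the
    domain. By uniqueness both assumptions therefore speak of the same derivatives, and the bounds
    can be merged. *)
Lemma Symb_union m (D E F : C -> Prop) : forall w phi,
  (forall z, D z -> 0 < Re z) -> (forall z, E z -> 0 < Re z) ->
  (forall z, D z -> 0 <= w z) -> (forall z, E z -> 0 <= w z) ->
  (forall z, F z -> D z \/ E z) -> Symb m D w phi -> Symb m E w phi -> Symb m F w phi.
Proof.
  induction m as [|m IH]; intros w phi HD HE WD WE HF H1 H2.
  - split; auto. destruct (Symb_bound D _ _ _ H1 WD) as [c1 [C1 B1]]. destruct (Symb_bound E _ _ _ H2 WE) as [c2 [C2 B2]].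
    exists (c1 + c2). intros z Hz. destruct (HF z Hz) as [Hz'|Hz'].
    + specialize (B1 z Hz'). specialize (WD z Hz'). nra.
    + specialize (B2 z Hz'). specialize (WE z Hz'). nra.
  - split.
    + destruct (Symb_bound D _ _ _ H1 WD) as [c1 [C1 B1]]. destruct (Symb_bound E _ _ _ H2 WE) as [c2 [C2 B2]]. exists (c1 + c2).
      intros z Hz. destruct (HF z Hz) as [Hz'|Hz'].
      * specialize (B1 z Hz'). specialize (WD z Hz'). nra.
      * specialize (B2 z Hz'). specialize (WE z Hz'). nra.
    + destruct H1 as [_ [phi' [P1 P2]]]. exists phi'. split; auto. apply IH; auto.
      * intros z Hz. apply Rmult_le_pos; auto. apply Rlt_le, Rinv_0_lt_compat, (D_Cmod D HD); auto.
      * intros z Hz. apply Rmult_le_pos; auto. apply Rlt_le, Rinv_0_lt_compat, (D_Cmod E HE); auto.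
      * apply (Symb_derive E HE m w phi); auto.
Qed.

(** * Entire power series with real coefficients *)

Definition CPS (a : nat -> R) (z : C) : C := CSeries (fun n => a n * z ^ n)%C.

Lemma CSeries_ext u v : (forall n, u n = v n) -> CSeries u = CSeries v.
Proof. intros H. unfold CSeries. f_equal; apply Series_ext; intros n; rewrite H; reflexivity. Qed.

Definition abs_summable (u : nat -> C) : Prop := ex_series (fun n => Cmod (u n)).

Lemma abs_summable_le u (v : nat -> R) :
  (forall n, Cmod (u n) <= v n) -> ex_series v -> abs_summable u.
Proof. intros H Hv. apply ex_series_Rabs_le with v; auto. intros n. rewrite Rabs_right; auto. pos. Qed.

Lemma abs_summable_Re u : abs_summable u -> ex_series (fun n => Re (u n)).
Proof. intros H. apply ex_series_Rabs_le with (fun n => Cmod (u n)); auto. intros; apply re_le_Cmod. Qed.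

Lemma abs_summable_Im u : abs_summable u -> ex_series (fun n => Im (u n)).
Proof. intros H. apply ex_series_Rabs_le with (fun n => Cmod (u n)); auto. intros; apply Im_le_Cmod. Qed.

Lemma abs_summable_plus u v : abs_summable u -> abs_summable v -> abs_summable (fun n => u n + v n)%C.
Proof.
  intros Hu Hv. apply (abs_summable_le _ (fun n => Cmod (u n) + Cmod (v n))).
  - intros; apply Cmod_triangle.
  - exact (ex_series_plus (V := R_NormedModule) _ _ Hu Hv).
Qed.

Lemma abs_summable_scal c u : abs_summable u -> abs_summable (fun n => c * u n)%C.
Proof.
  intros Hu. apply (abs_summable_le _ (fun n => Cmod c * Cmod (u n))).
  - intros; pos.
  - exact (ex_series_scal (V := R_NormedModule) (Cmod c) _ Hu).
Qed.

Lemma CSeries_plus u v : abs_summable u -> abs_summable v ->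
  CSeries (fun n => u n + v n)%C = (CSeries u + CSeries v)%C.
Proof.
  intros Hu Hv. apply C_eq_Re_Im; simpl.
  - rewrite <- Series_plus; try (apply abs_summable_Re; auto). reflexivity.
  - rewrite <- Series_plus; try (apply abs_summable_Im; auto). reflexivity.
Qed.

Lemma CSeries_scal c u : abs_summable u -> CSeries (fun n => c * u n)%C = (c * CSeries u)%C.
Proof.
  intros Hu. assert (H1 := abs_summable_Re u Hu). assert (H2 := abs_summable_Im u Hu). destruct c as [x y]. apply C_eq_Re_Im; simpl.
  - rewrite <- !Series_scal_l, <- Series_minus.
    + auto.
    + exact (ex_series_scal (V := R_NormedModule) x _ H1).
    + exact (ex_series_scal (V := R_NormedModule) y _ H2).
  - rewrite <- !Series_scal_l, <- Series_plus.
    + auto.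
    + exact (ex_series_scal (V := R_NormedModule) x _ H2).
    + exact (ex_series_scal (V := R_NormedModule) y _ H1).
Qed.

Lemma CSeries_bound u (v : nat -> R) :
  (forall n, Cmod (u n) <= v n) -> ex_series v -> Cmod (CSeries u) <= 2 * Series v.
Proof.
  intros H Hv. via Cmod_le_Re_Im. simpl. assert (B1 : Rabs (Series (fun n => Re (u n))) <= Series v).
  { apply Series_Rabs_le; auto. intros n. eapply Rle_trans; [apply re_le_Cmod|auto]. }
  assert (B2 : Rabs (Series (fun n => Im (u n))) <= Series v).
  { apply Series_Rabs_le; auto. intros n. eapply Rle_trans; [apply Im_le_Cmod|auto]. }
  lra.
Qed.

Lemma CSeries_incr_1 u : abs_summable u -> CSeries u = (u O + CSeries (fun n => u (S n)))%C.
Proof.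
  intros Hu. apply C_eq_Re_Im; simpl.
  - apply Series_incr_1, abs_summable_Re; auto.
  - apply Series_incr_1, abs_summable_Im; auto.
Qed.

Lemma entire_abs_summable a z : entire a -> abs_summable (fun n => a n * z ^ n)%C.
Proof.
  intros Ha. apply (abs_summable_le _ (fun n => Rabs (a n) * Cmod z ^ n)).
  - intros n. rewrite Cmod_mult, Cmod_R, Cmod_pow. lra.
  - apply Ha, Cmod_ge_0.
Qed.

Lemma CPS_Re_real a (x : R) : CPS a x = PSeries a x.
Proof.
  apply C_eq_Re_Im; simpl.
  - apply Series_ext. intros n. rewrite <- RtoC_pow. simpl; lra.
  - rewrite (Series_ext _ (fun _ => 0 * 0)).
    + rewrite Series_scal_l. ring.
    + intros n. rewrite <- RtoC_pow. simpl; lra.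
Qed.

Lemma Cpow_taylor (z k : C) (r : R) n : 1 <= r -> Cmod z + Cmod k <= r ->
  Cmod ((z + k) ^ n - z ^ n - k * (INR n * z ^ pred n))%C <= Cmod k ^ 2 * (INR n ^ 2 * r ^ n).
Proof.
  intros Hr Hz. assert (Hz0 := Cmod_ge_0 z). assert (Hk0 := Cmod_ge_0 k). induction n as [|n IH].
  - simpl. replace (1 - 1 - k * (0 * 1))%C with (RtoC 0) by ring. rewrite Cmod_0. lra.
  - replace ((z + k) ^ S n - z ^ S n - k * (INR (S n) * z ^ pred (S n)))%C
      with ((z + k) * ((z + k) ^ n - z ^ n - k * (INR n * z ^ pred n)) + INR n * (k * k) * z ^ pred n)%C.
    + via Cmod_triangle. rewrite !Cmod_mult, Cmod_R, Cmod_pow. assert (Hn := pos_INR n). rewrite (Rabs_right (INR n)) by lra.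
      assert (Hzk : Cmod (z + k)%C <= r) by (eapply Rle_trans; [apply Cmod_triangle|lra]). assert (Hzn : Cmod z ^ pred n <= r * r ^ n).
      { apply Rle_trans with (r ^ pred n); [apply pow_incr; lra|]. change (r * r ^ n) with (r ^ S n). apply Rle_pow; [auto|lia]. }
      assert (Hzp : 0 <= Cmod z ^ pred n) by (apply pow_le; auto).
      assert (HX := Cmod_ge_0 ((z + k) ^ n - z ^ n - k * (INR n * z ^ pred n))%C).
      set (X := Cmod ((z + k) ^ n - z ^ n - k * (INR n * z ^ pred n))%C) in *. set (Y := Cmod (z + k)%C) in *.
      set (Z := Cmod z ^ pred n) in *. assert (T2 : INR n * (Cmod k * Cmod k) * Z <= INR n * (Cmod k * Cmod k) * (r * r ^ n)).
      { apply Rmult_le_compat_l; auto. apply Rmult_le_pos; auto. nra. }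
      rewrite S_INR. simpl (r ^ S n). assert (T3 : 0 <= Cmod k ^ 2 * ((INR n + 1) * (r * r ^ n))).
      { apply Rmult_le_pos; [nra|]. apply Rmult_le_pos; [lra|nra]. }
      nra.
    + destruct n as [|n]; [simpl; ring|]. rewrite (S_INR (S n)), RtoC_plus. simpl; ring.
Qed.

Lemma entire_sq a r : entire a -> 0 <= r -> ex_series (fun n => Rabs (a n) * (INR n ^ 2 * r ^ n)).
Proof.
  intros Ha Hr. apply ex_series_Rabs_le with (fun n => Rabs (a n) * (4 * r) ^ n).
  - intros n. assert (Hn := pos_INR n). assert (Hrn : 0 <= r ^ n) by (apply pow_le; auto). assert (H4 : INR n <= 2 ^ n).
    { clear. induction n; [simpl; lra|]. rewrite S_INR. simpl. assert (1 <= 2 ^ n) by (apply pow_R1_Rle; lra). lra. }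
    assert (H5 : INR n ^ 2 <= 4 ^ n).
    { replace 4 with (2 * 2) by ring. rewrite Rpow_mult_distr. nra. }
    assert (H6 := Rabs_pos (a n)). rewrite Rabs_right.
    + apply Rmult_le_compat_l; auto. rewrite Rpow_mult_distr. nra.
    + pos.
  - apply Ha. lra.
Qed.

Lemma Cdiff_CPS a z : entire a -> Cdiff (CPS a) z (CPS (PS_derive a) z).
Proof.
  intros Ha. set (r := Cmod z + 1). assert (Hz0 := Cmod_ge_0 z).
  apply (Cdiff_quadratic _ _ _ 1 (2 * Series (fun n => Rabs (a n) * (INR n ^ 2 * r ^ n)))); [lra|]. intros k Hk.
  assert (Hs := entire_sq a r Ha ltac:(unfold r; lra)). assert (Hd : abs_summable (fun n => a n * (INR n * z ^ pred n))%C).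
  { unfold abs_summable. apply ex_series_incr_1. apply (ex_series_ext (fun n => Rabs (PS_derive a n) * Cmod z ^ n)).
    - intros n. rewrite !Cmod_mult, !Cmod_R, Cmod_pow. unfold PS_derive. rewrite Rabs_mult. simpl pred. eqR. ring.
    - apply entire_PS_derive; auto. }
  assert (E : CPS (PS_derive a) z = CSeries (fun n => a n * (INR n * z ^ pred n))%C).
  { rewrite (CSeries_incr_1 _ Hd). simpl (INR 0). rewrite Cmult_0_l, Cmult_0_r, Cplus_0_l. apply CSeries_ext. intros n. unfold PS_derive.
    rewrite RtoC_mult. simpl pred. ring. }
  rewrite E. unfold CPS. assert (S1 := entire_abs_summable a (z + k)%C Ha). assert (S2 := entire_abs_summable a z Ha).
  replace (CSeries (fun n => a n * (z + k) ^ n) - CSeries (fun n => a n * z ^ n)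
    - k * CSeries (fun n => a n * (INR n * z ^ pred n)))%C
    with (CSeries (fun n => (a n * (z + k) ^ n + - (1) * (a n * z ^ n))
    + (- k) * (a n * (INR n * z ^ pred n))))%C.
  - eapply Rle_trans.
    + apply (CSeries_bound _ (fun n => Cmod k ^ 2 * (Rabs (a n) * (INR n ^ 2 * r ^ n)))).
      * intros n. replace (a n * (z + k) ^ n + - (1) * (a n * z ^ n) + - k * (a n * (INR n * z ^ pred n)))%C
          with (a n * ((z + k) ^ n - z ^ n - k * (INR n * z ^ pred n)))%C by ring.
        rewrite Cmod_mult, Cmod_R. assert (T := Cpow_taylor z k r n ltac:(unfold r; lra) ltac:(unfold r; lra)).
        replace (Cmod k ^ 2 * (Rabs (a n) * (INR n ^ 2 * r ^ n)))
          with (Rabs (a n) * (Cmod k ^ 2 * (INR n ^ 2 * r ^ n))) by ring.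
        apply Rmult_le_compat_l; [apply Rabs_pos|exact T].
      * exact (ex_series_scal (V := R_NormedModule) (Cmod k ^ 2) _ Hs).
    + rewrite Series_scal_l. apply Req_le. ring.
  - rewrite !CSeries_plus, !CSeries_scal; auto.
    + ring.
    + apply abs_summable_scal; auto.
    + apply abs_summable_plus; auto. apply abs_summable_scal; auto.
    + apply abs_summable_scal; auto.
Qed.

Lemma entire_le a b : (forall n, Rabs (a n) <= Rabs (b n)) -> entire b -> entire a.
Proof.
  intros H Hb r Hr. apply ex_series_Rabs_le with (fun n => Rabs (b n) * r ^ n); auto. intros n.
  assert (H0 : 0 <= r ^ n) by (apply pow_le; auto). rewrite Rabs_mult, Rabs_Rabsolu, (Rabs_right (r ^ n)) by lra.
  apply Rmult_le_compat_r; auto.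
Qed.

Lemma entire_fact c : entire (fun n => c ^ n / INR (fact n)).
Proof.
  intros r Hr. apply ex_series_ext with (fun n => / INR (fact n) * (Rabs c * r) ^ n).
  - intros n. unfold Rdiv. rewrite Rabs_mult, <- RPow_abs, Rpow_mult_distr.
    rewrite (Rabs_right (/ _)) by (apply Rle_ge, Rlt_le, Rinv_0_lt_compat, INR_fact_lt_0). lra.
  - eexists. apply is_pseries_R. apply is_exp_Reals.
Qed.

Lemma entire_of_bound a K c : (forall n, Rabs (a n) <= K * (c ^ n / INR (fact n))) -> entire a.
Proof.
  intros H r Hr. apply ex_series_Rabs_le with (fun n => Rabs K * (Rabs (c ^ n / INR (fact n)) * r ^ n)).
  - intros n. assert (H0 : 0 <= r ^ n) by (apply pow_le; auto). rewrite Rabs_mult, Rabs_Rabsolu, (Rabs_right (r ^ n)) by lra.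
    rewrite <- Rmult_assoc, <- Rabs_mult. apply Rmult_le_compat_r; auto. eapply Rle_trans; [auto|apply Rle_abs].
  - apply (ex_series_scal (V := R_NormedModule) (Rabs K)). apply entire_fact; auto.
Qed.

(** A derivative brings out a factor [2 z], and [Cmod z <= 1 <= / Cmod z] on this domain, which is
    the required gain. *)
Lemma Symb_even_CPS m : forall a, entire a ->
  Symb m (fun z => 0 < Re z /\ Cmod z <= 1) (fun _ => 1) (fun z => CPS a (z * z)%C).
Proof.
  set (D := fun z => 0 < Re z /\ Cmod z <= 1). assert (HD : forall z, D z -> 0 < Re z) by (intros z Hz; apply Hz).
  induction m as [|m IH]; intros a Ha.
  - split; auto. exists (2 * Series (fun n => Rabs (a n) * 1 ^ n)). intros z [_ Hz]. rewrite Rmult_1_r.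
    apply CSeries_bound; [|apply Ha; lra]. intros n. rewrite Cmod_mult, Cmod_R, Cmod_pow, Cmod_mult.
    apply Rmult_le_compat_l; [apply Rabs_pos|]. apply pow_incr. assert (H := Cmod_ge_0 z). nra.
  - split.
    + exists (2 * Series (fun n => Rabs (a n) * 1 ^ n)). intros z [_ Hz]. rewrite Rmult_1_r. apply CSeries_bound; [|apply Ha; lra].
      intros n. rewrite Cmod_mult, Cmod_R, Cmod_pow, Cmod_mult. apply Rmult_le_compat_l; [apply Rabs_pos|]. apply pow_incr.
      assert (H := Cmod_ge_0 z). nra.
    + exists (fun z => CPS (PS_derive a) (z * z) * (2 * z))%C. split.
      * intros z _. apply (Cdiff_comp (CPS a) (fun z => z * z)%C); [apply Cdiff_CPS; auto|].
        eapply Cdiff_eq; [apply (Cdiff_mult (fun z => z) (fun z => z)); apply Cdiff_id|]. ring.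
      * apply (Symb_weight D HD m (fun z => 1 * Cmod z) _ _ 1).
        -- intros; pos.
        -- intros z Hz. assert (H := D_Cmod D HD z Hz). destruct Hz as [_ Hz].
          assert (1 <= / Cmod z) by (rewrite <- Rinv_1; apply Rinv_le_contravar; auto). lra.
        -- apply (Symb_mult D HD m (fun _ => 1) Cmod (fun z => CPS (PS_derive a) (z * z)%C)
            (fun z => 2 * z)%C).
          ++ intros; lra.
          ++ intros; pos.
          ++ apply IH, entire_PS_derive; auto.
          ++ apply (Symb_scal D HD); [intros; apply Cmod_ge_0|]. apply (Symb_id D HD).
Qed.

(** * The kernel [1 / (1 + z ^ 2)] on a sector *)

(** The set [cos (arg z) >= s], written without the argument so that it is visibly invariant under
    positive scaling. *)
Definition sector (s : R) (z : C) : Prop := 0 < Cmod z /\ s * Cmod z <= Re z.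

Lemma sector_Re s z : 0 < s -> sector s z -> 0 < Re z.
Proof. intros Hs [H1 H2]. nra. Qed.

Definition qker (z : C) : C := (/ (1 + z * z))%C.

Lemma sector_one_plus_sq s z : 0 < s <= 1 -> sector s z ->
  s / 2 <= Cmod (1 + z * z)%C /\ s / 2 * (Cmod z * Cmod z) <= Cmod (1 + z * z)%C.
Proof.
  intros Hs Hz. assert (Hre := sector_Re s z (proj1 Hs) Hz). destruct Hz as [Hm Hz]. destruct z as [x y].
  assert (Em : Cmod (x, y) * Cmod (x, y) = x * x + y * y).
  { rewrite Cmod_polar by auto. apply sqrt_sqrt. nra. }
  set (r := Cmod (x, y)) in *. set (q := Cmod (1 + (x, y) * (x, y))%C).
  assert (E1 : q * q = (1 + x * x - y * y) * (1 + x * x - y * y) + (2 * (x * y)) * (2 * (x * y))).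
  { unfold q. unfold Cmod. simpl. rewrite sqrt_sqrt; [ring|]. apply Rplus_le_le_0_compat; rewrite Rmult_1_r; apply Rle_0_sqr. }
  assert (E2 : q * q = (1 - r * r) * (1 - r * r) + 4 * (x * x)) by (rewrite E1, Em; ring). assert (Hq0 : 0 <= q) by apply Cmod_ge_0.
  assert (Hx2 : s * r * (s * r) <= x * x) by (apply Rmult_le_compat; auto; apply Rmult_le_pos; lra).
  (* Since [x >= s r] and [s <= 1], the sum [(1 - r^2)^2 + 4 x^2] is at least [s^2 ((1 - r^2)^2 + 4
     r^2) = s^2 (1 + r^2)^2]. *)
  assert (Hlow : s * s * ((1 + r * r) * (1 + r * r)) <= q * q).
  { assert (s * s <= 1) by nra. assert (0 <= (1 - r * r) * (1 - r * r)) by apply Rle_0_sqr. nra. }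
  nra.
Qed.

Lemma one_plus_sq_neq_0 z : 0 < Re z -> (1 + z * z)%C <> RtoC 0.
Proof.
  intros Hz. apply Cmod_pos_neq_0. assert (Hm : 0 < Cmod z) by (apply Cmod_pos, Re_pos_neq_0; auto). set (s := Re z / Cmod z).
  assert (Hs : 0 < s <= 1).
  { split; [apply Rdiv_lt_0_compat; auto|]. apply Rmult_le_reg_r with (Cmod z); auto. unfold s, Rdiv.
    rewrite Rmult_assoc, Rinv_l, Rmult_1_r by lra. assert (H := Re_le_Cmod z). lra. }
  assert (Hsec : sector s z).
  { split; auto. unfold s. apply Req_le. field. lra. }
  destruct (sector_one_plus_sq s z Hs Hsec) as [H _]. lra.
Qed.

Lemma Cdiff_qker z : 0 < Re z -> Cdiff qker z (- (2) * (z * (qker z * qker z)))%C.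
Proof.
  intros Hz. assert (H0 := one_plus_sq_neq_0 z Hz). eapply Cdiff_eq.
  - apply (Cdiff_comp Cinv (fun z => 1 + z * z)%C); [apply Cdiff_inv; auto|]. apply Cdiff_plus; [apply Cdiff_const|].
    apply (Cdiff_mult (fun z => z) (fun z => z)); apply Cdiff_id.
  - unfold qker. field. auto.
Qed.

(** The two weights are proved together: the derivative is [-2 z qker z ^ 2], and the induction for
    the constant weight needs one factor bounded by [1] and the other by the inverse square. *)
Lemma Symb_qker m s : 0 < s <= 1 ->
  Symb m (sector s) (fun _ => 1) qker /\ Symb m (sector s) (fun z => / Cmod z * / Cmod z) qker.
Proof.
  intros Hs. assert (HD : forall z, sector s z -> 0 < Re z) by (intros z; apply sector_Re; lra). assert (HC := D_Cmod _ HD).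
  assert (W : forall z, sector s z -> 0 <= / Cmod z * / Cmod z).
  { intros z Hz. nra. }
  assert (B1 : exists c, forall z, sector s z -> Cmod (qker z) <= c * 1).
  { exists (2 / s). intros z Hz. destruct (sector_one_plus_sq s z Hs Hz) as [H1 _]. unfold qker.
    rewrite Cmod_inv by (apply one_plus_sq_neq_0; auto). rewrite Rmult_1_r. replace (2 / s) with (/ (s / 2)) by (field; lra). pos. }
  assert (B2 : exists c, forall z, sector s z -> Cmod (qker z) <= c * (/ Cmod z * / Cmod z)).
  { exists (2 / s). intros z Hz. destruct (sector_one_plus_sq s z Hs Hz) as [_ H1]. specialize (HC z Hz). unfold qker.
    rewrite Cmod_inv by (apply one_plus_sq_neq_0; auto).
    replace (2 / s * (/ Cmod z * / Cmod z)) with (/ (s / 2 * (Cmod z * Cmod z))) by (field; lra). pos. }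
  induction m as [|m [IH1 IH2]]; [split; split; auto|]. assert (H2 : Symb m (sector s) (fun z => Cmod z * (1 * (/ Cmod z * / Cmod z)))
    (fun z => z * (qker z * qker z))%C).
  { apply (Symb_mult _ HD); auto.
    - intros; pos.
    - intros z Hz. nra.
    - apply (Symb_id _ HD).
    - apply (Symb_mult _ HD); auto. intros; lra. }
  assert (H3 : Symb m (sector s) (fun z => Cmod z * (/ Cmod z * / Cmod z * (/ Cmod z * / Cmod z)))
    (fun z => z * (qker z * qker z))%C).
  { apply (Symb_mult _ HD); auto.
    - intros; pos.
    - intros z Hz. nra.
    - apply (Symb_id _ HD).
    - apply (Symb_mult _ HD); auto. }
  split; split; auto; exists (fun z => - (2) * (z * (qker z * qker z)))%C;
    (split; [intros z Hz; apply Cdiff_qker; auto|]).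
  - apply (Symb_weight_eq _ HD m (fun z => Cmod z * (1 * (/ Cmod z * / Cmod z)))).
    + intros z Hz. apply Rmult_le_pos; [apply Cmod_ge_0|]. nra.
    + intros z Hz. specialize (HC z Hz). field. lra.
    + apply (Symb_scal _ HD); auto. intros z Hz. apply Rmult_le_pos; [apply Cmod_ge_0|]. nra.
  - apply (Symb_weight_eq _ HD m (fun z => Cmod z * (/ Cmod z * / Cmod z * (/ Cmod z * / Cmod z)))).
    + intros z Hz. apply Rmult_le_pos; [apply Cmod_ge_0|]. nra.
    + intros z Hz. specialize (HC z Hz). field. lra.
    + apply (Symb_scal _ HD); auto. intros z Hz. apply Rmult_le_pos; [apply Cmod_ge_0|]. nra.
Qed.

(** * Complex-valued improper integrals *)

Definition ccont (P : R -> Prop) (f : R -> C) : Prop :=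
  cont_on P (fun t => Re (f t)) /\ cont_on P (fun t => Im (f t)).

Definition is_cint (lo hi : nat -> R) (f : R -> C) (l : C) : Prop :=
  is_iint lo hi (fun t => Re (f t)) (Re l) /\ is_iint lo hi (fun t => Im (f t)) (Im l).

Definition cint (lo hi : nat -> R) (f : R -> C) : C :=
  (real (Lim_seq (fun n => RInt (fun t => Re (f t)) (lo n) (hi n))),
   real (Lim_seq (fun n => RInt (fun t => Im (f t)) (lo n) (hi n)))).

Section ComplexImproper.

Variables (lo hi : nat -> R) (P : R -> Prop).
Hypothesis HI : improper lo hi P.

Lemma is_cint_unique f l : is_cint lo hi f l -> cint lo hi f = l.
Proof.
  intros [H1 H2]. apply C_eq_Re_Im; simpl.
  - rewrite (is_lim_seq_unique _ _ H1). reflexivity.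
  - rewrite (is_lim_seq_unique _ _ H2). reflexivity.
Qed.

Lemma ccont_plus f g : ccont P f -> ccont P g -> ccont P (fun t => f t + g t)%C.
Proof.
  intros [F1 F2] [G1 G2]. split.
  - apply (cont_on_ext _ (fun t => Re (f t) + Re (g t))); [|apply cont_on_plus; auto]. auto.
  - apply (cont_on_ext _ (fun t => Im (f t) + Im (g t))); [|apply cont_on_plus; auto]. auto.
Qed.

Lemma ccont_scal c f : ccont P f -> ccont P (fun t => c * f t)%C.
Proof.
  intros [F1 F2]. destruct c as [x y]. split.
  - apply (cont_on_ext _ (fun t => x * Re (f t) + (- y) * Im (f t))).
    + intros t. destruct (f t); simpl. ring.
    + apply cont_on_plus; apply cont_on_scal; auto.
  - 
    + auto.
    + apply cont_on_plus; apply cont_on_scal; auto.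
Qed.

Lemma is_cint_plus f g lf lg : ccont P f -> ccont P g ->
  is_cint lo hi f lf -> is_cint lo hi g lg -> is_cint lo hi (fun t => f t + g t)%C (lf + lg)%C.
Proof.
  intros [F1 F2] [G1 G2] [A1 A2] [B1 B2]. split.
  - 
    + auto.
    + apply (iint_plus _ _ _ HI); auto.
  - 
    + auto.
    + apply (iint_plus _ _ _ HI); auto.
Qed.

Lemma is_cint_scal c f lf : ccont P f -> is_cint lo hi f lf ->
  is_cint lo hi (fun t => c * f t)%C (c * lf)%C.
Proof.
  intros [F1 F2] [A1 A2]. destruct c as [x y]. split.
  - apply (iint_ext _ _ _ HI (fun t => x * Re (f t) + (- y) * Im (f t))).
    + intros t _. destruct (f t); simpl. ring.
    + replace (Re ((x, y) * lf)%C) with (x * Re lf + (- y) * Im lf) by (destruct lf; simpl; ring).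
      apply (iint_plus _ _ _ HI); try (apply cont_on_scal; auto); apply (iint_scal _ _ _ HI); auto.
  - 
    + auto.
    + apply (iint_plus _ _ _ HI); try (apply cont_on_scal; auto); apply (iint_scal _ _ _ HI); auto.
Qed.

Lemma is_cint_bound f D l LD : ccont P f -> cont_on P D -> (forall t, P t -> Cmod (f t) <= D t) ->
  is_cint lo hi f l -> is_iint lo hi D LD -> Cmod l <= 2 * LD.
Proof.
  intros [F1 F2] CD H [A1 A2] HD. via Cmod_le_Re_Im. assert (B1 : Rabs (Re l) <= LD).
  { apply (iint_Rabs_le _ _ _ HI (fun t => Re (f t)) D); auto. intros t Ht. eapply Rle_trans; [apply re_le_Cmod|auto]. }
  assert (B2 : Rabs (Im l) <= LD).
  { apply (iint_Rabs_le _ _ _ HI (fun t => Im (f t)) D); auto. intros t Ht. eapply Rle_trans; [apply Im_le_Cmod|auto]. }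
  lra.
Qed.

Lemma is_cint_cint f D LD : ccont P f -> cont_on P D -> (forall t, P t -> Cmod (f t) <= D t) ->
  is_iint lo hi D LD -> is_cint lo hi f (cint lo hi f).
Proof.
  intros [F1 F2] CD H HD. destruct (iint_dominated _ _ _ HI (fun t => Re (f t)) D LD) as [l1 [H1 _]]; auto.
  { intros t Ht. eapply Rle_trans; [apply re_le_Cmod|auto]. }
  destruct (iint_dominated _ _ _ HI (fun t => Im (f t)) D LD) as [l2 [H2 _]]; auto.
  { intros t Ht. eapply Rle_trans; [apply Im_le_Cmod|auto]. }
  rewrite (is_cint_unique f (l1, l2)); split; auto.
Qed.

Lemma is_cint_primitive (F f : R -> C) (l0 l1 : C) :
  (forall t, P t -> is_Cderive F t (f t)) -> ccont P f ->
  is_lim_seq (fun n => Re (F (lo n))) (Re l0) -> is_lim_seq (fun n => Im (F (lo n))) (Im l0) ->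
  is_lim_seq (fun n => Re (F (hi n))) (Re l1) -> is_lim_seq (fun n => Im (F (hi n))) (Im l1) ->
  is_cint lo hi f (l1 - l0)%C.
Proof.
  intros H [C1 C2] A1 A2 B1 B2. split.
  - apply (iint_primitive _ _ _ HI (fun t => Re (F t))); auto. intros t Ht; apply H; auto.
  - apply (iint_primitive _ _ _ HI (fun t => Im (F t))); auto. intros t Ht; apply H; auto.
Qed.

(* Differentiation under the integral sign, with a dominated Taylor remainder. *)
Lemma Cdiff_cint (f : C -> R -> C) (f1 : R -> C) (I : C -> C) (J : C) (D : R -> R) z eta LD :
  0 < eta ->
  (forall k, Cmod k < eta -> ccont P (f (z + k)%C)) -> ccont P f1 -> cont_on P D ->
  (forall k t, Cmod k < eta -> P t ->
     Cmod (f (z + k)%C t - f z t - k * f1 t)%C <= Cmod k ^ 2 * D t) ->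
  is_iint lo hi D LD ->
  (forall k, Cmod k < eta -> is_cint lo hi (f (z + k)%C) (I (z + k)%C)) ->
  is_cint lo hi f1 J -> Cdiff I z J.
Proof.
  intros He Cf Cf1 CD H HD HIk HJ. apply (Cdiff_quadratic _ _ _ eta (2 * LD)); auto. intros k Hk.
  assert (H0 : Cmod (RtoC 0) < eta) by (rewrite Cmod_0; auto). assert (Cz := Cf 0 H0). assert (Iz := HIk 0 H0).
  rewrite Cplus_0_r in Cz, Iz. replace (I (z + k) - I z - k * J)%C with ((I (z + k) + - (1) * I z) + (- k) * J)%C by ring.
  replace (2 * LD * Cmod k ^ 2) with (2 * (Cmod k ^ 2 * LD)) by ring.
  apply (is_cint_bound (fun t => (f (z + k) t + - (1) * f z t) + (- k) * f1 t)%C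
    (fun t => Cmod k ^ 2 * D t)).
  - apply ccont_plus; [apply ccont_plus; auto|]; apply ccont_scal; auto.
  - apply cont_on_scal; auto.
  - intros t Ht. replace (f (z + k) t + - (1) * f z t + - k * f1 t)%C
      with (f (z + k)%C t - f z t - k * f1 t)%C by ring.
    auto.
  - apply is_cint_plus.
    + apply ccont_plus; auto. apply ccont_scal; auto.
    + apply ccont_scal; auto.
    + apply is_cint_plus; auto. apply ccont_scal; auto. apply is_cint_scal; auto.
    + apply is_cint_scal; auto.
  - apply (iint_scal _ _ _ HI); auto.
Qed.

End ComplexImproper.

(** * The complex exponential *)

Lemma exp_le x y : x <= y -> exp x <= exp y.
Proof. intros [H| ->]; [apply Rlt_le, exp_increasing; auto|lra]. Qed.

Definition Cexp (z : C) : C := (exp (Re z) * cos (Im z), exp (Re z) * sin (Im z)).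

Lemma Cmod_Cexp z : Cmod (Cexp z) = exp (Re z).
Proof.
  unfold Cexp, Cmod. simpl. replace (exp (Re z) * cos (Im z) * (exp (Re z) * cos (Im z) * 1)
    + exp (Re z) * sin (Im z) * (exp (Re z) * sin (Im z) * 1))
    with (exp (Re z) * exp (Re z) * (sin (Im z) * sin (Im z) + cos (Im z) * cos (Im z))) by ring.
  assert (H := sin2_cos2 (Im z)). unfold Rsqr in H. rewrite H, Rmult_1_r. apply sqrt_square, Rlt_le, exp_pos.
Qed.

Lemma Cexp_line_derive (z k : C) (t : R) :
  is_Cderive (fun t => Cexp (z + t * k)%C) t (k * Cexp (z + t * k)%C)%C.
Proof.
  destruct z as [x y], k as [u v]. assert (E : forall s : R, ((x, y) + s * (u, v))%C = (x + s * u, y + s * v)).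
  { intros s. apply C_eq_Re_Im; simpl; ring. }
  rewrite E. split.
  - apply (is_derive_ext (fun s => exp (x + s * u) * cos (y + s * v))).
    + intros s. rewrite E. reflexivity.
    + auto_derive; auto. simpl; lra.
  - apply (is_derive_ext (fun s => exp (x + s * u) * sin (y + s * v))).
    + intros s. rewrite E. reflexivity.
    + auto_derive; auto. simpl; lra.
Qed.

Lemma Cdiff_Cexp z : Cdiff Cexp z (Cexp z).
Proof.
  apply (Cdiff_of_lines Cexp Cexp z 1 (2 * exp (Re z + 1))); [lra| |].
  - intros k t _ _. apply Cexp_line_derive.
  - intros k Hk. replace (Cexp (z + k) - Cexp z)%C with (Cexp (z + RtoC 1 * k) - Cexp (z + RtoC 0 * k))%C
      by (rewrite Cmult_1_l, Cmult_0_l, Cplus_0_r; reflexivity).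
    replace (2 * exp (Re z + 1) * Cmod k) with (2 * (Cmod k * exp (Re z + 1)) * Rabs (1 - 0))
      by (rewrite Rminus_0_r, Rabs_R1; ring).
    apply (Cderive_bound (fun t : R => Cexp (z + t * k)%C) (fun t : R => k * Cexp (z + t * k))%C);
      rewrite Rmin_left, Rmax_right by lra; intros t Ht.
    + apply Cexp_line_derive.
    + rewrite Cmod_mult, Cmod_Cexp. apply Rmult_le_compat_l; [apply Cmod_ge_0|]. apply exp_le. rewrite re_plus, re_scal_l.
      assert (H := re_le_Cmod k). apply Rabs_le_between in H. nra.
Qed.

Lemma Cexp_taylor2 w k :
  Cmod (Cexp (w + k) - Cexp w - k * Cexp w)%C <= 4 * exp (Re w + Cmod k) * Cmod k ^ 2.
Proof.
  apply (Cdiff_taylor2 Cexp Cexp Cexp); intros t Ht; try apply Cdiff_Cexp. rewrite Cmod_Cexp. apply exp_le. rewrite re_plus, re_scal_l.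
  assert (H := re_le_Cmod k). apply Rabs_le_between in H. nra.
Qed.

(** * The integral representation of the Bessel function *)

Lemma cosh_ge_1 t : 1 <= cosh t.
Proof.
  unfold cosh. assert (H : exp t * exp (- t) = 1) by (rewrite <- exp_plus, Rplus_opp_r; apply exp_0). assert (H2 := exp_pos (- t)).
  assert (0 <= (exp t - exp (- t)) * (exp t - exp (- t))) by apply Rle_0_sqr. nra.
Qed.

Lemma inv_cosh_le t : / cosh t <= 2 * exp (- t).
Proof.
  assert (H1 := exp_pos t). assert (H2 := exp_pos (- t)). rewrite exp_Ropp. replace (2 * / exp t) with (/ (exp t / 2)) by (field; lra).
  apply Rinv_le_contravar; [lra|]. unfold cosh. lra.
Qed.

Lemma is_derive_cosh (t : R) : is_derive cosh t (sinh t).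
Proof. apply is_derive_Reals, derivable_pt_lim_cosh. Qed.

Lemma is_derive_sinh (t : R) : is_derive sinh t (cosh t).
Proof. apply is_derive_Reals, derivable_pt_lim_sinh. Qed.

(** The exponential series bounds [(x cosh t) ^ N * exp (- x cosh t)] by [N!]. As [j < N], a factor
    [/ cosh t] is left over and provides the integrable [2 * exp (- t)]. *)
Lemma cosh_pow_exp_le x t j N : 0 < x -> (j < N)%nat ->
  cosh t ^ j * exp (- (x * cosh t)) <= INR (fact N) / x ^ N * (2 * exp (- t)).
Proof.
  intros Hx HN. assert (Hc := cosh_ge_1 t). assert (Hi := inv_cosh_le t). assert (Hi0 : 0 < / cosh t) by (apply Rinv_0_lt_compat; lra).
  assert (Hp := pow_le_exp N (x * cosh t) ltac:(nra)). rewrite Rpow_mult_distr in Hp. assert (He := exp_pos (x * cosh t)).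
  assert (HxN : 0 < x ^ N) by (apply pow_lt; auto). assert (Hj : cosh t ^ j <= cosh t ^ N * / cosh t).
  { apply Rmult_le_reg_r with (cosh t); [lra|]. rewrite Rmult_assoc, Rinv_l, Rmult_1_r by lra.
    replace (cosh t ^ j * cosh t) with (cosh t ^ S j) by (simpl; ring). apply Rle_pow; auto. }
  assert (HcN : cosh t ^ N * exp (- (x * cosh t)) <= INR (fact N) / x ^ N).
  { rewrite exp_Ropp. apply Rmult_le_reg_r with (x ^ N * exp (x * cosh t)); [nra|].
    replace (cosh t ^ N * / exp (x * cosh t) * (x ^ N * exp (x * cosh t)))
      with (x ^ N * cosh t ^ N) by (field; lra).
    replace (INR (fact N) / x ^ N * (x ^ N * exp (x * cosh t)))
      with (INR (fact N) * exp (x * cosh t)) by (field; lra).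
    lra. }
  assert (He2 := exp_pos (- (x * cosh t))). apply Rle_trans with (cosh t ^ N * / cosh t * exp (- (x * cosh t))).
  - nra.
  - replace (cosh t ^ N * / cosh t * exp (- (x * cosh t)))
      with (cosh t ^ N * exp (- (x * cosh t)) * / cosh t) by ring.
    pos.
Qed.

Lemma improper_0_n : improper (fun _ => 0) INR (fun t => 0 <= t).
Proof.
  split; intros.
  - pos.
  - lra.
  - lra.
  - apply le_INR; lia.
Qed.

Lemma iint_exp_neg A : is_iint (fun _ => 0) INR (fun t => A * (2 * exp (- t))) (2 * A).
Proof.
  replace (2 * A) with (0 - (-2 * A)) by ring. apply (iint_primitive _ _ _ improper_0_n (fun t => -2 * A * exp (- t))).
  - intros t _. auto_derive; auto. lra.
  - apply (is_derive_cont_on _ _ (fun t => - (A * (2 * exp (- t))))). intros t _. auto_derive; auto. lra.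
  - rewrite Ropp_0, exp_0, Rmult_1_r. apply is_lim_seq_const.
  - replace 0 with (-2 * A * 0) by ring. apply (is_lim_seq_scal_l _ _ 0). apply (is_lim_comp_seq exp (fun n => - INR n) m_infty 0).
    + apply is_lim_exp_m.
    + exists O; intros; discriminate.
    + apply (is_lim_seq_opp INR p_infty), is_lim_seq_INR.
Qed.

Lemma cont_exp_neg A (P : R -> Prop) : cont_on P (fun t => A * (2 * exp (- t))).
Proof. apply (is_derive_cont_on _ _ (fun t => - (A * (2 * exp (- t))))). intros t _. auto_derive; auto. lra. Qed.

Definition Kker (j : nat) (z : C) (t : R) : C := ((- cosh t) ^ j * Cexp (- z * cosh t))%C.

(** The [j]-th derivative of the integral of [exp (- z * cosh t)] over [t >= 0]. *)
Definition KJ (j : nat) (z : C) : C := cint (fun _ => 0) INR (Kker j z).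

Lemma Kker_Re_Im j z t :
  Re (Kker j z t) = (- cosh t) ^ j * (exp (- (Re z * cosh t)) * cos (Im z * cosh t)) /\
  Im (Kker j z t) = - ((- cosh t) ^ j * (exp (- (Re z * cosh t)) * sin (Im z * cosh t))).
Proof.
  unfold Kker. rewrite <- RtoC_opp, <- RtoC_pow, re_scal_l, im_scal_l. destruct z as [x y]. simpl Re. simpl Im. split.
  - replace (- x * cosh t - - y * 0) with (- (x * cosh t)) by ring. replace (- x * 0 + - y * cosh t) with (- (y * cosh t)) by ring.
    rewrite cos_neg. ring.
  - replace (- x * cosh t - - y * 0) with (- (x * cosh t)) by ring. replace (- x * 0 + - y * cosh t) with (- (y * cosh t)) by ring.
    rewrite sin_neg. ring.
Qed.

Lemma Cmod_Kker j z t : Cmod (Kker j z t) = cosh t ^ j * exp (- (Re z * cosh t)).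
Proof.
  unfold Kker. rewrite Cmod_mult, Cmod_Cexp, <- RtoC_opp, <- RtoC_pow, Cmod_R.
  rewrite <- RPow_abs, Rabs_Ropp, Rabs_right by (assert (H := cosh_ge_1 t); lra). f_equal. f_equal. destruct z as [x y]; simpl. ring.
Qed.

Lemma is_Cderive_mult (f g : R -> C) (t : R) (d e : C) :
  is_Cderive f t d -> is_Cderive g t e -> is_Cderive (fun t => f t * g t)%C t (d * g t + f t * e)%C.
Proof.
  intros [A1 A2] [B1 B2]. split; (eapply is_derive_eq; [|symmetry]).
  - exact (is_derive_Rminus _ _ _ _ _ (is_derive_Rmult _ _ _ _ _ A1 B1) (is_derive_Rmult _ _ _ _ _ A2 B2)).
  - destruct d, e, (f t), (g t); simpl; ring.
  - exact (is_derive_Rplus _ _ _ _ _ (is_derive_Rmult _ _ _ _ _ A1 B2) (is_derive_Rmult _ _ _ _ _ A2 B1)).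
  - destruct d, e, (f t), (g t); simpl; ring.
Qed.

Lemma is_Cderive_RtoC (f : R -> R) (t d : R) : is_derive f t d -> is_Cderive (fun t => RtoC (f t)) t (RtoC d).
Proof. split; [exact H|]. simpl. apply is_derive_Rconst. Qed.

Lemma is_Cderive_ccont (P : R -> Prop) (f f' : R -> C) : (forall t, P t -> is_Cderive f t (f' t)) -> ccont P f.
Proof.
  split.
  - apply (is_derive_cont_on P _ (fun t => Re (f' t))). apply H.
  - apply (is_derive_cont_on P _ (fun t => Im (f' t))). apply H; auto.
Qed.

Lemma is_Cderive_Cexp_cosh z (t : R) : is_Cderive (fun t => Cexp (- z * cosh t)) t (Cexp (- z * cosh t) * (- z * sinh t)).
Proof.
  apply (Cdiff_curve Cexp (fun t => - z * cosh t)%C); [apply Cdiff_Cexp|]. apply (is_Cderive_eq _ _ (0 * cosh t + - z * sinh t)); [|ring].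
  apply (is_Cderive_mult (fun _ => - z)%C (fun t => RtoC (cosh t)) t 0 (sinh t)); [|apply is_Cderive_RtoC, is_derive_cosh].
  split; apply is_derive_Rconst.
Qed.

Lemma is_derive_cosh_pow j (t : R) : is_derive (fun t => (- cosh t) ^ j) t (- (INR j * (- cosh t) ^ pred j * sinh t)).
Proof.
  eapply is_derive_eq; [apply (is_derive_Rcomp (fun u => u ^ j) (fun t => - cosh t)); [apply is_derive_Reals, derivable_pt_lim_pow|]|].
  - apply (is_derive_opp (V := R_NormedModule)), is_derive_cosh.
  - change (opp (sinh t)) with (- sinh t). lra.
Qed.

Lemma ccont_Kker j z P : ccont P (Kker j z).
Proof.
  eapply is_Cderive_ccont. intros t _. apply (is_Cderive_mult (fun t => (- cosh t) ^ j)%C); [|apply is_Cderive_Cexp_cosh].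
  assert (H := is_Cderive_RtoC _ _ _ (is_derive_cosh_pow j t)).
  split; (eapply is_derive_ext; [intros s; rewrite <- RtoC_opp, <- RtoC_pow; reflexivity|apply H]).
Qed.

Lemma is_cint_KJ j z : 0 < Re z -> is_cint (fun _ => 0) INR (Kker j z) (KJ j z).
Proof.
  intros Hz. apply (is_cint_cint _ _ _ improper_0_n _
    (fun t => INR (fact (S j)) / Re z ^ S j * (2 * exp (- t)))
    (2 * (INR (fact (S j)) / Re z ^ S j))).
  - apply ccont_Kker.
  - apply cont_exp_neg.
  - intros t _. rewrite Cmod_Kker. apply cosh_pow_exp_le; auto.
  - apply iint_exp_neg.
Qed.

Lemma KJ_bound j z N : 0 < Re z -> (j < N)%nat -> Cmod (KJ j z) <= 4 * INR (fact N) / Re z ^ N.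
Proof.
  intros Hz HN. replace (4 * INR (fact N) / Re z ^ N) with (2 * (2 * (INR (fact N) / Re z ^ N))).
  2:{ lra. }
  apply (is_cint_bound _ _ _ improper_0_n (Kker j z)
    (fun t => INR (fact N) / Re z ^ N * (2 * exp (- t)))).
  - apply ccont_Kker.
  - apply cont_exp_neg.
  - intros t _. rewrite Cmod_Kker. apply cosh_pow_exp_le; auto.
  - apply is_cint_KJ; auto.
  - apply iint_exp_neg.
Qed.

Lemma Cdiff_KJ j z : 0 < Re z -> Cdiff (KJ j) z (KJ (S j) z).
Proof.
  (* Increments of modulus below [Re z / 2] keep at least half of the decay: the factor
     [exp (Cmod k * cosh t)] of the Taylor bound is absorbed and [exp (- x * cosh t)] remains. The
     second-order term adds two powers of [cosh t], hence the order [j + 3]. *)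
  intros Hz. set (x := Re z / 2). assert (Hx : 0 < x) by (unfold x; lra). set (A := 4 * (INR (fact (S (S (S j)))) / x ^ S (S (S j)))).
  apply (Cdiff_cint _ _ _ improper_0_n (Kker j) (Kker (S j) z) (KJ j) (KJ (S j) z)
    (fun t => A * (2 * exp (- t))) z x (2 * A)); auto.
  - intros k _. apply ccont_Kker.
  - apply ccont_Kker.
  - apply cont_exp_neg.
  - intros k t Hk Ht. assert (Hc := cosh_ge_1 t). unfold Kker.
    replace ((- cosh t) ^ j * Cexp (- (z + k) * cosh t) - (- cosh t) ^ j * Cexp (- z * cosh t)
      - k * ((- cosh t) ^ S j * Cexp (- z * cosh t)))%C
      with ((- cosh t) ^ j * (Cexp (- z * cosh t + - k * cosh t) - Cexp (- z * cosh t)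
      - (- k * cosh t) * Cexp (- z * cosh t)))%C.
    2:{ replace (- (z + k) * cosh t)%C with (- z * cosh t + - k * cosh t)%C by ring. simpl; ring. }
    rewrite Cmod_mult, <- RtoC_opp, <- RtoC_pow, Cmod_R, <- RPow_abs, Rabs_Ropp, Rabs_right by lra.
    assert (T := Cexp_taylor2 (- z * cosh t)%C (- k * cosh t)%C). rewrite Cmod_mult, Cmod_opp, Cmod_R, Rabs_right in T by lra.
    assert (Hcj : 0 < cosh t ^ j) by (apply pow_lt; lra). eapply Rle_trans; [apply Rmult_le_compat_l; [lra|exact T]|].
    assert (HE : exp (Re (- z * cosh t)%C + Cmod k * cosh t) <= exp (- (x * cosh t))).
    { apply exp_le. destruct z as [a c]; simpl in *. unfold x in *. nra. }
    apply Rle_trans with (4 * Cmod k ^ 2 * (cosh t ^ S (S j) * exp (- (x * cosh t)))).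
    + replace (cosh t ^ j * (4 * exp (Re (- z * cosh t)%C + Cmod k * cosh t) * (Cmod k * cosh t) ^ 2))
        with (4 * Cmod k ^ 2 * cosh t ^ S (S j) * exp (Re (- z * cosh t)%C + Cmod k * cosh t))
        by (simpl; ring).
      rewrite <- Rmult_assoc. pos.
    + unfold A. replace (Cmod k ^ 2 * (4 * (INR (fact (S (S (S j)))) / x ^ S (S (S j))) * (2 * exp (- t))))
        with (4 * Cmod k ^ 2 * (INR (fact (S (S (S j)))) / x ^ S (S (S j)) * (2 * exp (- t)))) by ring.
      apply Rmult_le_compat_l; [nra|]. apply cosh_pow_exp_le; auto.
  - apply iint_exp_neg.
  - intros k Hk. apply is_cint_KJ. rewrite re_plus. assert (H := re_le_Cmod k). apply Rabs_le_between in H. unfold x in *. lra.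
  - apply is_cint_KJ; auto.
Qed.

(** The Bessel operator applied to [exp (- z * cosh t)] is an exact derivative in [t], by
    [cosh ^ 2 = 1 + sinh ^ 2]. Integration with vanishing boundary terms then gives [KJ_ode]. *)
Lemma Kprim_derive z t :
  is_Cderive (fun t => - sinh t * Cexp (- z * cosh t))%C t
    (z * Kker 2 z t + Kker 1 z t + - z * Kker 0 z t)%C.
Proof.
  assert (Hcs : (cosh t * cosh t = 1 + sinh t * sinh t)%C).
  { rewrite <- !RtoC_mult, <- RtoC_plus. f_equal. unfold cosh, sinh. assert (H : exp t * exp (- t) = 1)
      by (rewrite <- exp_plus, Rplus_opp_r; apply exp_0).
    nra. }
  apply (is_Cderive_eq _ _ (- cosh t * Cexp (- z * cosh t) + - sinh t * (Cexp (- z * cosh t) * (- z * sinh t)))%C).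
  - apply (is_Cderive_mult (fun t => - sinh t)%C); [|apply is_Cderive_Cexp_cosh].
    split; simpl; [apply (is_derive_opp (V := R_NormedModule) sinh), is_derive_sinh|auto_derive; auto; eqR; ring].
  - unfold Kker. replace (- cosh t * Cexp (- z * cosh t) + - sinh t * (Cexp (- z * cosh t) * (- z * sinh t)))%C
      with (- cosh t * Cexp (- z * cosh t) + z * ((1 + sinh t * sinh t) - 1) * Cexp (- z * cosh t))%C by ring.
    rewrite <- Hcs. ring.
Qed.

Lemma exp_neg_INR_lim : is_lim_seq (fun n => exp (- INR n)) 0.
Proof.
  apply (is_lim_comp_seq exp (fun n => - INR n) m_infty 0).
  - apply is_lim_exp_m.
  - exists O; intros; discriminate.
  - apply (is_lim_seq_opp INR p_infty), is_lim_seq_INR.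
Qed.

Lemma is_lim_seq_Cmod_0 (u : nat -> C) (v : nat -> R) :
  (forall n, Cmod (u n) <= v n) -> is_lim_seq v 0 ->
  is_lim_seq (fun n => Re (u n)) 0 /\ is_lim_seq (fun n => Im (u n)) 0.
Proof.
  split; apply is_lim_seq_abs_0;
    apply is_lim_seq_le_le with (u := fun _ => 0) (w := v); auto; try apply is_lim_seq_const;
    intros n; (split; [pos|]).
  - eapply Rle_trans; [apply re_le_Cmod|auto].
  - eapply Rle_trans; [apply Im_le_Cmod|auto].
Qed.

Lemma KJ_ode z : 0 < Re z -> (z * KJ 2 z + KJ 1 z)%C = (z * KJ 0 z)%C.
Proof.
  intros Hz. set (f := fun t => (z * Kker 2 z t + Kker 1 z t + - z * Kker 0 z t)%C). assert (Cf : ccont (fun t => 0 <= t) f).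
  { apply ccont_plus; [apply ccont_plus; [apply ccont_scal|]|apply ccont_scal]; apply ccont_Kker. }
  assert (H1 : is_cint (fun _ => 0) INR f (z * KJ 2 z + KJ 1 z + - z * KJ 0 z)%C).
  { apply (is_cint_plus _ _ _ improper_0_n).
    - apply ccont_plus; [apply ccont_scal|]; apply ccont_Kker.
    - apply ccont_scal, ccont_Kker.
    - apply (is_cint_plus _ _ _ improper_0_n).
      + apply ccont_scal, ccont_Kker.
      + apply ccont_Kker.
      + apply (is_cint_scal _ _ _ improper_0_n); [apply ccont_Kker|apply is_cint_KJ; auto].
      + apply is_cint_KJ; auto.
    - apply (is_cint_scal _ _ _ improper_0_n); [apply ccont_Kker|apply is_cint_KJ; auto]. }
  assert (HL : is_lim_seq (fun n => Re (- sinh (INR n) * Cexp (- z * cosh (INR n)))%C) 0 /\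
    is_lim_seq (fun n => Im (- sinh (INR n) * Cexp (- z * cosh (INR n)))%C) 0).
  { apply (is_lim_seq_Cmod_0 _ (fun n => INR (fact 2) / Re z ^ 2 * (2 * exp (- INR n)))).
    - intros n. set (t := INR n). rewrite Cmod_mult, Cmod_Cexp, Cmod_opp, Cmod_R.
      eapply Rle_trans; [|apply (cosh_pow_exp_le (Re z) t 1 2); auto].
      replace (Re (- z * cosh t)%C) with (- (Re z * cosh t)) by (destruct z; simpl; ring).
      apply Rmult_le_compat_r; [apply Rlt_le, exp_pos|]. assert (H2 := exp_pos t). assert (H3 := exp_pos (- t)). unfold sinh, cosh.
      apply Rabs_le_between. lra.
    - replace 0 with (INR (fact 2) / Re z ^ 2 * (2 * 0)) by ring.
      apply (is_lim_seq_scal_l _ _ (2 * 0)), (is_lim_seq_scal_l _ 2 0), exp_neg_INR_lim. }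
  assert (H2 : is_cint (fun _ => 0) INR f (0 - 0)%C).
  { apply (is_cint_primitive _ _ _ improper_0_n (fun t => - sinh t * Cexp (- z * cosh t))%C); auto.
    - intros t _. apply Kprim_derive.
    - apply is_lim_seq_ext with (fun _ => 0); [|apply is_lim_seq_const]. intros n. rewrite sinh_0. simpl; lra.
    - apply is_lim_seq_ext with (fun _ => 0); [|apply is_lim_seq_const]. intros n. rewrite sinh_0. simpl; lra.
    - tauto.
    - tauto. }
  assert (E : (z * KJ 2 z + KJ 1 z + - z * KJ 0 z)%C = (0 - 0)%C).
  { rewrite <- (is_cint_unique _ _ f _ H1). apply is_cint_unique; auto. }
  replace (z * KJ 2 z + KJ 1 z)%C with ((z * KJ 2 z + KJ 1 z + - z * KJ 0 z) + z * KJ 0 z)%C by ring. rewrite E. ring.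
Qed.

(** * The kernel on the positive real axis *)

Definition KR (j : nat) (x : R) : R := Re (KJ j x).

Lemma KJ_real j (x : R) : 0 < x -> KJ j x = KR j x.
Proof.
  intros Hx. apply C_eq_Re_Im; [reflexivity|]. destruct (is_cint_KJ j x) as [_ H]; [simpl; auto|]. apply (iint_unique _ _ _ _ _ H).
  apply (iint_ext _ _ _ improper_0_n (fun _ => 0)).
  - intros t _. rewrite (proj2 (Kker_Re_Im j x t)). rewrite Rmult_0_l, sin_0. ring.
  - apply is_lim_seq_ext with (fun _ => 0); [|apply is_lim_seq_const]. intros n. rewrite RInt_const.
    unfold scal; simpl; unfold mult; simpl. ring.
Qed.

Lemma KR_iint j x : 0 < x ->
  is_iint (fun _ => 0) INR (fun t => (- cosh t) ^ j * exp (- (x * cosh t))) (KR j x).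
Proof.
  intros Hx. destruct (is_cint_KJ j x) as [H _]; [pos|]. apply (iint_ext _ _ _ improper_0_n (fun t => Re (Kker j x t))); auto. intros t _.
  rewrite (proj1 (Kker_Re_Im j x t)). simpl Re. rewrite Rmult_0_l, cos_0. ring.
Qed.

Lemma cont_on_KR_kernel j x P : cont_on P (fun t => (- cosh t) ^ j * exp (- (x * cosh t))).
Proof.
  apply (cont_on_ext _ (fun t => Re (Kker j x t))).
  - intros t. rewrite (proj1 (Kker_Re_Im j x t)). simpl Re. rewrite Rmult_0_l, cos_0. ring.
  - exact (proj1 (ccont_Kker j x P)).
Qed.

Lemma is_derive_KR j (x : R) : 0 < x -> is_derive (KR j) x (KR (S j) x).
Proof.
  intros Hx. assert (G : is_Cderive (fun t : R => RtoC t) x 1).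
  { split; simpl.
    - apply is_derive_Rid.
    - apply is_derive_Rconst. }
  destruct (Cdiff_curve (KJ j) (fun t : R => RtoC t) x _ _ (Cdiff_KJ j x Hx) G) as [H _]. rewrite Cmult_1_r in H. auto.
Qed.

Lemma KR_bound j x N : 0 < x -> (j < N)%nat -> Rabs (KR j x) <= 4 * INR (fact N) / x ^ N.
Proof. intros Hx HN. via re_le_Cmod. apply (KJ_bound j x N); auto. Qed.

Lemma KR_ode x : 0 < x -> x * KR 2 x + KR 1 x = x * KR 0 x.
Proof.
  intros Hx. assert (H := KJ_ode x Hx). rewrite !KJ_real in H by auto. rewrite <- !RtoC_mult, <- RtoC_plus in H. apply RtoC_inj in H. lra.
Qed.

Lemma KR0_pos x : 0 < x -> 0 < KR 0 x.
Proof.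
  intros Hx. assert (Hp : forall t, 0 < (- cosh t) ^ 0 * exp (- (x * cosh t))).
  { intros; pos. }
  assert (H : RInt (fun t => (- cosh t) ^ 0 * exp (- (x * cosh t))) 0 (INR 1) <= KR 0 x).
  { apply (RInt_le_iint _ _ _ improper_0_n _ 1).
    - apply cont_on_KR_kernel.
    - intros; pos.
    - apply KR_iint; auto. }
  eapply Rlt_le_trans; [|exact H]. apply RInt_gt_0.
  - simpl; lra.
  - auto.
  - intros t Ht. apply (cont_on_KR_kernel 0 x (fun _ => True)); auto.
Qed.

(** The Euler derivative [x d/dx] of [K_0]. The Bessel equation becomes the first-order system
    [K' = L / x], [L' = x K]. *)
Definition LR (x : R) : R := x * KR 1 x.

Lemma is_derive_KR0 (x : R) : 0 < x -> is_derive (KR 0) x (LR x / x).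
Proof. intros Hx. apply (is_derive_eq _ _ (KR 1 x)); [apply is_derive_KR; auto|]. unfold LR. field; lra. Qed.

Lemma is_derive_LR (x : R) : 0 < x -> is_derive LR x (x * KR 0 x).
Proof.
  intros Hx. apply (is_derive_eq _ _ (1 * KR 1 x + x * KR 2 x)).
  - apply (is_derive_Rmult (fun x => x)); [apply is_derive_Rid|]. apply is_derive_KR; auto.
  - rewrite <- KR_ode by auto. ring.
Qed.

Lemma cosh_eq_sinh t : cosh t = sinh t + exp (- t).
Proof. unfold cosh, sinh. lra. Qed.

(** Replacing [cosh] by [sinh] in the integral for [- LR x] makes the integrand exact, with value
    [exp (- x)]. The difference [cosh t - sinh t = exp (- t)] contributes between [0] and [x]. *)
Lemma LR_near_0 x : 0 < x -> Rabs (LR x + 1) <= x.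
Proof.
  intros Hx. set (f := fun t => - x * ((- cosh t) ^ 1 * exp (- (x * cosh t)))).
  assert (Cf : cont_on (fun t => 0 <= t) f) by apply cont_on_scal, cont_on_KR_kernel. assert (Hf : is_iint (fun _ => 0) INR f (- LR x)).
  { unfold LR. replace (- (x * KR 1 x)) with (- x * KR 1 x) by ring.
    apply (iint_scal _ _ _ improper_0_n); [apply cont_on_KR_kernel|apply KR_iint; auto]. }
  set (g := fun t => x * sinh t * exp (- (x * cosh t))).
  assert (Dg : forall t : R, is_derive (fun t => -1 * exp (- (x * cosh t))) t (g t)).
  { intros t. apply (is_derive_eq _ _ (-1 * (exp (- (x * cosh t)) * (- x * sinh t)))).
    - apply is_derive_Rscal. apply (is_derive_Rcomp exp (fun t => - (x * cosh t))).
      + apply is_derive_Reals, derivable_pt_lim_exp.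
      + apply (is_derive_ext (fun t => - x * cosh t)); [intros; eqR; ring|]. apply is_derive_Rscal, is_derive_cosh.
    - unfold g. lra. }
  assert (Cg : cont_on (fun t => 0 <= t) g).
  { intros t _. apply (ex_derive_continuous (fun t => x * sinh t * exp (- (x * cosh t)))).
    apply (ex_derive_mult (fun t => x * sinh t) (fun t => exp (- (x * cosh t)))).
    - eexists. apply is_derive_Rscal, is_derive_sinh.
    - apply (ex_derive_comp exp (fun t => - (x * cosh t))); [auto_derive; auto|].
      apply (ex_derive_opp (V := R_NormedModule) (fun t => x * cosh t)). eexists. apply is_derive_Rscal, is_derive_cosh. }
  assert (Hg : is_iint (fun _ => 0) INR g (0 - (-1 * exp (- x)))).
  { apply (iint_primitive _ _ _ improper_0_n (fun t => -1 * exp (- (x * cosh t)))); auto.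
    - rewrite cosh_0, Rmult_1_r. apply is_lim_seq_const.
    - replace 0 with (-1 * 0) by ring. apply (is_lim_seq_scal_l _ _ 0). apply is_lim_seq_le_le with (u := fun _ => 0)
        (w := fun n => INR (fact 1) / x ^ 1 * (2 * exp (- INR n))).
      + split; [apply Rlt_le, exp_pos|]. assert (H := cosh_pow_exp_le x (INR n) 0 1 Hx ltac:(lia)). lra.
      + apply is_lim_seq_const.
      + replace 0 with (INR (fact 1) / x ^ 1 * (2 * 0)) by ring.
        apply (is_lim_seq_scal_l _ _ (2 * 0)), (is_lim_seq_scal_l _ 2 0), exp_neg_INR_lim. }
  assert (H1 : 0 - (-1 * exp (- x)) <= - LR x).
  { apply (iint_le _ _ _ improper_0_n g f); auto. intros t Ht. unfold f, g. rewrite pow_1.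
    replace (- x * (- cosh t * exp (- (x * cosh t)))) with (x * cosh t * exp (- (x * cosh t))) by ring.
    apply Rmult_le_compat_r; [apply Rlt_le, exp_pos|]. apply Rmult_le_compat_l; [lra|]. rewrite cosh_eq_sinh. assert (H := exp_pos (- t)).
    lra. }
  assert (H2 : - LR x <= (0 - (-1 * exp (- x))) + 2 * (x / 2)).
  { apply (iint_le _ _ _ improper_0_n f (fun t => g t + x / 2 * (2 * exp (- t)))); auto.
    - apply cont_on_plus; auto. apply cont_exp_neg.
    - intros t Ht. unfold f, g. rewrite pow_1.
      replace (- x * (- cosh t * exp (- (x * cosh t)))) with (x * cosh t * exp (- (x * cosh t))) by ring. assert (He := exp_pos (- t)).
      assert (He3 : exp (- (x * cosh t)) <= 1).
      { rewrite <- exp_0. apply exp_le. assert (H := cosh_ge_1 t). nra. }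
      rewrite cosh_eq_sinh at 1. replace (x * (sinh t + exp (- t)) * exp (- (x * cosh t)))
        with (x * sinh t * exp (- (x * cosh t)) + x * exp (- t) * exp (- (x * cosh t))) by ring.
      apply Rplus_le_compat_l. replace (x / 2 * (2 * exp (- t))) with (x * exp (- t) * 1) by field. pos.
    - apply (iint_plus _ _ _ improper_0_n); auto; [apply cont_exp_neg|apply iint_exp_neg]. }
  assert (H3 : exp (- x) < 1) by (rewrite <- exp_0; apply exp_increasing; lra). assert (H4 := exp_ineq1_le (- x)). apply Rabs_le_between.
  lra.
Qed.

Lemma LR_bound x N : 0 < x -> (1 < N)%nat -> Rabs (LR x) <= x * (4 * INR (fact N) / x ^ N).
Proof.
  intros Hx HN. unfold LR. rewrite Rabs_mult, Rabs_right by lra. apply Rmult_le_compat_l; [lra|]. apply KR_bound; auto.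
Qed.

(** The derivative of [K_0 + ln] is [(LR t + 1) / t], bounded by [1]. So [K_0 + ln] extends to [0],
    and a limit there becomes an estimate with explicit error. *)
Lemma KR_log_lip x y : 0 < x -> 0 < y -> Rabs ((KR 0 y + ln y) - (KR 0 x + ln x)) <= 1 * Rabs (y - x).
Proof.
  intros Hx Hy. assert (Hpos : forall t, Rmin x y <= t <= Rmax x y -> 0 < t).
  { intros t [Ht _]. eapply Rlt_le_trans; [|exact Ht]. apply Rmin_pos; auto. }
  apply (deriv_bound (fun x => KR 0 x + ln x) (fun t => LR t / t + / t)).
  - intros t Ht. apply is_derive_Rplus; [apply is_derive_KR0; auto|]. apply is_derive_Reals, derivable_pt_lim_ln; auto.
  - intros t Ht. specialize (Hpos t Ht). replace (LR t / t + / t) with ((LR t + 1) / t) by (field; lra). unfold Rdiv.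
    rewrite Rabs_mult, Rabs_inv, (Rabs_right t) by lra. apply Rmult_le_reg_r with t; auto.
    rewrite Rmult_assoc, Rinv_l, Rmult_1_r, Rmult_1_l by lra. apply LR_near_0; auto.
Qed.

Lemma cont_on_KR0 : cont_on (fun x => 0 < x) (KR 0).
Proof. apply (is_derive_cont_on _ (KR 0) (KR 1)). intros; apply is_derive_KR; auto. Qed.

Lemma KR0_near_0 x : 0 < x <= 1 -> Rabs (KR 0 x) <= (KR 0 1 + 1) * (1 + Rabs (ln x)).
Proof.
  intros Hx. assert (H := KR_log_lip x 1 ltac:(lra) ltac:(lra)). assert (H1 := KR0_pos x ltac:(lra)).
  rewrite ln_1, Rplus_0_r, (Rabs_right (1 - x)) in H by lra. apply Rabs_le_between in H. assert (H2 := KR0_pos 1 ltac:(lra)).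
  rewrite Rabs_right, abs_ln_le by (auto; lra). assert (H3 := abs_ln_le x Hx). assert (H4 := Rabs_pos (ln x)). nra.
Qed.

Lemma mellin_kernel_KR0 : mellin_kernel (KR 0).
Proof.
  split.
  - apply cont_on_KR0.
  - apply KR0_pos.
  - exists (KR 0 1 + 1). intros x Hx. assert (H := KR0_near_0 x Hx). assert (H0 := KR0_pos x ltac:(lra)). rewrite Rabs_right in H by lra.
    lra.
  - intros p. exists (4 * INR (fact (S p))). intros x Hx. assert (H := KR_bound 0 x (S p) ltac:(lra) ltac:(lia)).
    rewrite Rabs_right in H by (apply Rle_ge, Rlt_le, KR0_pos; lra). assert (Hp : 0 < x ^ p) by pos.
    assert (Hf : 0 < 4 * INR (fact (S p))) by pos. apply Rle_div_r; auto. via H. apply Rmult_le_compat_l; [lra|].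
    apply Rinv_le_contravar; auto. simpl. nra.
Qed.

Notation MKl := (Mel (KR 0)).
Notation Kmel := (mint (KR 0)).
Notation MKl_iint := (Mel_iint (KR 0) mellin_kernel_KR0).
Notation MKl_pos := (Mel_pos (KR 0) mellin_kernel_KR0).
Notation is_derive_MKl := (is_derive_Mel (KR 0) mellin_kernel_KR0).
Notation cont_on_Kmel := (cont_on_mint (KR 0) mellin_kernel_KR0).

Lemma MKl_S s : 1 <= s -> MKl 0 (s + 2) = s ^ 2 * MKl 0 s.
Proof.
  intros Hs. assert (Hc := cont_on_Kmel 0). destruct (INR_unbounded s) as [p Hp]. set (N := (p + 2)%nat).
  (* By the Bessel equation, [F] is a primitive of [x^(s+1) K_0 - s^2 x^(s-1) K_0]: two integrations
     by parts in one. *)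
  set (F := fun x => (LR x + - s * KR 0 x) * Rpower x s).
  assert (B : forall x u v w, 0 < x -> Rabs (LR x) <= u -> Rabs (KR 0 x) <= v -> Rpower x s <= w -> Rabs (F x) <= (u + s * v) * w).
  { intros x u v w Hx Hu Hv Hw. assert (HR := Rpower_pos x s). unfold F. rewrite Rabs_mult, (Rabs_right (Rpower x s)) by lra.
    apply Rmult_le_compat; auto; [apply Rabs_pos|lra|]. via Rabs_triang. rewrite Rabs_mult, Rabs_Ropp, (Rabs_right s) by lra. nra. }
  assert (H2 : iint_0_oo (fun x => Kmel 0 (s + 2) x + - s ^ 2 * Kmel 0 s x) (0 - 0)).
  { apply (iint_primitive _ _ _ improper_0_oo F).
    - intros x Hx. eapply is_derive_eq.
      + apply (is_derive_Rmult (fun x => LR x + - s * KR 0 x) (fun x => Rpower x s)).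
        * apply is_derive_Rplus; [apply is_derive_LR; auto|apply is_derive_Rscal, is_derive_KR0; auto].
        * apply is_derive_Reals, derivable_pt_lim_power; auto.
      + unfold mint. replace (s + 2 - 1) with (s + 1) by ring. rewrite Rpower_plus, Rpower_1, Rpower_minus_1 by auto. lra.
    - apply cont_on_plus; [auto|apply cont_on_scal, Hc].
    - apply (lim_lo_log F (2 + s * (KR 0 1 + 1)) 0 1). intros x Hx. rewrite Rminus_0_r, pow_1. assert (HL := LR_near_0 x ltac:(lra)).
      apply Rabs_le_between in HL.
      eapply Rle_trans; [apply (B x 2 ((KR 0 1 + 1) * (1 + Rabs (ln x))) x); [lra|apply Rabs_le; lra|apply KR0_near_0; auto|]|].
      + rewrite <- (Rpower_1 x) at 2 by lra. apply exp_le. assert (Hl := abs_ln_le x Hx). assert (H0 := Rabs_pos (ln x)). nra.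
      + assert (H0 := Rabs_pos (ln x)). nra.
    - set (q := 4 * INR (fact N)). apply (lim_hi_0 F (q + s * q)). intros x Hx.
      assert (Hq : 0 < q) by (unfold q; assert (H := INR_fact_lt_0 N); lra). assert (HxN : 0 < x ^ N) by (apply pow_lt; lra).
      assert (Hqx : 0 < q / x ^ N) by (apply Rdiv_lt_0_compat; auto).
      eapply Rle_trans; [apply (B x (x * (q / x ^ N)) (x * (q / x ^ N)) (x ^ p)); [lra| | |]|].
      + apply LR_bound; [lra|lia].
      + eapply Rle_trans; [apply (KR_bound 0 x N); [lra|lia]|]. fold q. nra.
      + rewrite <- Rpower_pow by lra. apply Rle_Rpower; lra.
      + apply Req_le. unfold N. rewrite pow_add. field. pos. }
  assert (H1 := iint_plus _ _ _ improper_0_oo _ _ _ _ (Hc (s + 2)) (cont_on_scal _ _ (- s ^ 2) (Hc s)) (MKl_iint 0 (s + 2) ltac:(lra))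
    (iint_scal _ _ _ improper_0_oo _ (- s ^ 2) _ (Hc s) (MKl_iint 0 s ltac:(lra)))).
  assert (E := iint_unique _ _ _ _ _ H1 H2). lra.
Qed.

Lemma MK2_iint : iint_0_oo (fun y => KR 0 y * y) 1.
Proof.
  replace 1 with (0 - -1) by ring. apply (iint_primitive _ _ _ improper_0_oo LR).
  - intros x Hx. rewrite Rmult_comm. apply is_derive_LR; auto.
  - apply (cont_on_mult _ (KR 0) (fun y => y)); [apply cont_on_KR0|apply cont_on_id].
  - apply (lim_lo_log LR 1 _ 0). intros x Hx. replace (LR x - -1) with (LR x + 1) by ring. rewrite pow_O, Rmult_1_l, Rmult_1_r.
    apply LR_near_0; lra.
  - apply (lim_hi_0 LR (4 * INR (fact 2))). intros x Hx. eapply Rle_trans; [apply (LR_bound x 2); [lra|lia]|]. apply Req_le. field. lra.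
Qed.

Lemma Kmel_2 k x : 0 < x -> Kmel k 2 x = KR 0 x * (x * ln x ^ k).
Proof. intros Hx. unfold mint. replace (2 - 1) with 1 by ring. rewrite Rpower_1 by auto. reflexivity. Qed.

Lemma MKl_2 : MKl 0 2 = 1.
Proof.
  apply (iint_unique _ _ _ _ _ (MKl_iint 0 2 ltac:(lra))). apply (iint_ext _ _ _ improper_0_oo (fun y => KR 0 y * y)); [|apply MK2_iint].
  intros x Hx. rewrite Kmel_2, pow_O by auto. ring.
Qed.

Section KConstants.

Variable g0 : R.
Hypothesis Hg0 : euler_limit g0.

(* [sqrt (MKl 0 (2 + 2 x)) / 2 ^ x] satisfies the Bohr-Mollerup conditions for [Gamma (1 + x)]. *)
Lemma MKl_LG s : 0 < s -> MKl 0 (2 + s) = exp (2 * LG g0 (s / 2) + s * ln 2).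
Proof.
  intros Hs. set (phi := fun t => / 2 * ln (MKl 0 (2 * t)) - t * ln 2). assert (H : phi (1 + s / 2) = phi 1 + LG g0 (s / 2)).
  { apply bohr_mollerup; auto; [| |lra].
    - intros x Hx. unfold phi. replace (2 * (x + 1)) with (2 * x + 2) by ring. rewrite MKl_S by lra.
      replace ((2 * x) ^ 2) with ((2 * x) * (2 * x)) by ring. assert (HM := MKl_pos (2 * x) ltac:(lra)).
      rewrite (ln_mult (2 * x * (2 * x))), (ln_mult (2 * x) (2 * x)), (ln_mult 2 x) by nra. lra.
    - intros x y lam Hx Hy Hlam. unfold phi.
      assert (HL := Mel_log_convex (KR 0) mellin_kernel_KR0 (2 * x) (2 * y) lam ltac:(lra) ltac:(lra) Hlam).
      replace (lam * (2 * x) + (1 - lam) * (2 * y)) with (2 * (lam * x + (1 - lam) * y)) in HL by ring. lra. }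
  unfold phi in H. replace (2 * (1 + s / 2)) with (2 + s) in H by field. replace (2 * 1) with 2 in H by ring. rewrite MKl_2, ln_1 in H.
  rewrite <- (exp_ln (MKl 0 (2 + s))) by (apply MKl_pos; lra). f_equal. lra.
Qed.

(** The moments are the first two derivatives at [s = 2] of the Mellin transform [exp (h s)], where
    [h 2 = 0]. The constants come from [LG1 1 = 1 - g0] and from the sum of the inverse squares in
    [LG2]. *)
Theorem K_log_moments :
  iint_0_oo (fun x => KR 0 x * (x * ln x)) (ln 2 - g0) /\
  iint_0_oo (fun x => KR 0 x * (x * ln x ^ 2)) ((ln 2 - g0) ^ 2 + PI ^ 2 / 12).
Proof.
  set (h := fun s => 2 * LG g0 (s / 2) + s * ln 2 - 2 * ln s). set (h1 := fun s => LG1 g0 (s / 2) + ln 2 - 2 * / s).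
  set (h2 := fun s => LG2 (s / 2) / 2 + 2 / s ^ 2). assert (E0 : forall s, 1 < s -> MKl 0 s = exp (h s)).
  (* [MKl_LG] only covers arguments above [2]. The recursion [MKl_S] moves the formula down to
     [s > 1], so that [2] becomes an interior point. *)
  { intros s Hs. assert (H := MKl_S s ltac:(lra)). rewrite Rplus_comm, MKl_LG in H by lra.
    apply (Rmult_eq_reg_l (s ^ 2)); [|apply pow_nonzero; lra]. rewrite <- H.
    replace (h s) with ((2 * LG g0 (s / 2) + s * ln 2) + - (ln s + ln s)) by (unfold h; ring).
    rewrite (exp_plus _ (- _)), exp_Ropp, (exp_plus (ln s)), exp_ln by lra. field. lra. }
  assert (Dd : forall (f f' : R -> R) (s : R), is_derive f (s / 2) (f' (s / 2)) -> is_derive (fun s => f (s / 2)) s (f' (s / 2) / 2)).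
  { intros f f' s Hf. apply (is_derive_Rcomp f (fun s => s / 2)); [exact Hf|]. auto_derive; auto. lra. }
  assert (D0 : forall s : R, 1 < s -> is_derive h s (h1 s)).
  { intros s Hs. eapply is_derive_eq.
    - apply is_derive_Rminus; [apply is_derive_Rplus|].
      + apply is_derive_Rscal, (Dd (LG g0) (LG1 g0)), is_derive_LG. lra.
      + apply (is_derive_Rmult (fun s => s) (fun _ => ln 2)); [apply is_derive_Rid|apply is_derive_Rconst].
      + apply is_derive_Rscal, is_derive_Reals, derivable_pt_lim_ln. lra.
    - unfold h1. lra. }
  assert (D1 : forall s : R, 1 < s -> is_derive h1 s (h2 s)).
  { intros s Hs. eapply is_derive_eq.
    - apply is_derive_Rminus; [apply is_derive_Rplus|].
      + apply (Dd (LG1 g0) LG2), is_derive_LG1. lra.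
      + apply is_derive_Rconst.
      + apply is_derive_Rscal. apply (is_derive_inv (fun s => s) s 1); [apply is_derive_Rid|lra].
    - unfold h2. lra. }
  assert (De : forall s : R, 1 < s -> is_derive (fun s => exp (h s)) s (exp (h s) * h1 s)).
  { intros s Hs. apply (is_derive_Rcomp exp h); [apply is_derive_exp|auto]. }
  assert (E1 : forall s, 1 < s -> MKl 1 s = exp (h s) * h1 s).
  { intros s Hs. apply (is_derive_local_eq (MKl 0) (fun s => exp (h s)) (MKl 1) (fun s => exp (h s) * h1 s) s 1 (s + 1)); [lra| | |auto].
    - intros x Hx. apply E0. lra.
    - apply is_derive_MKl; lra. }
  assert (E2 : MKl 2 2 = exp (h 2) * h1 2 * h1 2 + exp (h 2) * h2 2).
  { apply (is_derive_local_eq (MKl 1) (fun s => exp (h s) * h1 s) (MKl 2) (fun s => exp (h s) * h1 s * h1 s + exp (h s) * h2 s) 2 1 3); [lra| | |].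
    - intros x Hx. apply E1. lra.
    - apply is_derive_MKl; lra.
    - apply (is_derive_Rmult (fun s => exp (h s)) h1); [apply De|apply D1]; lra. }
  assert (Eh : exp (h 2) = 1) by (rewrite <- E0, MKl_2; lra).
  assert (Eh1 : h1 2 = ln 2 - g0) by (unfold h1; replace (2 / 2) with 1 by field; rewrite LG1_1; field).
  assert (Eh2 : h2 2 = PI ^ 2 / 12).
  { unfold h2. replace (2 / 2) with (0 + 1) by field. rewrite LG2_shift by lra. replace (LG2 0) with (PI ^ 2 / 6); [field|].
    rewrite <- (is_series_unique _ _ basel). apply Series_ext. intros j. rewrite ?Rplus_0_r; ring. }
  split.
  - apply (iint_ext _ _ _ improper_0_oo (Kmel 1 2)); [intros x Hx; rewrite Kmel_2, pow_1; auto|].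
    replace (ln 2 - g0) with (MKl 1 2) by (rewrite E1, Eh, Eh1; lra). apply MKl_iint; lra.
  - apply (iint_ext _ _ _ improper_0_oo (Kmel 2 2)); [intros x Hx; rewrite Kmel_2; auto|].
    replace ((ln 2 - g0) ^ 2 + PI ^ 2 / 12) with (MKl 2 2) by (rewrite E2, Eh, Eh1, Eh2; ring). apply MKl_iint; lra.
Qed.

(** [F = ln * LR - K_0] is a primitive of [x ln x K_0] that vanishes at infinity, so its limit at
    [0] is minus the first logarithmic moment. Near [0] it behaves like [- ln - K_0], which fixes
    the constant; [KR_log_lip] supplies the error. *)
Theorem KR0_asymptotic x : 0 < x -> Rabs (KR 0 x + ln x - (ln 2 - g0)) <= x.
Proof.
  intros Hx. destruct K_log_moments as [H1 _]. set (F := fun x => ln x * LR x - KR 0 x).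
  assert (HF : forall y : R, 0 < y -> is_derive F y (KR 0 y * (y * ln y))).
  { intros y Hy. eapply is_derive_eq.
    - apply is_derive_Rminus; [|apply is_derive_KR0; auto].
      apply (is_derive_Rmult ln LR); [apply is_derive_Reals, derivable_pt_lim_ln; auto|apply is_derive_LR; auto].
    - lra. }
  assert (Hhi : is_lim_seq (fun n => F (INR (S n))) 0).
  { apply (lim_hi_0 F (8 * INR (fact 3))). intros y Hy. assert (HL := LR_bound y 3 ltac:(lra) ltac:(lia)).
    assert (HK := KR_bound 0 y 3 ltac:(lra) ltac:(lia)). set (q := 4 * INR (fact 3) / y ^ 3) in *. assert (Hq : 0 < q) by (unfold q; pos).
    assert (Hl := ln_le_minus_1 y Hy). assert (Hl0 := ln_ge_0 y Hy). via Rabs_triang.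
    rewrite Rabs_Ropp, Rabs_mult, (Rabs_right (ln y)) by lra.
    replace (8 * INR (fact 3) / y) with (y * (y * q) + y * y * q) by (unfold q; field; lra). apply Rplus_le_compat; [pos|].
    assert (1 * q <= y * y * q) by (apply Rmult_le_compat_r; nra). lra. }
  assert (Hlo : is_lim_seq (fun n => F (/ INR (S n))) (0 - (ln 2 - g0))).
  { apply is_lim_seq_ext with (fun n => F (INR (S n)) - RInt (fun x => KR 0 x * (x * ln x)) (/ INR (S n)) (INR (S n))).
    - intros n. destruct improper_0_oo as [J1 J2 _ _]. rewrite (RInt_primitive F); auto; [ring| |].
      + eauto.
      + intros y Hy. apply J2 in Hy.
        exact (cont_on_mult _ (KR 0) (fun x => x * ln x) cont_on_KR0 (cont_on_mult _ (fun x => x) ln (cont_on_id _) cont_on_ln) y Hy).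
    - apply is_lim_seq_minus'; auto. }
  assert (Hc : is_lim_seq (fun n => KR 0 (/ INR (S n)) + ln (/ INR (S n))) (0 - (0 - (ln 2 - g0)))).
  { apply is_lim_seq_ext with (fun n => ln (/ INR (S n)) * (LR (/ INR (S n)) + 1) - F (/ INR (S n))); [intros n; unfold F; ring|].
    apply is_lim_seq_minus'; auto. apply (lim_lo_log (fun y => ln y * (LR y + 1)) 1 0 1). intros y Hy.
    assert (HL := LR_near_0 y ltac:(lra)). rewrite Rminus_0_r, Rabs_mult, pow_1, Rmult_1_l, Rmult_comm. pos. }
  assert (Hle := is_lim_seq_le _ _ (Rabs ((KR 0 x + ln x) - (0 - (0 - (ln 2 - g0))))) (1 * Rabs (x - 0))
    (fun n => KR_log_lip (/ INR (S n)) x (proj1 (inv_S_bounds n)) Hx)).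
  rewrite Rminus_0_r, (Rabs_right x), Rmult_1_l in Hle by lra.
  replace (KR 0 x + ln x - (ln 2 - g0)) with (KR 0 x + ln x - (0 - (0 - (ln 2 - g0)))) by ring. apply Hle.
  - apply (is_lim_seq_abs _ (KR 0 x + ln x - (0 - (0 - (ln 2 - g0))))), is_lim_seq_minus'; auto. apply is_lim_seq_const.
  - apply (is_lim_seq_ext (fun n => Rabs (x - / INR (S n)))); [intros; ring|].
    replace (Finite x) with (Finite (Rabs (x - 0))) by (f_equal; rewrite Rminus_0_r, Rabs_right; lra).
    apply (is_lim_seq_abs _ (x - 0)), is_lim_seq_minus'; [apply is_lim_seq_const|apply is_lim_seq_inv_S].
Qed.

End KConstants.

(** * Uniqueness for the Bessel equation *)

(** Gronwall's inequality: [exp (- C * x) * S x] is nonincreasing. *)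
Lemma exp_decay_of_deriv (S S' : R -> R) (C a b : R) : a <= b ->
  (forall x, a <= x <= b -> is_derive S x (S' x)) ->
  (forall x, a <= x <= b -> S' x <= C * S x) ->
  S b <= exp (C * (b - a)) * S a.
Proof.
  intros Hab HS Hle. assert (H : - (exp (- C * a) * S a) <= - (exp (- C * b) * S b)).
  { apply (nondecreasing_of_deriv (fun x => - (exp (- C * x) * S x))
      (fun x => - 1 * (- C * exp (- C * x) * S x + exp (- C * x) * S' x))); auto.
    - intros x Hx. apply (is_derive_ext (fun x => - 1 * (exp (- C * x) * S x))); [intros; eqR; ring|]. apply is_derive_Rscal.
      apply (is_derive_Rmult (fun x => exp (- C * x)) S); [|apply HS; auto]. auto_derive; auto. lra.
    - intros x Hx. assert (He := exp_pos (- C * x)). specialize (Hle x Hx). nra. }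
  replace (exp (C * (b - a)) * S a) with (exp (C * b) * (exp (- C * a) * S a)).
  2:{ rewrite <- Rmult_assoc, <- exp_plus. do 2 f_equal. ring. }
  replace (S b) with (exp (C * b) * (exp (- C * b) * S b)).
  2:{ rewrite <- Rmult_assoc, <- exp_plus. replace (C * b + - C * b) with 0 by ring. rewrite exp_0. ring. }
  pos.
Qed.

(* For [W = u^2 + (v / x)^2] one has [W' <= 2 x W], because
   [4 |u w| <= 2 w^2 / x + 2 x u^2], and [W] tends to [0] at [0]. *)
Lemma singular_ode_unique (u v : R -> R) (sg C : R) : Rabs sg <= 1 ->
  (forall x, 0 < x -> is_derive u x (v x / x)) ->
  (forall x, 0 < x -> is_derive v x (sg * (x * u x))) ->
  (forall x, 0 < x <= 1 -> Rabs (u x) <= C * (x * (1 + Rabs (ln x)))) ->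
  (forall x, 0 < x <= 1 -> Rabs (v x) <= C * (x * (1 + Rabs (ln x)))) ->
  forall x, 0 < x -> u x = 0.
Proof.
  intros Hsg Hu Hv Bu Bv. assert (HC : 0 <= C).
  { specialize (Bu 1 ltac:(lra)). rewrite ln_1, Rabs_R0 in Bu. assert (H := Rabs_pos (u 1)). lra. }
  assert (Hl : forall x, 0 < x <= 1 -> x * (1 + Rabs (ln x)) <= exp 1).
  { intros x Hx. assert (H := x_log_pow_le x 1 Hx). simpl INR in H. lra. }
  (* The bound on [v] is first improved to [O(x^2)], from [v -> 0] at [0] and [Rabs (v' t) <= B * x]
     for [t <= x]. Without it [v / x] need not tend to [0]. *)
  set (B := C * exp 1). assert (HB : 0 <= B) by (unfold B; pos). assert (Bv2 : forall x, 0 < x <= 1 -> Rabs (v x) <= B * x ^ 2).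
  { intros x Hx. assert (L : is_lim_seq (fun n => Rabs (v (/ INR (S n))) + B * x ^ 2) (0 + B * x ^ 2)).
    { apply is_lim_seq_plus'; [|apply is_lim_seq_const]. rewrite <- Rabs_R0. apply (is_lim_seq_abs _ 0). apply (lim_lo_log v C 0 1).
      intros y Hy. rewrite Rminus_0_r, pow_1. auto. }
    rewrite Rplus_0_l in L. apply (le_lim_lo (fun y => Rabs (v y) + B * x ^ 2) _ _ x); [lra| |exact L]. intros y Hy.
    assert (H := deriv_bound v (fun t => sg * (t * u t)) y x (B * x)). rewrite Rmin_left, Rmax_right in H by lra.
    assert (H2 : Rabs (v x - v y) <= B * x * Rabs (x - y)).
    { apply H; intros t Ht; [apply Hv; lra|]. rewrite !Rabs_mult, (Rabs_right t) by lra. assert (Ht2 := Bu t ltac:(lra)).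
      assert (Hl2 := Hl t ltac:(lra)).
      assert (Hut : Rabs (u t) <= B) by (unfold B; apply Rle_trans with (1 := Ht2), Rmult_le_compat_l; auto).
      rewrite <- (Rmult_1_l (B * x)). apply Rmult_le_compat; auto; [pos|pos|]. nra. }
    rewrite (Rabs_right (x - y)) in H2 by lra. assert (H3 := Rabs_triang (v x - v y) (v y)).
    replace (v x - v y + v y) with (v x) in H3 by ring. assert (0 <= B * x) by pos. nra. }
  set (W := fun x => u x * u x + v x / x * (v x / x)).
  set (W' := fun x => 2 * (1 + sg) * (u x * (v x / x)) - 2 * (v x / x * (v x / x)) / x).
  assert (DW : forall x : R, 0 < x -> is_derive W x (W' x)).
  { intros x Hx. assert (Dw : is_derive (fun x => v x / x) x (sg * (x * u x) * / x + v x * (- 1 / x ^ 2))).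
    { apply (is_derive_Rmult v Rinv); [apply Hv; auto|]. apply (is_derive_inv (fun x => x)); [apply is_derive_Rid|lra]. }
    eapply is_derive_eq.
    - apply is_derive_Rplus; [apply (is_derive_Rmult u u); apply Hu; auto|].
      apply (is_derive_Rmult (fun x => v x / x) (fun x => v x / x)); exact Dw.
    - unfold W'. field. lra. }
  intros x Hx. apply Rabs_le_between in Hsg. assert (L : is_lim_seq (fun n => exp (2 * x * x) * W (/ INR (S n))) 0).
  { apply (lim_scal0 (exp (2 * x * x))), (lim_lo_log W (C * C + B * B) 0 2). intros y Hy. assert (Hy1 := Bu y Hy).
    assert (Hy2 := Bv2 y Hy). set (l := 1 + Rabs (ln y)) in *. assert (Hl1 : 1 <= l) by (unfold l; assert (H := Rabs_pos (ln y)); lra).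
    assert (Hw : Rabs (v y / y) <= B * y).
    { unfold Rdiv. rewrite Rabs_mult, Rabs_inv, (Rabs_right y) by lra. apply Rle_div_l; [lra|]. lra. }
    assert (Q : forall p q, Rabs p <= q -> p * p <= q * q).
    { intros p q Hpq. rewrite <- (Rabs_right (p * p)), Rabs_mult by nra. pos. }
    apply Q in Hy1. apply Q in Hw. unfold W. rewrite Rabs_right by nra.
    assert (Hyy : y * y <= y * l ^ 2) by (apply Rmult_le_compat_l; nra). assert (C * C * (y * y * (l * l)) <= C * C * (y * l ^ 2)) by nra.
    nra. }
  assert (HW : W x <= 0).
  { apply (le_lim_lo (fun y => exp (2 * x * x) * W y) _ _ x Hx); [|exact L]. intros y Hy.
    assert (HWy : forall t, 0 <= W t) by (intros t; unfold W; nra). apply Rle_trans with (exp (2 * x * (x - y)) * W y).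
    - apply (exp_decay_of_deriv W W'); [lra|intros; apply DW; lra|]. intros t Ht. unfold W', W. set (w := v t / t).
      assert (Hq : 0 <= (w - t * u t) ^ 2 / t) by pos. assert (Hq2 : 0 <= (w + t * u t) ^ 2 / t) by pos.
      replace ((w - t * u t) ^ 2 / t) with (w * w / t + t * (u t * u t) - 2 * (u t * w)) in Hq by (field; lra).
      replace ((w + t * u t) ^ 2 / t) with (w * w / t + t * (u t * u t) + 2 * (u t * w)) in Hq2 by (field; lra). nra.
    - apply Rmult_le_compat_r; auto. apply exp_le. nra. }
  unfold W in HW. nra.
Qed.

(** * Polar coordinates and passage from the real axis to the half-plane *)

Definition polar (rho phi : R) : C := (rho * cos phi, rho * sin phi).

Lemma Cmod_polar_eq rho phi : 0 <= rho -> Cmod (polar rho phi) = rho.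
Proof.
  unfold Cmod, polar. simpl. replace (rho * cos phi * (rho * cos phi * 1) + rho * sin phi * (rho * sin phi * 1))
    with (rho * rho * (sin phi * sin phi + cos phi * cos phi)) by ring.
  assert (H := sin2_cos2 phi). unfold Rsqr in H. rewrite H, Rmult_1_r. apply sqrt_square; auto.
Qed.

Lemma polar_0 rho : polar rho 0 = rho.
Proof. unfold polar. rewrite cos_0, sin_0. apply C_eq_Re_Im; simpl; ring. Qed.

Lemma is_Cderive_polar rho (phi : R) : is_Cderive (polar rho) phi (Ci * polar rho phi)%C.
Proof. split; simpl; auto_derive; auto; eqR; ring. Qed.

Lemma polar_form z : 0 < Re z -> exists phi, - PI / 2 < phi < PI / 2 /\
  z = polar (Cmod z) phi /\ cos phi = Re z / Cmod z.
Proof.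
  intros Hz. exists (Carg z). rewrite Carg_atan by auto. assert (Ha := atan_bound (Im z / Re z)). split; auto.
  assert (Hc : 0 < cos (atan (Im z / Re z))) by (apply cos_gt_0; lra). set (a := atan (Im z / Re z)) in *.
  assert (Et : Im z / Re z = sin a / cos a) by (change (Im z / Re z = tan a); unfold a; rewrite tan_atan; auto). destruct z as [x y].
  simpl in Hz. change (Im (x, y) / Re (x, y)) with (y / x) in Et. assert (Ey : y = x * sin a / cos a).
  { apply Rmult_eq_reg_r with (/ x); [|apply Rinv_neq_0_compat; lra]. replace (y * / x) with (y / x) by reflexivity. rewrite Et. field.
    lra. }
  assert (Em : Cmod (x, y) = x / cos a).
  { rewrite Cmod_polar by auto. rewrite Ey. replace (x * x + x * sin a / cos a * (x * sin a / cos a))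
      with (x / cos a * (x / cos a) * (cos a * cos a + sin a * sin a)) by (field; lra).
    assert (H := sin2_cos2 a). unfold Rsqr in H. replace (cos a * cos a + sin a * sin a) with 1 by lra. rewrite Rmult_1_r.
    apply sqrt_square. pos. }
  rewrite Em. split.
  - apply C_eq_Re_Im; simpl; [field; lra|]. lra.
  - simpl. field. lra.
Qed.

(* Gronwall along the vertical segment from [Re z] to [z]. *)
Lemma half_plane_ode_unique (d e : C -> C) :
  (forall z, 0 < Re z -> Cdiff d z (e z / z)%C) ->
  (forall z, 0 < Re z -> Cdiff e z (z * d z)%C) ->
  (forall x : R, 0 < x -> d x = 0) -> (forall x : R, 0 < x -> e x = 0) ->
  forall z, 0 < Re z -> d z = 0.
Proof.
  intros Hd He Rd Re0 z Hz. set (x := Re z) in *. set (h := ((0, Im z) : C)). set (w := fun t : R => (x + t * h)%C).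
  assert (HR : forall t, Re (w t) = x) by (intros t; simpl; ring).
  assert (Hh : Cmod h = Rabs (Im z)) by (unfold Cmod; simpl; rewrite <- sqrt_Rsqr_abs; f_equal; unfold Rsqr; ring).
  set (q := Rabs (Im z)) in *. assert (Hq : 0 <= q) by apply Rabs_pos. assert (Hsq : forall (f : R -> C) t d', is_Cderive f t d' ->
    is_derive (fun t => Re (f t) * Re (f t) + Im (f t) * Im (f t)) t (2 * (Re (f t) * Re d' + Im (f t) * Im d'))).
  { intros f t d' [F1 F2]. eapply is_derive_eq.
    - exact (is_derive_Rplus _ _ _ _ _ (is_derive_Rmult _ _ _ _ _ F1 F1) (is_derive_Rmult _ _ _ _ _ F2 F2)).
    - lra. }
  assert (Hcs : forall (a c : C) p, Cmod c <= p -> Re a * Re c + Im a * Im c <= Cmod a * p).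
  { intros a c p Hp. replace (Re a * Re c + Im a * Im c) with (Re (a * Cconj c)%C) by (destruct a, c; simpl; ring). via Re_le_Cmod.
    rewrite Cmod_mult, Cmod_conj. pos. }
  assert (Hm2 : forall a : C, Re a * Re a + Im a * Im a = Cmod a * Cmod a) by (intros a; assert (H := Cmod2_alt a); lra).
  set (S := fun t => (Re (d (w t)) * Re (d (w t)) + Im (d (w t)) * Im (d (w t)))
    + (Re (e (w t)) * Re (e (w t)) + Im (e (w t)) * Im (e (w t)))).
  set (d1 := fun t => (e (w t) / w t * h)%C). set (e1 := fun t => (w t * d (w t) * h)%C).
  (* On the segment [/ w] is at most [/ x], [w] at most [x + q] and the velocity has modulus [q];
     with [2 u v <= u^2 + v^2] these give the rate [q / x + (x + q) * q]. *)
  assert (HS := exp_decay_of_deriv S (fun t => 2 * (Re (d (w t)) * Re (d1 t) + Im (d (w t)) * Im (d1 t))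
    + 2 * (Re (e (w t)) * Re (e1 t) + Im (e (w t)) * Im (e1 t))) (q / x + (x + q) * q) 0 1).
  assert (H : S 1 <= 0).
  { replace (S 0) with 0 in HS.
    - rewrite Rmult_0_r in HS. apply HS; [lra| |].
      + intros t _. apply is_derive_Rplus; apply Hsq.
        * apply (Cdiff_curve d w); [apply Hd; rewrite HR; auto|apply is_Cderive_line].
        * apply (Cdiff_curve e w); [apply He; rewrite HR; auto|apply is_Cderive_line].
      + intros t Ht. unfold S. rewrite !Hm2. assert (Hp := Cmod_ge_0 (d (w t))). assert (Hr := Cmod_ge_0 (e (w t))).
        assert (Hw := Re_le_Cmod (w t)). rewrite HR in Hw. assert (Hw2 : Cmod (w t) <= x + q).
        { via Cmod_triangle. rewrite Cmod_mult, !Cmod_R, Hh, !Rabs_right by lra. nra. }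
        assert (B1 := Hcs (d (w t)) (d1 t) (q / x * Cmod (e (w t)))). assert (B2 := Hcs (e (w t)) (e1 t) ((x + q) * q * Cmod (d (w t)))).
        set (u := Cmod (d (w t))) in *. set (v := Cmod (e (w t))) in *.
        assert (Hk : forall k, 0 <= k -> k * (2 * (u * v)) <= k * (u * u + v * v)).
        { intros k Hk. apply Rmult_le_compat_l; auto. assert (H := pow2_ge_0 (u - v)). lra. }
        assert (K1 := Hk (q / x) ltac:(pos)). assert (K2 := Hk ((x + q) * q) ltac:(pos)). unfold d1, e1, Cdiv in *.
        rewrite !Cmod_mult, Hh in *. rewrite Cmod_inv in B1 by (apply Cmod_pos_neq_0; lra).
        assert (Hi : / Cmod (w t) <= / x) by (apply Rinv_le_contravar; lra).
        assert (B1' := B1 ltac:(replace (q / x * v) with (v * / x * q) by lra; apply Rmult_le_compat_r, Rmult_le_compat_l; auto)).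
        assert (B2' := B2 ltac:(replace ((x + q) * q * u) with ((x + q) * u * q) by ring; apply Rmult_le_compat_r, Rmult_le_compat_r; auto)).
        lra.
    - unfold S, w. replace (x + 0 * h)%C with (RtoC x) by ring. rewrite Rd, Re0 by auto. simpl; lra. }
  unfold S in H. rewrite !Hm2 in H. replace z with (w 1).
  - apply Cmod_eq_0. nra.
  - apply C_eq_Re_Im; simpl; unfold x; ring.
Qed.

(** * The ascending series *)

Definition ci (r : nat) : R := / INR (fact r) ^ 2.
(** Coefficients after applying [z d/dz] to [E2 a], since [(z^2 / 4)^r] is homogeneous of degree
    [2 r]. Bessel equations thus turn into recursions for coefficients. *)
Definition th (a : nat -> R) (r : nat) : R := 2 * INR r * a r.
Definition E2 (a : nat -> R) (z : C) : C := CPS a (z ^ 2 / 4)%C.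

Lemma ci_pos r : 0 < ci r.
Proof. apply Rinv_0_lt_compat, pow_lt, INR_fact_lt_0. Qed.

Lemma ci_le r : ci r <= / INR (fact r).
Proof. assert (H : 1 <= INR (fact r)) by (apply (le_INR 1), lt_O_fact). apply Rinv_le_contravar; [lra|]. nra. Qed.

Lemma ci_S r : INR (S r) ^ 2 * ci (S r) = ci r.
Proof. unfold ci. rewrite fact_simpl, mult_INR. field. pos. Qed.

Lemma INR_le_pow2 n : INR n <= 2 ^ n.
Proof. induction n; [simpl; lra|]. rewrite S_INR. simpl. assert (1 <= 2 ^ n) by (apply pow_R1_Rle; lra). lra. Qed.

Lemma Hn_bound r : 0 <= Hn r <= INR r.
Proof.
  split.
  - apply psum_pos. intros; pos.
  - rewrite <- (Rmult_1_r (INR r)), <- psum_const. apply psum_le. intros i _. assert (H := one_le_INR_S i). rewrite <- Rinv_1. pos.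
Qed.

Lemma entire_poly_ci a K : (forall r, Rabs (a r) <= K * ((1 + INR r) ^ 2 * ci r)) -> entire a.
Proof.
  intros H. apply (entire_of_bound a (Rabs K * 4) 4). intros n. via H. assert (Hc := ci_le n). assert (Hc0 := ci_pos n).
  assert (H2 := INR_le_pow2 n). assert (H1 : 1 <= 2 ^ n) by (apply pow_R1_Rle; lra). assert (Hn := pos_INR n).
  assert (H4 : (1 + INR n) ^ 2 <= 4 * 4 ^ n).
  { replace 4 with (2 * 2) by ring. rewrite Rpow_mult_distr. nra. }
  apply Rle_trans with (Rabs K * ((1 + INR n) ^ 2 * ci n)).
  - apply Rmult_le_compat_r; [nra|apply Rle_abs].
  - rewrite Rmult_assoc. apply Rmult_le_compat_l; [pos|]. nra.
Qed.

Lemma entire_ci : entire ci.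
Proof.
  apply (entire_poly_ci ci 1). intros r. assert (H := ci_pos r). assert (Hr := pos_INR r). rewrite Rabs_right by lra. nra.
Qed.

Lemma entire_Hn_ci c : entire (fun r => (Hn r + c) * ci r).
Proof.
  apply (entire_poly_ci _ (1 + Rabs c)). intros r. assert (H := ci_pos r). assert (Hh := Hn_bound r). assert (Hc := Rabs_pos c).
  rewrite Rabs_mult, (Rabs_right (ci r)), <- Rmult_assoc by lra. apply Rmult_le_compat_r; [lra|]. via Rabs_triang.
  rewrite (Rabs_right (Hn r)) by lra. nra.
Qed.

Lemma entire_th a : entire a -> entire (th a).
Proof.
  intros Ha r Hr. apply ex_series_Rabs_le with (fun n => 2 * (Rabs (a n) * (INR n ^ 2 * r ^ n))).
  - intros n. unfold th. assert (Hn := pos_INR n). assert (Hrn : 0 <= r ^ n) by (apply pow_le; auto).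
    rewrite !Rabs_mult, !Rabs_Rabsolu, (Rabs_right 2), (Rabs_right (INR n)), (Rabs_right (r ^ n)) by lra.
    assert (Hnn : INR n <= INR n ^ 2).
    { destruct n; [simpl; lra|]. assert (H := one_le_INR_S n). nra. }
    assert (Ha0 := Rabs_pos (a n)). replace (2 * INR n * Rabs (a n) * r ^ n) with (2 * (Rabs (a n) * (INR n * r ^ n))) by ring. pos.
  - apply (ex_series_scal (V := R_NormedModule) 2). apply entire_sq; auto.
Qed.

Lemma entire_shift a : entire a -> entire (fun n => a (S n)).
Proof.
  intros Ha. apply (entire_le _ (PS_derive a)); [|apply entire_PS_derive; auto]. intros n. unfold PS_derive.
  rewrite Rabs_mult, (Rabs_right (INR (S n))) by (apply Rle_ge, pos_INR). assert (H := one_le_INR_S n). assert (H0 := Rabs_pos (a (S n))).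
  nra.
Qed.

Lemma entire_scal c a : entire a -> entire (fun n => c * a n).
Proof.
  intros Ha r Hr. apply (ex_series_ext (fun n => Rabs c * (Rabs (a n) * r ^ n))).
  - intros n. rewrite Rabs_mult. lra.
  - apply (ex_series_scal (V := R_NormedModule)), Ha; auto.
Qed.

Lemma entire_plus a b : entire a -> entire b -> entire (fun n => a n + b n).
Proof.
  intros Ha Hb r Hr. apply ex_series_Rabs_le with (fun n => Rabs (a n) * r ^ n + Rabs (b n) * r ^ n).
  - intros n. assert (Hrn : 0 <= r ^ n) by (apply pow_le; auto).
    rewrite Rabs_mult, Rabs_Rabsolu, (Rabs_right (r ^ n)), <- Rmult_plus_distr_r by lra. apply Rmult_le_compat_r; auto. apply Rabs_triang.
  - apply (ex_series_plus (V := R_NormedModule)); [apply Ha|apply Hb]; auto.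
Qed.

Lemma CPS_decr a (z : C) : entire a -> CPS a z = (a O + z * CPS (fun n => a (S n)) z)%C.
Proof.
  intros Ha. unfold CPS at 1. rewrite CSeries_incr_1 by (apply entire_abs_summable; auto). rewrite Cmult_1_r. f_equal. unfold CPS.
  rewrite <- CSeries_scal by (apply entire_abs_summable, entire_shift; auto). apply CSeries_ext. intros n. simpl; ring.
Qed.

Lemma CPS_ext a b (z : C) : (forall n, a n = b n) -> CPS a z = CPS b z.
Proof. intros H. apply CSeries_ext. congruence. Qed.

Lemma CPS_scal (c : R) a z : entire a -> CPS (fun n => c * a n) z = (c * CPS a z)%C.
Proof.
  intros Ha. unfold CPS. rewrite <- CSeries_scal by (apply entire_abs_summable; auto). apply CSeries_ext. intros n. rewrite RtoC_mult.
  ring.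
Qed.

Lemma CPS_plus a b (z : C) : entire a -> entire b -> CPS (fun n => a n + b n) z = (CPS a z + CPS b z)%C.
Proof.
  intros Ha Hb. unfold CPS. rewrite <- CSeries_plus by (apply entire_abs_summable; auto). apply CSeries_ext. intros n. rewrite RtoC_plus.
  ring.
Qed.

Lemma E2_th a (z : C) : entire a -> (z <> 0)%C -> Cdiff (E2 a) z (E2 (th a) z / z)%C.
Proof.
  intros Ha Hz. unfold E2. eapply Cdiff_eq.
  - apply (Cdiff_comp (CPS a) (fun z => z ^ 2 / 4)%C); [apply Cdiff_CPS; auto|].
    apply (Cdiff_ext (fun z => / 4 * (z * z))%C); [intros; field|]. apply Cdiff_scal.
    apply (Cdiff_mult (fun z => z) (fun z => z)); apply Cdiff_id.
  - rewrite (CPS_decr (th a)) by (apply entire_th; auto). rewrite (CPS_ext (fun n => th a (S n)) (fun n => 2 * PS_derive a n)).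
    + rewrite CPS_scal by (apply entire_PS_derive; auto). unfold th. simpl (INR 0). rewrite Rmult_0_r, Rmult_0_l. field. auto.
    + intros n. unfold th, PS_derive. ring.
Qed.

Lemma E2_shift a b (z : C) : entire a -> a O = 0 -> (forall r, a (S r) = 4 * b r) -> entire b ->
  E2 a z = (z ^ 2 * E2 b z)%C.
Proof.
  intros Ha H0 H Hb. unfold E2. rewrite (CPS_decr a) by auto. rewrite H0. rewrite (CPS_ext (fun n => a (S n)) (fun n => 4 * b n)) by auto.
  rewrite CPS_scal by auto. field.
Qed.

Lemma E2_bound a : entire a -> exists K, 0 <= K /\ forall z : C, Cmod z <= 1 -> Cmod (E2 a z - a O)%C <= K * Cmod z ^ 2.
Proof.
  intros Ha. exists (2 * Series (fun n => Rabs (a (S n)) * 1 ^ n)).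
  assert (Hs : ex_series (fun n => Rabs (a (S n)) * 1 ^ n)) by (apply entire_shift; [auto|lra]).
  assert (Hb : forall z, Cmod z <= 1 -> Cmod (CPS (fun n => a (S n)) (z ^ 2 / 4)%C)
    <= 2 * Series (fun n => Rabs (a (S n)) * 1 ^ n)).
  { intros z Hz. apply CSeries_bound; auto. intros n. rewrite Cmod_mult, Cmod_R, Cmod_pow. apply Rmult_le_compat_l; [apply Rabs_pos|].
    apply pow_incr. rewrite Cmod_div, Cmod_pow, Cmod_R, Rabs_right; [|lra|].
    - assert (H := Cmod_ge_0 z). nra.
    - intros H. apply RtoC_inj in H. lra. }
  split.
  - eapply Rle_trans; [apply Cmod_ge_0|apply (Hb 0)]. rewrite Cmod_0. lra.
  - intros z Hz. unfold E2. rewrite CPS_decr by auto. replace (a O + z ^ 2 / 4 * CPS (fun n => a (S n)) (z ^ 2 / 4) - a O)%C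
      with (z ^ 2 / 4 * CPS (fun n => a (S n)) (z ^ 2 / 4))%C by ring.
    rewrite Cmod_mult, Cmod_div, Cmod_pow, Cmod_R, Rabs_right; [|lra|].
    + specialize (Hb z Hz). assert (H0 := Cmod_ge_0 (CPS (fun n => a (S n)) (z ^ 2 / 4)%C)). nra.
    + intros H. apply RtoC_inj in H. lra.
Qed.

Section KSeries.

Variable g0 : R.
Hypothesis Hg0 : euler_limit g0.

Definition ti (r : nat) : R := (Hn r + - g0) * ci r.

Lemma entire_ti : entire ti.
Proof. apply entire_Hn_ci. Qed.

Lemma BesselI0_E2 (z : C) : BesselI0 z = E2 ci z.
Proof.
  apply CSeries_ext. intros r. unfold ci. assert (H : INR (fact r) ^ 2 <> 0) by (apply pow_nonzero, INR_fact_neq_0).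
  rewrite <- RtoC_pow, RtoC_inv by auto. field. intros E. apply RtoC_inj in E. auto.
Qed.

Lemma BesselK0_E2 (z : C) : BesselK0 z = (- Clog (z / 2) * E2 ci z + E2 ti z)%C.
Proof.
  unfold BesselK0. rewrite BesselI0_E2. f_equal. apply CSeries_ext. intros r. rewrite (digamma_nat g0 Hg0). unfold ti, ci.
  assert (H : INR (fact r) ^ 2 <> 0) by (apply pow_nonzero, INR_fact_neq_0). rewrite RtoC_mult, (RtoC_inv (INR (fact r) ^ 2)) by auto.
  replace (Hn r + - g0) with (Hn r - g0) by ring. rewrite <- RtoC_pow. field. intros E. apply RtoC_inj in E. auto.
Qed.

Lemma E2_thth_ci (z : C) : E2 (th (th ci)) z = (z ^ 2 * E2 ci z)%C.
Proof.
  apply E2_shift.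
  - apply entire_th, entire_th, entire_ci.
  - unfold th. simpl; lra.
  - intros r. unfold th. rewrite <- (ci_S r). ring.
  - apply entire_ci.
Qed.

(** The increment [/ (r + 1)] of the harmonic numbers produces the term [2 * E2 (th ci)], which
    compensates the cross term of the logarithm times [I_0] in [Cdiff_LB]. *)
Lemma E2_thth_ti (z : C) : (E2 (th (th ti)) z - 2 * E2 (th ci) z = z ^ 2 * E2 ti z)%C.
Proof.
  assert (H1 : entire (th (th ti))) by apply entire_th, entire_th, entire_ti. assert (H2 : entire (th ci)) by apply entire_th, entire_ci.
  rewrite <- (E2_shift (fun n => th (th ti) n + -2 * th ci n) ti).
  - unfold E2. rewrite CPS_plus, CPS_scal; auto.
    + ring.
    + apply entire_scal; auto.
  - apply entire_plus, entire_scal; auto.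
  - unfold th. simpl; lra.
  - intros r. unfold th, ti. change (Hn (S r)) with (Hn r + / INR (S r)). rewrite <- (ci_S r). field. pos.
  - apply entire_ti.
Qed.

Definition KB (z : C) : C := (- Clog (z / 2) * E2 ci z + E2 ti z)%C.
(** The Euler derivative [z d/dz] of [KB], the counterpart of [LR]. *)
Definition LB (z : C) : C := (- E2 ci z - Clog (z / 2) * E2 (th ci) z + E2 (th ti) z)%C.

Lemma Cdiff_log_half (z : C) : 0 < Re z -> Cdiff (fun z => Clog (z / 2))%C z (/ z)%C.
Proof.
  intros Hz. assert (Hz0 := Re_pos_neq_0 z Hz). eapply Cdiff_eq.
  - apply (Cdiff_comp Clog (fun z => z / 2)%C).
    + apply Cdiff_Clog. replace (z / 2)%C with ((/ 2)%R * z)%C.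
      * rewrite re_scal_l. lra.
      * rewrite RtoC_inv by lra. field.
    + apply (Cdiff_ext (fun z => / 2 * z)%C); [intros; field|]. apply Cdiff_scal, Cdiff_id.
  - field. auto.
Qed.

Lemma Cdiff_KB (z : C) : 0 < Re z -> Cdiff KB z (LB z / z)%C.
Proof.
  intros Hz. assert (Hz0 := Re_pos_neq_0 z Hz).
  apply (Cdiff_ext (fun z => - (1) * (Clog (z / 2) * E2 ci z) + E2 ti z)%C); [intros; unfold KB; ring|]. eapply Cdiff_eq.
  - apply Cdiff_plus; [|apply E2_th; [apply entire_ti|auto]]. apply Cdiff_scal. apply (Cdiff_mult (fun z => Clog (z / 2))%C (E2 ci)).
    + apply Cdiff_log_half; auto.
    + apply E2_th; [apply entire_ci|auto].
  - unfold LB. field. auto.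
Qed.

Lemma Cdiff_LB (z : C) : 0 < Re z -> Cdiff LB z (z * KB z)%C.
Proof.
  intros Hz. assert (Hz0 := Re_pos_neq_0 z Hz).
  apply (Cdiff_ext (fun z => - (1) * E2 ci z + - (1) * (Clog (z / 2) * E2 (th ci) z) + E2 (th ti) z)%C);
    [intros; unfold LB; ring|].
  eapply Cdiff_eq.
  - apply Cdiff_plus; [|apply E2_th; [apply entire_th, entire_ti|auto]]. apply Cdiff_plus.
    + apply Cdiff_scal. apply E2_th; [apply entire_ci|auto].
    + apply Cdiff_scal. apply (Cdiff_mult (fun z => Clog (z / 2))%C (E2 (th ci))).
      * apply Cdiff_log_half; auto.
      * apply E2_th; [apply entire_th, entire_ci|auto].
  - unfold KB. rewrite E2_thth_ci. replace (E2 (th (th ti)) z) with (2 * E2 (th ci) z + z ^ 2 * E2 ti z)%C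
      by (rewrite <- E2_thth_ti; ring).
    field. auto.
Qed.

Lemma KB_near_0 : exists C, forall x, 0 < x <= 1 ->
  Cmod (KB x + ln x - (ln 2 - g0))%C <= C * (x * (1 + Rabs (ln x))) /\
  Cmod (LB x + 1)%C <= C * (x * (1 + Rabs (ln x))).
Proof.
  destruct (E2_bound ci entire_ci) as [K1 [P1 B1]]. destruct (E2_bound ti entire_ti) as [K2 [P2 B2]].
  destruct (E2_bound (th ci) (entire_th _ entire_ci)) as [K3 [P3 B3]].
  destruct (E2_bound (th ti) (entire_th _ entire_ti)) as [K4 [P4 B4]]. exists (2 * (K1 + K2 + K3 + K4)). intros x Hx.
  assert (Hxm : Cmod x = x) by (rewrite Cmod_R, Rabs_right; lra). specialize (B1 x ltac:(lra)). specialize (B2 x ltac:(lra)).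
  specialize (B3 x ltac:(lra)). specialize (B4 x ltac:(lra)). rewrite Hxm in *. assert (E1 : ci 0 = 1) by (unfold ci; simpl; field).
  assert (E2' : ti 0 = - g0) by (unfold ti, ci, Hn; simpl; field). assert (E3 : th ci 0 = 0) by (unfold th; simpl; ring).
  assert (E4 : th ti 0 = 0) by (unfold th; simpl; ring). rewrite E1 in B1. rewrite E2' in B2. rewrite E3 in B3. rewrite E4 in B4.
  assert (El : Clog (x / 2)%C = (ln x - ln 2)%C).
  { rewrite <- RtoC_div by lra. rewrite Clog_R by lra. rewrite <- RtoC_minus. f_equal. unfold Rdiv. rewrite ln_mult, ln_Rinv by lra. ring. }
  assert (Hl2 : 0 <= ln 2 <= 1).
  { split; [apply ln_ge_0; lra|]. assert (H3 := exp_ineq1_le 1). rewrite <- (ln_exp 1). destruct (Req_dec 2 (exp 1)) as [<-|]; [lra|].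
    apply Rlt_le, ln_increasing; lra. }
  set (l := Rabs (ln x)). assert (Hl : 0 <= l) by apply Rabs_pos. assert (Hlog : Cmod (ln x - ln 2)%C <= 1 + l).
  { rewrite <- RtoC_minus, Cmod_R. via Rabs_triang. rewrite Rabs_Ropp, (Rabs_right (ln 2)) by lra. fold l. lra. }
  assert (Hx2 : 0 <= x ^ 2 <= x) by (simpl; nra). assert (Hlog0 := Cmod_ge_0 (ln x - ln 2)%C).
  assert (T : forall K, 0 <= K -> (1 + l) * (K * x ^ 2) <= K * (x * (1 + l))).
  { intros K HK. replace (K * (x * (1 + l))) with ((1 + l) * (K * x)) by ring. pos. }
  assert (T2 : forall K, 0 <= K -> K * x ^ 2 <= K * (x * (1 + l))).
  { intros K HK. apply Rmult_le_compat_l; auto. nra. }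
  assert (HT1 := T K1 P1). assert (HT2 := T2 K2 P2). assert (HT3 := T2 K1 P1). assert (HT4 := T K3 P3). assert (HT5 := T2 K4 P4).
  assert (Hq : 0 <= x * (1 + l)) by nra. assert (0 <= K1 * (x * (1 + l))) by (apply Rmult_le_pos; auto).
  assert (0 <= K2 * (x * (1 + l))) by (apply Rmult_le_pos; auto). assert (0 <= K3 * (x * (1 + l))) by (apply Rmult_le_pos; auto).
  assert (0 <= K4 * (x * (1 + l))) by (apply Rmult_le_pos; auto). split.
  - unfold KB. rewrite El. replace (- (ln x - ln 2) * E2 ci x + E2 ti x + ln x - (ln 2 - g0))%C
      with (- ((ln x - ln 2) * (E2 ci x - RtoC 1)) + (E2 ti x - RtoC (- g0)))%C by (rewrite RtoC_opp; ring).
    via Cmod_triangle. rewrite Cmod_opp, Cmod_mult. assert (Cmod (ln x - ln 2)%C * Cmod (E2 ci x - 1)%C <= (1 + l) * (K1 * x ^ 2)) by pos.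
    lra.
  - unfold LB. rewrite El. replace (- E2 ci x - (ln x - ln 2) * E2 (th ci) x + E2 (th ti) x + 1)%C
      with (- (E2 ci x - RtoC 1) + (- ((ln x - ln 2) * (E2 (th ci) x - RtoC 0)) + (E2 (th ti) x - RtoC 0)))%C by ring.
    via Cmod_triangle. eapply Rle_trans; [apply Rplus_le_compat_l, Cmod_triangle|]. rewrite !Cmod_opp, Cmod_mult.
    assert (Cmod (ln x - ln 2)%C * Cmod (E2 (th ci) x - 0)%C <= (1 + l) * (K3 * x ^ 2)) by pos. lra.
Qed.

(** The difference [d] and its Euler derivative [e] solve the Bessel system. On the axis they are
    [O(x log x)] because both functions share the logarithm and the constant at [0], so
    [singular_ode_unique] applies to the real and imaginary parts. The half-plane follows from the
    axis. *)
Theorem BesselK0_KJ (z : C) : 0 < Re z -> BesselK0 z = KJ 0 z.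
Proof.
  intros Hz. rewrite BesselK0_E2. change (KB z = KJ 0 z). set (d := fun z => (KB z - KJ 0 z)%C).
  set (e := fun z => (LB z - z * KJ 1 z)%C). assert (Hd : forall z, 0 < Re z -> Cdiff d z (e z / z)%C).
  { intros w Hw. eapply Cdiff_eq.
    - apply Cdiff_minus; [apply Cdiff_KB|apply Cdiff_KJ]; auto.
    - unfold e. field. apply Re_pos_neq_0; auto. }
  assert (He : forall z, 0 < Re z -> Cdiff e z (z * d z)%C).
  { intros w Hw. eapply Cdiff_eq.
    - apply Cdiff_minus; [apply Cdiff_LB; auto|]. apply (Cdiff_mult (fun z => z) (KJ 1)); [apply Cdiff_id|apply Cdiff_KJ; auto].
    - unfold d. replace (w * (KB w - KJ 0 w))%C with (w * KB w - w * KJ 0 w)%C by ring. rewrite <- KJ_ode by auto. ring. }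
  destruct KB_near_0 as [Q HQ]. assert (Bd : forall x, 0 < x <= 1 -> Cmod (d x) <= (Q + 1) * (x * (1 + Rabs (ln x)))).
  { intros x Hx. destruct (HQ x Hx) as [H1 _]. unfold d. rewrite KJ_real by lra. assert (H2 := KR0_asymptotic g0 Hg0 x ltac:(lra)).
    replace (KB x - KR 0 x)%C with ((KB x + ln x - (ln 2 - g0)) - RtoC (KR 0 x + ln x - (ln 2 - g0)))%C
      by (rewrite !RtoC_minus, RtoC_plus; ring).
    via Cmod_triangle. rewrite Cmod_opp, Cmod_R. assert (H0 := Rabs_pos (ln x)). nra. }
  assert (Be : forall x, 0 < x <= 1 -> Cmod (e x) <= (Q + 1) * (x * (1 + Rabs (ln x)))).
  { intros x Hx. destruct (HQ x Hx) as [_ H1]. unfold e. rewrite KJ_real by lra. assert (H2 := LR_near_0 x ltac:(lra)). unfold LR in H2.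
    replace (LB x - x * KR 1 x)%C with ((LB x + 1) - RtoC (x * KR 1 x + 1))%C
      by (rewrite RtoC_plus, RtoC_mult; ring).
    via Cmod_triangle. rewrite Cmod_opp, Cmod_R. assert (H0 := Rabs_pos (ln x)). nra. }
  assert (G := fun x => is_Cderive_RtoC _ _ _ (is_derive_Rid x)).
  assert (Dd : forall x : R, 0 < x -> is_Cderive (fun t : R => d t) x (e x / x)%C).
  { intros x Hx. eapply is_Cderive_eq; [apply (Cdiff_curve d (fun t : R => RtoC t)); [apply Hd; auto|apply G]|ring]. }
  assert (De : forall x : R, 0 < x -> is_Cderive (fun t : R => e t) x (x * d x)%C).
  { intros x Hx. eapply is_Cderive_eq; [apply (Cdiff_curve e (fun t : R => RtoC t)); [apply He; auto|apply G]|ring]. }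
  assert (Hdiv : forall (w : C) (x : R), 0 < x -> Re (w / x)%C = Re w / x /\ Im (w / x)%C = Im w / x).
  { intros w x Hx. unfold Cdiv. rewrite <- RtoC_inv by lra. rewrite re_scal_r, im_scal_r. lra. }
  assert (R1 : Rabs 1 <= 1) by (rewrite Rabs_R1; lra). assert (Zd : forall x : R, 0 < x -> d x = 0).
  { intros x Hx. apply C_eq_Re_Im; simpl.
    - apply (singular_ode_unique (fun t => Re (d t)) (fun t => Re (e t)) 1 (Q + 1)); auto.
      + intros y Hy. destruct (Dd y Hy) as [H _]. rewrite (proj1 (Hdiv (e y) y Hy)) in H. auto.
      + intros y Hy. destruct (De y Hy) as [H _]. rewrite re_scal_l in H. eapply is_derive_eq; [exact H|eqR; ring].
      + intros y Hy. eapply Rle_trans; [apply re_le_Cmod|auto].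
      + intros y Hy. eapply Rle_trans; [apply re_le_Cmod|auto].
    - apply (singular_ode_unique (fun t => Im (d t)) (fun t => Im (e t)) 1 (Q + 1)); auto.
      + intros y Hy. destruct (Dd y Hy) as [_ H]. rewrite (proj2 (Hdiv (e y) y Hy)) in H. auto.
      + intros y Hy. destruct (De y Hy) as [_ H]. rewrite im_scal_l in H. eapply is_derive_eq; [exact H|eqR; ring].
      + intros y Hy. eapply Rle_trans; [apply Im_le_Cmod|auto].
      + intros y Hy. eapply Rle_trans; [apply Im_le_Cmod|auto]. }
  assert (Ze : forall x : R, 0 < x -> e x = 0).
  { intros x Hx. assert (H : (e x / x)%C = 0).
    { destruct (Dd x Hx) as [H1 H2]. assert (Hz1 : forall pr : C -> R, pr 0 = 0 ->
        is_derive (fun t : R => pr (d t)) x (pr (e x / x)%C) -> pr (e x / x)%C = 0).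
      { intros pr P0 HH.
        apply (is_derive_local_eq (fun t : R => pr (d t)) (fun _ => 0) (fun _ => pr (e x / x)%C) (fun _ => 0) x 0 (x + 1)).
        - lra.
        - intros y Hy. rewrite Zd by lra. lra.
        - auto.
        - apply is_derive_Rconst. }
      apply C_eq_Re_Im; [apply (Hz1 Re)|apply (Hz1 Im)]; auto. }
    replace (e x) with ((e x / x) * x)%C.
    - rewrite H. ring.
    - field. intros E. apply RtoC_inj in E. lra. }
  assert (Hz2 := half_plane_ode_unique d e Hd He Zd Ze z Hz). unfold d in Hz2. replace (KB z) with ((KB z - KJ 0 z) + KJ 0 z)%C by ring.
  rewrite Hz2. ring.
Qed.

End KSeries.

(** * The function [dilog v = - Li_2(- v^2) / 4] *)

(** For the Euler derivative [theta = t d/dt]: [theta dilog = hlog] and [theta hlog = hfrac]. Hence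
    [theta ^ 2] of [dilog] is rational, which is why it pairs with the kernel [1 / (1 + z^2)]. *)
Definition hlog (t : R) : R := / 2 * ln (1 + t ^ 2).
Definition hfrac (t : R) : R := t ^ 2 / (1 + t ^ 2).
Definition dlf (t : R) : R := hlog t / t.
Definition dilog (v : R) : R := RInt dlf 0 v.

Lemma one_plus_sq_pos (t : R) : 0 < 1 + t ^ 2.
Proof. pos. Qed.

Lemma is_derive_hlog (t : R) : 0 < t -> is_derive hlog t (hfrac t / t).
Proof. intros Ht. assert (H := one_plus_sq_pos t). unfold hlog, hfrac. auto_derive; [simpl in H; lra|]. field; lra. Qed.

Lemma is_derive_hfrac (t : R) : 0 < t -> is_derive hfrac t (2 * t ^ 2 / (1 + t ^ 2) ^ 2 / t).
Proof. intros Ht. assert (H := one_plus_sq_pos t). unfold hfrac. auto_derive; [simpl in H; lra|]. field; lra. Qed.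

Lemma hlog_bound t : 0 < t -> 0 <= hlog t <= t.
Proof.
  intros Ht. unfold hlog. split.
  - assert (0 <= ln (1 + t ^ 2)) by (apply ln_ge_0; assert (H := pow2_ge_0 t); lra). lra.
  - assert (H : ln (1 + t ^ 2) <= ln ((1 + t) * (1 + t))) by (apply ln_le; [apply one_plus_sq_pos|simpl; nra]).
    rewrite ln_mult in H by lra. assert (H2 := sub_ln_1p_bounds t ltac:(lra)). lra.
Qed.

Lemma hfrac_bound t : 0 < t -> 0 <= hfrac t <= t /\ hfrac t <= 1.
Proof.
  assert (H := one_plus_sq_pos t). assert (H2 := pow2_ge_0 t). repeat split.
  - apply Rdiv_le_0_compat; auto.
  - apply Rle_div_l; auto. nra.
  - apply Rle_div_l; auto. lra.
Qed.

Lemma dlf_0 : dlf 0 = 0.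
Proof. unfold dlf, hlog. rewrite pow_ne_zero, Rplus_0_r, ln_1 by lia. lra. Qed.

Lemma dlf_cont (t : R) : continuous dlf t.
Proof.
  destruct (Req_dec t 0) as [->|Ht].
  (* At [0] the quotient has the value [0] and the slope [/ 2], because [hlog y] is [y^2 / 2] up to
     order four. *)
  - apply (ex_derive_continuous (V := R_NormedModule)). exists (/ 2). apply (is_derive_of_quadratic dlf 0 (/ 2) 1 1); [lra|]. intros y Hy.
    rewrite Rminus_0_r in *. rewrite dlf_0. destruct (Req_dec y 0) as [->|Hy0].
    { rewrite dlf_0, Rmult_0_l, !Rminus_0_r, Rabs_R0. lra. }
    assert (B := sub_ln_1p_bounds (y ^ 2) (pow2_ge_0 y)).
    replace (dlf y - 0 - y * / 2) with (- ((y ^ 2 - ln (1 + y ^ 2)) / (2 * y))) by (unfold dlf, hlog; field; auto). rewrite Rabs_Ropp.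
    unfold Rdiv. rewrite Rabs_mult, (Rabs_right (_ - _)), Rabs_inv, Rabs_mult, (Rabs_right 2) by lra. assert (Hya := Rabs_pos_lt y Hy0).
    rewrite <- (pow2_abs y) in *. set (r := Rabs y) in *. apply Rle_trans with ((r ^ 2) ^ 2 / 2 * / (2 * r)).
    + pos.
    + replace ((r ^ 2) ^ 2 / 2 * / (2 * r)) with (r ^ 2 * (r / 4)) by (field; lra). nra.
  - apply (ex_derive_continuous (V := R_NormedModule)). unfold dlf, hlog. auto_derive. nra.
Qed.

Lemma is_derive_dilog (v : R) : is_derive dilog v (dlf v).
Proof.
  apply (is_derive_RInt dlf dilog 0 v).
  - apply filter_forall. intros y. apply (RInt_correct (V := R_CompleteNormedModule)).
    apply (ex_RInt_continuous (V := R_CompleteNormedModule)). intros; apply dlf_cont.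
  - apply dlf_cont.
Qed.

Lemma dilog_0 : dilog 0 = 0.
Proof. apply (RInt_point (V := R_CompleteNormedModule)). Qed.

Lemma dilog_bound t : 0 < t -> 0 <= dilog t <= t.
Proof.
  intros Ht. assert (B : forall x, 0 <= x <= t -> 0 <= dlf x <= 1).
  { intros x Hx. destruct (Req_dec x 0) as [->|H].
    - rewrite dlf_0. lra.
    - assert (H1 := hlog_bound x ltac:(lra)). split.
      + apply Rdiv_le_0_compat; lra.
      + apply Rle_div_l; lra. }
  split.
  - rewrite <- dilog_0. apply (nondecreasing_of_deriv dilog dlf); [lra| |apply B]. intros; apply is_derive_dilog.
  - assert (H := deriv_bound dilog dlf 0 t 1). rewrite Rmin_left, Rmax_right in H by lra.
    assert (H2 : Rabs (dilog t - dilog 0) <= 1 * Rabs (t - 0)).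
    { apply H; [intros; apply is_derive_dilog|]. intros x Hx. apply B in Hx. apply Rabs_le. lra. }
    rewrite dilog_0, !Rminus_0_r, (Rabs_right t) in H2 by lra. assert (H3 := Rle_abs (dilog t)). lra.
Qed.

Lemma alternating_inv_sq N :
  psum (fun i => (-1) ^ i / INR (S i) ^ 2) (2 * N) =
  psum (fun i => / INR (S i) ^ 2) (2 * N) - / 2 * psum (fun i => / INR (S i) ^ 2) N.
Proof.
  induction N as [|N IH]; [simpl; ring|]. replace (2 * S N)%nat with (S (S (2 * N))) by lia. cbn [psum]. rewrite IH.
  replace ((-1) ^ S (2 * N)) with (-1).
  - rewrite pow_1_even. replace (INR (S (S (2 * N)))) with (2 * INR (S N)) by (rewrite !S_INR, mult_INR; simpl; ring). field. pos.
  - rewrite <- tech_pow_Rmult, pow_1_even. ring.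
Qed.

Lemma ln_1p_partial_bound N x : 0 <= x ->
  Rabs (ln (1 + x) - psum (fun i => (-1) ^ i * x ^ S i / INR (S i)) N) <= x ^ S N / INR (S N).
Proof.
  intros Hx. assert (G : forall t, 0 <= t -> psum (fun i => (-1) ^ i * t ^ i) N = (1 - (-1) ^ N * t ^ N) / (1 + t)).
  { intros t Ht. induction N as [|N IH]; simpl; [field; lra|]. rewrite IH. field. lra. }
  assert (D : forall n (t : R), is_derive (fun t => t ^ S n / INR (S n)) t (t ^ n)).
  { intros n t. auto_derive; auto. replace (match n with O => 1 | S _ => INR n + 1 end) with (INR (S n)) by (destruct n; simpl; auto).
    field. pos. }
  assert (P : forall t : R, is_derive (fun t => psum (fun i => (-1) ^ i * t ^ S i / INR (S i)) N) t (psum (fun i => (-1) ^ i * t ^ i) N)).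
  { intros t. clear -D. induction N as [|N IH]; cbn [psum].
    - apply is_derive_Rconst.
    - apply is_derive_Rplus; auto. eapply is_derive_ext; [|apply (is_derive_Rscal _ t _ ((-1) ^ N) (D N t))]. intros; pos. }
  assert (H := deriv_comparison
    (fun t => ln (1 + t) - psum (fun i => (-1) ^ i * t ^ S i / INR (S i)) N)
    (fun t => / (1 + t) - psum (fun i => (-1) ^ i * t ^ i) N)
    (fun t => t ^ S N / INR (S N)) (fun t => t ^ N) 0 x Hx).
  assert (Z : psum (fun i => (-1) ^ i * 0 ^ S i / INR (S i)) N = 0).
  { rewrite (psum_ext _ (fun _ => 0)), psum_const by (intros; simpl; unfold Rdiv; ring). ring. }
  cbv beta in H. rewrite Z, Rplus_0_r, ln_1 in H.
  replace (0 ^ S N / INR (S N)) with 0 in H by (rewrite pow_ne_zero by lia; unfold Rdiv; ring). rewrite !Rminus_0_r in H. apply H.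
  - intros t Ht. apply is_derive_Rminus; auto. auto_derive; [lra|]. lra.
  - intros; auto.
  - intros t Ht. rewrite G by lra.
    replace (/ (1 + t) - (1 - (-1) ^ N * t ^ N) / (1 + t)) with ((-1) ^ N * (t ^ N * / (1 + t))) by (field; lra).
    assert (HtN : 0 <= t ^ N) by pos. assert (Hi : 0 < / (1 + t) <= 1).
    { rewrite <- Rinv_1. pos. }
    rewrite Rabs_mult, pow_1_abs, Rmult_1_l, Rabs_right by (apply Rle_ge; nra). nra.
Qed.

(** [dilog] minus its truncated series has on [[0, 1]] a derivative of size at most [/ INR (S N)],
    by the alternating estimate for [ln (1 + x^2)]. This reaches the end point [1] without Abel
    summation. *)
Lemma dilog_1_bound N : Rabs (dilog 1 - / 4 * psum (fun i => (-1) ^ i / INR (S i) ^ 2) N) <= / INR (S N).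
Proof.
  set (P := fun v => psum (fun i => / 4 * ((-1) ^ i * (v ^ 2) ^ S i / INR (S i) ^ 2)) N).
  assert (D : forall v : R, is_derive P v (psum (fun i => / 2 * ((-1) ^ i * (v ^ (2 * i + 1)) / INR (S i))) N)).
  { intros v. induction N as [|N IH]; cbn [psum].
    - apply is_derive_Rconst.
    - apply is_derive_Rplus; auto. apply (is_derive_ext (fun v => / 4 * (-1) ^ N / INR (S N) ^ 2 * v ^ (2 * S N))).
      + intros t. rewrite pow_mult. lra.
      + assert (HN : INR (S N) <> 0) by (apply not_0_INR; lia).
        eapply is_derive_eq; [apply is_derive_Rscal, is_derive_Reals, derivable_pt_lim_pow|].
        replace (pred (2 * S N)) with (2 * N + 1)%nat by lia. rewrite mult_INR. change (INR 2) with 2. field; lra. }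
  assert (H := deriv_bound (fun v => dilog v - P v)
    (fun v => dlf v - psum (fun i => / 2 * ((-1) ^ i * (v ^ (2 * i + 1)) / INR (S i))) N) 0 1 (/ INR (S N))).
  rewrite Rmin_left, Rmax_right in H by lra. assert (P0 : P 0 = 0).
  { unfold P. rewrite (psum_ext _ (fun _ => 0)), psum_const by (intros; simpl; unfold Rdiv; ring). ring. }
  assert (P1 : P 1 = / 4 * psum (fun i => (-1) ^ i / INR (S i) ^ 2) N).
  { rewrite <- psum_scal. apply psum_ext. intros i _. rewrite !pow1. lra. }
  rewrite P0, P1, dilog_0, !Rminus_0_r, Rabs_R1, Rmult_1_r in H. apply H.
  - intros x _. apply is_derive_Rminus; [apply is_derive_dilog|apply D].
  - intros x Hx. assert (HN : 0 < / INR (S N)) by (apply Rinv_0_lt_compat, lt_0_INR; lia). destruct (Req_dec x 0) as [->|Hx0].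
    { rewrite dlf_0, (psum_ext _ (fun _ => 0)), psum_const; [rewrite Rmult_0_r, Rminus_0_r, Rabs_R0; lra|]. intros i _.
      rewrite pow_ne_zero by lia. lra. }
    replace (dlf x - psum (fun i => / 2 * ((-1) ^ i * x ^ (2 * i + 1) / INR (S i))) N)
      with (/ (2 * x) * (ln (1 + x ^ 2) - psum (fun i => (-1) ^ i * (x ^ 2) ^ S i / INR (S i)) N)).
    + rewrite Rabs_mult, Rabs_right by (apply Rle_ge, Rlt_le, Rinv_0_lt_compat; lra).
      apply Rle_trans with (/ (2 * x) * ((x ^ 2) ^ S N / INR (S N))).
      * apply Rmult_le_compat_l; [pos|apply ln_1p_partial_bound, pow2_ge_0].
      * replace (/ (2 * x) * ((x ^ 2) ^ S N / INR (S N))) with (x / 2 * (x ^ 2) ^ N * / INR (S N))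
          by (rewrite <- (tech_pow_Rmult (x ^ 2) N); field; split; [apply not_0_INR; lia|auto]).
        rewrite <- (Rmult_1_l (/ INR (S N))) at 2. apply Rmult_le_compat_r; [lra|]. assert (0 <= (x ^ 2) ^ N <= 1).
        { split; [apply pow_le, pow2_ge_0|]. rewrite <- (pow1 N). apply pow_incr. nra. }
        nra.
    + rewrite Rmult_minus_distr_l, <- psum_scal. f_equal; [unfold dlf, hlog; field; auto|]. apply psum_ext. intros i _.
      rewrite pow_add, pow_mult, pow_1, <- (tech_pow_Rmult (x ^ 2) i). field. pos.
Qed.

(** A quarter of the alternating sum of inverse squares, which is half of [PI ^ 2 / 6]. *)
Lemma dilog_1 : dilog 1 = PI ^ 2 / 48.
Proof.
  set (b := psum (fun i => / INR (S i) ^ 2)). assert (Hb : is_lim_seq b (PI ^ 2 / 6)) by (apply is_series_psum, basel).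
  assert (Hb2 : is_lim_seq (fun N => b (2 * N)%nat) (PI ^ 2 / 6)).
  { apply (is_lim_seq_subseq b); [|exact Hb]. apply eventually_subseq. lia. }
  assert (L1 : is_lim_seq (fun N => / 4 * (b (2 * N)%nat - / 2 * b N)) (PI ^ 2 / 48)).
  { replace (PI ^ 2 / 48) with (/ 4 * (PI ^ 2 / 6 - / 2 * (PI ^ 2 / 6))) by field.
    apply (is_lim_seq_scal_l (fun N => b (2 * N)%nat - / 2 * b N) (/ 4) (PI ^ 2 / 6 - / 2 * (PI ^ 2 / 6))). apply is_lim_seq_minus'; auto.
    apply (is_lim_seq_scal_l b (/ 2) (PI ^ 2 / 6)); auto. }
  assert (L2 : is_lim_seq (fun N => / 4 * (b (2 * N)%nat - / 2 * b N)) (dilog 1)).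
  { assert (L0 : is_lim_seq (fun N => / INR (S N)) 0) by apply is_lim_seq_inv_S.
    apply is_lim_seq_le_le with (u := fun N => dilog 1 - / INR (S N)) (w := fun N => dilog 1 + / INR (S N)).
    - intros N. assert (H := dilog_1_bound (2 * N)). rewrite alternating_inv_sq in H. fold (b (2 * N)%nat) (b N) in H.
      assert (H2 : / INR (S (2 * N)) <= / INR (S N)).
      { apply Rinv_le_contravar; [pos|apply le_INR; lia]. }
      apply Rabs_le_between in H. lra.
    - replace (Finite (dilog 1)) with (Finite (dilog 1 - 0)) by (f_equal; ring).
      apply (is_lim_seq_minus' (fun _ => dilog 1)); [apply is_lim_seq_const|auto].
    - replace (Finite (dilog 1)) with (Finite (dilog 1 + 0)) by (f_equal; ring).
      apply (is_lim_seq_plus' (fun _ => dilog 1)); [apply is_lim_seq_const|auto]. }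
  assert (H1 := is_lim_seq_unique _ _ L1). assert (H2 := is_lim_seq_unique _ _ L2). congruence.
Qed.

(** Inversion formula of the dilogarithm: the difference of the two sides has derivative zero, and
    twice [dilog 1] fixes the constant. *)
Lemma dilog_inv v : 0 < v -> dilog v + dilog (/ v) = / 2 * ln v ^ 2 + PI ^ 2 / 24.
Proof.
  intros Hv. assert (H := deriv_bound (fun v => dilog v + dilog (/ v) - / 2 * ln v ^ 2) (fun _ => 0) 1 v 0). cbv beta in H.
  rewrite Rinv_1, ln_1, dilog_1, Rmult_0_l in H.
  assert (Hp : forall x, Rmin 1 v <= x -> 0 < x) by (intros x Hx; assert (0 < Rmin 1 v) by (apply Rmin_glb_lt; lra); lra).
  assert (H2 : Rabs (dilog v + dilog (/ v) - / 2 * ln v ^ 2 - (PI ^ 2 / 48 + PI ^ 2 / 48 - / 2 * 0 ^ 2)) <= 0).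
  { apply H; [|intros; rewrite Rabs_R0; lra]. intros x [Hx _]. apply Hp in Hx. eapply is_derive_eq.
    - apply is_derive_Rminus; [apply is_derive_Rplus|].
      + apply is_derive_dilog.
      + apply (is_derive_Rcomp dilog Rinv); [apply is_derive_dilog|]. apply (is_derive_inv (fun x => x) x 1); [apply is_derive_Rid|lra].
      + apply is_derive_Rscal. apply (is_derive_Rcomp (fun y => y ^ 2) ln); [|apply is_derive_Reals, derivable_pt_lim_ln; auto].
        apply is_derive_Reals, derivable_pt_lim_pow.
    - unfold dlf, hlog. replace (1 + (/ x) ^ 2) with ((1 + x ^ 2) * (/ x * / x)) by (field; lra). assert (Hi := Rinv_0_lt_compat x Hx).
      rewrite !ln_mult, ln_Rinv by nra. simpl INR. simpl pred. field. lra. }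
  assert (H3 := Rabs_pos (dilog v + dilog (/ v) - / 2 * ln v ^ 2 - (PI ^ 2 / 48 + PI ^ 2 / 48 - / 2 * 0 ^ 2))).
  apply Rle_antisym in H2; auto. symmetry in H2. apply Rabs_eq_0 in H2. lra.
Qed.

(** * Integrals of [K_0] against functions of [b / y] *)

Lemma KR0_integrable : exists l, iint_0_oo (KR 0) l /\ 0 <= l.
Proof.
  exists (Mel (KR 0) 0 1). split; [|apply Rlt_le, MKl_pos; lra]. apply (iint_ext _ _ _ improper_0_oo (Kmel 0 1)); [|apply MKl_iint; lra].
  intros x Hx. unfold mint. rewrite Rminus_diag, Rpower_O, pow_O by auto. ring.
Qed.

(** A multiplicative convolution, so that [b d/db] acts on [u] alone: the chain [dilog], [hlog],
    [hfrac] becomes the chain of Euler derivatives of [PsiF dilog]. *)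
Definition PsiF (u : R -> R) (b : R) : R := iintv (fun y => KR 0 y * (y * u (b / y))).

Lemma cont_on_PsiF (u : R -> R) b : 0 < b -> cont_on (fun t => 0 < t) u ->
  cont_on (fun y => 0 < y) (fun y => KR 0 y * (y * u (b / y))).
Proof.
  intros Hb Hu. apply (cont_on_mult _ (KR 0) (fun y => y * u (b / y))); [apply cont_on_KR0|].
  apply (cont_on_mult _ (fun y => y) (fun y => u (b / y))); [apply cont_on_id|]. intros y Hy. apply (continuous_comp (fun y => b / y) u).
  - apply (ex_derive_continuous (V := R_NormedModule)). auto_derive. lra.
  - apply Hu. pos.
Qed.

Lemma PsiF_iint (u : R -> R) C : cont_on (fun t => 0 < t) u -> (forall t, 0 < t -> Rabs (u t) <= C * t) ->
  exists A, 0 <= A /\ forall b, 0 < b ->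
    iint_0_oo (fun y => KR 0 y * (y * u (b / y))) (PsiF u b) /\ Rabs (PsiF u b) <= A * b.
Proof.
  intros Hc Hu. destruct KR0_integrable as [l [Hl Hl0]]. assert (HC : 0 <= C).
  { specialize (Hu 1 ltac:(lra)). assert (H := Rabs_pos (u 1)). lra. }
  exists (C * l). split; [nra|]. intros b Hb.
  destruct (iint_dominated _ _ _ improper_0_oo (fun y => KR 0 y * (y * u (b / y))) (fun y => (C * b) * KR 0 y) ((C * b) * l)) as [I [HI HIb]].
  - apply cont_on_PsiF; auto.
  - apply cont_on_scal, cont_on_KR0.
  - intros y Hy. assert (HK := KR0_pos y Hy). specialize (Hu (b / y) ltac:(pos)).
    rewrite !Rabs_mult, (Rabs_right (KR 0 y)), (Rabs_right y) by lra.
    replace (C * b * KR 0 y) with (KR 0 y * (y * (C * (b / y)))) by (field; lra). pos.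
  - apply (iint_scal _ _ _ improper_0_oo); auto. apply cont_on_KR0.
  - unfold PsiF. rewrite (iintv_eq _ _ HI). pos.
Qed.

Lemma cont_on_K_id : cont_on (fun y => 0 < y) (fun y => KR 0 y * y).
Proof. apply (cont_on_mult _ (KR 0) (fun y => y)); [apply cont_on_KR0|apply cont_on_id]. Qed.

Lemma is_derive_PsiF (u u1 u2 : R -> R) C C2 (b : R) :
  (forall t : R, 0 < t -> is_derive u t (u1 t / t)) -> (forall t : R, 0 < t -> is_derive u1 t (u2 t / t)) ->
  (forall t, 0 < t -> Rabs (u t) <= C * t) -> (forall t, 0 < t -> Rabs (u1 t) <= C * t) ->
  (forall t, 0 < t -> Rabs (u2 t) <= C2) -> 0 < b -> is_derive (PsiF u) b (PsiF u1 b / b).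
Proof.
  intros D0 D1 B0 B1 B2 Hb. assert (c0 : cont_on (fun t => 0 < t) u) by exact (is_derive_cont_on _ _ _ D0).
  assert (c1 : cont_on (fun t => 0 < t) u1) by exact (is_derive_cont_on _ _ _ D1). destruct (PsiF_iint u C c0 B0) as [A [_ HA]].
  destruct (PsiF_iint u1 C c1 B1) as [A1 [_ HA1]].
  assert (E : forall (v v1 : R -> R) (p y : R), (forall t : R, 0 < t -> is_derive v t (v1 t / t)) -> 0 < y ->
    is_derive (fun p => KR 0 y * (y * v (exp p / y))) p (KR 0 y * (y * v1 (exp p / y)))).
  { intros v v1 p y Hv Hy. assert (He := exp_pos p). eapply is_derive_eq.
    - apply is_derive_Rscal, is_derive_Rscal. apply (is_derive_Rcomp v (fun p => exp p / y)).
      + apply Hv. pos.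
      + apply (is_derive_ext (fun p => / y * exp p)); [intros; unfold Rdiv; eqR; ring|]. apply is_derive_Rscal, is_derive_exp.
    - field. lra. }
  (* In the variable [p = ln b] the Euler derivative is the ordinary one, and a constant bound on
     [u2] gives a majorant independent of [p]. *)
  assert (H : is_derive (fun p => PsiF u (exp p)) (ln b) (PsiF u1 b)).
  { apply (is_derive_iint _ _ _ improper_0_oo (fun p y => KR 0 y * (y * u (exp p / y)))
      (fun p y => KR 0 y * (y * u1 (exp p / y))) (fun p y => KR 0 y * (y * u2 (exp p / y)))
      (fun y => C2 * (KR 0 y * y)) (fun p => PsiF u (exp p)) (ln b) 1 (PsiF u1 b) (C2 * 1)); try lra.
    - intros p _. apply cont_on_PsiF; auto. apply exp_pos.
    - apply cont_on_PsiF; auto. apply exp_pos.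
    - apply cont_on_scal, cont_on_K_id.
    - auto.
    - auto.
    - intros p y _ Hy. assert (HK := KR0_pos y Hy). specialize (B2 (exp p / y) ltac:(pos)).
      rewrite !Rabs_mult, (Rabs_right (KR 0 y)), (Rabs_right y) by lra. replace (C2 * (KR 0 y * y)) with (KR 0 y * (y * C2)) by ring. pos.
    - apply (iint_scal _ _ _ improper_0_oo); [apply cont_on_K_id|apply MK2_iint].
    - intros p _. apply HA, exp_pos.
    - rewrite exp_ln by auto. apply HA1; auto. }
  apply (is_derive_ext_loc (fun b => PsiF u (exp (ln b)))).
  - apply (filter_imp (fun y => 0 < y)); [|apply locally_gt; auto]. intros y Hy. rewrite exp_ln; auto.
  - apply (is_derive_Rcomp (fun p => PsiF u (exp p)) ln); auto. apply is_derive_Reals, derivable_pt_lim_ln; auto.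
Qed.

Lemma is_derive_dilog' (t : R) : 0 < t -> is_derive dilog t (hlog t / t).
Proof. intros _. apply is_derive_dilog. Qed.

Lemma Rabs_dilog t : 0 < t -> Rabs (dilog t) <= 1 * t.
Proof. intros Ht. assert (H := dilog_bound t Ht). rewrite Rabs_right; lra. Qed.

Lemma Rabs_hlog t : 0 < t -> Rabs (hlog t) <= 1 * t.
Proof. intros Ht. assert (H := hlog_bound t Ht). rewrite Rabs_right; lra. Qed.

Lemma Rabs_hfrac t : 0 < t -> Rabs (hfrac t) <= 1 * t.
Proof. intros Ht. assert (H := hfrac_bound t Ht). rewrite Rabs_right; lra. Qed.

Lemma is_derive_Psi_dilog (b : R) : 0 < b -> is_derive (PsiF dilog) b (PsiF hlog b / b).
Proof.
  apply (is_derive_PsiF dilog hlog hfrac 1 1).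
  - apply is_derive_dilog'.
  - apply is_derive_hlog.
  - apply Rabs_dilog.
  - apply Rabs_hlog.
  - intros t Ht. assert (H := hfrac_bound t Ht). rewrite Rabs_right; lra.
Qed.

Lemma is_derive_Psi_hlog (b : R) : 0 < b -> is_derive (PsiF hlog) b (PsiF hfrac b / b).
Proof.
  apply (is_derive_PsiF hlog hfrac (fun t => 2 * t ^ 2 / (1 + t ^ 2) ^ 2) 1 2).
  - apply is_derive_hlog.
  - apply is_derive_hfrac.
  - apply Rabs_hlog.
  - apply Rabs_hfrac.
  - intros t Ht. assert (H := one_plus_sq_pos t). rewrite Rabs_right.
    + apply Rle_div_l; [apply pow_lt; auto|]. nra.
    + pos.
Qed.

Lemma is_derive_scaled (v v1 : R -> R) (b y : R) : 0 < b -> (forall t : R, 0 < t -> is_derive v t (v1 t / t)) -> 0 < y ->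
  is_derive (fun y => v (y / b)) y (v1 (y / b) / y).
Proof.
  intros Hb Hv Hy. eapply is_derive_eq; [apply (is_derive_Rcomp v (fun y => y / b)); [apply Hv; pos|]|].
  - apply (is_derive_ext (fun y => / b * y)); [intros; unfold Rdiv; eqR; ring|]. apply is_derive_Rscal, is_derive_Rid.
  - field. lra.
Qed.

Lemma cont_on_scaled (v v1 : R -> R) (b : R) : 0 < b -> (forall t : R, 0 < t -> is_derive v t (v1 t / t)) ->
  cont_on (fun y => 0 < y) (fun y => v (y / b)).
Proof. intros Hb Hv. exact (is_derive_cont_on _ _ _ (fun y => is_derive_scaled v v1 b y Hb Hv)). Qed.

(* [theta (K theta u - u theta K) = K theta^2 u - y^2 u K] with [u y = dilog (y / b)]
   integrates to [0]. *)
Lemma K_dilog_parts b : 0 < b ->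
  iint_0_oo (fun y => KR 0 y * (hfrac (y / b) / y) + -1 * (KR 0 y * (y * dilog (y / b)))) 0.
Proof.
  intros Hb. cut (iint_0_oo (fun y => KR 0 y * (hfrac (y / b) / y) + -1 * (KR 0 y * (y * dilog (y / b)))) (0 - 0));
    [rewrite Rminus_0_r; auto|].
  assert (Hin : forall y, 0 < y -> 0 < y / b) by (intros; apply Rdiv_lt_0_compat; auto).
  assert (Hbound : forall x, 0 < x -> Rabs (KR 0 x * hlog (x / b) + -1 * (dilog (x / b) * LR x))
    <= (Rabs (KR 0 x) + Rabs (LR x)) * (x / b)).
  { intros x Hx. assert (H1 := Rabs_hlog _ (Hin x Hx)). assert (H2 := Rabs_dilog _ (Hin x Hx)). assert (H3 := Rabs_pos (KR 0 x)).
    assert (H4 := Rabs_pos (LR x)). via Rabs_triang.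
    rewrite !Rabs_mult, (Rabs_left (-1)), Rmult_plus_distr_r, <- (Rmult_assoc (- -1)), (Rmult_comm (Rabs (LR x))) by lra. nra. }
  apply (iint_primitive _ _ _ improper_0_oo (fun y => KR 0 y * hlog (y / b) + -1 * (dilog (y / b) * LR y))).
  - intros y Hy. eapply is_derive_eq.
    + apply is_derive_Rplus; [|apply is_derive_Rscal].
      * apply (is_derive_Rmult (KR 0) (fun y => hlog (y / b))); [apply is_derive_KR0; auto|]. apply (is_derive_scaled hlog hfrac); auto.
        apply is_derive_hlog.
      * apply (is_derive_Rmult (fun y => dilog (y / b)) LR); [|apply is_derive_LR; auto]. apply (is_derive_scaled dilog hlog); auto.
        apply is_derive_dilog'.
    + lra.
  - apply cont_on_plus; [|apply cont_on_scal].
    + apply (cont_on_mult _ (KR 0) (fun y => hfrac (y / b) / y)); [apply cont_on_KR0|].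
      apply (cont_on_mult _ (fun y => hfrac (y / b)) Rinv).
      * eapply cont_on_scaled; [auto|apply is_derive_hfrac].
      * intros y Hy. apply (ex_derive_continuous (V := R_NormedModule)). auto_derive. lra.
    + apply (cont_on_mult _ (KR 0) (fun y => y * dilog (y / b))); [apply cont_on_KR0|].
      apply (cont_on_mult _ (fun y => y) (fun y => dilog (y / b))); [apply cont_on_id|]. eapply cont_on_scaled; [auto|apply is_derive_dilog'].
  - apply (lim_lo_log (fun y => KR 0 y * hlog (y / b) + -1 * (dilog (y / b) * LR y)) ((KR 0 1 + 3) / b) 0 1). intros x Hx.
    rewrite Rminus_0_r, pow_1. eapply Rle_trans; [apply Hbound; lra|]. assert (H1 := KR0_near_0 x Hx).
    assert (H2 := LR_near_0 x ltac:(lra)). assert (H3 : Rabs (LR x) <= 2) by (apply Rabs_le_between in H2; apply Rabs_le; lra).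
    assert (H4 := Rabs_pos (ln x)).
    replace ((KR 0 1 + 3) / b * (x * (1 + Rabs (ln x)))) with ((KR 0 1 + 3) * (1 + Rabs (ln x)) * (x / b)) by (field; lra). pos.
  - apply (lim_hi_0 (fun y => KR 0 y * hlog (y / b) + -1 * (dilog (y / b) * LR y)) (32 / b)). intros x Hx.
    eapply Rle_trans; [apply Hbound; lra|]. assert (H1 := KR_bound 0 x 2 ltac:(lra) ltac:(lia)).
    assert (H2 := LR_bound x 3 ltac:(lra) ltac:(lia)).
    replace (32 / b / x) with ((4 * INR (fact 2) / x ^ 2 + x * (4 * INR (fact 3) / x ^ 3)) * (x / b)) by (simpl; field; lra). pos.
Qed.

Lemma iint_lin c f g lf lg :
  cont_on (fun y => 0 < y) f /\ iint_0_oo f lf -> cont_on (fun y => 0 < y) g /\ iint_0_oo g lg ->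
  cont_on (fun y => 0 < y) (fun y => c * f y + g y) /\ iint_0_oo (fun y => c * f y + g y) (c * lf + lg).
Proof.
  intros [cf If] [cg Ig]. assert (ccf : cont_on (fun y => 0 < y) (fun y => c * f y)) by (apply cont_on_scal; auto).
  split; [apply cont_on_plus; auto|]. apply (iint_plus _ _ _ improper_0_oo (fun y => c * f y)); auto.
  apply (iint_scal _ _ _ improper_0_oo); auto.
Qed.

(** * The power series of [J_0] and its companions *)

(** [E2 a] on the imaginary axis, where it is real. In particular [Em ci] is [J_0]. *)
Definition Em (a : nat -> R) (x : R) : R := PSeries a (- (x ^ 2 / 4)).

Lemma Em_E2 a (x : R) : E2 a (x * Ci)%C = Em a x.
Proof.
  unfold E2, Em. rewrite <- CPS_Re_real. f_equal. replace ((x * Ci) ^ 2 / 4)%C with ((/ 4)%R * (x * Ci * (x * Ci)))%C.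
  - apply C_eq_Re_Im; simpl; field.
  - rewrite RtoC_inv by lra. field.
Qed.

Lemma is_derive_Em a (x : R) : entire a -> 0 < x -> is_derive (Em a) x (Em (th a) x / x).
Proof.
  intros Ha Hx. assert (Hix : (x * Ci)%C <> RtoC 0).
  { intros E. apply (f_equal Im) in E. simpl in E. lra. }
  destruct (Cdiff_curve _ (fun t => t * Ci)%C x _ _ (E2_th a _ Ha Hix) (is_Cderive_ray Ci x)) as [H _].
  replace (E2 (th a) (x * Ci) / (x * Ci) * Ci)%C with (RtoC (Em (th a) x / x)) in H.
  - apply (is_derive_ext (fun t : R => Re (E2 a (t * Ci)%C))); [|exact H]. intros t. rewrite Em_E2. reflexivity.
  - rewrite Em_E2, RtoC_div by lra. field. split; [|intros E; apply RtoC_inj in E; lra]. intros E. apply (f_equal Im) in E. simpl in E.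
    lra.
Qed.

Lemma Em_shift a c (x : R) : entire a -> a O = 0 -> (forall r, a (S r) = 4 * c r) -> entire c ->
  Em a x = - (x ^ 2 * Em c x).
Proof.
  intros Ha H0 H Hc. apply RtoC_inj. rewrite <- Em_E2, (E2_shift a c) by auto. rewrite Em_E2.
  replace ((x * Ci) ^ 2)%C with (RtoC (- x ^ 2)) by (apply C_eq_Re_Im; simpl; ring). rewrite <- RtoC_mult. f_equal. ring.
Qed.

Lemma Em_bound a : entire a -> exists K, 0 <= K /\ forall x, 0 < x <= 1 -> Rabs (Em a x - a O) <= K * x ^ 2.
Proof.
  intros Ha. destruct (E2_bound a Ha) as [K [HK H]]. exists K. split; auto. intros x Hx.
  assert (Hm : Cmod (x * Ci)%C = x) by (rewrite Cmod_mult, Cmod_R, Cmod_Ci, Rabs_right; lra). specialize (H (x * Ci)%C ltac:(lra)).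
  rewrite Em_E2, <- RtoC_minus, Cmod_R, Hm in H. lra.
Qed.

Lemma Em_plus a c x : entire a -> entire c -> Em (fun n => a n + c n) x = Em a x + Em c x.
Proof. intros Ha Hc. apply RtoC_inj. rewrite RtoC_plus, <- !Em_E2. apply CPS_plus; auto. Qed.

Lemma Em_scal k a x : entire a -> Em (fun n => k * a n) x = k * Em a x.
Proof. intros Ha. apply RtoC_inj. rewrite RtoC_mult, <- !Em_E2. apply CPS_scal; auto. Qed.

(** [ci r], [p1 r] and [p2 r] are the coefficients of [1], [t] and [t^2] in the product over
    [1 <= i <= r] of [(i - t / 2)^(-2)]: the Frobenius coefficients of the Bessel equation, expanded
    in the shift of the exponent. *)
Definition p1 (r : nat) : R := Hn r * ci r.
Definition p2 (r : nat) : R := (/ 2 * Hn r ^ 2 + / 4 * H2n r) * ci r.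

Lemma entire_p1 : entire p1.
Proof.
  apply (entire_le _ (fun r => (Hn r + 0) * ci r)); [|apply entire_Hn_ci]. intros r. unfold p1. rewrite Rplus_0_r. lra.
Qed.

Lemma entire_p2 : entire p2.
Proof.
  apply (entire_poly_ci p2 1). intros r. assert (H := ci_pos r). assert (Hh := Hn_bound r). assert (H2 : 0 <= H2n r <= INR r).
  { split.
    - apply psum_pos. intros; pos.
    - rewrite <- (Rmult_1_r (INR r)), <- psum_const. apply psum_le. intros i _. assert (Hi := one_le_INR_S i). rewrite <- Rinv_1.
      apply Rinv_le_contravar; [lra|]. nra. }
  rewrite Rabs_right by (apply Rle_ge, Rmult_le_pos; nra). rewrite <- Rmult_assoc. apply Rmult_le_compat_r; nra.
Qed.

Lemma Em_ode_0 (x : R) : Em (th (th ci)) x = - (x ^ 2 * Em ci x).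
Proof.
  apply Em_shift.
  - apply entire_th, entire_th, entire_ci.
  - unfold th. simpl; lra.
  - intros r. unfold th. rewrite <- (ci_S r). ring.
  - apply entire_ci.
Qed.

(** The Frobenius series [f] built on that product satisfies [(theta - t)^2 f = - x^2 f + t^2] with
    [theta = x d/dx]. This is its [t] part; [Em_ode_2] is its [t^2] part, where the inhomogeneity
    contributes the [1]. *)
Lemma Em_ode_1 (x : R) : Em (th (th p1)) x = 2 * Em (th ci) x - x ^ 2 * Em p1 x.
Proof.
  assert (H1 : entire (th (th p1))) by apply entire_th, entire_th, entire_p1. assert (H2 : entire (th ci)) by apply entire_th, entire_ci.
  assert (H := Em_shift (fun n => th (th p1) n + -2 * th ci n) p1 x). rewrite Em_plus, Em_scal in H by (auto; apply entire_scal; auto).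
  assert (Em (th (th p1)) x + -2 * Em (th ci) x = - (x ^ 2 * Em p1 x)); [apply H|lra].
  - apply entire_plus; auto. apply entire_scal; auto.
  - unfold th. simpl; lra.
  - intros r. unfold th, p1. change (Hn (S r)) with (Hn r + / INR (S r)). rewrite <- (ci_S r). field. pos.
  - apply entire_p1.
Qed.

Lemma Em_ode_2 (x : R) : Em (th (th p2)) x = 2 * Em (th p1) x - (Em ci x - 1) - x ^ 2 * Em p2 x.
Proof.
  assert (H1 : entire (th (th p2))) by apply entire_th, entire_th, entire_p2. assert (H2 : entire (th p1)) by apply entire_th, entire_p1.
  set (c0 := fun r => match r with O => 0 | S _ => ci r end). assert (H3 : entire c0).
  { apply (entire_le _ ci); [|apply entire_ci]. intros [|r]; simpl; [rewrite Rabs_R0; apply Rabs_pos|lra]. }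
  assert (E0 : Em c0 x = Em ci x - 1).
  { apply RtoC_inj. rewrite RtoC_minus, <- !Em_E2. unfold E2. rewrite (CPS_decr c0), (CPS_decr ci) by (auto; apply entire_ci).
    replace (ci 0) with 1 by (unfold ci; simpl; field). simpl; ring. }
  assert (H := Em_shift (fun n => th (th p2) n + (-2 * th p1 n + c0 n)) p2 x).
  rewrite !Em_plus, Em_scal, E0 in H by (repeat first [apply entire_plus|apply entire_scal|assumption]).
  assert (Em (th (th p2)) x + (-2 * Em (th p1) x + (Em ci x - 1)) = - (x ^ 2 * Em p2 x)); [apply H|lra].
  - repeat first [apply entire_plus|apply entire_scal|assumption].
  - unfold th, c0. simpl; lra.
  - intros r. unfold th, p2, p1, c0. change (Hn (S r)) with (Hn r + / INR (S r)). change (H2n (S r)) with (H2n r + / INR (S r) ^ 2).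
    rewrite <- (ci_S r). field. pos.
  - apply entire_p2.
Qed.

Lemma ci_0 : ci 0 = 1.
Proof. unfold ci. simpl; lra. Qed.

Lemma is_derive_Em_energy (x : R) : 0 < x ->
  is_derive (fun x => Em ci x ^ 2 + (Em (th ci) x / x) ^ 2) x (- (2 * Em (th ci) x ^ 2 / x ^ 3)).
Proof.
  intros Hx. assert (D0 := is_derive_Em ci x entire_ci Hx). assert (D1 := is_derive_Em (th ci) x (entire_th _ entire_ci) Hx).
  rewrite Em_ode_0 in D1. eapply is_derive_eq.
  - apply (is_derive_Rplus (fun x => Em ci x ^ 2) (fun x => (Em (th ci) x / x) ^ 2)).
    + apply (is_derive_Rcomp (fun y => y ^ 2) (Em ci)); [apply is_derive_Reals, derivable_pt_lim_pow|exact D0].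
    + apply (is_derive_Rcomp (fun y => y ^ 2) (fun x => Em (th ci) x / x)); [apply is_derive_Reals, derivable_pt_lim_pow|].
      apply (is_derive_Rmult (Em (th ci)) Rinv); [exact D1|]. apply (is_derive_inv (fun x => x) x 1); [apply is_derive_Rid|lra].
  - simpl. field. lra.
Qed.

(* The energy [J_0^2 + J_0'^2] is decreasing, so [J_0 b = 1] would force it to be
   constant on [(0, b]]. *)
Lemma J0_neq_1 b : 0 < b -> Em ci b <> 1.
Proof.
  intros Hb HJ. set (E := fun x => Em ci x ^ 2 + (Em (th ci) x / x) ^ 2). assert (Hmono : forall x y, 0 < x <= y -> E y <= E x).
  { intros x y Hxy. assert (H := nondecreasing_of_deriv (fun x => - E x) (fun x => - - (2 * Em (th ci) x ^ 2 / x ^ 3)) x y).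
    enough (- E x <= - E y) by lra. apply H; [lra| |].
    - intros t Ht. apply (is_derive_opp (K := R_AbsRing) (V := R_NormedModule) E), is_derive_Em_energy. lra.
    - intros t Ht. rewrite Ropp_involutive. pos. }
  assert (Hlim : is_lim_seq (fun n => E (/ INR (S n))) 1).
  { destruct (Em_bound ci entire_ci) as [K1 [HK1 B1]]. destruct (Em_bound _ (entire_th _ entire_ci)) as [K2 [HK2 B2]].
    apply (lim_lo_log E (2 * K1 + K1 * K1 + K2 * K2) 1 0). intros x Hx. specialize (B1 x Hx). specialize (B2 x Hx). rewrite ci_0 in B1.
    unfold th at 2 in B2. rewrite Rmult_0_r, Rmult_0_l, Rminus_0_r in B2. assert (Hd : Rabs (Em (th ci) x / x) <= K2 * x).
    { unfold Rdiv. rewrite Rabs_mult, Rabs_inv, (Rabs_right x) by lra. apply Rle_div_l; [lra|]. lra. }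
    unfold E. set (u := Em ci x) in *. set (v := Em (th ci) x / x) in *.
    replace (u ^ 2 + v ^ 2 - 1) with (2 * (u - 1) + (u - 1) * (u - 1) + v * v) by ring. via Rabs_triang.
    eapply Rle_trans; [apply Rplus_le_compat_r, Rabs_triang|]. rewrite !Rabs_mult, (Rabs_right 2) by lra. assert (Hu := Rabs_pos (u - 1)).
    assert (Hv := Rabs_pos v). assert (Hu1 : Rabs (u - 1) <= K1 * x) by nra. nra. }
  assert (Hle : forall x, 0 < x -> E x <= 1).
  { intros x Hx. apply (le_lim_lo E _ _ x); auto. }
  assert (Hb1 : 1 <= E b).
  { unfold E. nra. }
  assert (H1 : forall x, 0 < x < b -> E x = 1).
  { intros x Hx. assert (H := Hmono x b ltac:(lra)). assert (H2 := Hle x ltac:(lra)). lra. }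
  assert (HQ : forall x, 0 < x < b -> Em (th ci) x = 0).
  { intros x Hx. assert (H : - (2 * Em (th ci) x ^ 2 / x ^ 3) = 0).
    { apply (is_derive_local_eq E (fun _ => 1) (fun x => - (2 * Em (th ci) x ^ 2 / x ^ 3)) (fun _ => 0) x 0 b); auto.
      - apply is_derive_Em_energy; lra.
      - apply is_derive_Rconst. }
    assert (H2 : Em (th ci) x ^ 2 = 0).
    { replace (Em (th ci) x ^ 2) with (- (- (2 * Em (th ci) x ^ 2 / x ^ 3)) * (x ^ 3 / 2)) by (field; lra). rewrite H. ring. }
    nra. }
  (* If [J_0'] vanishes on an interval, the Bessel equation forces [J_0 = 0] there, against the
     energy being [1]. *)
  assert (HP : Em ci (b / 2) = 0).
  { assert (H : Em (th (th ci)) (b / 2) / (b / 2) = 0).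
    { apply (is_derive_local_eq (Em (th ci)) (fun _ => 0) (fun x => Em (th (th ci)) x / x) (fun _ => 0) (b / 2) 0 b); auto; [lra| |].
      - apply is_derive_Em; [apply entire_th, entire_ci|lra].
      - apply is_derive_Rconst. }
    rewrite Em_ode_0 in H. replace (Em ci (b / 2)) with (- (- ((b / 2) ^ 2 * Em ci (b / 2)) / (b / 2)) * (2 / b)) by (field; lra).
    rewrite H. ring. }
  assert (H := H1 (b / 2) ltac:(lra)). unfold E in H. rewrite HP, HQ in H by lra. lra.
Qed.

Section BesselJ.

Variable g0 : R.
Hypothesis Hg0 : euler_limit g0.

(** Minus the constant term of [K_0 (b x)] at [x = 0], whose leading part is [- ln x - lam b]. *)
Definition lam (b : R) : R := ln (b / 2) + g0.

Lemma lam_ln b : 0 < b -> lam b = ln b - (ln 2 - g0).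
Proof. intros Hb. unfold lam, Rdiv. rewrite ln_mult, ln_Rinv by lra. ring. Qed.

(** An inhomogeneous Bessel equation for [PsiF dilog]. It is [K_dilog_parts] after inversion of
    [dilog (y / b)]; the squared logarithm is integrated by [K_log_moments]. Half of [PI ^ 2 / 12]
    comes from the inversion formula, half from the second moment. *)
Lemma Psi_hfrac_ode b : 0 < b ->
  PsiF hfrac b = b ^ 2 * (/ 2 * lam b ^ 2 + PI ^ 2 / 12 - PsiF dilog b).
Proof.
  intros Hb. destruct (K_log_moments g0 Hg0) as [M1 M2]. set (c1 := ln 2 - g0) in *. assert (M0 := MK2_iint). assert (I := improper_0_oo).
  destruct (PsiF_iint hfrac 1 (is_derive_cont_on _ _ _ is_derive_hfrac) Rabs_hfrac) as [A2 [_ HA2]].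
  destruct (PsiF_iint dilog 1 (is_derive_cont_on _ _ _ is_derive_dilog') Rabs_dilog) as [A0 [_ HA0]]. destruct (HA2 b Hb) as [J2 _].
  destruct (HA0 b Hb) as [J0 _]. set (f1 := fun y => KR 0 y * y). set (f2 := fun y => KR 0 y * (y * ln y)).
  set (f3 := fun y => KR 0 y * (y * ln y ^ 2)). set (f4 := fun y => KR 0 y * (y * dilog (b / y))).
  set (f5 := fun y => KR 0 y * (y * hfrac (b / y))). assert (k1 : cont_on (fun y => 0 < y) f1) by apply cont_on_K_id.
  assert (k3 : cont_on (fun y => 0 < y) f3).
  { apply (cont_on_mult _ (KR 0) (fun y => y * ln y ^ 2)); [apply cont_on_KR0|].
    apply (cont_on_mult _ (fun y => y) (fun y => ln y ^ 2)); [apply cont_on_id|apply (cont_on_pow _ ln), cont_on_ln]. }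
  assert (k2 : cont_on (fun y => 0 < y) f2).
  { apply (cont_on_ext _ (fun y => KR 0 y * (y * ln y ^ 1))); [intros; unfold f2; ring|].
    apply (cont_on_mult _ (KR 0) (fun y => y * ln y ^ 1)); [apply cont_on_KR0|].
    apply (cont_on_mult _ (fun y => y) (fun y => ln y ^ 1)); [apply cont_on_id|apply (cont_on_pow _ ln), cont_on_ln]. }
  assert (k4 : cont_on (fun y => 0 < y) f4).
  { apply cont_on_PsiF; auto. apply (is_derive_cont_on _ _ _ is_derive_dilog'). }
  assert (k5 : cont_on (fun y => 0 < y) f5).
  { apply cont_on_PsiF; auto. apply (is_derive_cont_on _ _ _ is_derive_hfrac). }
  set (q := / 2 * ln b ^ 2 + PI ^ 2 / 24). assert (P4 := iint_lin (- / 2) f3 f4 _ _ (conj k3 M2) (conj k4 J0)).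
  assert (P2 := iint_lin (ln b) f2 _ _ _ (conj k2 M1) P4). assert (P1 := iint_lin (-1 * q) f1 _ _ _ (conj k1 M0) P2).
  assert (T := proj2 (iint_lin (/ b ^ 2) f5 _ _ _ (conj k5 J2) P1)).
  assert (E : / b ^ 2 * PsiF hfrac b + (-1 * q * 1 + (ln b * c1 + (- / 2 * (c1 ^ 2 + PI ^ 2 / 12) + PsiF dilog b))) = 0).
  { apply (iint_unique _ _ _ _ _ T). apply (iint_ext _ _ _ I _ _ _) with (2 := K_dilog_parts b Hb). intros y Hy.
    unfold f1, f2, f3, f4, f5, q. assert (Hl := dilog_inv (y / b) ltac:(pos)). replace (/ (y / b)) with (b / y) in Hl by (field; lra).
    replace (dilog (y / b)) with (/ 2 * ln (y / b) ^ 2 + PI ^ 2 / 24 - dilog (b / y)) by lra.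
    replace (ln (y / b)) with (ln y - ln b) by (unfold Rdiv; rewrite ln_mult, ln_Rinv by (auto; apply Rinv_0_lt_compat; auto); ring).
    unfold hfrac. field; nra. }
  rewrite lam_ln by auto. fold c1. replace (PsiF hfrac b) with (b ^ 2 * (/ b ^ 2 * PsiF hfrac b)) by (field; lra). unfold q in E. nra.
Qed.


(** With [q = / 2 * lam x ^ 2 + PI ^ 2 / 12], this is [q - g - PI ^ 2 / 12 * J_0], where [g] is the
    [t^2] coefficient of [exp (- t lam) f] for the Frobenius series [f] and solves
    [theta^2 g = 1 - x^2 g]. The multiple of [J_0] makes it vanish at [0]. *)
Definition Sser (x : R) : R :=
  (/ 2 * lam x ^ 2 + PI ^ 2 / 12) * (1 - Em ci x) + lam x * Em p1 x - Em p2 x.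
Definition Sser1 (x : R) : R :=
  lam x * (1 - Em ci x) - (/ 2 * lam x ^ 2 + PI ^ 2 / 12) * Em (th ci) x
  + Em p1 x + lam x * Em (th p1) x - Em (th p2) x.

Lemma is_derive_lam (x : R) : 0 < x -> is_derive lam x (/ x).
Proof. intros Hx. unfold lam. auto_derive; [lra|]. field; lra. Qed.

Lemma is_derive_lam_sq (x : R) : 0 < x -> is_derive (fun x => / 2 * lam x ^ 2 + PI ^ 2 / 12) x (lam x / x).
Proof.
  intros Hx. eapply is_derive_eq.
  - apply is_derive_Rplus; [apply is_derive_Rscal|apply is_derive_Rconst].
    apply (is_derive_Rcomp (fun y => y ^ 2) lam); [apply is_derive_Reals, derivable_pt_lim_pow|apply is_derive_lam; auto].
  - simpl; lra.
Qed.

Lemma is_derive_Sser (x : R) : 0 < x -> is_derive Sser x (Sser1 x / x).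
Proof.
  intros Hx. eapply is_derive_eq.
  - apply is_derive_Rminus; [apply is_derive_Rplus|].
    + apply (is_derive_Rmult (fun x => / 2 * lam x ^ 2 + PI ^ 2 / 12) (fun x => 1 - Em ci x)); [apply is_derive_lam_sq; auto|].
      apply is_derive_Rminus; [apply is_derive_Rconst|]. apply is_derive_Em; auto. apply entire_ci.
    + apply (is_derive_Rmult lam (Em p1)); [apply is_derive_lam; auto|apply is_derive_Em; auto; apply entire_p1].
    + apply is_derive_Em; auto. apply entire_p2.
  - unfold Sser1. lra.
Qed.

Lemma is_derive_Sser1 (x : R) : 0 < x ->
  is_derive Sser1 x (x ^ 2 * (/ 2 * lam x ^ 2 + PI ^ 2 / 12 - Sser x) / x).
Proof.
  intros Hx. eapply is_derive_eq.
  - apply is_derive_Rminus; [apply is_derive_Rplus; [apply is_derive_Rplus; [apply is_derive_Rminus|]|]|].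
    + apply (is_derive_Rmult lam (fun x => 1 - Em ci x)); [apply is_derive_lam; auto|]. apply is_derive_Rminus; [apply is_derive_Rconst|].
      apply is_derive_Em; auto. apply entire_ci.
    + apply (is_derive_Rmult (fun x => / 2 * lam x ^ 2 + PI ^ 2 / 12) (Em (th ci))); [apply is_derive_lam_sq; auto|].
      apply is_derive_Em; auto. apply entire_th, entire_ci.
    + apply is_derive_Em; auto. apply entire_p1.
    + apply (is_derive_Rmult lam (Em (th p1))); [apply is_derive_lam; auto|apply is_derive_Em; auto; apply entire_th, entire_p1].
    + apply is_derive_Em; auto. apply entire_th, entire_p2.
  - rewrite Em_ode_0, Em_ode_1, Em_ode_2. unfold Sser. lra.
Qed.

Lemma Sser_near_0 : exists C, forall x, 0 < x <= 1 ->
  Rabs (Sser x) <= C * (x * (1 + Rabs (ln x))) /\ Rabs (Sser1 x) <= C * (x * (1 + Rabs (ln x))).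
Proof.
  destruct (Em_bound ci entire_ci) as [K0 [P0 B0]]. destruct (Em_bound _ (entire_th _ entire_ci)) as [K1 [P1 B1]].
  destruct (Em_bound p1 entire_p1) as [K2 [P2 B2]]. destruct (Em_bound _ (entire_th _ entire_p1)) as [K3 [P3 B3]].
  destruct (Em_bound p2 entire_p2) as [K4 [P4 B4]]. destruct (Em_bound _ (entire_th _ entire_p2)) as [K5 [P5 B5]].
  set (c := 1 + Rabs (ln 2 - g0) + PI ^ 2 / 6). set (K := K0 + K1 + K2 + K3 + K4 + K5). exists (K * (c * c * exp 1)). intros x Hx.
  assert (Z1 : p1 0 = 0) by (unfold p1, Hn; simpl; ring). assert (Z2 : p2 0 = 0) by (unfold p2, Hn, H2n; simpl; field).
  assert (Zt : forall a, th a 0 = 0) by (intros a; unfold th; simpl; ring). specialize (B0 x Hx). specialize (B1 x Hx).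
  specialize (B2 x Hx). specialize (B3 x Hx). specialize (B4 x Hx). specialize (B5 x Hx). rewrite ci_0, Rabs_minus_sym in B0.
  rewrite ?Zt, ?Z1, ?Z2, ?Rminus_0_r in *. set (l := 1 + Rabs (ln x)).
  assert (Hl : 1 <= l) by (unfold l; assert (H := Rabs_pos (ln x)); lra). assert (HPI : 0 < PI ^ 2) by (apply pow_lt, PI_RGT_0).
  assert (Hc : 1 <= c) by (unfold c; assert (H := Rabs_pos (ln 2 - g0)); lra). assert (Hlam : Rabs (lam x) <= c * l).
  { rewrite lam_ln by lra. via Rabs_triang. rewrite Rabs_Ropp. assert (H2 := Rabs_pos (ln 2 - g0)).
    apply Rle_trans with (l + Rabs (ln 2 - g0)); [unfold l; lra|]. unfold c. nra. }
  assert (Hlam0 := Rabs_pos (lam x)). set (w := c * l) in *. assert (Hw : 1 <= w) by (unfold w; nra).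
  assert (Hq : Rabs (/ 2 * lam x ^ 2 + PI ^ 2 / 12) <= w * w).
  { via Rabs_triang. rewrite Rabs_mult, <- RPow_abs, (Rabs_right (/ 2)), (Rabs_right (PI ^ 2 / 12)) by lra.
    assert (PI ^ 2 / 6 <= w); [unfold w; assert (H2 := Rabs_pos (ln 2 - g0)); assert (PI ^ 2 / 6 <= c) by (unfold c; lra); nra|]. nra. }
  assert (Ht : w * w * x ^ 2 <= c * c * exp 1 * (x * l)).
  { assert (H := x_log_pow_le x 1 Hx). rewrite pow_1 in H. rewrite Rmult_1_l in H.
    replace (w * w * x ^ 2) with (c * c * (x * l) * (x * l)) by (unfold w; ring). pos. }
  assert (G : forall k Q y, 0 <= k -> Rabs Q <= k * x ^ 2 -> Rabs y <= w * w -> Rabs (y * Q) <= k * (c * c * exp 1 * (x * l))).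
  { intros k Q y Hk HQ Hy. rewrite Rabs_mult. apply Rle_trans with (k * (w * w * x ^ 2)).
    - replace (k * (w * w * x ^ 2)) with (w * w * (k * x ^ 2)) by ring. pos.
    - pos. }
  assert (Hlw : Rabs (lam x) <= w * w) by nra. assert (H1w : Rabs 1 <= w * w) by (rewrite Rabs_R1; nra).
  assert (Hpos : forall k, 0 <= k -> 0 <= k * (c * c * exp 1 * (x * l))).
  { intros; pos. }
  assert (G1 := Hpos _ P1). assert (G3 := Hpos _ P3). assert (G4 := Hpos _ P4). assert (G5 := Hpos _ P5). split.
  - assert (T1 := G _ _ _ P0 B0 Hq). assert (T2 := G _ _ _ P2 B2 Hlw). assert (T3 := G _ _ _ P4 B4 H1w). apply Rabs_le_between in T1.
    apply Rabs_le_between in T2. apply Rabs_le_between in T3. unfold Sser, K. apply Rabs_le. lra.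
  - assert (T1 := G _ _ _ P0 B0 Hlw). assert (T2 := G _ _ _ P1 B1 Hq). assert (T3 := G _ _ _ P2 B2 H1w). assert (T4 := G _ _ _ P3 B3 Hlw).
    assert (T5 := G _ _ _ P5 B5 H1w). apply Rabs_le_between in T1. apply Rabs_le_between in T2. apply Rabs_le_between in T3.
    apply Rabs_le_between in T4. apply Rabs_le_between in T5. unfold Sser1, K. apply Rabs_le. lra.
Qed.

(** Both sides solve the same inhomogeneous equation and are [O(x log x)] at [0] along with their
    Euler derivatives, so the difference falls under [singular_ode_unique] with sign [-1]. *)
Theorem Psi_series b : 0 < b -> PsiF dilog b = Sser b.
Proof.
  intros Hb. destruct Sser_near_0 as [C1 HC1].
  destruct (PsiF_iint dilog 1 (is_derive_cont_on _ _ _ is_derive_dilog') Rabs_dilog) as [A0 [P0 HA0]].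
  destruct (PsiF_iint hlog 1 (is_derive_cont_on _ _ _ is_derive_hlog) Rabs_hlog) as [A1 [P1 HA1]].
  assert (Hx1 : forall A x, 0 <= A -> 0 < x <= 1 -> A * x <= A * (x * (1 + Rabs (ln x)))).
  { intros A x HA Hx. apply Rmult_le_compat_l; auto. assert (H := Rabs_pos (ln x)). nra. }
  enough (PsiF dilog b - Sser b = 0) by lra.
  apply (singular_ode_unique (fun x => PsiF dilog x - Sser x) (fun x => PsiF hlog x - Sser1 x) (-1) (A0 + A1 + C1)); auto.
  - rewrite Rabs_left; lra.
  - intros x Hx. eapply is_derive_eq.
    + apply is_derive_Rminus; [apply is_derive_Psi_dilog; auto|apply is_derive_Sser; auto].
    + lra.
  - intros x Hx. eapply is_derive_eq.
    + apply is_derive_Rminus; [apply is_derive_Psi_hlog; auto|apply is_derive_Sser1; auto].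
    + rewrite Psi_hfrac_ode by auto. field. lra.
  - intros x Hx. destruct (HA0 x ltac:(lra)) as [_ H1]. destruct (HC1 x Hx) as [H2 _]. assert (H3 := Hx1 _ _ P0 Hx).
    assert (H4 := Hx1 _ _ P1 Hx). assert (0 <= A1 * x) by nra. via Rabs_triang. rewrite Rabs_Ropp. lra.
  - intros x Hx. destruct (HA1 x ltac:(lra)) as [_ H1]. destruct (HC1 x Hx) as [_ H2]. assert (H3 := Hx1 _ _ P0 Hx).
    assert (H4 := Hx1 _ _ P1 Hx). assert (0 <= A0 * x) by nra. via Rabs_triang. rewrite Rabs_Ropp. lra.
Qed.

(* Green's identity for [K_0(y)] and [W(y / b)], [W x = ln^2 x / 2 - dilog x],
   where [theta^2 W = 1 / (1 + x^2)], identifies the finite part. *)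
Theorem finite_part (b : R) (G : R -> R) (C : R) : 0 < b ->
  (forall x : R, 0 < x -> is_derive G x (KR 0 (b * x) / (1 + x ^ 2) / x)) ->
  (forall x, 0 < x -> Rabs (G x) <= C / x) ->
  is_lim_seq (fun n => let x := / INR (S n) / b in G x + / 2 * ln x ^ 2 + lam b * ln x)
    (PI ^ 2 / 24 - Sser b).
Proof.
  intros Hb HG HGb. set (c1 := ln 2 - g0). assert (Hin : forall y, 0 < y -> 0 < y / b) by (intros; apply Rdiv_lt_0_compat; auto).
  assert (Hln : forall y, 0 < y -> ln (y / b) = ln y - ln b).
  { intros y Hy. unfold Rdiv. rewrite ln_mult, ln_Rinv by pos. ring. }
  (* [bd] is the Green boundary form [K theta W - W theta K]. After its subtraction only [y W K] is
     left, and inversion writes [W] as [dilog (b / y) - PI ^ 2 / 24], which gives the integrable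
     [f]. *)
  set (W := fun y => / 2 * ln (y / b) ^ 2 - dilog (y / b)). set (bd := fun y => KR 0 y * (ln (y / b) - hlog (y / b)) - W y * LR y).
  set (f := fun y => KR 0 y * (y * dilog (b / y)) + - (PI ^ 2 / 24) * (KR 0 y * y)).
  assert (DE : forall y : R, 0 < y -> is_derive (fun y => G (y / b) - bd y) y (f y)).
  { intros y Hy. assert (Hl := dilog_inv (y / b) (Hin y Hy)). replace (/ (y / b)) with (b / y) in Hl by (field; lra).
    assert (DW : is_derive W y ((ln (y / b) - hlog (y / b)) / y)).
    { apply (is_derive_scaled (fun t => / 2 * ln t ^ 2 - dilog t) (fun t => ln t - hlog t)); auto. intros t Ht. eapply is_derive_eq.
      - apply is_derive_Rminus; [apply is_derive_Rscal|apply is_derive_dilog'; auto].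
        apply (is_derive_Rcomp (fun y => y ^ 2) ln); [apply is_derive_Reals, derivable_pt_lim_pow|apply is_derive_Reals, derivable_pt_lim_ln; auto].
      - simpl; lra. }
    assert (D1 : is_derive (fun y => ln (y / b) - hlog (y / b)) y ((1 - hfrac (y / b)) / y)).
    { apply (is_derive_scaled (fun t => ln t - hlog t) (fun t => 1 - hfrac t)); auto. intros t Ht. eapply is_derive_eq.
      - apply is_derive_Rminus; [apply is_derive_Reals, derivable_pt_lim_ln; auto|apply is_derive_hlog; auto].
      - lra. }
    eapply is_derive_eq.
    - apply is_derive_Rminus.
      + apply (is_derive_scaled G (fun t => KR 0 (b * t) / (1 + t ^ 2))); auto.
      + apply is_derive_Rminus.
        * apply (is_derive_Rmult (KR 0) (fun y => ln (y / b) - hlog (y / b))); [apply is_derive_KR0; auto|exact D1].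
        * apply (is_derive_Rmult W LR); [exact DW|apply is_derive_LR; auto].
    - unfold f. replace (dilog (b / y)) with (W y + PI ^ 2 / 24) by (unfold W; lra). replace (b * (y / b)) with y by (field; lra).
      unfold hfrac. field; nra. }
  assert (k4 : cont_on (fun y => 0 < y) (fun y => KR 0 y * (y * dilog (b / y)))).
  { apply cont_on_PsiF; auto. apply (is_derive_cont_on _ _ _ is_derive_dilog'). }
  assert (kf : cont_on (fun y => 0 < y) f).
  { apply cont_on_plus; auto. apply cont_on_scal, cont_on_K_id. }
  destruct (PsiF_iint dilog 1 (is_derive_cont_on _ _ _ is_derive_dilog') Rabs_dilog) as [A0 [P0 HA0]]. destruct (HA0 b Hb) as [I0 _].
  rewrite Psi_series in I0 by auto. assert (If : iint_0_oo f (Sser b + - (PI ^ 2 / 24) * 1)).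
  { apply (iint_plus _ _ _ improper_0_oo (fun y => KR 0 y * (y * dilog (b / y)))); auto.
    - apply cont_on_scal, cont_on_K_id.
    - apply (iint_scal _ _ _ improper_0_oo); [apply cont_on_K_id|apply MK2_iint]. }
  assert (HPI := PI_RGT_0). assert (Hhi : is_lim_seq (fun n => G (INR (S n) / b) - bd (INR (S n))) 0).
  { apply (lim_hi_0 (fun y => G (y / b) - bd y) (C * b + (8 * (1 + Rabs (ln b) + / b) + 24 * (b + PI ^ 2)))). intros y Hy.
    assert (H1 := HGb _ (Hin y ltac:(lra))). assert (H2 := KR_bound 0 y 2 ltac:(lra) ltac:(lia)).
    assert (H3 := LR_bound y 3 ltac:(lra) ltac:(lia)). replace (4 * INR (fact 2) / y ^ 2) with (8 / y * / y) in H2 by (simpl; field; lra).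
    replace (y * (4 * INR (fact 3) / y ^ 3)) with (24 / y * / y) in H3 by (simpl; field; lra).
    assert (H4 := Rabs_hlog _ (Hin y ltac:(lra))). assert (H5 : Rabs (W y) <= b + PI ^ 2).
    { assert (Hl := dilog_inv (y / b) (Hin y ltac:(lra))). replace (/ (y / b)) with (b / y) in Hl by (field; lra).
      replace (W y) with (dilog (b / y) - PI ^ 2 / 24) by (unfold W; lra). assert (H := dilog_bound (b / y) ltac:(pos)).
      assert (b / y <= b) by (apply Rle_div_l; nra). assert (0 < PI ^ 2) by (apply pow_lt; auto). apply Rabs_le. lra. }
    assert (H6 : Rabs (ln (y / b)) <= (1 + Rabs (ln b)) * y).
    { rewrite Hln by lra. via Rabs_triang. rewrite Rabs_Ropp. rewrite (Rabs_right (ln y)) by (apply Rle_ge, ln_ge_0; auto).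
      assert (H := ln_le_minus_1 y Hy). assert (H0 := Rabs_pos (ln b)). nra. }
    assert (Hiy : 0 < / y <= 1).
    { split; [apply Rinv_0_lt_compat; lra|]. rewrite <- Rinv_1. pos. }
    assert (H7 : Rabs (ln (y / b) - hlog (y / b)) <= (1 + Rabs (ln b) + / b) * y).
    { via Rabs_triang. rewrite Rabs_Ropp. lra. }
    assert (T1 : Rabs (KR 0 y * (ln (y / b) - hlog (y / b))) <= 8 * (1 + Rabs (ln b) + / b) / y).
    { rewrite Rabs_mult. eapply Rle_trans; [apply Rmult_le_compat; [pos|pos|exact H2|exact H7]|]. apply Req_le. field. lra. }
    assert (T2 : Rabs (W y * LR y) <= 24 * (b + PI ^ 2) / y).
    { rewrite Rabs_mult. eapply Rle_trans; [apply Rmult_le_compat; [apply Rabs_pos|pos|exact H5|exact H3]|].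
      replace ((b + PI ^ 2) * (24 / y * / y)) with (24 * (b + PI ^ 2) / y * / y) by (field; lra).
      rewrite <- (Rmult_1_r (24 * (b + PI ^ 2) / y)) at 2. pos. }
    replace (C / (y / b)) with (C * b / y) in H1 by (field; lra). unfold bd. apply Rabs_le_between in H1. apply Rabs_le_between in T1.
    apply Rabs_le_between in T2. apply Rabs_le. lra. }
  assert (Hlo : is_lim_seq (fun n => G (/ INR (S n) / b) - bd (/ INR (S n))) (PI ^ 2 / 24 - Sser b)).
  { apply (is_lim_seq_ext (fun n => (G (INR (S n) / b) - bd (INR (S n))) - RInt f (/ INR (S n)) (INR (S n)))).
    - intros n. destruct improper_0_oo as [J1 J2 _ _]. rewrite (RInt_primitive (fun y => G (y / b) - bd y) f); auto.
      + ring.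
      + eauto.
      + eauto.
    - replace (PI ^ 2 / 24 - Sser b) with (0 - (Sser b + - (PI ^ 2 / 24) * 1)) by ring. apply is_lim_seq_minus'; auto. }
  (* Near [0] the boundary form equals minus the two logarithmic terms of the statement up to
     [o(1)], so the finite part is the limit of [G - bd]. *)
  set (rest := fun y => bd y + / 2 * ln (y / b) ^ 2 + lam b * ln (y / b)). assert (Hrest : is_lim_seq (fun n => rest (/ INR (S n))) 0).
  { set (c := 1 + Rabs (ln b) + Rabs c1). apply (lim_lo_log rest (c + 2 * (c / b) + 3 * / b + c * c) 0 2). intros y Hy.
    assert (Q1 := KR0_asymptotic g0 Hg0 y ltac:(lra)). assert (Q2 := LR_near_0 y ltac:(lra)).
    assert (Q3 := hlog_bound _ (Hin y ltac:(lra))). assert (Q4 := dilog_bound _ (Hin y ltac:(lra))). set (e1 := KR 0 y + ln y - c1) in *.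
    set (e2 := LR y + 1) in *. set (l := ln (y / b)). set (h := hlog (y / b)) in *. set (d := dilog (y / b)) in *.
    set (m := 1 + Rabs (ln y)). assert (Hm : 1 <= m) by (unfold m; assert (H := Rabs_pos (ln y)); lra).
    assert (Hc : 1 <= c) by (unfold c; assert (H := Rabs_pos (ln b)); assert (H2 := Rabs_pos c1); lra).
    assert (E : rest y = e1 * l - (KR 0 y - e1) * h - e1 * h - d - / 2 * l ^ 2 * e2 + d * e2).
    { unfold rest, bd, W, e1, e2. fold l h d. rewrite (lam_ln b Hb). fold c1.
      replace (ln y) with (l + ln b) by (unfold l; rewrite Hln by lra; ring). lra. }
    assert (Hl : Rabs l <= c * m).
    { unfold l. rewrite Hln by lra. via Rabs_triang. rewrite Rabs_Ropp. unfold c, m. assert (H := Rabs_pos (ln b)).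
      assert (H2 := Rabs_pos c1). assert (H3 := Rabs_pos (ln y)). nra. }
    assert (Hk : Rabs (KR 0 y - e1) <= c * m).
    { replace (KR 0 y - e1) with (- ln y + c1) by (unfold e1; ring). via Rabs_triang. rewrite Rabs_Ropp. unfold c, m.
      assert (H := Rabs_pos (ln b)). assert (H2 := Rabs_pos c1). assert (H3 := Rabs_pos (ln y)). nra. }
    assert (Hh : Rabs h <= / b * y) by (rewrite Rabs_right; unfold Rdiv in *; lra).
    assert (Hd : Rabs d <= / b * y) by (rewrite Rabs_right; unfold Rdiv in *; lra). assert (Hib := Rinv_0_lt_compat b Hb).
    assert (Hmm : m <= m * m) by nra. assert (G2 : forall u v U V, Rabs u <= U -> Rabs v <= V -> Rabs (u * v) <= U * V).
    { intros; pos. }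
    assert (G1 : forall k w, 0 <= k -> 0 <= w <= m * m -> k * (w * y) <= k * (y * m ^ 2)).
    { intros k w Hk0 Hw. replace (y * m ^ 2) with (m * m * y) by ring. pos. }
    assert (T1 : Rabs (e1 * l) <= c * (y * m ^ 2)).
    { via (G2 _ _ _ _ Q1 Hl). replace (y * (c * m)) with (c * (m * y)) by ring. apply G1; lra. }
    assert (T2 : Rabs ((KR 0 y - e1) * h) <= c / b * (y * m ^ 2)).
    { via (G2 _ _ _ _ Hk Hh). replace (c * m * (/ b * y)) with (c / b * (m * y)) by (field; lra). apply G1; [|lra]. pos. }
    assert (T3 : Rabs (e1 * h) <= / b * (y * m ^ 2)).
    { via (G2 _ _ _ _ Q1 Hh). nra. }
    assert (T4 : Rabs d <= / b * (y * m ^ 2)) by nra. assert (T5 : Rabs (/ 2 * l ^ 2 * e2) <= c * c * (y * m ^ 2)).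
    { replace (/ 2 * l ^ 2 * e2) with (l * l * (/ 2 * e2)) by ring.
      eapply Rle_trans; [apply (G2 _ _ (c * m * (c * m)) y); [apply (G2 _ _ _ _ Hl Hl)|]|].
      - rewrite Rabs_mult, Rabs_right by lra. lra.
      - lra. }
    assert (T6 : Rabs (d * e2) <= / b * (y * m ^ 2)).
    { via (G2 _ _ _ _ Hd Q2). nra. }
    apply Rabs_le_between in T1. apply Rabs_le_between in T2. apply Rabs_le_between in T3. apply Rabs_le_between in T4.
    apply Rabs_le_between in T5. apply Rabs_le_between in T6. apply Rabs_le. lra. }
  replace (PI ^ 2 / 24 - Sser b) with (PI ^ 2 / 24 - Sser b + 0) by ring.
  apply (is_lim_seq_ext (fun n => (G (/ INR (S n) / b) - bd (/ INR (S n))) + rest (/ INR (S n)))).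
  - intros n. unfold rest. lra.
  - apply is_lim_seq_plus'; auto.
Qed.

Lemma BesselJ0_Em b : BesselJ0 b = Em ci b.
Proof. apply Series_ext. intros r. unfold bterm, ci, Rdiv. ring. Qed.

Lemma BesselY0_Em b : PI / 2 * BesselY0 b = lam b * Em ci b - Em p1 b.
Proof.
  unfold BesselY0. rewrite BesselJ0_Em.
  replace (Series (fun r => digamma (INR r + 1) * bterm (b ^ 2 / 4) r)) with (Em p1 b + - g0 * Em ci b).
  - unfold lam. field. pos.
  - rewrite <- Em_scal, <- Em_plus by (try apply entire_scal; try apply entire_p1; apply entire_ci). apply Series_ext. intros r.
    rewrite (digamma_nat g0 Hg0). unfold p1, ci, bterm, Rdiv. ring.
Qed.

Lemma Em_incr a b : entire a ->
  Em a b = a O - b ^ 2 / 4 * Series (fun n => (- (b ^ 2 / 4)) ^ n * a (S n)).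
Proof.
  intros Ha. unfold Em, PSeries. rewrite Series_incr_1 by (apply entire_ex_series; auto).
  rewrite (Series_ext _ (fun n => - (b ^ 2 / 4) * ((- (b ^ 2 / 4)) ^ n * a (S n)))).
  - rewrite Series_scal_l, pow_O. ring.
  - intros n. simpl; lra.
Qed.

Lemma Em_incr_2 a b : entire a -> a 1%nat = 0 ->
  Em a b = a O - b ^ 2 / 4 * Series (fun n => (- (b ^ 2 / 4)) ^ S n * a (S (S n))).
Proof.
  intros Ha H1. rewrite Em_incr by auto. rewrite Series_incr_1, H1, Rmult_0_r, Rplus_0_l; auto.
  apply (ex_series_ext (fun n => a (S n) * (- (b ^ 2 / 4)) ^ n)); [intros; eqR; ring|]. apply entire_ex_series, entire_shift; auto.
Qed.

Lemma Fchi_Em b : b ^ 2 / 4 * Fchi (b ^ 2 / 4) = 1 - Em ci b.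
Proof.
  rewrite (Em_incr ci), ci_0 by apply entire_ci. unfold Fchi.
  rewrite (Series_ext (fterm (b ^ 2 / 4)) (fun n => (- (b ^ 2 / 4)) ^ n * ci (S n))); [ring|]. intros n. unfold fterm, ci.
  rewrite Nat.add_1_r. reflexivity.
Qed.

Lemma Fchi_neq_0 b : 0 < b -> Fchi (b ^ 2 / 4) <> 0.
Proof. intros Hb H. assert (E := Fchi_Em b). rewrite H, Rmult_0_r in E. assert (HJ := J0_neq_1 b Hb). lra. Qed.

Lemma digamma_diff n : digamma (2 + INR (S n)) - digamma 2 = Hn (S (S n)) - 1.
Proof.
  replace (2 + INR (S n)) with (INR (S (S n)) + 1) by (rewrite !S_INR; ring). assert (E := digamma_nat g0 Hg0 1).
  replace (INR 1 + 1) with 2 in E by (simpl; ring). rewrite (digamma_nat g0 Hg0), E. replace (Hn 1) with 1 by (unfold Hn; simpl; field).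
  ring.
Qed.

Lemma trigamma_diff n : trigamma (2 + INR (S n)) - trigamma 2 = 1 - H2n (S (S n)).
Proof.
  replace (2 + INR (S n)) with (INR (S (S n)) + 1) by (rewrite !S_INR; ring). assert (E := trigamma_nat g0 Hg0 1).
  replace (INR 1 + 1) with 2 in E by (simpl; ring). rewrite (trigamma_nat g0 Hg0), E.
  replace (H2n 1) with 1 by (unfold H2n; simpl; field). ring.
Qed.

(** The coefficients of [Em p1 - Em ci] are [(Hn r - 1) * ci r] and vanish at [r = 1]. So the sum in
    [F1star], where [psi 2] is subtracted, is the tail from [r = 2] of this series. *)
Lemma F1star_Em b : 0 < b -> (1 - Em ci b) * F1star (b ^ 2 / 4) = Em ci b - Em p1 b - 1.
Proof.
  intros Hb. assert (HF := Fchi_neq_0 b Hb). rewrite <- Fchi_Em. unfold F1star.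
  assert (E : Em (fun r => p1 r + -1 * ci r) b = -1 - b ^ 2 / 4 * Series (fun n => (- (b ^ 2 / 4)) ^ S n * (p1 (S (S n)) + -1 * ci (S (S n))))).
  { rewrite Em_incr_2.
    - unfold p1 at 1. rewrite ci_0. unfold Hn at 1. simpl; lra.
    - apply entire_plus; [apply entire_p1|apply entire_scal, entire_ci].
    - unfold p1, Hn, ci. simpl; lra. }
  rewrite Em_plus, Em_scal in E by (try apply entire_scal; try apply entire_p1; apply entire_ci).
  rewrite (Series_ext _ (fun n => (- (b ^ 2 / 4)) ^ S n * (p1 (S (S n)) + -1 * ci (S (S n))))).
  - set (Q := Series _) in *. replace (b ^ 2 / 4 * Fchi (b ^ 2 / 4) * (/ Fchi (b ^ 2 / 4) * Q)) with (b ^ 2 / 4 * Q) by (field; auto).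
    lra.
  - intros n. rewrite digamma_diff. unfold fterm, p1, ci. rewrite Nat.add_1_r. lra.
Qed.

(** Here [2 (Hn r - 1)^2 - (1 - H2n r)] times [ci r] is the coefficient of [4 p2 - 4 p1 + ci], which
    again vanishes at [r = 1]. *)
Lemma F2star_Em b : 0 < b -> (1 - Em ci b) * (4 * F2star (b ^ 2 / 4)) = 1 - 4 * Em p2 b + 4 * Em p1 b - Em ci b.
Proof.
  intros Hb. assert (HF := Fchi_neq_0 b Hb). rewrite <- Fchi_Em. unfold F2star.
  assert (E : Em (fun r => 4 * p2 r + (-4 * p1 r + ci r)) b = 1 - b ^ 2 / 4 * Series (fun n => (- (b ^ 2 / 4)) ^ S n * (4 * p2 (S (S n)) + (-4 * p1 (S (S n)) + ci (S (S n)))))).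
  { rewrite Em_incr_2.
    - unfold p1 at 1, p2 at 1. rewrite ci_0. unfold Hn at 1 2, H2n at 1. simpl; lra.
    - apply entire_plus; [apply entire_scal, entire_p2|apply entire_plus; [apply entire_scal, entire_p1|apply entire_ci]].
    - unfold p2, p1, Hn, H2n, ci. simpl; lra. }
  rewrite !Em_plus, !Em_scal in E by (repeat first [apply entire_plus|apply entire_scal|apply entire_p1|apply entire_p2|apply entire_ci]).
  rewrite (Series_ext _ (fun n => (- (b ^ 2 / 4)) ^ S n * (4 * p2 (S (S n)) + (-4 * p1 (S (S n)) + ci (S (S n)))))).
  - set (Q := Series _) in *.
    replace (b ^ 2 / 4 * Fchi (b ^ 2 / 4) * (4 * (/ (4 * Fchi (b ^ 2 / 4)) * Q))) with (b ^ 2 / 4 * Q) by (field; auto). lra.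
  - intros n. rewrite digamma_diff, trigamma_diff. unfold fterm, p1, p2, ci. rewrite Nat.add_1_r. lra.
Qed.

Lemma Res1_eq g1 b (a : C) : 0 < b ->
  Res1 g0 g1 b a = (/ a ^ 2 * (Defs.B2 g0 g1 a - lam b * Defs.B1 g0 a + (Sser b - PI ^ 2 / 24)%R))%C.
Proof.
  intros Hb. unfold Res1. rewrite BesselJ0_Em. assert (HY := BesselY0_Em b). assert (H1 := F1star_Em b Hb). assert (H2 := F2star_Em b Hb).
  assert (Hl : ln (b ^ 2 / 4) = 2 * (lam b - g0)).
  { replace (b ^ 2 / 4) with ((b / 2) * (b / 2)) by field. rewrite ln_mult by lra. unfold lam. ring. }
  set (P := Em ci b) in *. set (a1 := Defs.A1 g0 (b ^ 2 / 4)). set (a2 := Defs.A2 g0 (b ^ 2 / 4)). set (f1 := F1star (b ^ 2 / 4)) in *.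
  (* [E1] gathers the coefficient of [B1] and [E2] that of [B0]; each is an identity between
     [Em ci], [Em p1], [Em p2] and [lam b]. *)
  set (f2 := F2star (b ^ 2 / 4)) in *. assert (E1 : (1 - P) * (a1 + Defs.A0 * f1) - PI / 2 * BesselY0 b = - lam b).
  { unfold a1, Defs.A1, Defs.A0. nra. }
  assert (E2 : (1 - P) * (a2 + a1 * f1 + Defs.A0 * f2) - PI ^ 2 / 24 * P = Sser b - PI ^ 2 / 24).
  { unfold a2, a1, Defs.A2, Defs.A1, Defs.A0, Sser. fold P. nra. }
  rewrite <- E2. rewrite <- (Ropp_involutive (lam b)), <- E1. unfold Defs.B0, Defs.A0.
  rewrite !RtoC_minus, RtoC_opp, !RtoC_minus, !RtoC_mult, !RtoC_plus, !RtoC_mult, !RtoC_minus, !RtoC_div, RtoC_pow by lra. ring.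
Qed.

End BesselJ.

(** * The kernel K_0(b z) / (1 + z^2) and its antiderivative *)

Definition is_tower (m : nat) (T : nat -> C -> C) : Prop :=
  forall j z, (j < m)%nat -> 0 < Re z -> Cdiff (T j) z (T (S j) z).

(** Unfolds the nested existentials of [Symb] into one indexed family with a common constant, the
    shape from which jets along a ray are built. *)
Lemma Symb_tower m (D : C -> Prop) : (forall z, D z -> 0 < Re z) ->
  forall w phi, (forall z, D z -> 0 <= w z) -> Symb m D w phi ->
  exists T, T O = phi /\ is_tower m T /\
    exists c, 0 <= c /\ forall j z, (j <= m)%nat -> D z -> Cmod (T j z) <= c * (w z / Cmod z ^ j).
Proof.
  intros HD. induction m as [|m IH]; intros w phi Hw Hp.
  - destruct (Symb_bound D 0 w phi Hp Hw) as [c [Hc B]]. exists (fun _ => phi). split; auto. split; [intros j z Hj; lia|]. exists c.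
    split; auto. intros j z Hj Hz. replace j with 0%nat by lia. rewrite pow_O, Rdiv_1_r. auto.
  - destruct (Symb_bound D (S m) w phi Hp Hw) as [c [Hc B]]. destruct Hp as [_ [phi' [Hd Hs]]].
    assert (Hpos : forall z, D z -> 0 < Cmod z) by (intros z Hz; apply Cmod_pos, Re_pos_neq_0; auto).
    destruct (IH (fun z => w z / Cmod z) phi') as [T [T0 [T1 [c' [Hc' T2]]]]]; auto.
    { intros z Hz. apply Rdiv_le_0_compat; auto. }
    exists (fun j => match j with O => phi | S i => T i end). split; auto. split.
    + intros [|j] z Hj Hz; [rewrite T0; auto|apply T1; [lia|auto]].
    + exists (c + c'). split; [lra|]. intros [|j] z Hj Hz.
      * rewrite pow_O, Rdiv_1_r. specialize (B z Hz). specialize (Hw z Hz). nra.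
      * specialize (T2 j z ltac:(lia) Hz). assert (Hz0 := Hpos z Hz).
        replace (w z / Cmod z ^ S j) with (w z / Cmod z / Cmod z ^ j) by (simpl; field; split; [apply pow_nonzero|]; lra). via T2.
        apply Rmult_le_compat_r; [|lra]. apply Rdiv_le_0_compat; [|apply pow_lt; auto]. apply Rdiv_le_0_compat; auto.
Qed.

Section Kernel.

Variable b : R.
Hypothesis Hb : 0 < b.

Lemma Re_scal_pos z : 0 < Re z -> 0 < Re (b * z)%C.
Proof. rewrite re_scal_l. nra. Qed.

Lemma Cdiff_KJ_scal j z : 0 < Re z -> Cdiff (fun z => KJ j (b * z)%C) z (b * KJ (S j) (b * z))%C.
Proof.
  intros Hz. eapply Cdiff_eq.
  - apply (Cdiff_comp (KJ j) (fun z => b * z)%C); [apply Cdiff_KJ, Re_scal_pos; auto|]. apply Cdiff_scal, Cdiff_id.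
  - ring.
Qed.

Lemma Symb_KJ s m : 0 < s -> forall j N, (j < N)%nat ->
  Symb m (sector s) (fun z => / Cmod z ^ N) (fun z => KJ j (b * z)%C).
Proof.
  intros Hs. assert (HD := fun z => sector_Re s z Hs). induction m as [|m IH]; intros j N HjN.
  all: assert (B : exists c, forall z, sector s z -> Cmod (KJ j (b * z)%C) <= c * / Cmod z ^ N).
  1, 3: exists (4 * INR (fact N) / (b * s) ^ N); intros z Hz; assert (Hz1 := HD z Hz); destruct Hz as [Hz2 Hz3];
    eapply Rle_trans; [apply (KJ_bound j _ N); auto; apply Re_scal_pos; auto|];
    assert (Hbs : 0 < b * s) by nra; assert (HbsN := pow_lt _ N Hbs); assert (HzN := pow_lt _ N Hz2);
    unfold Rdiv; rewrite !Rmult_assoc, <- Rinv_mult, <- Rpow_mult_distr;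
    do 2 (apply Rmult_le_compat_l; [try apply pos_INR; lra|]);
    apply Rinv_le_contravar; [pos|apply pow_incr; rewrite re_scal_l; nra].
  - split; pos.
  - split; auto. exists (fun z => b * KJ (S j) (b * z))%C. split; [apply Cdiff_KJ_scal|].
    apply (Symb_weight_eq _ HD m (fun z => / Cmod z ^ S N)).
    + intros z [Hz _]. pos.
    + intros z [Hz _]. simpl. field. pos.
    + apply (Symb_scal _ HD); [|apply IH; lia]. intros z [Hz _]. pos.
Qed.

Definition gker (z : C) : C := (KJ 0 (b * z) * qker z)%C.

Lemma Symb_gker s m : 0 < s <= 1 -> Symb m (sector s) (fun z => / Cmod z) gker.
Proof.
  intros Hs. assert (HD := fun z => sector_Re s z (proj1 Hs)). apply (Symb_weight_eq _ HD m (fun z => / Cmod z ^ 1 * 1)).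
  - intros z [Hz _]. pos.
  - intros z _. rewrite Rmult_1_r, pow_1. reflexivity.
  - apply (Symb_mult _ HD).
    + intros z [Hz _]. pos.
    + intros; lra.
    + apply Symb_KJ; [lra|lia].
    + apply Symb_qker; auto.
Qed.

Lemma improper_1_oo : improper (fun _ => 1) (fun n => INR (S n)) (fun x => 1 <= x).
Proof.
  split.
  - apply one_le_INR_S.
  - tauto.
  - reflexivity.
  - intros n. simpl; lra.
Qed.

Lemma iint_inv_sq c : is_iint (fun _ => 1) (fun n => INR (S n)) (fun x => c * / x ^ 2) c.
Proof.
  cut (is_iint (fun _ => 1) (fun n => INR (S n)) (fun x => c * / x ^ 2) (0 - - c));
    [rewrite Rminus_0_l, Ropp_involutive; auto|].
  apply (iint_primitive _ _ _ improper_1_oo (fun x => - c * / x)).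
  - intros x Hx. auto_derive; [lra|]. field; lra.
  - intros x Hx. apply (ex_derive_continuous (V := R_NormedModule)). auto_derive. pos.
  - rewrite Rinv_1, Rmult_1_r. apply is_lim_seq_const.
  - replace (Finite 0) with (Finite (- c * 0)) by (f_equal; ring). apply (is_lim_seq_scal_l _ (- c) 0), is_lim_seq_inv_S.
Qed.

Lemma cont_on_inv_sq c : cont_on (fun x => 1 <= x) (fun x => c * / x ^ 2).
Proof. intros x Hx. apply (ex_derive_continuous (V := R_NormedModule)). auto_derive. pos. Qed.

(** Minus the integral of [gker w / w] from [z] to infinity along the ray through [z]. The
    substitution [w = x z] makes the path of integration independent of [z]. *)
Definition Gint (z : C) : C := (- cint (fun _ => 1) (fun n => INR (S n)) (fun x => / x * gker (x * z)))%C.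

Lemma Re_pos_sector z : 0 < Re z -> exists s, 0 < s <= 1 /\
  forall k, Cmod k <= Re z / 2 -> Re z / 2 <= Cmod (z + k)%C /\ sector s (z + k)%C.
Proof.
  assert (Hm := Re_le_Cmod z). exists (Re z / (4 * Cmod z)). split.
  - split; [apply Rdiv_lt_0_compat; lra|]. apply Rle_div_l; lra.
  - intros k Hk. assert (H1 : Re (z + k)%C = Re z + Re k) by (destruct z, k; reflexivity). assert (H2 := re_le_Cmod k).
    apply Rabs_le_between in H2. assert (H3 := Re_le_Cmod (z + k)%C). assert (H4 := Cmod_triangle z k). repeat split; [lra|lra|].
    apply Rle_trans with (Re z / (4 * Cmod z) * (2 * Cmod z)).
    + pos.
    + replace (Re z / (4 * Cmod z) * (2 * Cmod z)) with (Re z / 2) by (field; lra). lra.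
Qed.

Lemma sector_scal s x z : 0 < x -> sector s z -> sector s (x * z)%C.
Proof. intros Hx [H1 H2]. unfold sector. rewrite Cmod_mult, Cmod_R, Rabs_right, re_scal_l by lra. split; nra. Qed.

Lemma Cmod_scal (x : R) z : 0 <= x -> Cmod (x * z)%C = x * Cmod z.
Proof. intros Hx. rewrite Cmod_mult, Cmod_R, Rabs_right; auto. lra. Qed.

Lemma ccont_gray z : 0 < Re z -> ccont (fun x => 1 <= x) (fun x => / x * gker (x * z))%C.
Proof.
  intros Hz. destruct (Re_pos_sector z Hz) as [s [Hs _]]. destruct (Symb_gker s 1 Hs) as [_ [g' [Hg _]]].
  assert (H : ccont (fun x => 1 <= x) (fun x : R => gker (x * z)%C)).
  { apply (is_Cderive_ccont _ _ (fun x : R => g' (x * z) * z)%C). intros x Hx.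
    apply (Cdiff_curve gker (fun x => x * z)%C); [|apply is_Cderive_ray]. apply Hg. rewrite re_scal_l. nra. }
  assert (Hi : cont_on (fun x => 1 <= x) Rinv).
  { intros x Hx. apply (ex_derive_continuous (V := R_NormedModule)). auto_derive. lra. }
  split.
  - intros x Hx. apply (continuous_ext_loc _ (fun x => Rinv x * Re (gker (x * z)%C))).
    + apply (filter_imp (fun y => 0 < y)); [|apply locally_gt; lra]. intros y Hy. rewrite <- RtoC_inv by lra. simpl; lra.
    + apply (cont_on_mult _ Rinv (fun x => Re (gker (x * z)%C)) Hi (proj1 H)); auto.
  - intros x Hx. apply (continuous_ext_loc _ (fun x => Rinv x * Im (gker (x * z)%C))).
    + apply (filter_imp (fun y => 0 < y)); [|apply locally_gt; lra]. intros y Hy. rewrite <- RtoC_inv by lra. simpl; lra.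
    + apply (cont_on_mult _ Rinv (fun x => Im (gker (x * z)%C)) Hi (proj2 H)); auto.
Qed.

Lemma Gint_spec s : 0 < s <= 1 -> exists c, 0 <= c /\ forall z, sector s z ->
  is_cint (fun _ => 1) (fun n => INR (S n)) (fun x => / x * gker (x * z))%C (- Gint z)%C
  /\ Cmod (Gint z) <= c * / Cmod z.
Proof.
  intros Hs. assert (HD := fun z => sector_Re s z (proj1 Hs)). assert (Hw : forall z, sector s z -> 0 <= / Cmod z).
  { intros z [Hz _]. pos. }
  destruct (Symb_bound (sector s) 0 _ _ (Symb_gker s 0 Hs) Hw) as [c [Hc B]]. exists (2 * c). split; [lra|]. intros z Hz.
  assert (Hz0 := proj1 Hz). assert (HB : forall x, 1 <= x -> Cmod (/ x * gker (x * z))%C <= c * / Cmod z * / x ^ 2).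
  { intros x Hx. assert (H := B (x * z)%C (sector_scal s x z ltac:(lra) Hz)).
    rewrite <- RtoC_inv, Cmod_scal by (try (apply Rlt_le, Rinv_0_lt_compat); lra). rewrite Cmod_scal in H by lra.
    replace (c * / Cmod z * / x ^ 2) with (/ x * (c * / (x * Cmod z))) by (field; lra). pos. }
  assert (I := is_cint_cint _ _ _ improper_1_oo _ _ _ (ccont_gray z (HD z Hz)) (cont_on_inv_sq _) HB (iint_inv_sq _)). unfold Gint. split.
  - replace (- - cint (fun _ => 1) (fun n => INR (S n)) (fun x => / x * gker (x * z)))%C
      with (cint (fun _ => 1) (fun n => INR (S n)) (fun x => / x * gker (x * z))%C) by ring.
    auto.
  - rewrite Cmod_opp, Rmult_assoc.
    exact (is_cint_bound _ _ _ improper_1_oo _ _ _ _ (ccont_gray z (HD z Hz)) (cont_on_inv_sq _) HB I (iint_inv_sq _)).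
Qed.

Lemma Cdiff_Gint z : 0 < Re z -> Cdiff Gint z (gker z / z)%C.
Proof.
  intros Hz. assert (Hz0 := Re_pos_neq_0 z Hz). destruct (Re_pos_sector z Hz) as [s [Hs Hn]]. set (r := Re z / 2) in *.
  assert (Hr : 0 < r) by (unfold r; lra). assert (HD := fun z => sector_Re s z (proj1 Hs)). assert (Hsz : sector s z).
  { replace z with (z + 0)%C by ring. apply Hn. rewrite Cmod_0. lra. }
  destruct (Symb_tower 2 (sector s) HD _ _ (fun z Hz => Rlt_le _ _ (Rinv_0_lt_compat _ (proj1 Hz))) (Symb_gker s 2 Hs))
    as [T [T0 [T1 [c [Hc T2]]]]].
  destruct (Gint_spec s Hs) as [c0 [_ HG]].
  assert (Hline : forall (x t : R) k, (x * z + t * (x * k))%C = (x * (z + t * k))%C) by (intros; ring).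
  assert (Hk : forall k t, Cmod k < r -> 0 <= t <= 1 -> Cmod (t * k)%C <= r).
  { intros k t Hk Ht. rewrite Cmod_scal by lra. nra. }
  enough (H : Cdiff (fun w => - Gint w)%C z (0 - / z * gker z)%C).
  { apply (Cdiff_ext (fun w => - (1) * - Gint w)%C); [intros; ring|]. eapply Cdiff_eq; [apply Cdiff_scal; exact H|]. field. auto. }
  apply (Cdiff_cint _ _ _ improper_1_oo (fun w x => / x * gker (x * w))%C (fun x : R => T 1%nat (x * z)%C)
    _ _ (fun x => 4 * c * / r ^ 3 * / x ^ 2) z r (4 * c * / r ^ 3)); auto.
  - intros k H. apply ccont_gray. apply HD, Hn. lra.
  - apply (is_Cderive_ccont _ _ (fun x : R => T 2%nat (x * z) * z)%C). intros x Hx.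
    apply (Cdiff_curve (T 1%nat) (fun x => x * z)%C); [|apply is_Cderive_ray]. apply T1; [lia|]. rewrite re_scal_l. nra.
  - apply cont_on_inv_sq.
  - intros k x H Hx. assert (Hx0 : x <> 0) by lra. assert (HxC : RtoC x <> 0%C) by (intros E; apply RtoC_inj in E; lra).
    replace (/ x * gker (x * (z + k)) - / x * gker (x * z) - k * T 1%nat (x * z))%C
      with (/ x * (gker (x * z + x * k) - gker (x * z) - (x * k) * T 1%nat (x * z)))%C
      by (replace (x * (z + k))%C with (x * z + x * k)%C by ring; field; auto).
    rewrite <- RtoC_inv, Cmod_scal by pos. assert (HT := Cdiff_taylor2 gker (T 1%nat) (T 2%nat) (x * z)%C (x * k)%C (c * / (x * r) ^ 3)).
    rewrite Cmod_scal in HT by lra.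
    replace (Cmod k ^ 2 * (4 * c * / r ^ 3 * / x ^ 2)) with (/ x * (4 * (c * / (x * r) ^ 3) * (x * Cmod k) ^ 2)) by (field; lra).
    apply Rmult_le_compat_l; [apply Rlt_le, Rinv_0_lt_compat; lra|]. apply HT; intros t Ht; rewrite Hline; specialize (Hk k t H Ht);
      destruct (Hn (t * k)%C Hk) as [Hm Hsec]; assert (Hsx := sector_scal s x _ ltac:(lra) Hsec); assert (HR := HD _ Hsx).
    + rewrite <- T0. auto.
    + auto.
    + eapply Rle_trans; [apply T2; auto|]. apply Rmult_le_compat_l; auto. rewrite Cmod_scal by lra. unfold Rdiv. rewrite <- Rinv_mult.
      assert (0 < x * r) by nra. assert (x * r <= x * Cmod (z + t * k)%C) by (apply Rmult_le_compat_l; lra).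
      set (y := x * Cmod (z + t * k)%C) in *. replace (y * y ^ 2) with (y ^ 3) by ring. pos.
  - apply iint_inv_sq.
  - intros k H. apply HG, Hn. lra.
  (* The differentiated integrand is the derivative in [x] of [/ z * gker (x * z)], which vanishes
     at infinity; only the end point [x = 1] contributes. *)
  - replace (0 - / z * gker z)%C with (0 - / z * gker (1 * z))%C by (rewrite Cmult_1_l; reflexivity).
    assert (Hlim : is_lim_seq (fun n => Re (/ z * gker (INR (S n) * z))%C) 0 /\ is_lim_seq (fun n => Im (/ z * gker (INR (S n) * z))%C) 0).
    { apply (is_lim_seq_Cmod_0 _ (fun n => / Cmod z * (c * / Cmod z) * / INR (S n))).
      - intros n. assert (Hn1 := one_le_INR_S n). assert (Hmz := Cmod_pos z Hz0). rewrite Cmod_mult, Cmod_inv, !Rmult_assoc by auto.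
        apply Rmult_le_compat_l; [apply Rlt_le, Rinv_0_lt_compat; auto|].
        assert (H := T2 0%nat (INR (S n) * z)%C ltac:(lia) (sector_scal s (INR (S n)) z ltac:(lra) Hsz)).
        rewrite T0, Cmod_scal, pow_O, Rdiv_1_r, Rinv_mult, (Rmult_comm (/ INR (S n))) in H by lra. lra.
      - replace (Finite 0) with (Finite (/ Cmod z * (c * / Cmod z) * 0)) by (f_equal; ring).
        apply (is_lim_seq_scal_l _ _ 0), is_lim_seq_inv_S. }
    apply (is_cint_primitive _ _ _ improper_1_oo (fun x : R => / z * gker (x * z))%C).
    + intros x Hx. eapply is_Cderive_eq.
      * apply (Cdiff_curve (fun w => / z * gker w)%C (fun x => x * z)%C); [|apply is_Cderive_ray]. apply Cdiff_scal. rewrite <- T0.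
        apply T1; [lia|]. rewrite re_scal_l. nra.
      * field. auto.
    + apply (is_Cderive_ccont _ _ (fun x : R => T 2%nat (x * z) * z)%C). intros x Hx.
      apply (Cdiff_curve (T 1%nat) (fun x => x * z)%C); [|apply is_Cderive_ray]. apply T1; [lia|]. rewrite re_scal_l. nra.
    + apply is_lim_seq_const.
    + apply is_lim_seq_const.
    + tauto.
    + tauto.
Qed.

Lemma Symb_Gint s m : 0 < s <= 1 -> Symb (S m) (sector s) (fun z => / Cmod z) Gint.
Proof.
  intros Hs. assert (HD := fun z => sector_Re s z (proj1 Hs)). assert (Hw : forall z, sector s z -> 0 <= / Cmod z).
  { intros z [Hz _]. pos. }
  split.
  - destruct (Gint_spec s Hs) as [c [_ HG]]. exists c. apply HG.
  - exists (fun z => gker z / z)%C. split; [apply Cdiff_Gint|].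
    apply (Symb_mult _ HD m (fun z => / Cmod z) (fun z => / Cmod z) gker Cinv); auto.
    + apply Symb_gker; auto.
    + apply (Symb_inv _ HD).
Qed.

Lemma gker_real (x : R) : 0 < x -> gker x = RtoC (KR 0 (b * x) / (1 + x ^ 2)).
Proof.
  intros Hx. unfold gker, qker. rewrite <- RtoC_mult, KJ_real by nra. assert (H : 0 < 1 + x * x) by nra.
  rewrite <- RtoC_mult, <- RtoC_plus, <- RtoC_inv, <- RtoC_mult by lra. simpl. rewrite Rmult_1_r. reflexivity.
Qed.

Lemma Gint_real : (forall x : R, 0 < x -> is_derive (fun x : R => Re (Gint x)) x (KR 0 (b * x) / (1 + x ^ 2) / x)) /\
  (forall x : R, 0 < x -> Im (Gint x) = 0) /\ exists c, forall x : R, 0 < x -> Cmod (Gint x) <= c / x.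
Proof.
  destruct (Gint_spec 1 ltac:(lra)) as [c [Hc HG]]. assert (B : forall x : R, 0 < x -> Cmod (Gint x) <= c / x).
  { intros x Hx. assert (H : sector 1 x) by (unfold sector; rewrite Cmod_R, Rabs_right by lra; simpl; lra). apply HG in H.
    rewrite Cmod_R, Rabs_right in H by lra. lra. }
  assert (D : forall x : R, 0 < x -> is_Cderive (fun x : R => Gint x) x (RtoC (KR 0 (b * x) / (1 + x ^ 2) / x))).
  { intros x Hx. eapply is_Cderive_eq.
    - apply (Cdiff_curve Gint (fun t : R => RtoC t)); [apply Cdiff_Gint; auto|apply (is_Cderive_RtoC (fun t => t)), is_derive_Rid].
    - rewrite gker_real, (RtoC_div _ x) by lra. ring. }
  split; [|split].
  - apply D.
  (* The derivative on the axis is real, so the imaginary part is constant on [[x, y]]. For [y]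
     beyond [2 c / e] it would exceed the bound [c / y]. *)
  - intros x Hx. destruct (Req_dec (Im (Gint x)) 0) as [|Hne]; auto. assert (Hp := Rabs_pos_lt _ Hne). set (e := Rabs (Im (Gint x))) in *.
    set (y := Rmax x (2 * c / e + 1)). assert (Hy : x <= y) by apply Rmax_l. assert (Hy2 : 2 * c / e + 1 <= y) by apply Rmax_r.
    assert (H := deriv_bound (fun x : R => Im (Gint x)) (fun _ => 0) x y 0). rewrite Rmin_left, Rmax_right in H by auto.
    rewrite Rmult_0_l in H. assert (H1 : Rabs (Im (Gint y) - Im (Gint x)) <= 0).
    { apply H; [|intros; rewrite Rabs_R0; lra]. intros t Ht. apply (proj2 (D t ltac:(lra))). }
    assert (H2 := B y ltac:(lra)). assert (H3 := Im_le_Cmod (Gint y)). assert (H4 : Im (Gint y) = Im (Gint x)).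
    { assert (H0 := Rabs_pos (Im (Gint y) - Im (Gint x))). apply Rle_antisym in H1; auto. symmetry in H1. apply Rabs_eq_0 in H1. lra. }
    rewrite H4 in H3. fold e in H3. assert (H5 : c / y < e); [|lra]. apply Rlt_div_l; [lra|].
    assert (e * (2 * c / e + 1) <= e * y) by (apply Rmult_le_compat_l; lra).
    replace (e * (2 * c / e + 1)) with (2 * c + e) in * by (field; lra). lra.
  - eauto.
Qed.

End Kernel.

(** * Expansion of the kernel and of its antiderivative at the origin *)

Lemma entire_geom a c : entire a -> entire (fun r => a r * c ^ r).
Proof.
  intros Ha r Hr. apply (ex_series_ext (fun n => Rabs (a n) * (Rabs c * r) ^ n)).
  - intros n. rewrite Rabs_mult, <- RPow_abs, Rpow_mult_distr. lra.
  - apply Ha. pos.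
Qed.

Lemma entire_shift_n a k : entire a -> entire (fun n => a (n + k)%nat).
Proof.
  intros Ha. induction k as [|k IH].
  - apply (entire_le _ a); auto. intros n. rewrite Nat.add_0_r. lra.
  - apply (entire_le _ (fun n => (fun n => a (n + k)%nat) (S n))); [|apply (entire_shift (fun n => a (n + k)%nat)); auto]. intros n.
    replace (n + S k)%nat with (S n + k)%nat by lia. lra.
Qed.

Fixpoint csum (f : nat -> C) (n : nat) : C :=
  match n with O => 0%C | S p => (csum f p + f p)%C end.

(* The Taylor coefficients of [f(X) / (1 + X)]. *)
Fixpoint pdiv (f : nat -> R) (k : nat) : R :=
  match k with O => f O | S i => f (S i) - pdiv f i end.

(** Long division by [1 + X] with explicit remainder. Unlike multiplication by the geometric series
    it holds for every [X], and the factor [X ^ S n] is visible. *)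
Lemma CPS_pdiv f (X : C) n : entire f ->
  (CPS f X - (1 + X) * csum (fun k => X ^ k * pdiv f k) (S n)
   = X ^ S n * (CPS (fun i => f (i + S n)%nat) X - pdiv f n))%C.
Proof.
  intros Hf. induction n as [|n IH].
  - rewrite (CPS_decr f), (CPS_ext (fun i => f (i + 1)%nat) (fun i => f (S i))) by (auto; intros; f_equal; lia). simpl. ring.
  - change (csum (fun k => X ^ k * pdiv f k)%C (S (S n)))
      with (csum (fun k => X ^ k * pdiv f k)%C (S n) + X ^ S n * pdiv f (S n))%C.
    replace (CPS f X - (1 + X) * (csum (fun k => X ^ k * pdiv f k) (S n) + X ^ S n * pdiv f (S n)))%C
      with (CPS f X - (1 + X) * csum (fun k => X ^ k * pdiv f k) (S n) - (1 + X) * (X ^ S n * pdiv f (S n)))%C by ring.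
    rewrite IH, (CPS_decr (fun i => f (i + S n)%nat)) by (apply entire_shift_n; auto).
    rewrite (CPS_ext (fun i => f (S i + S n)%nat) (fun i => f (i + S (S n))%nat)) by (intros; f_equal; lia). cbn [pdiv].
    rewrite RtoC_minus, (Cpow_S X (S n)). simpl; ring.
Qed.

Section Expansion.

Variable g0 : R.
Hypothesis Hg0 : euler_limit g0.
Variable b : R.
Hypothesis Hb : 0 < b.

(** The series in [z^2] multiplying [- Clog z] in [K_0 (b z)]; [fcoef] is the part without
    logarithm, with [ln (b / 2)] merged into [lam]. *)
Definition ecoef (r : nat) : R := ci r * (b ^ 2 / 4) ^ r.
Definition fcoef (r : nat) : R := (Hn r + - lam g0 b) * ci r * (b ^ 2 / 4) ^ r.

Lemma entire_ecoef : entire ecoef.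
Proof. apply entire_geom, entire_ci. Qed.

Lemma entire_fcoef : entire fcoef.
Proof. apply (entire_geom (fun r => (Hn r + - lam g0 b) * ci r)), entire_Hn_ci. Qed.

Lemma CPS_rescale a (z : C) : CPS a ((b * z) ^ 2 / 4)%C = CPS (fun r => a r * (b ^ 2 / 4) ^ r) (z * z)%C.
Proof.
  apply CSeries_ext. intros r. replace ((b * z) ^ 2 / 4)%C with (RtoC (b ^ 2 / 4) * (z * z))%C
    by (rewrite RtoC_div, RtoC_pow by lra; field; intros E; apply RtoC_inj in E; lra).
  rewrite Cpow_mult_l, RtoC_mult, <- RtoC_pow. ring.
Qed.

Lemma KJ_expand z : 0 < Re z ->
  KJ 0 (b * z)%C = (CPS fcoef (z * z) - Clog z * CPS ecoef (z * z))%C.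
Proof.
  intros Hz. rewrite <- (BesselK0_KJ g0 Hg0) by (apply Re_scal_pos; auto). rewrite (BesselK0_E2 g0 Hg0). unfold E2. rewrite !CPS_rescale.
  replace (b * z / 2)%C with ((b / 2)%R * z)%C
    by (rewrite RtoC_div by lra; field; intros E; apply RtoC_inj in E; lra).
  rewrite Clog_mult_pos by lra. rewrite (CPS_ext fcoef (fun r => ti g0 r * (b ^ 2 / 4) ^ r + - ln (b / 2) * ecoef r)).
  - rewrite CPS_plus, CPS_scal; try apply entire_scal; try apply entire_ecoef; try (apply entire_geom, entire_ti). fold ecoef.
    rewrite RtoC_opp. ring.
  - intros r. unfold fcoef, ti, ecoef, lam. ring.
Qed.

Definition pker (k : nat) (z : C) : C := ((z * z) ^ k * (pdiv fcoef k - pdiv ecoef k * Clog z))%C.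
Definition Rker (n : nat) (z : C) : C := (gker b z - csum (fun k => pker k z) (S n))%C.

Lemma csum_plus f g n : csum (fun k => f k + g k)%C n = (csum f n + csum g n)%C.
Proof. induction n; simpl; [ring|rewrite IHn; ring]. Qed.

Lemma csum_scal c f n : csum (fun k => c * f k)%C n = (c * csum f n)%C.
Proof. induction n; simpl; [ring|rewrite IHn; ring]. Qed.

Lemma csum_ext f g n : (forall i, (i < n)%nat -> f i = g i) -> csum f n = csum g n.
Proof. intros H. induction n; simpl; auto. rewrite IHn, H by auto. reflexivity. Qed.

Lemma Rker_eq n z : 0 < Re z -> Rker n z = (qker z * ((z * z) ^ S n *
   ((CPS (fun i => fcoef (i + S n)%nat) (z * z) + - pdiv fcoef n)
    + - (1) * (Clog z * (CPS (fun i => ecoef (i + S n)%nat) (z * z) + - pdiv ecoef n)))))%C.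
Proof.
  intros Hz. assert (Hq := one_plus_sq_neq_0 z Hz). unfold Rker, gker. rewrite KJ_expand by auto.
  assert (H1 := CPS_pdiv fcoef (z * z)%C n entire_fcoef). assert (H2 := CPS_pdiv ecoef (z * z)%C n entire_ecoef).
  set (X := (z * z)%C) in *. set (L := Clog z). set (sf := csum (fun k => X ^ k * pdiv fcoef k)%C (S n)) in *.
  set (se := csum (fun k => X ^ k * pdiv ecoef k)%C (S n)) in *. replace (csum (fun k => pker k z) (S n)) with (sf + - L * se)%C.
  - replace (X ^ S n * (CPS (fun i => fcoef (i + S n)%nat) X + - pdiv fcoef n
      + - (1) * (L * (CPS (fun i => ecoef (i + S n)%nat) X + - pdiv ecoef n))))%C
      with (X ^ S n * (CPS (fun i => fcoef (i + S n)%nat) X - pdiv fcoef n)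
      - L * (X ^ S n * (CPS (fun i => ecoef (i + S n)%nat) X - pdiv ecoef n)))%C by ring.
    rewrite <- H1, <- H2. unfold qker. fold X. field; auto.
  - unfold sf, se. rewrite <- csum_scal, <- csum_plus. apply csum_ext. intros k _. unfold pker. fold X L. ring.
Qed.

Definition wK (n : nat) (z : C) : R := Cmod z ^ (2 * S n) * logw z.

Lemma wK_pos n z : 0 <= wK n z.
Proof. apply Rmult_le_pos; [pos|]. assert (H := logw_ge_1 z). lra. Qed.

Lemma Symb_sq_pow (D : C -> Prop) m n : (forall z, D z -> 0 < Re z) ->
  Symb m D (fun z => Cmod z ^ (2 * n)) (fun z => (z * z) ^ n)%C.
Proof.
  intros HD. apply (Symb_ext D HD m _ (fun z => z ^ (2 * n))%C).
  - intros z _. rewrite Cpow_mult_r. f_equal. ring.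
  - apply (Symb_pow D HD).
Qed.

Lemma Symb_Rker_near s m n : 0 < s <= 1 ->
  Symb m (fun z => sector s z /\ Cmod z <= 1) (wK n) (Rker n).
Proof.
  intros Hs. set (D := fun z => sector s z /\ Cmod z <= 1).
  assert (HD : forall z, D z -> 0 < Re z) by (intros z [Hz _]; apply (sector_Re s); lra || auto).
  assert (W1 : forall z : C, D z -> 0 <= 1) by (intros; lra).
  assert (WL : forall z, D z -> 0 <= logw z) by (intros z _; assert (H := logw_ge_1 z); lra).
  assert (WP : forall z, D z -> 0 <= Cmod z ^ (2 * S n)) by (intros z _; apply pow_le, Cmod_ge_0).
  assert (HC : forall a c, entire a -> Symb m D (fun _ => 1) (fun z => CPS (fun i => a (i + S n)%nat) (z * z) + c)%C).
  { intros a c Ha. apply Symb_plus; [|apply (Symb_const D HD)].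
    apply (Symb_sub m (fun z => 0 < Re z /\ Cmod z <= 1)); [intros z Hz; split; [auto|apply Hz]|]. apply Symb_even_CPS.
    apply entire_shift_n; auto. }
  apply (Symb_ext D HD m _ _ _ (fun z Hz => eq_sym (Rker_eq n z Hz))).
  apply (Symb_weight_eq D HD m (fun z => 1 * (Cmod z ^ (2 * S n) * logw z))).
  - intros z Hz. rewrite Rmult_1_l. apply wK_pos.
  - intros z _. unfold wK. ring.
  - apply (Symb_mult D HD m (fun _ => 1) (fun z => Cmod z ^ (2 * S n) * logw z)); auto.
    + intros z _. apply (wK_pos n).
    + apply (Symb_sub m (sector s)); [intros z Hz; apply Hz|]. apply Symb_qker; auto.
    + apply (Symb_mult D HD m (fun z => Cmod z ^ (2 * S n)) logw); auto.
      * apply Symb_sq_pow; auto.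
      * apply Symb_plus.
        -- apply (Symb_weight D HD m (fun _ => 1) _ _ 1); auto.
          ++ intros z _. assert (H := logw_ge_1 z). lra.
          ++ apply HC, entire_fcoef.
        -- apply (Symb_scal D HD); auto.
          apply (Symb_weight_eq D HD m (fun z => logw z * 1)); [intros z Hz; rewrite Rmult_1_r; auto|intros; ring|].
          apply (Symb_mult D HD); auto; [apply (Symb_log D HD)|apply HC, entire_ecoef].
Qed.

Lemma Symb_Rker_far s m n : 0 < s <= 1 ->
  Symb m (fun z => sector s z /\ 1 <= Cmod z) (wK n) (Rker n).
Proof.
  intros Hs. set (D := fun z => sector s z /\ 1 <= Cmod z).
  assert (HD : forall z, D z -> 0 < Re z) by (intros z [Hz _]; apply (sector_Re s); lra || auto).
  assert (WL : forall z, D z -> 0 <= logw z) by (intros z _; assert (H := logw_ge_1 z); lra).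
  assert (HP : forall k, (k <= S n)%nat -> Symb m D (wK n) (fun z => - (1) * pker k z)%C).
  { intros k Hk. apply (Symb_scal D HD); [intros; apply wK_pos|]. apply (Symb_weight D HD m (fun z => Cmod z ^ (2 * k) * logw z) _ _ 1).
    - intros z Hz. apply Rmult_le_pos; auto. pos.
    - intros z Hz. rewrite Rmult_1_l. apply Rmult_le_compat_r; auto. apply Rle_pow; [apply Hz|lia].
    - apply (Symb_mult D HD); auto.
      + intros; pos.
      + apply Symb_sq_pow; auto.
      + apply (Symb_ext D HD m _ (fun z => pdiv fcoef k + - pdiv ecoef k * Clog z)%C); [intros; ring|]. apply Symb_plus.
        * apply (Symb_weight D HD m (fun _ => 1) _ _ 1); [intros; lra| |apply (Symb_const D HD)]. intros z _. assert (H := logw_ge_1 z).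
          lra.
        * apply (Symb_scal D HD); auto. apply (Symb_log D HD). }
  apply (Symb_ext D HD m _ (fun z => gker b z + csum (fun k => - (1) * pker k z) (S n))%C).
  { intros z _. unfold Rker. rewrite csum_scal. ring. }
  apply Symb_plus.
  - apply (Symb_weight D HD m (fun z => / Cmod z) _ _ 1).
    + intros z [[Hz _] _]. pos.
    + intros z [_ Hz]. unfold wK. assert (H := logw_ge_1 z). assert (1 <= Cmod z ^ (2 * S n)) by (apply pow_R1_Rle; auto).
      apply Rle_trans with 1; [rewrite <- Rinv_1; apply Rinv_le_contravar; lra|nra].
    + apply (Symb_sub m (sector s)); [intros z Hz; apply Hz|]. apply Symb_gker; auto.
  - assert (HS : forall j, (j <= S (S n))%nat -> Symb m D (wK n) (fun z => csum (fun k => - (1) * pker k z)%C j)).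
    { induction j as [|j IH]; intros Hj.
      - apply (Symb_zero D HD). intros; apply wK_pos.
      - apply (Symb_plus D m (wK n) (fun z => csum (fun k => - (1) * pker k z)%C j) (fun z => - (1) * pker j z)%C); [apply IH|apply HP]; lia. }
    auto.
Qed.

Lemma Symb_Rker s m n : 0 < s <= 1 -> Symb m (sector s) (wK n) (Rker n).
Proof.
  intros Hs. apply (Symb_union m (fun z => sector s z /\ Cmod z <= 1) (fun z => sector s z /\ 1 <= Cmod z)).
  - intros z [Hz _]. apply (sector_Re s); lra || auto.
  - intros z [Hz _]. apply (sector_Re s); lra || auto.
  - intros; apply wK_pos.
  - intros; apply wK_pos.
  - intros z Hz. destruct (Rle_dec (Cmod z) 1); [left|right]; split; auto; lra.
  - apply Symb_Rker_near; auto.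
  - apply Symb_Rker_far; auto.
Qed.

(** Chosen so that [z d/dz] maps [z^(2k) (aG k - bG k log z)] to [z^(2k) (pdiv fcoef k - pdiv ecoef
    k log z)]: the conditions are [2 k bG = pdiv ecoef k] and [2 k aG - bG = pdiv fcoef k]. *)
Definition aG (k : nat) : R := pdiv fcoef k / (2 * INR k) + pdiv ecoef k / (4 * INR k ^ 2).
Definition bG (k : nat) : R := pdiv ecoef k / (2 * INR k).
Definition PolyG (n : nat) (z : C) : C :=
  (- lam g0 b * Clog z + - / 2 * (Clog z * Clog z)
   + csum (fun i => (z * z) ^ S i * (aG (S i) + - bG (S i) * Clog z)) n)%C.

Lemma Cdiff_sq_pow k (z : C) : z <> RtoC 0 -> Cdiff (fun z => (z * z) ^ k)%C z (RtoC (2 * INR k) * (z * z) ^ k / z)%C.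
Proof.
  intros Hz. induction k as [|k IH].
  - simpl. eapply Cdiff_eq; [apply Cdiff_const|]. rewrite Rmult_0_r. field. auto.
  - apply (Cdiff_ext (fun z => (z * z) * (z * z) ^ k)%C); [intros; rewrite Cpow_S; reflexivity|]. eapply Cdiff_eq.
    + apply (Cdiff_mult (fun z => z * z)%C); [|exact IH]. apply (Cdiff_mult (fun z => z) (fun z => z)); apply Cdiff_id.
    + rewrite S_INR, Cpow_S, !RtoC_mult, RtoC_plus. field. auto.
Qed.

Lemma Cdiff_PolyG n z : 0 < Re z -> Cdiff (PolyG n) z (csum (fun k => pker k z) (S n) / z)%C.
Proof.
  intros Hz. assert (Hz0 := Re_pos_neq_0 z Hz). assert (HL := Cdiff_Clog z Hz). induction n as [|n IH].
  - apply (Cdiff_ext (fun z => - lam g0 b * Clog z + - / 2 * (Clog z * Clog z))%C); [intros; unfold PolyG; simpl; ring|]. eapply Cdiff_eq.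
    + apply Cdiff_plus; apply Cdiff_scal; [exact HL|]. apply (Cdiff_mult Clog Clog); exact HL.
    + unfold pker, fcoef, ecoef. simpl. rewrite ci_0. replace (Hn 0) with 0 by reflexivity. rewrite !Rmult_1_r, Rplus_0_l, RtoC_opp.
      field. auto.
  - apply (Cdiff_ext (fun z => PolyG n z + (z * z) ^ S n * (aG (S n) + - bG (S n) * Clog z))%C);
      [intros; unfold PolyG; simpl; ring|].
    eapply Cdiff_eq.
    + apply Cdiff_plus; [exact IH|].
      apply (Cdiff_mult (fun z => (z * z) ^ S n)%C (fun z => aG (S n) + - bG (S n) * Clog z)%C); [apply Cdiff_sq_pow; auto|].
      apply Cdiff_plus; [apply Cdiff_const|apply Cdiff_scal; exact HL].
    + change (csum (fun k => pker k z) (S (S n))) with (csum (fun k => pker k z) (S n) + pker (S n) z)%C.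
      assert (HN : INR (S n) <> 0) by (apply not_0_INR; lia).
      assert (HNC : RtoC (INR (S n)) <> RtoC 0) by (intros E; apply RtoC_inj in E; auto).
      assert (E1 : (RtoC (2 * INR (S n)) * aG (S n) = pdiv fcoef (S n) + bG (S n))%C).
      { rewrite <- RtoC_mult, <- RtoC_plus. f_equal. unfold aG, bG. field; lra. }
      assert (E2 : (RtoC (2 * INR (S n)) * bG (S n) = pdiv ecoef (S n))%C).
      { rewrite <- RtoC_mult. f_equal. unfold bG. field; lra. }
      unfold pker. replace (pdiv fcoef (S n) - pdiv ecoef (S n) * Clog z)%C
        with (RtoC (2 * INR (S n)) * aG (S n) - bG (S n) - RtoC (2 * INR (S n)) * bG (S n) * Clog z)%C
        by (rewrite E1, E2; ring).
      field. auto.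
Qed.

(** Minus the finite part of [Gint b] at [0], so that [RG] tends to [0] there. *)
Definition G0c : R := Sser g0 b - PI ^ 2 / 24.
Definition RG (n : nat) (z : C) : C := (Gint b z + G0c - PolyG n z)%C.

Lemma Cdiff_RG n z : 0 < Re z -> Cdiff (RG n) z (Rker n z * / z)%C.
Proof.
  intros Hz. eapply Cdiff_eq.
  - apply Cdiff_minus; [apply Cdiff_plus; [apply Cdiff_Gint; auto|apply Cdiff_const]|apply Cdiff_PolyG; auto].
  - unfold Rker. field. apply Re_pos_neq_0; auto.
Qed.

Lemma id_log_mono t x : 0 < t <= x -> t * (1 + Rabs (ln t)) <= x * (1 + Rabs (ln x)).
Proof.
  intros H. set (r := x / t). assert (Hr : 1 <= r) by (apply Rle_div_r; lra). assert (Ht : x = r * t) by (unfold r; field; lra).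
  assert (Hlr : 0 <= ln r) by (apply ln_ge_0; auto). assert (Hlr2 : ln r <= r - 1).
  { assert (H2 := sub_ln_1p_bounds (r - 1) ltac:(lra)). replace (1 + (r - 1)) with r in H2 by ring. lra. }
  assert (Hlt : Rabs (ln t) <= Rabs (ln x) + ln r).
  { replace (ln t) with (ln x + - ln r) by (rewrite Ht, ln_mult by lra; ring). via Rabs_triang.
    rewrite Rabs_Ropp, (Rabs_right (ln r)) by lra. lra. }
  assert (H0 := Rabs_pos (ln x)). nra.
Qed.

Lemma csum_real_small n : exists c, forall y, 0 < y <= 1 ->
  Rabs (psum (fun i => ((y / b) * (y / b)) ^ S i * (aG (S i) - bG (S i) * ln (y / b))) n) <= c * (y * (1 + Rabs (ln y))).
Proof.
  induction n as [|n [c IH]].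
  - exists 0. intros y Hy. simpl. rewrite Rabs_R0. lra.
  - set (d := Rabs (aG (S n)) + Rabs (bG (S n)) * (1 + Rabs (ln b))). exists (c + (/ b * / b) ^ S n * d). intros y Hy. via Rabs_triang.
    rewrite Rmult_plus_distr_r. apply Rplus_le_compat; [apply IH; auto|].
    assert (Hib : 0 < (/ b * / b) ^ S n) by (assert (H := Rinv_0_lt_compat b Hb); apply pow_lt; nra).
    replace ((y / b * (y / b)) ^ S n) with ((/ b * / b) ^ S n * (y * y) ^ S n) by (rewrite <- Rpow_mult_distr; f_equal; field; lra).
    rewrite !Rmult_assoc. rewrite Rabs_mult, (Rabs_right ((/ b * / b) ^ S n)) by lra. apply Rmult_le_compat_l; [lra|].
    assert (Hl : Rabs (aG (S n) - bG (S n) * ln (y / b)) <= d * (1 + Rabs (ln y))).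
    { unfold Rdiv. rewrite ln_mult, ln_Rinv by pos. assert (H1 := Rabs_pos (aG (S n))). assert (H2 := Rabs_pos (bG (S n))).
      assert (H3 := Rabs_pos (ln y)). assert (H4 := Rabs_pos (ln b)). via Rabs_triang. rewrite Rabs_Ropp, Rabs_mult.
      assert (H5 : Rabs (ln y + - ln b) <= Rabs (ln y) + Rabs (ln b)) by (via Rabs_triang; rewrite Rabs_Ropp; lra).
      assert (Rabs (bG (S n)) * Rabs (ln y + - ln b) <= Rabs (bG (S n)) * ((1 + Rabs (ln b)) * (1 + Rabs (ln y)))) by (apply Rmult_le_compat_l; nra).
      unfold d. nra. }
    assert (Hy2 : 0 <= (y * y) ^ S n <= y).
    { split; [apply pow_le; nra|]. simpl. assert ((y * y) ^ n <= 1) by (rewrite <- (pow1 n); apply pow_incr; nra). nra. }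
    rewrite Rabs_mult, (Rabs_right ((y * y) ^ S n)) by lra.
    replace (d * (y * (1 + Rabs (ln y)))) with (y * (d * (1 + Rabs (ln y)))) by ring. pos.
Qed.

Lemma PolyG_real n (x : R) : 0 < x -> PolyG n x =
  RtoC (- lam g0 b * ln x - / 2 * ln x ^ 2 + psum (fun i => (x * x) ^ S i * (aG (S i) - bG (S i) * ln x)) n).
Proof.
  intros Hx. unfold PolyG. rewrite Clog_R by auto. assert (E : csum (fun i => (x * x) ^ S i * (aG (S i) + - bG (S i) * ln x))%C n
    = RtoC (psum (fun i => (x * x) ^ S i * (aG (S i) - bG (S i) * ln x)) n)).
  { induction n as [|n IH]; [reflexivity|]. cbn [csum psum]. rewrite IH.
    rewrite RtoC_plus, RtoC_mult, RtoC_minus, !RtoC_mult, RtoC_pow, RtoC_mult. ring. }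
  rewrite E, RtoC_plus, RtoC_minus, !RtoC_mult, RtoC_pow, !RtoC_opp. rewrite RtoC_inv by lra. ring.
Qed.

Lemma RG_real n (x : R) : 0 < x -> RG n x = RtoC (Re (RG n x)).
Proof.
  intros Hx. apply C_eq_Re_Im; [reflexivity|]. unfold RG. rewrite PolyG_real by auto. unfold Cminus.
  destruct (Gint_real b Hb) as [_ [H _]]. specialize (H x Hx). rewrite !im_plus, H. simpl; lra.
Qed.

Lemma RG_lim n : is_lim_seq (fun j => Re (RG n (RtoC (/ INR (S j) / b)))) 0.
Proof.
  destruct (Gint_real b Hb) as [D [_ [c B]]]. assert (F := finite_part g0 Hg0 b (fun x : R => Re (Gint b x)) c Hb D).
  assert (F2 : forall x : R, 0 < x -> Rabs (Re (Gint b x)) <= c / x).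
  { intros x Hx. eapply Rle_trans; [apply re_le_Cmod|auto]. }
  specialize (F F2). destruct (csum_real_small n) as [d Hd].
  assert (L := lim_lo_log (fun y => psum (fun i => ((y / b) * (y / b)) ^ S i * (aG (S i) - bG (S i) * ln (y / b))) n) d 0 1).
  assert (L1 : is_lim_seq (fun j => psum (fun i => ((/ INR (S j) / b) * (/ INR (S j) / b)) ^ S i * (aG (S i) - bG (S i) * ln (/ INR (S j) / b))) n) 0).
  { apply L. intros y Hy. rewrite Rminus_0_r, pow_1. auto. }
  apply (is_lim_seq_ext (fun j => (let x := / INR (S j) / b in Re (Gint b x) + / 2 * ln x ^ 2 + lam g0 b * ln x)
    + G0c - psum (fun i => ((/ INR (S j) / b) * (/ INR (S j) / b)) ^ S i * (aG (S i) - bG (S i) * ln (/ INR (S j) / b))) n)).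
  - intros j. set (x := / INR (S j) / b). assert (Hx : 0 < x).
    { apply Rdiv_lt_0_compat; auto. apply Rinv_0_lt_compat, lt_0_INR; lia. }
    unfold RG, Cminus. rewrite PolyG_real by auto. simpl; lra.
  - replace (Finite 0) with (Finite (PI ^ 2 / 24 - Sser g0 b + G0c - 0)) by (f_equal; unfold G0c; ring). apply is_lim_seq_minus'; auto.
    apply is_lim_seq_plus'; [pos|apply is_lim_seq_const].
Qed.

Lemma wK_RtoC n (t : R) : 0 < t -> wK n t = t ^ (2 * n + 1) * (t * (1 + Rabs (ln t))).
Proof.
  intros Ht. unfold wK, logw. rewrite Cmod_R, Rabs_right by lra. replace (2 * S n)%nat with (S (2 * n + 1)) by lia. simpl; lra.
Qed.

(** [RG] tends to [0] along the points [/ INR (S j) / b], and its derivative [Rker / x] is small;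
    integrating from these points gives the bound. Near [0] the weight is handled by the
    monotonicity of [t * (1 + Rabs (ln t))]. *)
Lemma RG_bound_real n : exists c, 0 <= c /\ forall x : R, 0 < x -> Cmod (RG n x) <= c * wK n x.
Proof.
  destruct (Symb_bound (sector 1) 0 _ _ (Symb_Rker 1 0 n ltac:(lra)) (fun z _ => wK_pos n z)) as [c [Hc B]]. exists c. split; auto.
  intros x Hx. rewrite RG_real, Cmod_R by auto. set (M := c * (x ^ (2 * n) * (x * (1 + Rabs (ln x))))).
  assert (Hlip : forall y, 0 < y <= x -> Rabs (Re (RG n x) - Re (RG n y)) <= c * wK n x).
  { intros y Hy. assert (H := deriv_bound (fun t : R => Re (RG n t)) (fun t : R => Re (Rker n t * / t)%C) y x M).
    rewrite Rmin_left, Rmax_right in H by lra. apply Rle_trans with (M * Rabs (x - y)).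
    - apply H; intros t Ht; assert (Ht0 : 0 < t) by lra.
      + destruct (Cdiff_curve (RG n) (fun t : R => RtoC t) t _ _ (Cdiff_RG n t Ht0) (is_Cderive_RtoC _ _ _ (is_derive_Rid t))) as [H1 _].
        eapply is_derive_eq; [exact H1|]. simpl; lra.
      + via re_le_Cmod. rewrite Cmod_mult, <- RtoC_inv, Cmod_R, Rabs_right
          by (try (apply Rle_ge, Rlt_le, Rinv_0_lt_compat); lra).
        assert (Hs : sector 1 t) by (unfold sector; rewrite Cmod_R, Rabs_right by lra; simpl; lra). assert (H1 := B _ Hs).
        rewrite wK_RtoC in H1 by auto. replace (2 * n + 1)%nat with (S (2 * n)) in H1 by lia.
        apply Rle_trans with (c * (t ^ S (2 * n) * (t * (1 + Rabs (ln t)))) * / t).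
        * pos.
        * replace (c * (t ^ S (2 * n) * (t * (1 + Rabs (ln t)))) * / t) with (c * (t ^ (2 * n) * (t * (1 + Rabs (ln t))))) by (simpl; field; lra).
          apply Rmult_le_compat_l; auto. assert (H0 := Rabs_pos (ln t)). apply Rmult_le_compat.
          -- pos.
          -- pos.
          -- pos.
          -- apply id_log_mono; lra.
    - assert (H0 := Rabs_pos (ln x)). assert (HM : 0 <= M).
      { apply Rmult_le_pos; auto. pos. }
      rewrite Rabs_right by lra. rewrite wK_RtoC by auto. apply Rle_trans with (M * x); [nra|]. unfold M.
      replace (2 * n + 1)%nat with (S (2 * n)) by lia. simpl; lra. }
  enough (0 <= c * wK n x - Rabs (Re (RG n x) - 0)) by (rewrite Rminus_0_r in *; lra).
  apply (le_lim_lo (fun y => c * wK n x - Rabs (Re (RG n x) - Re (RG n (RtoC (y / b))))) _ _ (x * b)); [pos| |].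
  - intros y Hy. assert (H := Hlip (y / b)). enough (0 < y / b <= x) by (specialize (H ltac:(auto)); lra).
    split; [pos|]. apply Rle_div_l; lra.
  - apply is_lim_seq_minus'; [apply is_lim_seq_const|]. apply (is_lim_seq_abs _ (Re (RG n x) - 0)).
    apply is_lim_seq_minus'; [apply is_lim_seq_const|apply RG_lim].
Qed.

Lemma cos_le_of_Rabs t phi : Rabs t <= Rabs phi -> - PI / 2 < phi < PI / 2 -> cos phi <= cos t.
Proof.
  intros Ht Hp. assert (E : forall u, cos u = cos (Rabs u)).
  { intros u. unfold Rabs. destruct (Rcase_abs u); [rewrite cos_neg|]; reflexivity. }
  rewrite (E phi), (E t). assert (H0 := Rabs_pos t). assert (H1 : Rabs phi <= PI / 2) by (apply Rabs_le; lra).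
  destruct (Req_dec (Rabs t) (Rabs phi)) as [->|]; [lra|]. apply Rlt_le, cos_decreasing_1; lra.
Qed.

(** The value is carried from the real axis to [z] along the arc of radius [Cmod z]. The weight
    depends on the modulus only and the arc stays in the sector; the angle is below [2], hence the
    added [4 c]. *)
Lemma RG_bound s n : 0 < s <= 1 -> exists c, 0 <= c /\ forall z, sector s z -> Cmod (RG n z) <= c * wK n z.
Proof.
  intros Hs. destruct (RG_bound_real n) as [c1 [Hc1 B1]].
  destruct (Symb_bound (sector s) 0 _ _ (Symb_Rker s 0 n Hs) (fun z _ => wK_pos n z)) as [c [Hc B]]. exists (c1 + 4 * c). split; [lra|].
  intros z Hz. assert (HR := sector_Re s z (proj1 Hs) Hz). assert (Hr : 0 < Cmod z) by apply (proj1 Hz). set (rho := Cmod z) in *.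
  destruct (polar_form z HR) as [phi [Hp [Ez Hcos]]]. fold rho in Ez, Hcos. assert (Ew : forall t, wK n (polar rho t) = wK n rho).
  { intros t. unfold wK, logw. rewrite Cmod_polar_eq, Cmod_R, (Rabs_right rho) by lra. reflexivity. }
  assert (Harc : forall t, Rabs t <= Rabs phi -> sector s (polar rho t)).
  { split; rewrite Cmod_polar_eq by lra; auto. rewrite Rmult_comm. apply Rmult_le_compat_l; [lra|].
    apply Rle_trans with (cos phi); [|apply cos_le_of_Rabs; auto]. rewrite Hcos. apply Rle_div_r; auto. destruct Hz; auto. }
  assert (Hin : forall t, Rmin 0 phi <= t <= Rmax 0 phi -> Rabs t <= Rabs phi).
  { intros t. unfold Rmin, Rmax. destruct (Rle_dec 0 phi); intros Ht.
    - rewrite !Rabs_right; lra.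
    - rewrite !Rabs_left1; lra. }
  assert (H := Cderive_bound (fun t => RG n (polar rho t)) (fun t => Rker n (polar rho t) * Ci)%C 0 phi (c * wK n rho)).
  assert (H1 : Cmod (RG n (polar rho phi) - RG n (polar rho 0))%C <= 2 * (c * wK n rho) * Rabs (phi - 0)).
  { apply H; intros t Ht; apply Hin, Harc in Ht.
    - assert (HRt := sector_Re s _ (proj1 Hs) Ht). eapply is_Cderive_eq.
      + apply (Cdiff_curve (RG n) (polar rho)); [apply Cdiff_RG; auto|apply is_Cderive_polar].
      + field. apply Re_pos_neq_0; auto.
    - rewrite Cmod_mult, Cmod_Ci, Rmult_1_r, <- (Ew t). auto. }
  rewrite <- Ez, polar_0, Rminus_0_r in H1. assert (Hw := wK_pos n rho).
  assert (Hphi : Rabs phi <= 2) by (assert (HP4 := PI_4); apply Rabs_le; lra). rewrite Ez at 2. rewrite Ew.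
  replace (RG n z) with (RG n rho + (RG n z - RG n rho))%C by ring. via Cmod_triangle. rewrite Rmult_plus_distr_r.
  apply Rplus_le_compat; auto. assert (0 <= c * wK n rho) by nra. nra.
Qed.

Lemma Symb_RG s m n : 0 < s <= 1 -> Symb (S m) (sector s) (wK n) (RG n).
Proof.
  intros Hs. assert (HD := fun z => sector_Re s z (proj1 Hs)). split.
  - destruct (RG_bound s n Hs) as [c [_ H]]. eauto.
  - exists (fun z => Rker n z * / z)%C. split; [apply Cdiff_RG|]. apply (Symb_mult _ HD m (wK n) (fun z => / Cmod z) (Rker n) Cinv).
    + intros; apply wK_pos.
    + intros z [Hz _]. pos.
    + apply Symb_Rker; auto.
    + apply (Symb_inv _ HD).
Qed.

End Expansion.

(** * Regularised sums of complex jets *)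

Definition RegC (m : nat) (J : nat -> R -> C) : C :=
  (Reg m (fun j x => Re (J j x)), Reg m (fun j x => Im (J j x))).

Definition is_Cjet (m : nat) (J : nat -> R -> C) (B : R) : Prop :=
  (forall j x, (j < S m)%nat -> 0 < x -> is_Cderive (J j) x (J (S j) x)) /\
  forall x, 1 <= x -> Cmod (J (S m) x) <= B / x ^ 2.

Lemma is_Cjet_Re m J B : is_Cjet m J B -> em_admissible m (fun j x => Re (J j x)) B.
Proof.
  intros [H1 H2]. split.
  - intros j x Hj Hx. apply H1; auto. lra.
  - intros x Hx. eapply Rle_trans; [apply re_le_Cmod|auto].
Qed.

Lemma is_Cjet_Im m J B : is_Cjet m J B -> em_admissible m (fun j x => Im (J j x)) B.
Proof.
  intros [H1 H2]. split.
  - intros j x Hj Hx. apply H1; auto. lra.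
  - intros x Hx. eapply Rle_trans; [apply Im_le_Cmod|auto].
Qed.

Lemma is_Cderive_plus (f g : R -> C) (t : R) (d e : C) :
  is_Cderive f t d -> is_Cderive g t e -> is_Cderive (fun t => f t + g t)%C t (d + e)%C.
Proof.
  intros [F1 F2] [G1 G2]. split.
  - apply is_derive_Rplus; auto.
  - apply is_derive_Rplus; auto.
Qed.

Lemma is_Cjet_plus m J1 J2 A1 A2 : is_Cjet m J1 A1 -> is_Cjet m J2 A2 ->
  is_Cjet m (fun j x => J1 j x + J2 j x)%C (A1 + A2).
Proof.
  intros [H1 H2] [H3 H4]. split.
  - intros j x Hj Hx. apply is_Cderive_plus; auto.
  - intros x Hx. via Cmod_triangle. unfold Rdiv. rewrite Rmult_plus_distr_r. apply Rplus_le_compat; auto.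
Qed.

Lemma RegC_plus m J1 J2 A1 A2 : (1 <= m)%nat -> is_Cjet m J1 A1 -> is_Cjet m J2 A2 ->
  RegC m (fun j x => J1 j x + J2 j x)%C = (RegC m J1 + RegC m J2)%C.
Proof.
  transitivity (Reg m (fun j x => Re (J1 j x)) + Reg m (fun j x => Re (J2 j x)),
    Reg m (fun j x => Im (J1 j x)) + Reg m (fun j x => Im (J2 j x))); [|reflexivity].
  unfold RegC. f_equal.
  - rewrite <- (Reg_plus m _ _ A1 A2) by (auto; apply is_Cjet_Re; auto). auto.
  - rewrite <- (Reg_plus m _ _ A1 A2) by (auto; apply is_Cjet_Im; auto). auto.
Qed.

Lemma RegC_bound m J B : (1 <= m)%nat -> is_Cjet m J B -> (forall j, (j <= m)%nat -> Cmod (J j 1) <= B) ->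
  Cmod (RegC m J) <= 6 * em_const m * B.
Proof.
  intros Hm H HB. via Cmod_le_Re_Im. simpl.
  assert (R1 := Reg_bound m _ B Hm (is_Cjet_Re _ _ _ H) (fun j Hj => Rle_trans _ _ _ (re_le_Cmod (J j 1)) (HB j Hj))).
  assert (R2 := Reg_bound m _ B Hm (is_Cjet_Im _ _ _ H) (fun j Hj => Rle_trans _ _ _ (Im_le_Cmod (J j 1)) (HB j Hj))). lra.
Qed.

(** The function at level [0] determines the higher levels by uniqueness of derivatives. So jets of
    one function built in different ways, by scaling a tower or from powers and logarithms, have the
    same value. *)
Lemma RegC_unique m J1 J2 A1 A2 : (1 <= m)%nat -> is_Cjet m J1 A1 -> is_Cjet m J2 A2 ->
  (forall x, 0 < x -> J1 O x = J2 O x) -> RegC m J1 = RegC m J2.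
Proof.
  intros Hm [H1 _] [H2 _] H0. assert (E : forall j, (j <= m)%nat -> forall x, 0 < x -> J1 j x = J2 j x).
  { induction j as [|j IH]; intros Hj x Hx; auto. destruct (H1 j x ltac:(lia) Hx) as [P1 P2]. destruct (H2 j x ltac:(lia) Hx) as [Q1 Q2].
    assert (IH' : forall y, 0 < y < x + 1 -> J1 j y = J2 j y) by (intros; apply IH; [lia|lra]). apply C_eq_Re_Im.
    - apply (is_derive_local_eq (fun t => Re (J1 j t)) (fun t => Re (J2 j t)) (fun t => Re (J1 (S j) t)) (fun t => Re (J2 (S j) t)) x 0 (x + 1)); auto; [lra|].
      intros y Hy. rewrite IH'; auto.
    - apply (is_derive_local_eq (fun t => Im (J1 j t)) (fun t => Im (J2 j t)) (fun t => Im (J1 (S j) t)) (fun t => Im (J2 (S j) t)) x 0 (x + 1)); auto; [lra|].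
      intros y Hy. rewrite IH'; auto. }
  unfold RegC. f_equal; apply Reg_ext; auto; intros j x Hj Hx; rewrite E by (auto; lra); reflexivity.
Qed.

Lemma RegC_plj A m k a c : 0 <= A -> 2 * A + 2 <= INR m -> Rabs a <= A ->
  is_Cjet m (fun j x => c * plj j k a x)%C (Cmod c * plj_const A m k) /\
  RegC m (fun j x => c * plj j k a x)%C = (c * RegF m k a)%C.
Proof.
  intros HA Hm Ha. destruct (plj_admissible A m k a HA Hm Ha) as [[_ H1] _]. assert (Hm1 : (1 <= m)%nat) by (apply INR_le; simpl; lra).
  split; [split|].
  - intros j x Hj Hx. assert (D := is_derive_plj_x j k a x Hx). split.
    + rewrite re_scal_r. apply (is_derive_ext (fun x => Re c * plj j k a x)); [intros; rewrite re_scal_r; reflexivity|].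
      apply is_derive_Rscal; auto.
    + rewrite im_scal_r. apply (is_derive_ext (fun x => Im c * plj j k a x)); [intros; rewrite im_scal_r; reflexivity|].
      apply is_derive_Rscal; auto.
  - intros x Hx. rewrite Cmod_mult, Cmod_R. unfold Rdiv. rewrite Rmult_assoc. apply Rmult_le_compat_l; [apply Cmod_ge_0|]. auto.
  - transitivity (Re c * RegF m k a, Im c * RegF m k a).
    + unfold RegC, RegF. rewrite <- !Reg_scal. f_equal; apply Reg_ext; auto; intros; [apply re_scal_r|apply im_scal_r].
    + apply C_eq_Re_Im; [rewrite re_scal_r|rewrite im_scal_r]; reflexivity.
Qed.

Lemma is_series_C (u : nat -> C) (l : C) :
  is_series (fun n => Re (u n)) (Re l) -> is_series (fun n => Im (u n)) (Im l) ->
  @is_series C_AbsRing C_NormedModule u l.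
Proof.
  intros H1 H2. assert (E : forall n, sum_n (G := C_NormedModule) u n = (sum_n (fun n => Re (u n)) n, sum_n (fun n => Im (u n)) n)).
  { induction n as [|n IH].
    - auto.
    - rewrite !sum_Sn, IH. reflexivity. }
  apply (filterlim_ext (fun n => (sum_n (fun n => Re (u n)) n, sum_n (fun n => Im (u n)) n))); [intros; symmetry; apply E|].
  apply (proj2 (filterlim_locally (U := C_UniformSpace) (F := eventually) _ l)). intros eps.
  assert (P1 := proj1 (filterlim_locally _ _) H1 eps). assert (P2 := proj1 (filterlim_locally _ _) H2 eps).
  generalize (filter_and _ _ P1 P2). auto.
Qed.

Lemma sum_n_m_csum (f : nat -> C) n : sum_n_m (G := C_AbelianMonoid) f 1 n = csum (fun i => f (S i)) n.
Proof.
  induction n as [|n IH].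
  - auto.
  - rewrite sum_n_Sm by lia. rewrite IH. reflexivity.
Qed.

Lemma plj_S_0_to_0 j : (1 <= j)%nat -> is_lim_seq (fun n => plj j 1 0 (INR (S n))) 0.
Proof.
  intros Hj. set (c := (INR 1 + Rabs 0 + INR j) ^ j).
  apply (is_lim_seq_ext (fun n => plj j 1 0 (/ / INR (S n)))); [intros n; rewrite Rinv_inv; reflexivity|].
  apply (lim_lo_log (fun y => plj j 1 0 (/ y)) c 0 1). intros y Hy.
  assert (Hiy : 1 <= / y) by (rewrite <- Rinv_1; apply Rinv_le_contravar; lra). rewrite Rminus_0_r, pow_1.
  eapply Rle_trans; [apply plj_bound; auto|]. rewrite pow_1, ln_Rinv by lra. rewrite abs_ln_le by auto.
  replace (c * (y * (1 + - ln y))) with (c * (1 + - ln y) * y) by ring. assert (Hc : 0 <= c).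
  { apply pow_le. pos. }
  assert (Hl : 0 <= - ln y) by (rewrite <- abs_ln_le by auto; apply Rabs_pos). apply Rmult_le_compat_l; [apply Rmult_le_pos; lra|].
  rewrite <- (Rinv_inv y) at 2. rewrite <- (Rpower_1 (/ y)) at 2 by lra. rewrite <- Rpower_Ropp. apply Rle_Rpower; auto.
  apply (le_INR 1) in Hj. simpl in Hj. lra.
Qed.

(** The regularised value for [ln x] has two readings: as a derivative of [a * zeta (1 - a)] at [0]
    it is the Laurent coefficient, and as an Euler-Maclaurin limit it is harmonic number minus
    logarithm. *)
Lemma gamma0_lim zeta c g0 g1 :
  (forall s, 1 < s -> is_series (fun n => Rpower (INR (S n)) (- s)) (zeta s)) ->
  entire c -> (forall s, s <> 1 -> zeta s = / (s - 1) + PSeries c (s - 1)) -> laurent_at_1 zeta g0 g1 ->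
  euler_limit g0.
Proof.
  intros H1 H2 H3 H4. assert (Hm : 2 * 1 + 2 <= INR 4) by (simpl; lra). rewrite <- (RegF_1_0 zeta c g0 g1 1 4 H1 H2 H3 H4 ltac:(lra) Hm).
  destruct (plj_admissible 1 4 1 0 ltac:(lra) Hm ltac:(rewrite Rabs_R0; lra)) as [Ha _].
  assert (L := is_lim_seq_em_partial 4 (fun j => plj j 1 0) _ ltac:(lia) Ha (fun j Hj => plj_S_0_to_0 j (proj1 Hj))). revert L.
  apply is_lim_seq_ext. intros N. f_equal.
  - apply psum_ext. intros i _. cbn [plj Nat.pred pow]. assert (Hi := one_le_INR_S i).
    rewrite Rmult_0_l, Rplus_0_r, !Rmult_1_l, Rminus_0_l, Rpower_Ropp, Rpower_1 by lra. reflexivity.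
  - cbn [plj pow]. assert (HN := one_le_INR_S N). rewrite Rpower_O by lra. lra.
Qed.

(** * Assembling the expansion *)

(** The jet of [x -> T 0 (x h)]: each derivative in [x] brings out a factor [h], and symbol
    estimates turn this into a gain of [1 / x]. *)
Definition wjet (T : nat -> C -> C) (h : C) (j : nat) (x : R) : C := (h ^ j * T j (x * h))%C.

Lemma wjet_derive m T h : is_tower m T -> 0 < Re h ->
  forall j x, (j < m)%nat -> 0 < x -> is_Cderive (wjet T h j) x (wjet T h (S j) x).
Proof.
  intros HT Hh j x Hj Hx. unfold wjet. eapply is_Cderive_eq.
  - apply (Cdiff_curve (fun z => h ^ j * T j z)%C (fun t => t * h)%C); [|apply is_Cderive_ray]. apply Cdiff_scal, HT; auto.
    rewrite re_scal_l. nra.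
  - simpl; ring.
Qed.

Lemma Cmod_wjet T h j (x : R) : 0 <= x -> Cmod (wjet T h j x) = Cmod h ^ j * Cmod (T j (x * h)%C).
Proof. unfold wjet. rewrite Cmod_mult, Cmod_pow. reflexivity. Qed.

Section Assembly.

Variables (zeta : R -> R) (c : nat -> R) (g0 g1 : R).
Hypothesis Hz1 : forall s, 1 < s -> is_series (fun n => Rpower (INR (S n)) (- s)) (zeta s).
Hypothesis Hc : entire c.
Hypothesis Hz : forall s, s <> 1 -> zeta s = / (s - 1) + PSeries c (s - 1).
Hypothesis HL : laurent_at_1 zeta g0 g1.
Variable b : R.
Hypothesis Hb : 0 < b.
Variables (n m : nat).
Hypothesis Hm : m = (4 * n + 4)%nat.

(** The exponents [0, 2, ..., 2 n] have to lie strictly inside [(- A, A)]; the requirement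
    [2 A + 2 <= m] is then met with equality by [m = 4 n + 4]. *)
Let A : R := 2 * INR n + 1.

Lemma HA : 1 <= A.
Proof. assert (H := pos_INR n). unfold A. lra. Qed.

Lemma HmA : 2 * A + 2 <= INR m.
Proof. rewrite Hm, plus_INR, mult_INR. unfold A. simpl. lra. Qed.

Lemma Hg0 : euler_limit g0.
Proof. exact (gamma0_lim zeta c g0 g1 Hz1 Hc Hz HL). Qed.

Notation pe := (pdiv (ecoef b)).
Notation pf := (pdiv (fcoef g0 b)).
Notation aGc := (aG g0 b).
Notation bGc := (bG b).

(** The part of [PolyG - G0c] without positive powers, with [Clog (x h) = ln x + Clog h] expanded in
    powers of [ln x], so that only real functions of [x] are regularised. *)
Definition low_jet (h : C) (j : nat) (x : R) : C :=
  ((- G0c g0 b - lam g0 b * Clog h - / 2 * (Clog h * Clog h)) * plj j 0 0 x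
   + ((- lam g0 b - Clog h) * plj j 1 0 x + - / 2 * plj j 2 0 x))%C.

Definition term_jet (h : C) (i j : nat) (x : R) : C :=
  ((h * h) ^ S i * (aGc (S i) - bGc (S i) * Clog h) * plj j 0 (2 * INR (S i)) x
   + - ((h * h) ^ S i * bGc (S i)) * plj j 1 (2 * INR (S i)) x)%C.

Lemma low_jet_0 h (x : R) : 0 < x -> 0 < Re h ->
  low_jet h 0 x = (- G0c g0 b - lam g0 b * Clog (x * h) - / 2 * (Clog (x * h) * Clog (x * h)))%C.
Proof.
  intros Hx Hh. unfold low_jet, plj. rewrite Rpower_O, Clog_mult_pos by auto. rewrite pow_O, !Rmult_1_r, pow_1, RtoC_pow. field.
Qed.

Lemma term_jet_0 h i (x : R) : 0 < x -> 0 < Re h ->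
  term_jet h i 0 x = ((x * h * (x * h)) ^ S i * (aGc (S i) + - bGc (S i) * Clog (x * h)))%C.
Proof.
  intros Hx Hh. unfold term_jet, plj. rewrite Clog_mult_pos by auto.
  replace (2 * INR (S i)) with (INR (2 * S i)) by (rewrite mult_INR; reflexivity).
  rewrite Rpower_pow, pow_O, pow_1, Rmult_1_l, pow_mult, RtoC_mult, RtoC_pow by auto.
  replace (x * h * (x * h))%C with ((x ^ 2)%R * (h * h))%C by (rewrite RtoC_pow; ring). set (hh := (h * h)%C). rewrite Cpow_mult_l. ring.
Qed.

Lemma low_jet_Reg h : 0 < Re h ->
  (exists B, is_Cjet m (low_jet h) B) /\
  RegC m (low_jet h) = (G0c g0 b + (/ 2 * Clog h ^ 2 - g0 * Clog h - g1) - lam g0 b * (- Clog h + g0))%C.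
Proof.
  assert (HA0 := HA). assert (HA1 := HmA). assert (Hm1 : (1 <= m)%nat) by lia. assert (Ha : Rabs 0 <= A) by (rewrite Rabs_R0; lra).
  destruct (RegC_plj A m 0 0 (- G0c g0 b - lam g0 b * Clog h - / 2 * (Clog h * Clog h))%C ltac:(lra) HA1 Ha) as [J0 R0].
  destruct (RegC_plj A m 1 0 (- lam g0 b - Clog h)%C ltac:(lra) HA1 Ha) as [J1 R1].
  destruct (RegC_plj A m 2 0 (- / 2)%C ltac:(lra) HA1 Ha) as [J2 R2]. assert (J12 := is_Cjet_plus _ _ _ _ _ J1 J2).
  assert (J012 := is_Cjet_plus _ _ _ _ _ J0 J12). split; [eexists; exact J012|]. unfold low_jet.
  rewrite (RegC_plus m _ _ _ _ Hm1 J0 J12), (RegC_plus m _ _ _ _ Hm1 J1 J2), R0, R1, R2.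
  (* The values for [1], [ln x] and [ln x ^ 2] are [-1], [g0] and [2 g1]; the first reverses the
     sign of the constant [G0c]. *)
  rewrite (RegF_0_0 zeta c A m), (RegF_1_0 zeta c g0 g1 A m), (RegF_2_0 zeta c g0 g1 A m); auto. rewrite RtoC_mult. field; lra.
Qed.

Lemma term_jet_Reg h i : (i < n)%nat -> 0 < Re h ->
  (exists B, is_Cjet m (term_jet h i) B) /\
  RegC m (term_jet h i) = let s := 1 - 2 * INR (S i) in
    ((h * h) ^ S i * (zeta s * (pf (S i) - pe (S i) * Clog h) + pe (S i) * Derive zeta s))%C.
Proof.
  intros Hi Hh. assert (HA1 := HmA). assert (Hm1 : (1 <= m)%nat) by lia. set (a := 2 * INR (S i)). assert (Ha : 2 <= a < A).
  { assert (H := one_le_INR_S i). assert (H2 := le_INR (S i) n ltac:(lia)). unfold a, A. lra. }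
  assert (Ha2 : Rabs a <= A) by (rewrite Rabs_right; lra).
  destruct (RegC_plj A m 0 a ((h * h) ^ S i * (aGc (S i) - bGc (S i) * Clog h))%C ltac:(lra) HA1 Ha2) as [J0 R0].
  destruct (RegC_plj A m 1 a (- ((h * h) ^ S i * bGc (S i)))%C ltac:(lra) HA1 Ha2) as [J1 R1].
  split; [eexists; exact (is_Cjet_plus _ _ _ _ _ J0 J1)|]. unfold term_jet. fold a. rewrite (RegC_plus m _ _ _ _ Hm1 J0 J1), R0, R1.
  rewrite (RegF_0_zeta zeta c A m), (RegF_1_zeta zeta c A m) by pos. assert (HS : INR (S i) <> 0) by (apply not_0_INR; lia).
  (* The factor [a = 2 k] undoes the divisions in [aG] and [bG]. The term [bG * zeta s] from
     [a * aG] cancels against the one from [RegF_1_zeta]. *)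
  assert (E2 : (RtoC a * bGc (S i) = pe (S i))%C).
  { rewrite <- RtoC_mult. f_equal. unfold a, bG. field; lra. }
  rewrite RtoC_minus, !RtoC_mult. rewrite <- E2. replace (pf (S i)) with (a * aGc (S i) - bGc (S i)) by (unfold a, aG, bG; field; auto).
  rewrite RtoC_minus, RtoC_mult. ring.
Qed.

Definition poly_jet (h : C) (N j : nat) (x : R) : C :=
  (low_jet h j x + csum (fun i => term_jet h i j x) N)%C.

Lemma poly_jet_Reg h : 0 < Re h -> forall N, (N <= n)%nat ->
  (exists B, is_Cjet m (poly_jet h N) B) /\
  RegC m (poly_jet h N) = (RegC m (low_jet h) + csum (fun i => RegC m (term_jet h i)) N)%C.
Proof.
  intros Hh. assert (Hm1 : (1 <= m)%nat) by lia. destruct (low_jet_Reg h Hh) as [[B0 J0] _]. induction N as [|N IH]; intros HN.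
  - assert (J : is_Cjet m (poly_jet h 0) B0).
    { destruct J0 as [P Q]. split.
      - intros j x Hj Hx. destruct (P j x Hj Hx) as [P1 P2]. unfold poly_jet; simpl. split.
        + apply (is_derive_ext (fun x => Re (low_jet h j x))); [intros; f_equal; ring|]. rewrite Cplus_0_r. auto.
        + apply (is_derive_ext (fun x => Im (low_jet h j x))); [intros; f_equal; ring|]. rewrite Cplus_0_r. auto.
      - intros x Hx. unfold poly_jet; simpl. rewrite Cplus_0_r. auto. }
    split; [exists B0; exact J|]. rewrite Cplus_0_r. apply (RegC_unique m _ _ B0 B0 Hm1 J J0). intros x _. unfold poly_jet. simpl. ring.
  - destruct (IH ltac:(lia)) as [[B1 J1] R1]. destruct (term_jet_Reg h N ltac:(lia) Hh) as [[B2 J2] _].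
    assert (J12 := is_Cjet_plus _ _ _ _ _ J1 J2). assert (J : is_Cjet m (poly_jet h (S N)) (B1 + B2)).
    { destruct J12 as [P Q]. split.
      - intros j x Hj Hx. destruct (P j x Hj Hx) as [P1 P2].
        assert (E : forall j x, (poly_jet h N j x + term_jet h N j x)%C = poly_jet h (S N) j x) by (intros; unfold poly_jet; simpl; ring).
        rewrite E in P1, P2. split.
        + apply (is_derive_ext (fun x => Re (poly_jet h N j x + term_jet h N j x)%C)); [intros; f_equal; apply E|exact P1].
        + apply (is_derive_ext (fun x => Im (poly_jet h N j x + term_jet h N j x)%C)); [intros; f_equal; apply E|exact P2].
      - intros x Hx. specialize (Q x Hx). unfold poly_jet in *. simpl in *. rewrite Cplus_assoc. lra. }
    split; [exists (B1 + B2); exact J|]. simpl. rewrite Cplus_assoc, <- R1, <- (RegC_plus m _ _ _ _ Hm1 J1 J2).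
    apply (RegC_unique m _ _ _ _ Hm1 J J12). intros x _. unfold poly_jet. simpl. ring.
Qed.

Lemma poly_jet_0 h (x : R) : 0 < x -> 0 < Re h -> poly_jet h n 0 x = (PolyG g0 b n (x * h) - G0c g0 b)%C.
Proof.
  intros Hx Hh. unfold poly_jet, PolyG. rewrite low_jet_0 by auto.
  rewrite (csum_ext _ (fun i => (x * h * (x * h)) ^ S i * (aGc (S i) + - bGc (S i) * Clog (x * h)))%C)
    by (intros; apply term_jet_0; auto).
  ring.
Qed.

Lemma logw_scal (x : R) h : 1 <= x -> 0 < Cmod h -> logw (x * h)%C <= x * logw h.
Proof.
  intros Hx Hh. unfold logw. rewrite Cmod_scal, ln_mult by lra. assert (H1 := ln_ge_0 x Hx). assert (H2 : ln x <= x - 1).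
  { assert (H := sub_ln_1p_bounds (x - 1) ltac:(lra)). replace (1 + (x - 1)) with x in H by ring. lra. }
  assert (H3 := Rabs_pos (ln (Cmod h))). apply Rle_trans with (x + Rabs (ln (Cmod h))); [|nra].
  assert (H4 := Rabs_triang (ln x) (ln (Cmod h))). rewrite (Rabs_right (ln x)) in H4 by lra. lra.
Qed.

(** The antiderivative splits as [RG] plus [PolyG - G0c]. Its own jet vanishes at infinity, so its
    regularised value is the convergent series [T]; what is left after the polynomial part is [RegC]
    of the jet of [RG], proportional to [wK n h] with a constant depending on the sector only. *)
Lemma remainder_bound s : 0 < s <= 1 -> exists M, 0 <= M /\ forall h, sector s h -> exists T,
  @is_series C_AbsRing C_NormedModule (fun i => / INR (S i) * gker b (INR (S i) * h))%C T /\
  Cmod (T - RegC m (poly_jet h n))%C <= M * wK n h.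
Proof.
  intros Hs. assert (HD := fun z => sector_Re s z (proj1 Hs)). assert (Hm1 : (1 <= m)%nat) by lia.
  destruct (Symb_tower (S m) (sector s) HD _ _ (fun z Hz => Rlt_le _ _ (Rinv_0_lt_compat _ (proj1 Hz))) (Symb_Gint b Hb s m Hs))
    as [TG [TG0 [TG1 [cg [Hcg TG2]]]]].
  destruct (Symb_tower (S m) (sector s) HD _ _ (fun z _ => wK_pos n z) (Symb_RG g0 Hg0 b Hb s m n Hs))
    as [TR [TR0 [TR1 [cr [Hcr TR2]]]]].
  exists (6 * em_const m * cr). split; [assert (H := em_const_pos m); nra|]. intros h Hh. assert (HRh := HD h Hh).
  assert (Hh0 := proj1 Hh). set (JG := wjet TG h). set (JR := wjet TR h).
  assert (BG : forall j x, (j <= S m)%nat -> 1 <= x -> Cmod (JG j x) <= cg * / Cmod h / x ^ S j).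
  { intros j x Hj Hx. unfold JG. rewrite Cmod_wjet by lra. specialize (TG2 j (x * h)%C Hj (sector_scal s x h ltac:(lra) Hh)).
    rewrite Cmod_scal in TG2 by lra. assert (Hhj := pow_lt _ j Hh0). assert (Hxj : 0 < x ^ j) by (apply pow_lt; lra).
    apply Rle_trans with (Cmod h ^ j * (cg * (/ (x * Cmod h) / (x * Cmod h) ^ j))).
    - nra.
    - rewrite Rpow_mult_distr. simpl. apply Req_le. field; lra. }
  assert (CG : is_Cjet m JG (cg * / Cmod h)).
  { split; [apply wjet_derive; auto|]. intros x Hx. eapply Rle_trans; [apply BG; auto|].
    apply Rmult_le_compat_l; [apply Rmult_le_pos; auto; apply Rlt_le, Rinv_0_lt_compat; auto|].
    apply Rinv_le_contravar; [apply pow_lt; lra|]. apply Rle_pow; auto. lia. }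
  (* [logw (x h) <= x * logw h] separates [x] from [h] at the price of one power of [x], whence the
     exponent [2 * S n + 1]. *)
  set (BB := cr * wK n h). assert (BR : forall j x, (j <= S m)%nat -> 1 <= x -> Cmod (JR j x) <= BB * x ^ (2 * S n + 1) / x ^ j).
  { intros j x Hj Hx. unfold JR. rewrite Cmod_wjet by lra. specialize (TR2 j (x * h)%C Hj (sector_scal s x h ltac:(lra) Hh)).
    unfold wK in TR2. rewrite Cmod_scal in TR2 by lra. assert (Hhj := pow_lt _ j Hh0). assert (Hxj : 0 < x ^ j) by (apply pow_lt; lra).
    assert (Hl := logw_scal x h Hx Hh0). assert (Hxh : 0 <= (x * Cmod h) ^ (2 * S n)) by (apply pow_le; nra).
    apply Rle_trans with (Cmod h ^ j * (cr * ((x * Cmod h) ^ (2 * S n) * (x * logw h) / (x * Cmod h) ^ j))).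
    - apply Rmult_le_compat_l; [lra|]. via TR2. pos.
    - rewrite !Rpow_mult_distr, pow_add, pow_1. unfold BB, wK. apply Req_le. field; lra. }
  assert (HBB : 0 <= BB) by (apply Rmult_le_pos; auto; apply wK_pos). assert (CR : is_Cjet m JR BB).
  { split; [apply wjet_derive; auto|]. intros x Hx. eapply Rle_trans; [apply BR; auto|]. unfold Rdiv. rewrite Rmult_assoc.
    apply Rmult_le_compat_l; auto. assert (Hx3 : forall k, 0 < x ^ k) by (intros; apply pow_lt; lra).
    (* The order of differentiation exceeds the growth exponent [2 n + 3] by at least two, which
       gives the decay [/ x ^ 2] demanded of a jet. *)
    replace (S m) with ((2 * S n + 1) + (2 + (2 * n)))%nat by lia. rewrite (pow_add x (2 * S n + 1)).
    replace (x ^ (2 * S n + 1) * / (x ^ (2 * S n + 1) * x ^ (2 + 2 * n))) with (/ x ^ (2 + 2 * n))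
      by (field; split; apply Rgt_not_eq, Hx3).
    apply Rinv_le_contravar; auto. apply Rle_pow; auto. lia. }
  destruct (poly_jet_Reg h HRh n (le_n _)) as [[BP CP] _]. assert (E : RegC m JG = (RegC m JR + RegC m (poly_jet h n))%C).
  { rewrite <- (RegC_plus m _ _ _ _ Hm1 CR CP). apply (RegC_unique m _ _ _ _ Hm1 CG (is_Cjet_plus _ _ _ _ _ CR CP)). intros x Hx.
    rewrite poly_jet_0 by auto. unfold JG, JR, wjet. rewrite TG0, TR0. unfold RG. ring. }
  exists (RegC m JG). split.
  - assert (E1 : forall i, JG 1%nat (INR (S i)) = (/ INR (S i) * gker b (INR (S i) * h))%C).
    { intros i. assert (Hi := one_le_INR_S i). unfold JG, wjet. assert (HRi : 0 < Re (INR (S i) * h)%C) by (rewrite re_scal_l; nra).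
      rewrite (Cdiff_unique (Gint b) (INR (S i) * h)%C (TG 1%nat (INR (S i) * h)%C) (gker b (INR (S i) * h) / (INR (S i) * h))%C).
      - field. split; [intros H; apply RtoC_inj in H; lra|apply Re_pos_neq_0; auto].
      - rewrite <- TG0. auto.
      - apply Cdiff_Gint; auto. }
    assert (Lim : forall j, (j <= m)%nat -> is_lim_seq (fun i => Re (JG j (INR (S i)))) 0 /\ is_lim_seq (fun i => Im (JG j (INR (S i)))) 0).
    { intros j Hj. apply (is_lim_seq_Cmod_0 _ (fun i => cg * / Cmod h * / INR (S i))).
      - intros i. assert (Hi := one_le_INR_S i). eapply Rle_trans; [apply BG; auto; lia|].
        apply Rmult_le_compat_l; [apply Rmult_le_pos; auto; apply Rlt_le, Rinv_0_lt_compat; auto|]. apply Rinv_le_contravar; [lra|].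
        rewrite <- (pow_1 (INR (S i))) at 1. apply Rle_pow; auto. lia.
      - replace (Finite 0) with (Finite (cg * / Cmod h * 0)) by (f_equal; ring). apply (is_lim_seq_scal_l _ _ 0), is_lim_seq_inv_S. }
    apply is_series_C.
    + apply (is_series_ext (fun i => Re (JG 1%nat (INR (S i))))); [intros i; rewrite E1; reflexivity|].
      apply (is_series_Reg m (fun j x => Re (JG j x)) _ Hm1 (is_Cjet_Re _ _ _ CG)). intros j Hj. apply (Lim j Hj).
    + apply (is_series_ext (fun i => Im (JG 1%nat (INR (S i))))); [intros i; rewrite E1; reflexivity|].
      apply (is_series_Reg m (fun j x => Im (JG j x)) _ Hm1 (is_Cjet_Im _ _ _ CG)). intros j Hj. apply (Lim j Hj).
  - rewrite E. replace (RegC m JR + RegC m (poly_jet h n) - RegC m (poly_jet h n))%C with (RegC m JR) by ring. rewrite Rmult_assoc.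
    fold BB. apply RegC_bound; auto. intros j Hj. eapply Rle_trans; [apply BR; [lia|lra]|]. rewrite !pow1. lra.
Qed.

End Assembly.

(** * Identification of the coefficients *)

Lemma pdiv_psum f k : pdiv f k = (-1) ^ k * psum (fun r => (-1) ^ r * f r) (S k).
Proof.
  induction k as [|k IH]; [simpl; ring|].
  assert (H : (-1) ^ k * (-1) ^ k = 1) by (rewrite <- Rpow_mult_distr; replace (-1 * -1) with 1 by ring; apply pow1).
  change (psum (fun r => (-1) ^ r * f r) (S (S k))) with (psum (fun r => (-1) ^ r * f r) (S k) + (-1) ^ S k * f (S k)). cbn [pdiv].
  rewrite IH, <- !tech_pow_Rmult. replace (-1 * (-1) ^ k * (psum (fun r => (-1) ^ r * f r) (S k) + -1 * (-1) ^ k * f (S k)))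
    with ((-1) ^ k * (-1) ^ k * f (S k) - (-1) ^ k * psum (fun r => (-1) ^ r * f r) (S k)) by ring.
  rewrite H. ring.
Qed.

Lemma bterm_ecoef b r : bterm (b ^ 2 / 4) r = (-1) ^ r * ecoef b r.
Proof.
  unfold bterm, ecoef, ci, Rdiv. replace (- (b ^ 2 * / 4)) with (-1 * (b ^ 2 * / 4)) by ring. rewrite Rpow_mult_distr. ring.
Qed.

Lemma pdiv_ecoef b k : pdiv (ecoef b) k = (-1) ^ k * F1k k (b ^ 2 / 4).
Proof.
  rewrite pdiv_psum. unfold F1k. rewrite psum_sum_n. f_equal. apply psum_ext. intros; symmetry; apply bterm_ecoef.
Qed.

Lemma pdiv_fcoef (g0 b : R) k : euler_limit g0 ->
  pdiv (fcoef g0 b) k = (-1) ^ k * (F1k_hatF k (b ^ 2 / 4) - lam g0 b * F1k k (b ^ 2 / 4)).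
Proof.
  intros Hg0. rewrite pdiv_psum. f_equal. assert (E : F1k_hatF k (b ^ 2 / 4) = psum (fun r => bterm (b ^ 2 / 4) r * Hn r) (S k)).
  { assert (D : forall r, digamma (1 + INR r) - digamma 1 = Hn r).
    { intros r. rewrite (Rplus_comm 1), (digamma_nat g0 Hg0). assert (H := digamma_nat g0 Hg0 0).
      replace (INR 0 + 1) with 1 in H by (simpl; ring). rewrite H. change (Hn 0) with 0. ring. }
    unfold F1k_hatF. induction k as [|k IH].
    - rewrite sum_n_m_zero by lia. simpl. change (Hn 0) with 0. change (@zero R_AbelianMonoid) with 0. ring.
    - rewrite sum_n_Sm, IH by lia. rewrite D. reflexivity. }
  rewrite E. unfold F1k. rewrite psum_sum_n, <- psum_scal, <- psum_minus. apply psum_ext. intros r _. rewrite bterm_ecoef.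
  unfold fcoef, ecoef. ring.
Qed.

(** Brings the stated term to the form delivered by [term_jet_Reg] at [h = / a]. The logarithm
    becomes [Clog a - lam g0 b] because [ln (2 / b) = g0 - lam g0 b], and the quotient by zeta
    disappears thanks to nonvanishing. *)
Lemma expansion_term_eq zeta (g0 b : R) (a : C) k :
  euler_limit g0 -> 0 < b -> 0 < Re a ->
  zeta (1 - 2 * INR k) <> 0 ->
  expansion_term zeta g0 b a k = let s := 1 - 2 * INR k in
    ((/ a * / a) ^ k * (zeta s * (pdiv (fcoef g0 b) k + pdiv (ecoef b) k * Clog a) + pdiv (ecoef b) k * Derive zeta s))%C.
Proof.
  intros Hg0 Hb Ha Hz. unfold expansion_term. assert (Ha0 := Re_pos_neq_0 a Ha). rewrite pdiv_ecoef, (pdiv_fcoef g0 b k Hg0).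
  replace (2 * a / b)%C with ((2 / b)%R * a)%C by (rewrite RtoC_div by lra; field; intros E; apply RtoC_inj in E; lra).
  rewrite Clog_mult_pos by (auto; apply Rdiv_lt_0_compat; lra). replace (ln (2 / b)) with (g0 - lam g0 b).
  - replace ((/ a * / a) ^ k)%C with (/ a ^ (2 * k))%C.
    + rewrite !RtoC_mult, !RtoC_minus, RtoC_mult, RtoC_pow. field. split; [|intros E; apply RtoC_inj in E; auto]. apply Cpow_nz; auto.
    + rewrite Cpow_mult_r, <- Cpow_inv by (apply Cpow_nz; auto). f_equal. field; auto.
  - unfold lam. replace (2 / b) with (/ (b / 2)) by (field; lra). rewrite ln_Rinv by lra. ring.
Qed.

(** The aperture enters only through [cos (PI / 2 - delta) = sin delta], the constant of the sector
    used for all symbol estimates. *)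
Lemma Carg_sector a delta : a <> RtoC 0 -> 0 < delta < PI / 2 -> Rabs (Carg a) <= PI / 2 - delta ->
  sin delta * Cmod a <= Re a.
Proof.
  intros Ha Hd H. assert (Hm := Cmod_pos a Ha). assert (Hr := re_le_Cmod a). apply Rabs_le_between in Hr. set (y := Re a / Cmod a).
  assert (Hy : -1 <= y <= 1).
  { split; [apply Rle_div_r|apply Rle_div_l]; lra. }
  assert (B := acos_bound y). assert (H1 : acos y <= PI / 2 - delta).
  { unfold Carg in H. fold y in H. destruct (Rle_dec 0 (Im a)); [|rewrite Rabs_Ropp in H]; rewrite Rabs_right in H; lra. }
  assert (H2 : cos (PI / 2 - delta) <= y).
  { rewrite <- (cos_acos y) by auto. apply cos_decr_1; lra. }
  rewrite cos_shift in H2. apply Rle_div_r in H2; auto.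
Qed.

(** * The expansion for large a, through h = 1 / a *)

Theorem theorem6 (zeta : R -> R) (gamma0 gamma1 : R)
  (Hzeta : is_riemann_zeta zeta)
  (Hgamma : laurent_at_1 zeta gamma0 gamma1)
  (b : R) (Hb : 0 < b) :
  forall (K : nat) (delta : R), (1 <= K)%nat -> 0 < delta < PI / 2 ->
  exists M R0 : R, forall a : C,
    R0 <= Cmod a -> Rabs (Carg a) <= PI / 2 - delta ->
    exists S : C,
      @is_series C_AbsRing C_NormedModule
        (fun n => mathieu_term b a (n + 1)) S /\
      Cmod (S - Res1 gamma0 gamma1 b a
            - / a ^ 2 * sum_n_m (expansion_term zeta gamma0 b a) 1 (K - 1))%C
      <= M * (/ Cmod a ^ (2 + 2 * K) * ln (Cmod a)).
Proof.
  (* With [K = n + 1] exactly [n] terms are subtracted, and the remainder weight is [Cmod (/ a)] to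
     the power [2 K] times a logarithm. *)
  intros K delta HK Hd. destruct K as [|n]; [lia|]. destruct (Hzeta) as [Hz1 [c [Hc0 Hz]]].
  assert (Hc : entire c) by (apply entire_CV_radius; auto). assert (Hg0 := gamma0_lim zeta c gamma0 gamma1 Hz1 Hc Hz Hgamma).
  set (m := (4 * n + 4)%nat). set (s := sin delta). assert (Hs : 0 < s <= 1).
  { assert (HP := PI_RGT_0). split; [apply sin_gt_0; lra|apply SIN_bound]. }
  (* For [exp 1 <= Cmod a] the logarithm is at least [1], so [1 + ln (Cmod a)] is at most twice
     [ln (Cmod a)]: this is the origin of both [exp 1] and the factor [2]. *)
  destruct (remainder_bound zeta c gamma0 gamma1 Hz1 Hc Hz Hgamma b Hb n m eq_refl s Hs) as [M [HM HT]]. exists (2 * M), (exp 1).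
  intros a Ha Harg. assert (He := exp_ineq1_le 1). assert (Hm : 0 < Cmod a) by lra. assert (Ha0 := Cmod_pos_neq_0 a Hm).
  assert (HRe := Carg_sector a delta Ha0 Hd Harg). fold s in HRe.
  assert (HR : 0 < Re a) by (assert (0 < s * Cmod a) by (apply Rmult_lt_0_compat; lra); lra). assert (Hh : sector s (/ a)%C).
  { assert (H2 : Re (/ a)%C = Re a / Cmod a ^ 2).
    { rewrite Cmod2_alt. auto. }
    split; rewrite Cmod_inv by auto; [apply Rinv_0_lt_compat; auto|]. rewrite H2.
    replace (s * / Cmod a) with (s * Cmod a * / Cmod a ^ 2) by (field; lra).
    apply Rmult_le_compat_r; [apply Rlt_le, Rinv_0_lt_compat, pow_lt; auto|auto]. }
  assert (HRh := sector_Re s _ (proj1 Hs) Hh). destruct (HT _ Hh) as [T [HT1 HT2]]. exists (/ a ^ 2 * T)%C. split.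
  - apply (is_series_ext (fun i => scal (/ a ^ 2)%C (/ INR (Datatypes.S i) * gker b (INR (Datatypes.S i) * / a))%C)).
    + intros i. assert (Hi := one_le_INR_S i). unfold mathieu_term. rewrite Nat.add_1_r. set (N := INR (Datatypes.S i)) in *.
      assert (HNC : RtoC N <> RtoC 0) by (intros E; apply RtoC_inj in E; lra).
      assert (HRN : 0 < Re (N * / a)%C) by (rewrite re_scal_l; apply Rmult_lt_0_compat; lra).
      replace (N * b / a)%C with (b * (N * / a))%C by (field; auto). rewrite (BesselK0_KJ gamma0 Hg0) by (apply Re_scal_pos; auto).
      assert (Hq := one_plus_sq_neq_0 _ HRN). unfold gker, qker. set (k := KJ 0 (b * (N * / a))%C).
      change (/ a ^ 2 * (/ N * (k * / (1 + N * / a * (N * / a)))) = k / (N * (N ^ 2 + a ^ 2)))%C.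
      replace (N ^ 2 + a ^ 2)%C with (a ^ 2 * (1 + N * / a * (N * / a)))%C by (field; auto). field. repeat split; auto. intros E.
      apply Hq. replace (1 + N * / a * (N * / a))%C with ((a * a + N * N) / (a * a))%C by (field; auto). rewrite E. field. auto.
    + apply (is_series_scal (K := C_AbsRing) (V := C_NormedModule) (/ a ^ 2)%C). auto.
  - destruct (poly_jet_Reg zeta c gamma0 gamma1 Hz1 Hc Hz Hgamma b n m eq_refl (/ a)%C HRh n (le_n _)) as [_ RP].
    destruct (low_jet_Reg zeta c gamma0 gamma1 Hz1 Hc Hz Hgamma b n m eq_refl (/ a)%C HRh) as [_ RL].
    assert (Hla : Clog (/ a)%C = (- Clog a)%C) by (apply Clog_inv; auto). assert (E : RegC m (poly_jet gamma0 b (/ a)%C n) =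
      (B2 gamma0 gamma1 a - lam gamma0 b * Defs.B1 gamma0 a + (Sser gamma0 b - PI ^ 2 / 24)%R
      + sum_n_m (G := C_AbelianMonoid) (expansion_term zeta gamma0 b a) 1 n)%C).
    { rewrite RP, RL, sum_n_m_csum, Hla. f_equal.
      - unfold B2, Defs.B1, G0c. ring.
      - apply csum_ext. intros i Hi. rewrite (proj2 (term_jet_Reg zeta c gamma0 Hz1 Hc Hz b n m eq_refl (/ a)%C i Hi HRh)).
        rewrite (expansion_term_eq zeta gamma0 b a (Datatypes.S i) Hg0 Hb HR) by (apply zeta_neg_odd_neq_0; [auto|lia]). cbv zeta.
        rewrite Hla. ring. }
    rewrite (Res1_eq gamma0 Hg0 gamma1 b a Hb). replace (Datatypes.S n - 1)%nat with n by lia.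
    match goal with |- Cmod ?X <= _ => replace X with (/ a ^ 2 * (T - RegC m (poly_jet gamma0 b (/ a)%C n)))%C end.
    + rewrite Cmod_mult, Cmod_inv, Cmod_pow by (apply Cpow_nz; auto).
      assert (Hln : 1 <= ln (Cmod a)) by (rewrite <- (ln_exp 1); apply ln_le; [apply exp_pos|auto]).
      assert (Hw : wK n (/ a)%C <= / Cmod a ^ (2 * Datatypes.S n) * (2 * ln (Cmod a))).
      { unfold wK, logw. rewrite Cmod_inv by auto. rewrite ln_Rinv, Rabs_Ropp, (Rabs_right (ln (Cmod a))), pow_inv by lra. pos. }
      rewrite pow_add, Rinv_mult. replace (2 * M * (/ Cmod a ^ 2 * / Cmod a ^ (2 * Datatypes.S n) * ln (Cmod a)))
        with (/ Cmod a ^ 2 * (M * (/ Cmod a ^ (2 * Datatypes.S n) * (2 * ln (Cmod a))))) by ring.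
      apply Rmult_le_compat_l; [apply Rlt_le, Rinv_0_lt_compat, pow_lt; auto|]. nra.
    + rewrite E. ring.
Qed.
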